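(* Let $\epsilon>0$ be fixed (sufficiently small), let $C:=(1/\epsilon)^{1/\epsilon}$ and $\Gamma:=32\pi C^3/\epsilon^5$. There is a polynomial-time algorithm for the unsplittable Euclidean capacitated vehicle routing problem which, on every instance such that (i) the set of terminals $V$ has bounded distance, i.e., $D_{\max}/D_{\min}\leq C$ where $D_{\max}:=\max_{v\in V}\mathrm{dist}(v)$, $D_{\min}:=\min_{v\in V}\mathrm{dist}(v)$ and $\mathrm{dist}(p)$ is the Euclidean distance from $p$ to the depot $O$, and (ii) an optimal solution $\mathrm{OPT}$ consists of at least $\Gamma$ tours, outputs a feasible solution of cost at most $(2+O(\epsilon))\cdot\mathrm{opt}$, where $\mathrm{opt}$ is the optimal cost and the constant in $O(\epsilon)$ is absolute.
   Context: The unsplittable Euclidean capacitated vehicle routing problem: the input consists of a point $O\in\mathbb{R}^2$ called the depot and a finite set $V$ of $n$ points in $\mathbb{R}^2$ called terminals, each terminal $v\in V$ having a demand $\mathrm{demand}(v)\in(0,1]$. A tour is a closed walk starting and ending at $O$; its cost is its total Euclidean length. A feasible solution is a finite collection of tours together with an assignment of each terminal to a single tour visiting it, such that for every tour the total demand of the terminals assigned to it is at most $1$. The cost of a solution is the sum of the costs of its tours, to be minimized; $\mathrm{opt}$ denotes the minimum cost and $\mathrm{OPT}$ an optimal solution. *)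

(* Defs.v *)
From mathcomp Require Import all_boot all_order all_algebra.
From mathcomp Require Import reals exp trigo.
Set Implicit Arguments.
Unset Strict Implicit.
Unset Printing Implicit Defensive.
Import Order.TTheory GRing.Theory Num.Theory.
Local Open Scope ring_scope.

(** * Unsplittable Euclidean capacitated vehicle routing *)

(* The library norm on [R * R] is the sup norm, hence this definition. *)
Definition edist (R : realType) (p q : R * R) : R :=
  Num.sqrt ((p.1 - q.1) ^+ 2 + (p.2 - q.2) ^+ 2).

Record instance (R : realType) (n : nat) := Instance {
  depot : R * R;
  pos : 'I_n -> R * R;
  demand : 'I_n -> R;
  pos_inj : injective pos;
  demand_in : forall v, 0 < demand v <= 1 }.

(* A tour is the closed polygonal walk O, p_1, ..., p_k, O; only the sequence
   p_1, ..., p_k of intermediate points (arbitrary points of the plane, with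
   repetitions allowed) is stored.
   The terminal [v] is assigned to the tour of index [assign v]. *)
Record solution (R : realType) (n : nat) := Solution {
  tours : seq (seq (R * R));
  assign : 'I_n -> nat }.

Definition tour_cost (R : realType) (O : R * R) (p : seq (R * R)) : R :=
  \sum_(d <- pairmap (@edist R) O (rcons p O)) d.

Definition cost (R : realType) (n : nat) (I : instance R n)
    (S : solution R n) : R :=
  \sum_(p <- tours S) tour_cost (depot I) p.

Definition feasible (R : realType) (n : nat) (I : instance R n)
    (S : solution R n) : Prop :=
  (forall v, (assign S v < size (tours S))%N /\
     pos I v \in depot I :: nth [::] (tours S) (assign S v)) /\
  (forall j, (j < size (tours S))%N ->
     \sum_(v < n | assign S v == j) demand I v <= 1).

Definition optimal (R : realType) (n : nat) (I : instance R n)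
    (S : solution R n) : Prop :=
  feasible I S /\ forall T, feasible I T -> cost I S <= cost I T.

(* Only tours to which some terminal is assigned are counted: otherwise one
   could inflate the number of tours of an optimal solution at no cost by adding
   trivial walks that stay at the depot. *)
Definition ntours (R : realType) (n : nat) (S : solution R n) : nat :=
  count (fun j => [exists v, assign S v == j]) (iota 0 (size (tours S))).

Definition dist (R : realType) (n : nat) (I : instance R n) (v : 'I_n) : R :=
  edist (pos I v) (depot I).

(* Distances are nonnegative and at most [dmax I], so for n > 0 the initial
   values of the two iterated operations are harmless; for n = 0 both are 0. *)
Definition dmax (R : realType) (n : nat) (I : instance R n) : R :=
  \big[Num.max/0]_(v < n) dist I v.

Definition dmin (R : realType) (n : nat) (I : instance R n) : R :=
  \big[Num.min/dmax I]_(v < n) dist I v.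

(* The conjunct [0 < dmin I] says that the quotient is meaningful. *)
Definition bounded_distance (R : realType) (n : nat) (C : R)
    (I : instance R n) : Prop :=
  0 < dmin I /\ dmax I / dmin I <= C.

Definition Cst (R : realType) (eps : R) : R := (1 / eps) `^ (1 / eps).

Definition Gamma (R : realType) (eps : R) : R :=
  32%:R * pi * Cst eps ^+ 3 / eps ^+ 5.

(** * Real RAM

   Programs of the standard unit-cost real RAM, in structured form.  The memory
   consists of infinitely many integer cells N[0], N[1], ... and infinitely many
   real cells R[0], R[1], ...; addresses are integer expressions, which gives
   indirect addressing.  Real cells support exact arithmetic, square roots and
   comparisons, but there is no rounding to integers.  Integer cells support
   addition and truncated subtraction only, so that they have polynomially many
   bits after polynomially many steps.  The only constants are natural numbers,
   so that a program, which is common to all input sizes, is a finite object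
   that cannot carry nonuniform advice. *)

Inductive nexp : Type :=
| NConst of nat
| NCell of nexp
| NAdd of nexp & nexp
| NSub of nexp & nexp.

Inductive rexp : Type :=
| RConst of nat
| RCell of nexp
| RAdd of rexp & rexp
| RSub of rexp & rexp
| RMul of rexp & rexp
| RDiv of rexp & rexp
| RSqrt of rexp.

Inductive test : Type :=
| NLe of nexp & nexp
| RLe of rexp & rexp
| TNot of test
| TAnd of test & test.

Inductive cmd : Type :=
| Skip
| NSet of nexp & nexp
| RSet of nexp & rexp
| Seq of cmd & cmd
| If of test & cmd & cmd
| While of test & cmd.

Record state (R : realType) := State {
  nmem : nat -> nat;
  rmem : nat -> R }.

Fixpoint neval (R : realType) (s : state R) (e : nexp) : nat :=
  match e with
  | NConst k => k
  | NCell a => nmem s (neval s a)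
  | NAdd a b => (neval s a + neval s b)%N
  | NSub a b => (neval s a - neval s b)%N
  end.

(* Division by 0 and square roots of negative numbers return 0. *)
Fixpoint reval (R : realType) (s : state R) (e : rexp) : R :=
  match e with
  | RConst k => k%:R
  | RCell a => rmem s (neval s a)
  | RAdd a b => reval s a + reval s b
  | RSub a b => reval s a - reval s b
  | RMul a b => reval s a * reval s b
  | RDiv a b => reval s a / reval s b
  | RSqrt a => Num.sqrt (reval s a)
  end.

Fixpoint teval (R : realType) (s : state R) (b : test) : bool :=
  match b with
  | NLe e f => (neval s e <= neval s f)%N
  | RLe e f => reval s e <= reval s f
  | TNot c => ~~ teval s c
  | TAnd c d => teval s c && teval s d
  end.

Definition nset (R : realType) (s : state R) (a x : nat) : state R :=
  State [eta nmem s with a |-> x] (rmem s).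

Definition rset (R : realType) (s : state R) (a : nat) (x : R) : state R :=
  State (nmem s) [eta rmem s with a |-> x].

(* [exec c s t s']: started in [s], the program [c] halts in [s'] after [t]
   steps.  Each assignment and each evaluation of a test counts as one step; as
   the expressions are fixed by the program, counting every operation
   separately would change [t] by at most a factor depending on [c] only. *)
Inductive exec (R : realType) : cmd -> state R -> nat -> state R -> Prop :=
| ExecSkip s : exec Skip s 1 s
| ExecNSet a e s : exec (NSet a e) s 1 (nset s (neval s a) (neval s e))
| ExecRSet a e s : exec (RSet a e) s 1 (rset s (neval s a) (reval s e))
| ExecSeq c d s1 t1 s2 t2 s3 :
    exec c s1 t1 s2 -> exec d s2 t2 s3 -> exec (Seq c d) s1 (t1 + t2) s3
| ExecIfT b c d s t s' :
    teval s b -> exec c s t s' -> exec (If b c d) s t.+1 s'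
| ExecIfF b c d s t s' :
    ~~ teval s b -> exec d s t s' -> exec (If b c d) s t.+1 s'
| ExecWhileF b c s : ~~ teval s b -> exec (While b c) s 1 s
| ExecWhileT b c s1 t1 s2 t2 s3 :
    teval s1 b -> exec c s1 t1 s2 -> exec (While b c) s2 t2 s3 ->
    exec (While b c) s1 (t1 + t2).+1 s3.

(* Input format: N[0] = n, and R[0], R[1], R[2], ... contain the two coordinates
   of the depot and then, for each terminal, its two coordinates and its demand;
   all other cells contain 0. *)
Definition input (R : realType) (n : nat) (I : instance R n) : state R :=
  State
    [eta (fun=> 0%N) with 0%N |-> n]
    (nth 0 ([:: (depot I).1; (depot I).2] ++
       flatten [seq [:: (pos I v).1; (pos I v).2; demand I v] | v <- enum 'I_n])).

(* Output format: N[0] is the number m of tours, N[1], ..., N[n] are the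
   tour indices (from 0) assigned to the terminals, N[n+1], ..., N[n+m] are the
   numbers of intermediate points of the tours, and the coordinates of all these
   points, tour after tour, are in R[0], R[1], R[2], ... *)
Definition output (R : realType) (n : nat) (s : state R) : solution R n :=
  let lens := [seq nmem s (n.+1 + j)%N | j <- iota 0 (nmem s 0)] in
  {| tours := reshape lens
       [seq (rmem s k.*2, rmem s k.*2.+1) | k <- iota 0 (sumn lens)];
     assign := fun v => nmem s v.+1 |}.
Arguments output {R} n s.

(* The size of an input is its number n of terminals. *)
Definition polytime (R : realType) (P : cmd) : Prop :=
  exists a k : nat, forall (n : nat) (I : instance R n),
    exists t s, exec P (input I) t s /\ (t <= a * n.+1 ^ k)%N.

(* Main.v *)
Require Import Defs.
From mathcomp Require Import all_boot all_order all_algebra.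
From mathcomp Require Import boolp.
From mathcomp Require Import reals exp trigo.
From mathcomp Require Import zify ring lra.
Set Implicit Arguments.
Unset Strict Implicit.
Unset Printing Implicit Defensive.
Import Order.TTheory GRing.Theory Num.Theory.
Local Open Scope ring_scope.

(* The plane is cut into poly(1/eps) cells by two families of lines whose
   distances to the depot grow geometrically, so that the points of a cell are
   within eps^2 times their distance to the depot.  A travelling salesman tour
   through the terminals, of length L <= opt, can be modified at a cost of
   O(eps) L + poly(1/eps) D_max so that it crosses every box of some guillotine
   decomposition refining the cells O(1/eps) times (each favourable cut is
   bridged, and the bridges are charged to the crossings); a dynamic programme
   over boxes finds, in every cell, paths that are at least as short.

   The tours of OPT are rounded in every cell.  Large items (demand > eps) are
   linearly grouped, and an item of group g + 1 leaves its slot to an item of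
   group g.  The small items of a tour are all reserved in a single cell of that
   tour, chosen so that the imbalances of the cells stay small in the l2 sense;
   the imbalances, the first groups and the roundings are absorbed by extra
   tours.  A rounded plan only consists of the multiplicities of boundedly many
   tour types, which the algorithm enumerates.  Each slot is filled with
   consecutive small items along the path of its cell: connecting them costs at
   most the total length of the paths, about L, on top of about opt for the tours
   through representatives, hence the factor 2.  All additive errors are
   poly(1/eps) C^2 D_min, and opt >= Gamma D_min >= C^3 D_min, where C exceeds
   every polynomial in 1/eps. *)

(** * Structured programs on the real RAM *)

Section Machine.
Variable R : realType.
Notation st := (state R).
Implicit Types (s : st) (d j k : nat).

(** The machine cannot round reals, so the program never sees the grid, the pixels or the cuts: they
    belong to the analysis only. A cell reaches the program as four terminals spanning its bounding
    box, a path as the order relation that it induces, a floor as a count. Whatever the program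
    cannot compute from the input is packed into one natural number, the advice, below a polynomial
    in n; trying all of them and keeping the cheapest feasible decoding leaves only the existence of
    one good advice to be proved. Apart from input and output no code is written by hand: polynomial
    computability is closed under bounded sums, case distinctions, minimization and passes over
    arrays, and the program is assembled from these closure properties. One integer p between 1/eps
    and 1/eps + 1 sets all parameters: 1/p is the threshold of large items, fewer than p edges are
    set aside at each end of a bridge, and the grid refines by the ratio 1 + 1/(12 p^2). The numbers
    of cells and blocks are then bounded by a fixed power of p, which is below (1/eps)^(1/eps) as
    soon as 1/eps > 100; this is the origin of the bound on eps. *)

Lemma exec_det c s t1 s1 t2 s2 : exec c s t1 s1 -> exec c s t2 s2 -> s1 = s2.
Proof.
move=> h; elim: h t2 s2 => {c s t1 s1}.
- by move=> s t2 s2 h; inversion h.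
- by move=> a e s t2 s2 h; inversion h.
- by move=> a e s t2 s2 h; inversion h.
- move=> c d s1 t1 s2 t2 s3 _ IH1 _ IH2 t s h; inversion h; subst.
  by have E := IH1 _ _ H1; subst; apply: IH2 H5.
- move=> b c d s t s' hb _ IH t2 s2 h; inversion h; subst; first by eauto.
  by match goal with H : is_true (~~ _) |- _ => rewrite hb in H end.
- move=> b c d s t s' hb _ IH t2 s2 h; inversion h; subst; last by eauto.
  by match goal with H : is_true (teval s b) |- _ => rewrite H in hb end.
- move=> b c s hb t2 s2 h; inversion h; subst => //.
  by match goal with H : is_true (teval _ b) |- _ => rewrite H in hb end.
- move=> b c s1 t1 s2 t2 s3 hb _ IH1 _ IH2 t s h; inversion h; subst.
    by match goal with H : is_true (~~ _) |- _ => rewrite hb in H end.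
  by match goal with H : exec c s1 _ _ |- _ => have E := IH1 _ _ H end; subst; eauto.
Qed.

(* Registers are the cells at multiples of 16; the cells congruent to [j] modulo
   16, for 0 < j < 16, form the array number [j]. *)
Definition prot d y : bool := ~~ ((16 %| y) && (16 * d <= y))%N.

(** Register [d] and those above it serve as an evaluation stack: a computation with target [d] may
    spoil them, while lower registers and all arrays survive. A second operand can thus be computed
    at [d.+1] without losing the first. *)
Definition same d s s' : Prop :=
  forall y, prot d y -> nmem s' y = nmem s y /\ rmem s' y = rmem s y.

Lemma same_trans d s s' s'' : same d s s' -> same d s' s'' -> same d s s''.
Proof. by move=> h h' y p; have [-> ->] := h' y p; apply: h. Qed.

Lemma prot_le d d' y : (d <= d')%N -> prot d y -> prot d' y.
Proof.
move=> h; apply: contra => /andP[-> /= h']; apply: leq_trans h'.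
by rewrite leq_mul2l.
Qed.

Lemma same_le d d' s s' : (d <= d')%N -> same d' s s' -> same d s s'.
Proof. by move=> h h' y /(prot_le h); apply: h'. Qed.

Lemma prot_reg d i : prot d (16 * i) = (i < d)%N.
Proof. by rewrite /prot dvdn_mulr //= leq_mul2l /= -ltnNge. Qed.

Lemma prot_arr d x j : (0 < j < 16)%N -> prot d (16 * x + j).
Proof.
case/andP=> j0 j16; rewrite /prot; apply/negP => /andP[+ _].
by rewrite dvdn_addr ?dvdn_mulr // gtnNdvd.
Qed.

(** Cell 1 is entry 0 of array 1, where n is kept throughout; all bounds on time and on values are
    relative to it. *)
Definition sz s : nat := nmem s 1.

Lemma same_sz d s s' : same d s s' -> sz s' = sz s.
Proof. by move=> h; case: (h 1%N). Qed.

Lemma same_reg d s s' i : same d s s' -> (i < d)%N -> nmem s' (16 * i) = nmem s (16 * i).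
Proof. by move=> h; rewrite -prot_reg => /h[]. Qed.

Lemma same_rreg d s s' i : same d s s' -> (i < d)%N -> rmem s' (16 * i) = rmem s (16 * i).
Proof. by move=> h; rewrite -prot_reg => /h[]. Qed.

Lemma same_nset d s i x : (d <= i)%N -> same d s (nset s (16 * i) x).
Proof.
move=> h y; rewrite /nset /=; case: eqP => // ->.
by rewrite prot_reg ltnNge h.
Qed.

Lemma same_rset d s i x : (d <= i)%N -> same d s (rset s (16 * i) x).
Proof.
move=> h y; rewrite /rset /=; case: eqP => // ->.
by rewrite prot_reg ltnNge h.
Qed.

Lemma nset_reg s i x : nmem (nset s (16 * i) x) (16 * i) = x.
Proof. by rewrite /nset /= eqxx. Qed.

Lemma rset_reg s i x : rmem (rset s (16 * i) x) (16 * i) = x.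
Proof. by rewrite /rset /= eqxx. Qed.

(** With a base of at least 2, constants, sums and products of such bounds are again below a power
    of the same base, so that resource bounds reduce to bookkeeping of exponents. *)
Definition pol k m : nat := (m + 2) ^ k.

Lemma pol_gt0 k m : (0 < pol k m)%N. Proof. by rewrite expn_gt0 addn2. Qed.

Lemma pol_le k k' m : (k <= k')%N -> (pol k m <= pol k' m)%N.
Proof. by move=> h; rewrite leq_pexp2l // addn2. Qed.

Lemma pol_const c m : (c <= pol c m)%N.
Proof.
apply: leq_trans (ltnW (ltn_expl c (ltnSn 1))) _.
by case: c => [|c] //; rewrite /pol leq_exp2r // addn2.
Qed.

Lemma pol_mul k k' m : (pol k m * pol k' m = pol (k + k') m)%N.
Proof. by rewrite /pol expnD. Qed.

Lemma pol_add k k' m : (pol k m + pol k' m <= pol (k + k').+1 m)%N.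
Proof.
rewrite /pol expnS expnD.
have := pol_gt0 k m; have := pol_gt0 k' m; rewrite /pol.
by move: (_ ^ k)%N (_ ^ k')%N => a b; nia.
Qed.

Lemma pol_mulE x y k k' m : (x <= pol k m -> y <= pol k' m -> x * y <= pol (k + k') m)%N.
Proof. by move=> h h'; rewrite -pol_mul leq_mul. Qed.

Lemma pol_addE x y k k' m :
  (x <= pol k m -> y <= pol k' m -> x + y <= pol (k + k').+1 m)%N.
Proof. by move=> h h'; apply: leq_trans (pol_add k k' m); rewrite leq_add. Qed.

Lemma polS x k m : (x <= pol k m -> x.+1 <= pol k.+1 m)%N.
Proof.
move=> h; rewrite /pol expnS; have := pol_gt0 k m; move: h; rewrite /pol.
by move: (_ ^ k)%N => a; nia.
Qed.

Record world := World { wN : nat -> nat -> nat; wR : nat -> nat -> R }.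

(** The environment of an expression: the data [car] it may refer to, how a state represents them,
    the first register [lv] free for scratch, and the contents of the arrays. [cb] bounds the
    integers stored in arrays, because a value read there may become a loop bound. *)
Record ctx := Ctx {
  car : Type;
  crep : car -> st -> Prop;
  lv : nat;
  cw : car -> world;
  cb : nat;
  cst : forall a s s', same lv s s' -> crep a s -> crep a s';
  carr : forall a s, crep a s -> forall j x, (0 < j < 16)%N ->
    [/\ nmem s (16 * x + j) = wN (cw a) j x,
        rmem s (16 * x + j) = wR (cw a) j x &
        (nmem s (16 * x + j) <= pol cb (sz s))%N] }.

(** Code must exist for every target register, so that subexpressions can be placed anywhere on the
    stack; one program and one exponent serve all states. The value itself has to be polynomial
    since it may bound a loop, which a real, in [rcomp], cannot do. *)
Definition ncomp (G : ctx) (f : car G -> nat) : Prop :=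
  forall d, (lv G <= d)%N -> exists c k, forall a s, crep a s ->
    exists t s', [/\ exec c s t s', same d s s', nmem s' (16 * d) = f a,
      (t <= pol k (sz s))%N & (f a <= pol k (sz s))%N].

Definition rcomp (G : ctx) (f : car G -> R) : Prop :=
  forall d, (lv G <= d)%N -> exists c k, forall a s, crep a s ->
    exists t s', [/\ exec c s t s', same d s s', rmem s' (16 * d) = f a &
      (t <= pol k (sz s))%N].

Definition bcomp (G : ctx) (f : car G -> bool) : Prop :=
  ncomp (fun a : car G => nat_of_bool (f a)).

Definition ncell i := NCell (NConst (16 * i)).
Definition rcell i := RCell (NConst (16 * i)).

Lemma nc_const (G : ctx) m : ncomp (fun _ : car G => m).
Proof.
move=> d ld; exists (NSet (NConst (16 * d)) (NConst m)), m => a s ra.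
exists 1%N, (nset s (16 * d) m); split; rewrite ?nset_reg ?pol_gt0 ?pol_const //.
  exact: (ExecNSet (NConst (16 * d)) (NConst m)).
exact: same_nset.
Qed.

Lemma rc_const (G : ctx) (m : nat) : rcomp (fun _ : car G => m%:R : R).
Proof.
move=> d ld; exists (RSet (NConst (16 * d)) (RConst m)), 0%N => a s ra.
exists 1%N, (rset s (16 * d) m%:R); split; rewrite ?rset_reg ?pol_gt0 //.
  exact: (ExecRSet (NConst (16 * d)) (RConst m)).
exact: same_rset.
Qed.

Lemma nc_ext (G : ctx) (f g : car G -> nat) : f =1 g -> ncomp f -> ncomp g.
Proof.
move=> e h d ld; have [c [k hc]] := h d ld; exists c, k => a s ra.
by rewrite -e; apply: hc.
Qed.

Lemma rc_ext (G : ctx) (f g : car G -> R) : f =1 g -> rcomp f -> rcomp g.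
Proof.
move=> e h d ld; have [c [k hc]] := h d ld; exists c, k => a s ra.
by rewrite -e; apply: hc.
Qed.

Lemma nc_op2 (G : ctx) (op : nat -> nat -> nat) (e : nexp -> nexp -> nexp) (f g : car G -> nat) :
    (forall s x y, neval s (e x y) = op (neval s x) (neval s y)) ->
    (forall x y, (op x y <= x + y)%N) ->
  ncomp f -> ncomp g -> ncomp (fun a => op (f a) (g a)).
Proof.
move=> ee ob hf hg d ld.
have [c1 [k1 h1]] := hf d ld; have [c2 [k2 h2]] := hg d.+1 (leqW ld).
exists (Seq c1 (Seq c2 (NSet (NConst (16 * d)) (e (ncell d) (ncell d.+1))))).
exists (k1 + k2.+1).+1 => a s ra.
have [t1 [s1 [e1 m1 v1 b1 q1]]] := h1 a s ra.
have ra1 := cst (same_le ld m1) ra.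
have [t2 [s2 [e2 m2 v2 b2 q2]]] := h2 a s1 ra1.
rewrite (same_sz m1) in b2 q2.
exists (t1 + (t2 + 1))%N; eexists; split.
- by apply: ExecSeq e1 _; apply: ExecSeq e2 _; apply: ExecNSet.
- apply: same_trans m1 _; apply: same_trans (same_le (leqnSn d) m2) _ => /=.
  exact: same_nset.
- by rewrite /= ee /= eqxx v2 (same_reg m2) // v1.
- by apply: pol_addE => //; rewrite addn1; apply: polS.
- apply: leq_trans (ob _ _) _; apply: leq_trans (pol_addE q1 q2) _.
  by apply: pol_le; lia.
Qed.

Lemma nc_add (G : ctx) (f g : car G -> nat) :
  ncomp f -> ncomp g -> ncomp (fun a => f a + g a)%N.
Proof. exact: (@nc_op2 G addn NAdd). Qed.

Lemma nc_sub (G : ctx) (f g : car G -> nat) :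
  ncomp f -> ncomp g -> ncomp (fun a => f a - g a)%N.
Proof. by apply: (@nc_op2 G subn NSub) => // x y; lia. Qed.

Lemma rc_op2 (G : ctx) (op : R -> R -> R) (e : rexp -> rexp -> rexp) (f g : car G -> R) :
    (forall s x y, reval s (e x y) = op (reval s x) (reval s y)) ->
  rcomp f -> rcomp g -> rcomp (fun a => op (f a) (g a)).
Proof.
move=> ee hf hg d ld.
have [c1 [k1 h1]] := hf d ld; have [c2 [k2 h2]] := hg d.+1 (leqW ld).
exists (Seq c1 (Seq c2 (RSet (NConst (16 * d)) (e (rcell d) (rcell d.+1))))).
exists (k1 + k2.+1).+1 => a s ra.
have [t1 [s1 [e1 m1 v1 b1]]] := h1 a s ra.
have ra1 := cst (same_le ld m1) ra.
have [t2 [s2 [e2 m2 v2 b2]]] := h2 a s1 ra1.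
rewrite (same_sz m1) in b2.
exists (t1 + (t2 + 1))%N; eexists; split.
- by apply: ExecSeq e1 _; apply: ExecSeq e2 _; apply: ExecRSet.
- apply: same_trans m1 _; apply: same_trans (same_le (leqnSn d) m2) _ => /=.
  exact: same_rset.
- by rewrite /= ee /= eqxx v2 (same_rreg m2) // v1.
- by apply: pol_addE => //; rewrite addn1; apply: polS.
Qed.

Lemma rc_add (G : ctx) (f g : car G -> R) :
  rcomp f -> rcomp g -> rcomp (fun a => f a + g a).
Proof. exact: (@rc_op2 G +%R RAdd). Qed.

Lemma rc_sub (G : ctx) (f g : car G -> R) :
  rcomp f -> rcomp g -> rcomp (fun a => f a - g a).
Proof. exact: (@rc_op2 G (fun x y => x - y) RSub). Qed.

Lemma rc_mul (G : ctx) (f g : car G -> R) :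
  rcomp f -> rcomp g -> rcomp (fun a => f a * g a).
Proof. exact: (@rc_op2 G *%R RMul). Qed.

Lemma rc_sqrt (G : ctx) (f : car G -> R) :
  rcomp f -> rcomp (fun a => Num.sqrt (f a)).
Proof.
move=> hf; apply: (@rc_op2 G (fun x y => Num.sqrt x) (fun x _ => RSqrt x) f f) => //.
Qed.

Lemma nc_rle (G : ctx) (f g : car G -> R) :
  rcomp f -> rcomp g -> bcomp (fun a => f a <= g a).
Proof.
move=> hf hg d ld.
have [c1 [k1 h1]] := hf d ld; have [c2 [k2 h2]] := hg d.+1 (leqW ld).
exists (Seq c1 (Seq c2 (If (RLe (rcell d) (rcell d.+1)) (NSet (NConst (16 * d)) (NConst 1))
  (NSet (NConst (16 * d)) (NConst 0))))).
exists (k1 + k2.+2).+1 => a s ra.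
have [t1 [s1 [e1 m1 v1 b1]]] := h1 a s ra.
have ra1 := cst (same_le ld m1) ra.
have [t2 [s2 [e2 m2 v2 b2]]] := h2 a s1 ra1.
rewrite (same_sz m1) in b2.
have tv : teval s2 (RLe (rcell d) (rcell d.+1)) = (f a <= g a).
  by rewrite /= v2 (same_rreg m2) // v1.
exists (t1 + (t2 + 2))%N, (nset s2 (16 * d) (nat_of_bool (f a <= g a)%R)); split.
- apply: ExecSeq e1 _; apply: ExecSeq e2 _.
  case E : (f a <= g a).
    by apply: ExecIfT; [rewrite tv | apply: (ExecNSet (NConst (16 * d)) (NConst 1))].
  by apply: ExecIfF; [rewrite tv E | apply: (ExecNSet (NConst (16 * d)) (NConst 0))].
- apply: same_trans m1 _; apply: same_trans (same_le (leqnSn d) m2) _ => /=.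
  exact: same_nset.
- by rewrite nset_reg.
- by apply: pol_addE => //; rewrite addn2; do 2 apply: polS.
- by apply: leq_trans (pol_gt0 _ _); case: (_ <= _).
Qed.

(** Integer cells have no multiplication; four doublings produce the factor 16 of array
    addresses. *)
Definition nsc (e : nexp) := let e2 := NAdd e e in let e4 := NAdd e2 e2 in
  let e8 := NAdd e4 e4 in NAdd e8 e8.

Lemma neval_sc s e : neval s (nsc e) = (16 * neval s e)%N.
Proof. by rewrite /nsc /=; lia. Qed.

Lemma neval_addr s e j : neval s (NAdd (nsc e) (NConst j)) = (16 * neval s e + j)%N.
Proof. by rewrite -neval_sc. Qed.

Lemma nc_read (G : ctx) j (f : car G -> nat) : (0 < j < 16)%N ->
  ncomp f -> ncomp (fun a => wN (cw a) j (f a)).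
Proof.
move=> hj hf d ld; have [c [k h]] := hf d ld.
exists (Seq c (NSet (NConst (16 * d)) (NCell (NAdd (nsc (ncell d)) (NConst j))))).
exists (k.+1 + cb G)%N => a s ra.
have [t [s1 [e m v b q]]] := h a s ra.
have ra1 := cst (same_le ld m) ra.
have [w1 _ w3] := carr ra1 (f a) hj; rewrite (same_sz m) w1 in w3.
exists (t + 1)%N; eexists; split.
- by apply: ExecSeq e _; apply: ExecNSet.
- by apply: same_trans m _; apply: same_nset.
- by rewrite nset_reg -w1; simpl neval; rewrite v; congr nmem; lia.
- rewrite addn1; apply: leq_trans (polS b) _; apply: pol_le; lia.
- by apply: leq_trans w3 _; apply: pol_le; lia.
Qed.

Lemma rc_read (G : ctx) j (f : car G -> nat) : (0 < j < 16)%N ->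
  ncomp f -> rcomp (fun a => wR (cw a) j (f a)).
Proof.
move=> hj hf d ld; have [c [k h]] := hf d ld.
exists (Seq c (RSet (NConst (16 * d)) (RCell (NAdd (nsc (ncell d)) (NConst j))))).
exists (k.+1)%N => a s ra.
have [t [s1 [e m v b q]]] := h a s ra.
have ra1 := cst (same_le ld m) ra.
have [_ w1 _] := carr ra1 (f a) hj.
exists (t + 1)%N; eexists; split.
- by apply: ExecSeq e _; apply: ExecRSet.
- by apply: same_trans m _; apply: same_rset.
- by rewrite rset_reg -w1; simpl reval; rewrite v; congr rmem; lia.
- by rewrite addn1; apply: polS.
Qed.

Lemma nc_if (G : ctx) (b : car G -> bool) (f g : car G -> nat) :
  bcomp b -> ncomp f -> ncomp g -> ncomp (fun a => if b a then f a else g a).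
Proof.
move=> hb hf hg d ld.
have [c [k h]] := hb d ld; have [c1 [k1 h1]] := hf d ld; have [c2 [k2 h2]] := hg d ld.
exists (Seq c (If (NLe (NConst 1) (ncell d)) c1 c2)), (k + (k1 + k2).+1).+1 => a s ra.
have [t [s1 [e m v q _]]] := h a s ra.
have ra1 := cst (same_le ld m) ra.
have [t1 [s2 [e1 m1 v1 q1 p1]]] := h1 a s1 ra1.
have [t2 [s3 [e2 m2 v2 q2 p2]]] := h2 a s1 ra1.
rewrite (same_sz m) in q1 p1 q2 p2.
have tv : teval s1 (NLe (NConst 1) (ncell d)) = b a by rewrite /= v; case: (b a).
case E : (b a).
- exists (t + t1.+1)%N, s2; split; rewrite ?E //.
  + by apply: ExecSeq e _; apply: ExecIfT; rewrite ?tv.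
  + exact: same_trans m m1.
  + by apply: pol_addE => //; apply: leq_trans (polS q1) _; apply: pol_le; lia.
  + by apply: leq_trans p1 _; apply: pol_le; lia.
- exists (t + t2.+1)%N, s3; split; rewrite ?E //.
  + by apply: ExecSeq e _; apply: ExecIfF; rewrite ?tv ?E.
  + exact: same_trans m m2.
  + by apply: pol_addE => //; apply: leq_trans (polS q2) _; apply: pol_le; lia.
  + by apply: leq_trans p2 _; apply: pol_le; lia.
Qed.

Lemma rc_if (G : ctx) (b : car G -> bool) (f g : car G -> R) :
  bcomp b -> rcomp f -> rcomp g -> rcomp (fun a => if b a then f a else g a).
Proof.
move=> hb hf hg d ld.
have [c [k h]] := hb d ld; have [c1 [k1 h1]] := hf d ld; have [c2 [k2 h2]] := hg d ld.
exists (Seq c (If (NLe (NConst 1) (ncell d)) c1 c2)), (k + (k1 + k2).+1).+1 => a s ra.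
have [t [s1 [e m v q _]]] := h a s ra.
have ra1 := cst (same_le ld m) ra.
have [t1 [s2 [e1 m1 v1 q1]]] := h1 a s1 ra1.
have [t2 [s3 [e2 m2 v2 q2]]] := h2 a s1 ra1.
rewrite (same_sz m) in q1 q2.
have tv : teval s1 (NLe (NConst 1) (ncell d)) = b a by rewrite /= v; case: (b a).
case E : (b a).
- exists (t + t1.+1)%N, s2; split; rewrite ?E //.
  + by apply: ExecSeq e _; apply: ExecIfT; rewrite ?tv.
  + exact: same_trans m m1.
  + by apply: pol_addE => //; apply: leq_trans (polS q1) _; apply: pol_le; lia.
- exists (t + t2.+1)%N, s3; split; rewrite ?E //.
  + by apply: ExecSeq e _; apply: ExecIfF; rewrite ?tv ?E.
  + exact: same_trans m m2.
  + by apply: pol_addE => //; apply: leq_trans (polS q2) _; apply: pol_le; lia.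
Qed.

Lemma ext_subproof1 (G : ctx) d k (a : car G * nat) s s' :
  same (maxn (lv G) d).+1 s s' ->
  [/\ crep a.1 s, nmem s (16 * d) = a.2 & (a.2 <= pol k (sz s))%N] ->
  [/\ crep a.1 s', nmem s' (16 * d) = a.2 & (a.2 <= pol k (sz s'))%N].
Proof.
move=> m [h1 h2 h3]; split.
- by apply: cst h1; apply: same_le m; lia.
- by rewrite (same_reg m) //; lia.
- by rewrite (same_sz m).
Qed.

Lemma ext_subproof2 (G : ctx) d k (a : car G * nat) s :
  [/\ crep a.1 s, nmem s (16 * d) = a.2 & (a.2 <= pol k (sz s))%N] ->
  forall j x, (0 < j < 16)%N ->
    [/\ nmem s (16 * x + j) = wN (cw a.1) j x,
        rmem s (16 * x + j) = wR (cw a.1) j x &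
        (nmem s (16 * x + j) <= pol (cb G) (sz s))%N].
Proof. by case=> h _ _; apply: carr. Qed.

(* The context extended with one loop variable, kept in register [d]. *)
Definition ext (G : ctx) d k : ctx :=
  @Ctx (car G * nat) _ (maxn (lv G) d).+1 (fun a => cw a.1) (cb G)
   (@ext_subproof1 G d k) (@ext_subproof2 G d k).

Lemma nc_lift (G : ctx) d k (f : car G -> nat) :
  ncomp f -> ncomp (fun a : car (ext G d k) => f a.1).
Proof.
move=> h d' ld; have [|c [k' hc]] := h d'; first by apply: leq_trans ld; rewrite /=; lia.
by exists c, k' => a s [ra _ _]; apply: hc.
Qed.

Lemma nc_var (G : ctx) d k : ncomp (fun a : car (ext G d k) => a.2).
Proof.
move=> d' ld; exists (NSet (NConst (16 * d')) (ncell d)), k => a s [ra v b].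
exists 1%N; eexists; split; first exact: ExecNSet.
- exact: same_nset.
- by rewrite nset_reg.
- exact: pol_gt0.
- by [].
Qed.

Definition ltcell d := NLe (NAdd (ncell d.+1) (NConst 1)) (ncell d).

Lemma while_exec body d b B (I : nat -> st -> Prop) :
    (forall i s, I i s -> nmem s (16 * d) = b /\ nmem s (16 * d.+1) = i) ->
    (forall i s, (i < b)%N -> I i s -> exists t s', [/\ exec body s t s', I i.+1 s' & (t <= B)%N]) ->
  forall s, I 0%N s -> exists t s',
    [/\ exec (While (ltcell d) body) s t s', I b s' & (t <= (b * B.+1).+1)%N].
Proof.
move=> hI hb.
suff: forall m i s, (i + m = b)%N -> I i s -> exists t s',
    [/\ exec (While (ltcell d) body) s t s', I b s' & (t <= (m * B.+1).+1)%N].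
  by move=> h s; apply: (h b 0%N).
elim=> [|m IH] i s im Is.
  have [e1 e2] := hI _ _ Is; have ib : i = b by lia.
  exists 1%N, s; split; [apply: ExecWhileF; rewrite /= e1 e2; lia | by rewrite -ib | by []].
have [e1 e2] := hI _ _ Is.
have [|t1 [s1 [x1 I1 l1]]] := hb i s _ Is; first lia.
have [|t2 [s2 [x2 I2 l2]]] := IH i.+1 s1 _ I1; first lia.
exists (t1 + t2).+1, s2; split=> //.
  by apply: ExecWhileT x1 x2; rewrite /= e1 e2; lia.
by rewrite mulSn; lia.
Qed.

Lemma exec_nset i e s v : neval s e = v ->
  exec (NSet (NConst (16 * i)) e) s 1 (nset s (16 * i) v).
Proof. by move=> <-; apply: (ExecNSet (NConst (16 * i))). Qed.

Lemma exec_rset i e s v : reval s e = v ->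
  exec (RSet (NConst (16 * i)) e) s 1 (rset s (16 * i) v).
Proof. by move=> <-; apply: (ExecRSet (NConst (16 * i))). Qed.

Lemma nset_regE s i x j :
  nmem (nset s (16 * i) x) (16 * j) = if j == i then x else nmem s (16 * j).
Proof. by rewrite /nset /= eqn_mul2l. Qed.

Lemma rset_regE s i x j :
  rmem (rset s (16 * i) x) (16 * j) = if j == i then x else rmem s (16 * j).
Proof. by rewrite /rset /= eqn_mul2l. Qed.

Lemma sz_nset s i x : sz (nset s (16 * i) x) = sz s.
Proof. by apply: (@same_sz 0); apply: same_nset. Qed.

(** The weaker invariant for code that writes into arrays. *)
Definition rsame d s s' : Prop :=
  (forall i, (i < d)%N -> nmem s' (16 * i) = nmem s (16 * i)) /\ sz s' = sz s.

Lemma same_rsame d s s' : same d s s' -> rsame d s s'.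
Proof. by move=> h; split=> [i|]; [apply: same_reg | apply: same_sz h]. Qed.

Lemma rsame_trans d s s' s'' : rsame d s s' -> rsame d s' s'' -> rsame d s s''.
Proof. by case=> h1 h2 [h3 h4]; split=> [i id|]; rewrite ?h3 ?h1 ?h4. Qed.

Lemma rsame_le d d' s s' : (d <= d')%N -> rsame d' s s' -> rsame d s s'.
Proof. by move=> h [h1 h2]; split=> // i id; apply: h1; apply: leq_trans h. Qed.

Lemma rsame_nset d s i x : (d <= i)%N -> rsame d s (nset s (16 * i) x).
Proof. by move=> h; apply/same_rsame/same_nset. Qed.

(** One loop shell for sums, minimization and array passes: [d] holds the bound, [d.+1] the counter,
    and the body works from [d.+2] on. The invariant [J] refers back to the state [s0] before the
    loop, where the context is known to be represented. *)
Lemma loop_gen (G : ctx) (b : car G -> nat) d cb1 kb init kI body kB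
    (J : car G -> st -> nat -> st -> Prop) :
    (lv G <= d)%N ->
    (forall a s, crep a s -> exists t s', [/\ exec cb1 s t s', same d s s',
       nmem s' (16 * d) = b a, (t <= pol kb (sz s))%N & (b a <= pol kb (sz s))%N]) ->
    (forall a s0 s, crep a s -> same d s0 s -> exists t s',
       [/\ exec init s t s', rsame d.+2 s s', J a s0 0%N s' & (t <= pol kI (sz s))%N]) ->
    (forall a s0 i s v, J a s0 i s -> J a s0 i (nset s (16 * d.+1) v)) ->
    (forall a s0 i s, crep a s0 -> (i < b a)%N -> (b a <= pol kb (sz s0))%N -> J a s0 i s ->
       nmem s (16 * d.+1) = i -> sz s = sz s0 -> exists t s',
       [/\ exec body s t s', rsame d.+2 s s', J a s0 i.+1 s' & (t <= pol kB (sz s0))%N]) ->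
  exists c k, forall a s, crep a s -> exists t s',
    [/\ exec c s t s', J a s (b a) s', rsame d s s' & (t <= pol k (sz s))%N].
Proof.
move=> ld h1 h2 h3 h4.
pose lbody := Seq body (NSet (NConst (16 * d.+1)) (NAdd (ncell d.+1) (NConst 1))).
exists (Seq cb1 (Seq (NSet (NConst (16 * d.+1)) (NConst 0)) (Seq init (While (ltcell d) lbody)))).
exists (kb + (kI + (kb + kB.+2).+1).+2).+1 => a s ra.
have [t1 [s1 [e1 m1 v1 b1 q1]]] := h1 a s ra.
have ra1 := cst (same_le ld m1) ra.
pose s2 := nset s1 (16 * d.+1) 0.
have m12 : same d s1 s2 by apply: same_nset.
have ra2 : crep a s2 by apply: cst ra1; apply: same_le m12.
have [t3 [s3 [e3 m3 J3 b3]]] := h2 a s s2 ra2 (same_trans m1 m12).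
have z2 : sz s2 = sz s by rewrite sz_nset (same_sz m1).
rewrite z2 in b3.
pose I i s' := [/\ J a s i s', rsame d s s', nmem s' (16 * d) = b a & nmem s' (16 * d.+1) = i].
have I0 : I 0%N s3.
  split=> //.
  - apply: rsame_trans (same_rsame m1) _; apply: rsame_trans (same_rsame m12) _.
    by apply: rsame_le m3; lia.
  - by rewrite m3.1 //; rewrite nset_regE ifF //; lia.
  - by rewrite m3.1 // nset_regE eqxx.
have hI i s' : I i s' -> nmem s' (16 * d) = b a /\ nmem s' (16 * d.+1) = i by case.
have hb i s' : (i < b a)%N -> I i s' ->
    exists t s'', [/\ exec lbody s' t s'', I i.+1 s'' & (t <= pol kB.+1 (sz s))%N].
  move=> ib [i1 i2 i3 i4].
  have [t [s'' [e m Jn bt]]] := h4 a s i s' ra ib q1 i1 i4 i2.2.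
  exists (t + 1)%N, (nset s'' (16 * d.+1) i.+1); split.
  - apply: ExecSeq e _; apply: exec_nset; rewrite /= m.1 // i4; lia.
  - split.
    + exact: h3.
    + apply: rsame_trans i2 _; apply: rsame_trans (rsame_le _ m) _; first lia.
      exact: rsame_nset.
    + by rewrite nset_regE ifF ?m.1 //; lia.
    + by rewrite nset_regE eqxx.
  - by rewrite addn1; apply: polS.
have [t4 [s4 [e4 [i1 i2 _ _] b4]]] := while_exec hI hb I0.
exists (t1 + (1 + (t3 + t4)))%N, s4; split=> //.
  apply: ExecSeq e1 _; apply: ExecSeq; first by apply: (@exec_nset d.+1 (NConst 0) s1 0).
  by apply: ExecSeq e3 e4.
apply: pol_addE => //; rewrite add1n; apply: polS; apply: pol_addE => //.
by apply: leq_trans b4 _; apply: polS; apply: pol_mulE => //; apply: polS.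
Qed.

Lemma nc_sum (G : ctx) (b : car G -> nat) (F : car G -> nat -> nat) :
    ncomp b -> (forall d k, ncomp (fun x : car (ext G d k) => F x.1 x.2)) ->
  ncomp (fun a => \sum_(i < b a) F a i)%N.
Proof.
move=> hb hF d ld; have [cb1 [kb h1]] := hb d ld.
have [|cF [kF h2]] := hF d.+1 kb (d + 3)%N; first by rewrite /=; lia.
pose init := NSet (NConst (16 * d.+2)) (NConst 0).
pose body := Seq cF (NSet (NConst (16 * d.+2)) (NAdd (ncell d.+2) (ncell (d + 3)))).
pose J (a : car G) s0 i (s : st) := same d s0 s /\ nmem s (16 * d.+2) = (\sum_(j < i) F a j)%N.
have [|||c [k hc]] := @loop_gen G b d cb1 kb init 0 body kF.+1 J ld h1.
- move=> a s0 s ra m; exists 1%N, (nset s (16 * d.+2) 0); split.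
  + exact: exec_nset.
  + exact: rsame_nset.
  + split; last by rewrite nset_regE eqxx big_ord0.
    by apply: same_trans m _; apply: same_nset; lia.
  + exact: pol_gt0.
- move=> a s0 i s v [j1 j2]; split; first by apply: same_trans j1 _; apply: same_nset.
  by rewrite nset_regE ifF //; lia.
- move=> a s0 i s ra ib q [j1 j2] vi zs.
  have [|t [s' [e m v bt _]]] := h2 (a, i) s.
    split=> //=; first by apply: cst ra; apply: same_le j1.
    by rewrite zs; lia.
  exists (t + 1)%N, (nset s' (16 * d.+2) (\sum_(j < i.+1) F a j)%N); split.
  + apply: ExecSeq e _; apply: exec_nset => /=.
    by rewrite v (same_reg m) ?j2 ?big_ord_recr //; lia.
  + apply: rsame_trans (rsame_le _ (same_rsame m)) _; first lia.
    exact: rsame_nset.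
  + split; last by rewrite nset_regE eqxx.
    apply: same_trans j1 _; apply: same_trans (same_le _ m) _; first lia.
    by apply: same_nset; lia.
  + by rewrite addn1; apply: polS; rewrite -zs.
exists (Seq c (NSet (NConst (16 * d)) (ncell d.+2))), (kb + kF + k.+1)%N => a s ra.
have [t [s' [e [m v] _ bt]]] := hc a s ra.
exists (t + 1)%N, (nset s' (16 * d) (\sum_(i < b a) F a i)%N); split.
- by apply: ExecSeq e _; apply: exec_nset.
- by apply: same_trans m _; apply: same_nset.
- by rewrite nset_regE eqxx.
- by rewrite addn1; apply: leq_trans (polS bt) _; apply: pol_le; lia.
have [_ [_ [_ _ _ _ q1]]] := h1 a s ra.
suff h : (\sum_(i < b a) F a i <= pol (kb + kF) (sz s))%N.
  by apply: leq_trans h _; apply: pol_le; lia.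
apply: leq_trans (pol_mulE q1 (leqnn (pol kF (sz s)))).
rewrite -[X in (_ <= X * _)%N]card_ord -sum_nat_const; apply: leq_sum => i _.
(* The bound on a summand is part of its computability: it is read off from a run of the body in a
   state whose counter holds [i]. *)
have [|_ [_ [_ _ _ _]]] := h2 (a, nat_of_ord i) (nset s (16 * d.+1) i).
  split; [by apply: cst ra; apply: same_le ld _; apply: same_nset|by rewrite nset_regE eqxx|].
  by rewrite sz_nset /=; have := ltn_ord i; lia.
by rewrite sz_nset.
Qed.

Lemma rc_sum (G : ctx) (b : car G -> nat) (F : car G -> nat -> R) :
    ncomp b -> (forall d k, rcomp (fun x : car (ext G d k) => F x.1 x.2)) ->
  rcomp (fun a => \sum_(i < b a) F a i).
Proof.
move=> hb hF d ld; have [cb1 [kb h1]] := hb d ld.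
have [|cF [kF h2]] := hF d.+1 kb (d + 3)%N; first by rewrite /=; lia.
pose init := RSet (NConst (16 * d.+2)) (RConst 0).
pose body := Seq cF (RSet (NConst (16 * d.+2)) (RAdd (rcell d.+2) (rcell (d + 3)))).
pose J (a : car G) s0 i (s : st) := same d s0 s /\ rmem s (16 * d.+2) = (\sum_(j < i) F a j).
have [|||c [k hc]] := @loop_gen G b d cb1 kb init 0 body kF.+1 J ld h1.
- move=> a s0 s ra m; exists 1%N, (rset s (16 * d.+2) 0); split.
  + exact: exec_rset.
  + by apply/same_rsame/same_rset.
  + split; last by rewrite rset_regE eqxx big_ord0.
    by apply: same_trans m _; apply: same_rset; lia.
  + exact: pol_gt0.
- move=> a s0 i s v [j1 j2]; split=> //; by apply: same_trans j1 _; apply: same_nset.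
- move=> a s0 i s ra ib q [j1 j2] vi zs.
  have [|t [s' [e m v bt]]] := h2 (a, i) s.
    split=> //=; first by apply: cst ra; apply: same_le j1.
    by rewrite zs; lia.
  exists (t + 1)%N, (rset s' (16 * d.+2) (\sum_(j < i.+1) F a j)); split.
  + apply: ExecSeq e _; apply: exec_rset => /=.
    by rewrite v (same_rreg m) ?j2 ?big_ord_recr //; lia.
  + by apply: rsame_trans (rsame_le _ (same_rsame m)) _; [lia | apply/same_rsame/same_rset].
  + split; last by rewrite rset_regE eqxx.
    apply: same_trans j1 _; apply: same_trans (same_le _ m) _; first lia.
    by apply: same_rset; lia.
  + by rewrite addn1; apply: polS; rewrite -zs.
exists (Seq c (RSet (NConst (16 * d)) (rcell d.+2))), k.+1 => a s ra.
have [t [s' [e [m v] _ bt]]] := hc a s ra.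
exists (t + 1)%N, (rset s' (16 * d) (\sum_(i < b a) F a i)); split.
- by apply: ExecSeq e _; apply: exec_rset.
- by apply: same_trans m _; apply: same_rset.
- by rewrite rset_regE eqxx.
- by rewrite addn1; apply: polS.
Qed.

(* [amin ok c N] is i.+1 for the first i < N minimizing [c] subject to [ok],
   and 0 if there is none. *)
Fixpoint amin (ok : nat -> bool) (c : nat -> R) N : nat :=
  if N is N'.+1 then
    let p := amin ok c N' in
    if ok N' && ~~ ((1 <= p)%N && (c p.-1 <= c N')) then N'.+1 else p
  else 0.

Lemma amin_le ok c N : (amin ok c N <= N)%N.
Proof. by elim: N => //= N IH; case: ifP => // _; apply: leqW. Qed.

Lemma aminP ok c N : let p := amin ok c N in
  if p is i.+1 then [/\ (i < N)%N, ok i & forall j, (j < N)%N -> ok j -> c i <= c j]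
  else forall j, (j < N)%N -> ~~ ok j.
Proof.
elim: N => [|N] //=; case E : (amin ok c N) => [|i] /= IH.
  rewrite andbT; case okN : (ok N).
    by split=> // j; rewrite ltnS leq_eqVlt => /orP[/eqP->//|/IH/negPf->].
  by move=> j; rewrite ltnS leq_eqVlt => /orP[/eqP->|/IH//]; rewrite okN.
have [iN oki mini] := IH.
case: ifP => [/andP[okN]|h].
  rewrite -ltNge => h; split=> // j; rewrite ltnS leq_eqVlt => /orP[/eqP->//|jN okj].
  by apply: le_trans (ltW h) _; apply: mini.
split=> //; first exact: leqW.
move=> j; rewrite ltnS leq_eqVlt => /orP[/eqP->|jN okj]; last exact: mini.
by move=> okN; move: h; rewrite okN /= => /negbT; rewrite negbK.
Qed.

(** The integer and the real cell of register [d.+2] cooperate: the first holds the current value of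
    [amin], the second the cost of the candidate it designates. The real is meaningful only when the
    integer is positive, hence the guard in [J]. *)
Lemma nc_amin (G : ctx) (b : car G -> nat) (ok : car G -> nat -> bool) (c : car G -> nat -> R) :
    ncomp b -> (forall d k, bcomp (fun x : car (ext G d k) => ok x.1 x.2)) ->
    (forall d k, rcomp (fun x : car (ext G d k) => c x.1 x.2)) ->
  ncomp (fun a => amin (ok a) (c a) (b a)).
Proof.
move=> hb hF hG d ld; have [cb1 [kb h1]] := hb d ld.
have [|cF [kF h2]] := hF d.+1 kb (d + 3)%N; first by rewrite /=; lia.
have [|cG [kG h3]] := hG d.+1 kb (d + 4)%N; first by rewrite /=; lia.
pose init := NSet (NConst (16 * d.+2)) (NConst 0).
pose upd := Seq (NSet (NConst (16 * d.+2)) (NAdd (ncell d.+1) (NConst 1)))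
   (RSet (NConst (16 * d.+2)) (rcell (d + 4))).
pose tst := TAnd (NLe (NConst 1) (ncell (d + 3)))
   (TNot (TAnd (NLe (NConst 1) (ncell d.+2)) (RLe (rcell d.+2) (rcell (d + 4))))).
pose body := Seq cF (Seq cG (If tst upd Skip)).
pose J (a : car G) s0 i (s : st) := [/\ same d s0 s, nmem s (16 * d.+2) = amin (ok a) (c a) i &
  (0 < amin (ok a) (c a) i)%N -> rmem s (16 * d.+2) = c a (amin (ok a) (c a) i).-1].
have [|||c0 [k hc]] := @loop_gen G b d cb1 kb init 0 body (kF + kG.+3).+1 J ld h1.
- move=> a s0 s ra m; exists 1%N, (nset s (16 * d.+2) 0); split.
  + exact: exec_nset.
  + exact: rsame_nset.
  + split=> //; last by rewrite nset_regE eqxx.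
    by apply: same_trans m _; apply: same_nset; lia.
  + exact: pol_gt0.
- move=> a s0 i s v [j1 j2 j3]; split=> //; first by apply: same_trans j1 _; apply: same_nset.
  by rewrite nset_regE ifF //; lia.
- move=> a s0 i s ra ib q [j1 j2 j3] vi zs.
  have [|t [s1 [e m v bt _]]] := h2 (a, i) s.
    split=> //=; first by apply: cst ra; apply: same_le j1.
    by rewrite zs; lia.
  have zs1 : sz s1 = sz s0 by rewrite (same_sz m).
  have vi1 : nmem s1 (16 * d.+1) = i by rewrite (same_reg m) //; lia.
  have [|t' [s2 [e' m' v' bt']]] := h3 (a, i) s1.
    split=> //=.
    - apply: cst ra; apply: same_trans (same_le ld j1) _; apply: same_le m; lia.
    - by rewrite zs1; lia.
  rewrite /= in v v'; rewrite zs in bt; rewrite zs1 in bt'.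
  have vi2 : nmem s2 (16 * d.+1) = i by rewrite (same_reg m') //; lia.
  have vp : nmem s2 (16 * d.+2) = amin (ok a) (c a) i.
    by rewrite (same_reg m') ?(same_reg m) //; lia.
  have vr : rmem s2 (16 * d.+2) = rmem s (16 * d.+2).
    by rewrite (same_rreg m') ?(same_rreg m) //; lia.
  have vo : nmem s2 (16 * (d + 3)) = ok a i by rewrite (same_reg m') ?v //; lia.
  have ms : same d s0 s2.
    apply: same_trans j1 _; apply: same_trans (same_le _ m) _; first lia.
    by apply: same_le m'; lia.
  have m2 : rsame d.+2 s s2.
    apply: rsame_trans (rsame_le _ (same_rsame m)) _; first lia.
    by apply: rsame_le (same_rsame m'); lia.
  have tv : teval s2 tst = ok a i && ~~ ((1 <= amin (ok a) (c a) i)%N &&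
       (c a (amin (ok a) (c a) i).-1 <= c a i)).
    rewrite /= vo vp vr v'; congr andb; first by case: (ok a i).
    congr negb; case E : (0 < amin (ok a) (c a) i)%N => //=; by rewrite j3.
  case E : (teval s2 tst).
  + exists (t + (t' + (1 + 1).+1))%N, (rset (nset s2 (16 * d.+2) i.+1) (16 * d.+2) (c a i)).
    split.
    * apply: ExecSeq e _; apply: ExecSeq e' _; apply: ExecIfT => //.
      apply: ExecSeq; first by apply: exec_nset; rewrite /= vi2 addn1.
      by apply: exec_rset; rewrite /= v'.
    * apply: rsame_trans m2 _; apply: (@rsame_trans _ _ (nset s2 (16 * d.+2) i.+1)).
        exact: rsame_nset.
      by apply/same_rsame/same_rset.
    * split.
      - apply: same_trans ms _; apply: (@same_trans _ _ (nset s2 (16 * d.+2) i.+1)).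
          by apply: same_nset; lia.
        by apply: same_rset; lia.
      - change (nmem (nset s2 (16 * d.+2) i.+1) (16 * d.+2) = amin (ok a) (c a) i.+1).
        by rewrite nset_regE eqxx /= -tv E.
      - by rewrite rset_regE eqxx => _; rewrite /= -tv E.
    * apply: pol_addE => //; rewrite addn3; do 3 apply: polS; exact: bt'.
  + exists (t + (t' + 2))%N, s2; split=> //.
    * apply: ExecSeq e _; apply: ExecSeq e' _; apply: ExecIfF; rewrite ?E //.
      exact: ExecSkip.
    * by split=> //; rewrite /= -tv E ?vr // vp.
    * apply: pol_addE => //; apply: leq_trans (polS (polS (polS bt'))); lia.
exists (Seq c0 (NSet (NConst (16 * d)) (ncell d.+2))), (kb + k.+1)%N => a s ra.
have [t [s' [e [m v _] _ bt]]] := hc a s ra.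
exists (t + 1)%N, (nset s' (16 * d) (amin (ok a) (c a) (b a))); split.
- by apply: ExecSeq e _; apply: exec_nset.
- by apply: same_trans m _; apply: same_nset.
- by rewrite nset_regE eqxx.
- by rewrite addn1; apply: leq_trans (polS bt) _; apply: pol_le; lia.
have [_ [_ [_ _ _ _ q1]]] := h1 a s ra.
by apply: leq_trans (amin_le _ _ _) _; apply: leq_trans q1 _; apply: pol_le; lia.
Qed.

End Machine.

Section Closure.
Variable R : realType.
Notation st := (state R).
Variable G : ctx R.

Lemma bc_leq (f g : car G -> nat) : ncomp f -> ncomp g -> bcomp (fun a => f a <= g a)%N.
Proof.
move=> hf hg; apply: (@nc_ext _ _ (fun a => 1 - (f a - g a))%N); last first.
  by apply: nc_sub; [apply: nc_const | apply: nc_sub].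
by move=> a; case: leqP; lia.
Qed.

Lemma bc_not (b : car G -> bool) : bcomp b -> bcomp (fun a => ~~ b a).
Proof.
move=> hb; apply: (@nc_ext _ _ (fun a => 1 - b a)%N); first by move=> a; case: (b a).
by apply: nc_sub => //; apply: nc_const.
Qed.

Lemma bc_and (b c : car G -> bool) : bcomp b -> bcomp c -> bcomp (fun a => b a && c a).
Proof.
move=> hb hc; apply: (@nc_ext _ _ (fun a => if b a then nat_of_bool (c a) else 0%N)).
  by move=> a; case: (b a).
by apply: nc_if => //; apply: nc_const.
Qed.

Lemma bc_or (b c : car G -> bool) : bcomp b -> bcomp c -> bcomp (fun a => b a || c a).
Proof.
move=> hb hc; apply: (@nc_ext _ _ (fun a => if b a then 1%N else nat_of_bool (c a))).
  by move=> a; case: (b a).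
by apply: nc_if => //; apply: nc_const.
Qed.

Lemma bc_eqn (f g : car G -> nat) : ncomp f -> ncomp g -> bcomp (fun a => f a == g a).
Proof.
move=> hf hg; apply: (@nc_ext _ _ (fun a => nat_of_bool ((f a <= g a) && (g a <= f a)))%N).
  by move=> a; rewrite -eqn_leq.
by apply: bc_and; apply: bc_leq.
Qed.

Lemma bc_rlt (f g : car G -> R) : rcomp f -> rcomp g -> bcomp (fun a => f a < g a).
Proof.
move=> hf hg; apply: (@nc_ext _ _ (fun a => nat_of_bool (~~ (g a <= f a)))).
  by move=> a; rewrite ltNge.
by apply: bc_not; apply: nc_rle.
Qed.

End Closure.

Section Closure2.
Variable R : realType.
Notation st := (state R).
Variable G : ctx R.

Lemma bc_all (f : car G -> nat) (P : car G -> nat -> bool) :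
    ncomp f -> (forall d k, bcomp (fun x : car (ext G d k) => P x.1 x.2)) ->
  bcomp (fun a => all (P a) (iota 0 (f a))).
Proof.
move=> hf hP; apply: (@nc_ext _ _ (fun a => nat_of_bool (\sum_(i < f a) ~~ P a i == 0)%N)).
  move=> a; congr nat_of_bool; rewrite sum_nat_eq0.
  apply/forallP/allP => [h i|h i]; last by rewrite implyTb eqb0 negbK h // mem_iota ltn_ord.
  by rewrite mem_iota add0n => /andP[_ hi]; have := h (Ordinal hi); rewrite implyTb eqb0 negbK.
apply: bc_eqn; last exact: nc_const.
apply: (@nc_sum _ G f (fun a i => nat_of_bool (~~ P a i))) => // d k.
exact: bc_not.
Qed.

Lemma nc_mul (f g : car G -> nat) : ncomp f -> ncomp g -> ncomp (fun a => f a * g a)%N.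
Proof.
move=> hf hg; apply: (@nc_ext _ _ (fun a => \sum_(i < f a) g a)%N).
  by move=> a; rewrite sum_nat_const card_ord.
by apply: (@nc_sum _ G f (fun a _ => g a)) => // d k; apply: (@nc_lift _ G d k g).
Qed.

Lemma nc_exp (f : car G -> nat) k : ncomp f -> ncomp (fun a => f a ^ k)%N.
Proof.
move=> hf; elim: k => [|k IH]; first by apply: (@nc_ext _ _ (fun _ => 1%N)) => //; apply: nc_const.
apply: (@nc_ext _ _ (fun a => f a * f a ^ k)%N); first by move=> a; rewrite expnS.
exact: nc_mul.
Qed.

End Closure2.

Lemma sum_lt n q : (\sum_(i < n) (i < q))%N = minn n q.
Proof. by elim: n => [|n IH]; rewrite ?big_ord0 ?min0n // big_ord_recr /= IH; lia. Qed.

Section Closure3.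
Variable R : realType.
Notation st := (state R).
Variable G : ctx R.

Lemma nc_succ (H : ctx R) (f : car H -> nat) : ncomp f -> ncomp (fun a => (f a).+1).
Proof.
move=> hf; apply: (@nc_ext _ _ (fun a => f a + 1)%N); first by move=> a; rewrite addn1.
by apply: nc_add => //; apply: nc_const.
Qed.

(** A quotient is the number of positive multiples of the divisor up to the dividend. Such counting
    loops stay polynomial because computable integers are polynomially bounded by definition. *)
Lemma nc_div (f g : car G -> nat) : ncomp f -> ncomp g -> ncomp (fun a => f a %/ g a)%N.
Proof.
move=> hf hg.
apply: (@nc_ext _ _ (fun a => if g a == 0%N then 0%N else \sum_(i < f a) (i.+1 * g a <= f a))%N).
  move=> a; case: eqP => [->|/eqP g0]; first by rewrite divn0.
  rewrite -[RHS](minn_idPr (leq_div (f a) (g a))) -sum_lt; apply: eq_bigr => i _.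
  by rewrite leq_divRL // lt0n.
apply: nc_if; [by apply: bc_eqn => //; apply: nc_const | exact: nc_const|].
apply: (@nc_sum _ G f (fun a i => nat_of_bool (i.+1 * g a <= f a)%N)) => // d k.
apply: (@bc_leq _ _ (fun x : car (ext G d k) => x.2.+1 * g x.1)%N (fun x => f x.1)).
  apply: nc_mul; [apply: nc_succ; exact: nc_var | exact: nc_lift].
exact: nc_lift.
Qed.

Lemma nc_mod (f g : car G -> nat) : ncomp f -> ncomp g -> ncomp (fun a => f a %% g a)%N.
Proof.
move=> hf hg; apply: (@nc_ext _ _ (fun a => f a - f a %/ g a * g a)%N).
  by move=> a; rewrite {1}(divn_eq (f a) (g a)) addKn.
by apply: nc_sub => //; apply: nc_mul => //; apply: nc_div.
Qed.

Lemma rc_nat (f : car G -> nat) : ncomp f -> rcomp (fun a => (f a)%:R : R).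
Proof.
move=> hf; apply: (@rc_ext _ _ (fun a => \sum_(i < f a) 1%:R)).
  by move=> a; rewrite sumr_const card_ord.
by apply: (@rc_sum _ G f (fun _ _ => 1%:R)) => // d k; apply: rc_const.
Qed.

End Closure3.

(** * Passes over the arrays *)

Section Worlds.
Variable R : realType.
Notation st := (state R).
Variable kap : nat.

Definition brep (w : world R) (s : st) : Prop := forall j x, (0 < j < 16)%N ->
  [/\ nmem s (16 * x + j) = wN w j x, rmem s (16 * x + j) = wR w j x &
      (nmem s (16 * x + j) <= pol kap (sz s))%N].

Lemma brep_same (w : world R) s s' : same 0 s s' -> brep w s -> brep w s'.
Proof.
move=> m h j x hj; have [h1 h2 h3] := h j x hj.
have [e1 e2] := m _ (prot_arr 0 x hj).
by rewrite e1 e2 (same_sz m).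
Qed.

Definition base : ctx R := @Ctx R (world R) brep 0 id kap brep_same (fun w s h => h).

Lemma brep_n w s : brep w s -> wN w 1 0 = sz s.
Proof. by move=> /(_ 1%N 0%N isT)[]. Qed.

(** The code exists above every register [d], so that a pass can be the body of a loop whose bound
    and counter lie below [d]. *)
Definition tcomp (F : world R -> world R) : Prop :=
  forall d, exists c k, forall w s, brep w s -> exists t s',
    [/\ exec c s t s', rsame d s s', brep (F w) s' & (t <= pol k (sz s))%N].

Lemma tc_comp F F' : tcomp F -> tcomp F' -> tcomp (fun w => F' (F w)).
Proof.
move=> h1 h2 d; have [c1 [k1 {}h1]] := h1 d; have [c2 [k2 {}h2]] := h2 d.
exists (Seq c1 c2), (k1 + k2).+1 => w s ra.
have [t1 [s1 [e1 m1 r1 b1]]] := h1 w s ra.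
have [t2 [s2 [e2 m2 r2 b2]]] := h2 _ s1 r1.
exists (t1 + t2)%N, s2; split=> //; first exact: ExecSeq e1 e2.
  exact: rsame_trans m1 m2.
by rewrite m1.2 in b2; apply: pol_addE.
Qed.

Lemma tc_iter (b : world R -> nat) F : @ncomp R base b -> tcomp F ->
  tcomp (fun w => iter (b w) F w).
Proof.
move=> hb hF d; have [cb1 [kb h1]] := hb d (leq0n d).
have [cF [kF h2]] := hF d.+2.
pose J w (s0 : st) i (s : st) := brep (iter i F w) s.
have [|||c [k hc]] := @loop_gen R base b d cb1 kb Skip 0 cF kF J (leq0n d) h1.
- move=> w s0 s ra m; exists 1%N, s; split; rewrite ?pol_gt0 //; exact: ExecSkip.
- move=> w s0 i s v; apply: brep_same; exact: same_nset.
- move=> w s0 i s ra ib q hJ vi zs; have [t [s' [e m r bt]]] := h2 _ s hJ.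
  by exists t, s'; rewrite -zs.
by exists c, k => w s ra; have [t [s' [e m r bt]]] := hc w s ra; exists t, s'.
Qed.

Definition setN (w : world R) j b (f : nat -> nat) : world R :=
  World (fun j' x => if (j' == j) && (x < b)%N then f x else wN w j' x) (wR w).

Definition setR (w : world R) j b (f : nat -> R) : world R :=
  World (wN w) (fun j' x => if (j' == j) && (x < b)%N then f x else wR w j' x).

Definition wbd (w : world R) : Prop :=
  forall j x, (0 < j < 16)%N -> (wN w j x <= pol kap (wN w 1 0))%N.

Lemma brep_wbd w s : brep w s -> wbd w.
Proof. by move=> h j x hj; rewrite (brep_n h); have [<-] := h j x hj. Qed.

Lemma addr_eq j x j' x' : (0 < j < 16)%N -> (0 < j' < 16)%N ->
  (16 * x + j == 16 * x' + j')%N = (j == j') && (x == x').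
Proof. by move=> h h'; apply/eqP/andP => [e|[/eqP-> /eqP->]//]; split; apply/eqP; lia. Qed.

Lemma reg_neq i x j : (0 < j < 16)%N -> (16 * i == 16 * x + j)%N = false.
Proof. by move=> h; apply/eqP; lia. Qed.

(** The pass evaluates [f] at [i] when the entries of array [j] below [i] are already overwritten;
    the hypothesis on [setN] says that this does not change the value. Array 1 is excluded because
    it carries the input and its size. *)
Lemma tc_wn j (b : world R -> nat) (f : world R -> nat -> nat) : (1 < j < 16)%N ->
    @ncomp R base b -> (forall d k, @ncomp R (ext base d k) (fun x => f x.1 x.2)) ->
    (forall w i g, f (setN w j i g) i = f w i) ->
    (forall w i, wbd w -> (i < b w)%N -> (f w i <= pol kap (wN w 1 0))%N) ->
  tcomp (fun w => setN w j (b w) (f w)).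
Proof.
move=> hj hb hf ind bd d.
have hj0 : (0 < j < 16)%N by lia.
have [cb1 [kb h1]] := hb d (leq0n d).
have [|cF [kF h2]] := hf d.+1 kb (d + 3)%N; first by rewrite /=; lia.
pose body := Seq cF (NSet (NAdd (nsc (ncell d.+1)) (NConst j)) (ncell (d + 3))).
pose J w (s0 : st) i (s : st) := brep (setN w j i (f w)) s.
have [|||c [k hc]] := @loop_gen R base b d cb1 kb Skip 0 body kF.+1 J (leq0n d) h1.
- move=> w s0 s ra m; exists 1%N, s; split; rewrite ?pol_gt0 //; first exact: ExecSkip.
  by move=> j' x hj'; rewrite /= ltn0 andbF; apply: ra.
- move=> w s0 i s v; apply: brep_same; exact: same_nset.
- move=> w s0 i s ra ib q hJ vi zs.
  have [|t [s' [e m v bt _]]] := h2 (setN w j i (f w), i) s.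
    by split=> //=; rewrite zs; lia.
  rewrite /= ind in v.
  have z' : sz s' = sz s0 by rewrite (same_sz m).
  exists (t + 1)%N, (nset s' (16 * i + j) (f w i)); split.
  + apply: ExecSeq e _.
    suff -> : (nset s' (16 * i + j) (f w i) =
        nset s' (neval s' (NAdd (nsc (ncell d.+1)) (NConst j))) (neval s' (ncell (d + 3))))%N.
      exact: ExecNSet.
    rewrite neval_addr /= v.
    by rewrite (same_reg m) ?vi //; lia.
  + split=> [r hr|]; first by rewrite /= reg_neq // (same_reg m) //; lia.
    by rewrite /sz /= ifF ?(same_sz m) //; [rewrite -/(sz s') z' -zs | apply/eqP; lia].
  + move=> j' x hj'.
    have sze : sz (nset s' (16 * i + j) (f w i)) = sz s0.
      by rewrite /sz /= ifF //; apply/eqP; lia.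
    have [g1 g2 g3] : [/\ nmem s' (16 * x + j') = wN (setN w j i (f w)) j' x,
        rmem s' (16 * x + j') = wR (setN w j i (f w)) j' x &
        (nmem s' (16 * x + j') <= pol kap (sz s'))%N].
      by apply: (brep_same (same_le (leq0n _) m) hJ).
    rewrite sze; split=> //=.
    * rewrite addr_eq // g1 /=; case: eqP => //= _.
      by rewrite ltnS; case: (ltngtP x i) => // ->.
    * rewrite addr_eq //; case: eqP => [_|_] /=; last by rewrite -z'.
      case: eqP => [_|_]; last by rewrite -z'.
      by rewrite -(brep_n ra); apply: bd => //; apply: brep_wbd ra.
  + by rewrite addn1; apply: polS; rewrite -zs.
by exists c, k => w s ra; have [t [s' [e m r bt]]] := hc w s ra; exists t, s'.
Qed.

Lemma tc_wr j (b : world R -> nat) (f : world R -> nat -> R) : (1 < j < 16)%N ->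
    @ncomp R base b -> (forall d k, @rcomp R (ext base d k) (fun x => f x.1 x.2)) ->
    (forall w i g, f (setR w j i g) i = f w i) ->
  tcomp (fun w => setR w j (b w) (f w)).
Proof.
move=> hj hb hf ind d.
have hj0 : (0 < j < 16)%N by lia.
have [cb1 [kb h1]] := hb d (leq0n d).
have [|cF [kF h2]] := hf d.+1 kb (d + 3)%N; first by rewrite /=; lia.
pose body := Seq cF (RSet (NAdd (nsc (ncell d.+1)) (NConst j)) (rcell (d + 3))).
pose J w (s0 : st) i (s : st) := brep (setR w j i (f w)) s.
have [|||c [k hc]] := @loop_gen R base b d cb1 kb Skip 0 body kF.+1 J (leq0n d) h1.
- move=> w s0 s ra m; exists 1%N, s; split; rewrite ?pol_gt0 //; first exact: ExecSkip.
  by move=> j' x hj'; rewrite /= ltn0 andbF; apply: ra.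
- move=> w s0 i s v; apply: brep_same; exact: same_nset.
- move=> w s0 i s ra ib q hJ vi zs.
  have [|t [s' [e m v bt]]] := h2 (setR w j i (f w), i) s.
    by split=> //=; rewrite zs; lia.
  rewrite /= ind in v.
  have z' : sz s' = sz s0 by rewrite (same_sz m).
  exists (t + 1)%N, (rset s' (16 * i + j) (f w i)); split.
  + apply: ExecSeq e _.
    suff -> : rset s' (16 * i + j) (f w i) =
        rset s' (neval s' (NAdd (nsc (ncell d.+1)) (NConst j))) (reval s' (rcell (d + 3))).
      exact: ExecRSet.
    rewrite neval_addr /= v.
    by rewrite (same_reg m) ?vi //; lia.
  + split=> [r hr|]; first by rewrite /= (same_reg m) //; lia.
    by rewrite -(same_sz m).
  + move=> j' x hj'.
    have [g1 g2 g3] : [/\ nmem s' (16 * x + j') = wN (setR w j i (f w)) j' x,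
        rmem s' (16 * x + j') = wR (setR w j i (f w)) j' x &
        (nmem s' (16 * x + j') <= pol kap (sz s'))%N].
      by apply: (brep_same (same_le (leq0n _) m) hJ).
    split=> //=.
    rewrite addr_eq // g2 /=; case: eqP => //= _.
    by rewrite ltnS; case: (ltngtP x i) => // ->.
  + by rewrite addn1; apply: polS; rewrite -zs.
by exists c, k => w s ra; have [t [s' [e m r bt]]] := hc w s ra; exists t, s'.
Qed.

End Worlds.

(** * Reading the input *)

Section InputOutput.
Variable R : realType.
Notation st := (state R).
Variable kap : nat.
Hypothesis kap_gt0 : (0 < kap)%N.

(** The input occupies consecutive real cells, which the arrays will overlap. Moving entry [y] to
    address [16 * y + 1] in decreasing order of [y] never hits a cell that is still to be read. *)
Definition Pin : cmd :=
  Seq (NSet (NConst 1) (NCell (NConst 0)))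
  (Seq (NSet (NConst 16) (NAdd (NCell (NConst 1)) (NAdd (NCell (NConst 1))
     (NAdd (NCell (NConst 1)) (NConst 2)))))
  (While (NLe (NConst 1) (NCell (NConst 16)))
    (Seq (RSet (NAdd (nsc (NSub (NCell (NConst 16)) (NConst 1))) (NConst 1))
            (RCell (NSub (NCell (NConst 16)) (NConst 1))))
         (NSet (NConst 16) (NSub (NCell (NConst 16)) (NConst 1)))))).

Lemma Pin_loop (inp : nat -> R) m x (s : st) : nmem s 16 = x ->
    (forall y, (y < x)%N -> rmem s y = inp y) ->
    (forall y, (x <= y < m)%N -> rmem s (16 * y + 1) = inp y) ->
  exists t s', [/\ exec (While (NLe (NConst 1) (NCell (NConst 16)))
    (Seq (RSet (NAdd (nsc (NSub (NCell (NConst 16)) (NConst 1))) (NConst 1))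
            (RCell (NSub (NCell (NConst 16)) (NConst 1))))
         (NSet (NConst 16) (NSub (NCell (NConst 16)) (NConst 1))))) s t s',
     (forall y, nmem s' y = if y == 16 then 0%N else nmem s y),
     (forall y, (y < m)%N -> rmem s' (16 * y + 1) = inp y) & (t <= 3 * x + 1)%N].
Proof.
elim: x s => [|x IH] s hx h1 h2.
  exists 1%N, s; split=> // [|y].
  - by apply: ExecWhileF; rewrite /= hx.
  - by case: eqP => // ->.
pose s1 := rset s (16 * x + 1) (inp x); pose s2 := nset s1 16 x.
have [||t [s' [e n' r' bt]]] := IH s2 erefl.
- by move=> y yx; rewrite /= ifF ?h1 //; apply/eqP; lia.
- move=> y ym; rewrite /= eqn_add2r eqn_mul2l /=; case: eqP => [->//|ne].
  by apply: h2; lia.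
exists ((1 + 1) + t).+1, s'; split=> //.
- apply: ExecWhileT e; first by rewrite /= hx.
  apply: (@ExecSeq _ _ _ _ _ s1).
    have -> : s1 = rset s (neval s (NAdd (nsc (NSub (NCell (NConst 16)) (NConst 1))) (NConst 1)))
        (reval s (RCell (NSub (NCell (NConst 16)) (NConst 1)))).
      by rewrite neval_addr /= hx subn1 /= h1.
    exact: ExecRSet.
  have -> : s2 = nset s1 (neval s1 (NConst 16)) (neval s1 (NSub (NCell (NConst 16)) (NConst 1))).
    by rewrite /= hx subn1.
  exact: ExecNSet.
- by move=> y; rewrite n' /=; case: eqP.
- lia.
Qed.

Lemma Pin_spec n (I : instance R n) : exists t s' w,
  [/\ exec Pin (input I) t s', (t <= 9 * n + 9)%N, brep kap w s', sz s' = n & [/\ wN w 1 0 = n,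
    forall j x, (j != 1)%N || (x != 0)%N -> (0 < j < 16)%N -> wN w j x = 0%N &
    forall x, (x < 3 * n + 2)%N -> wR w 1 x = rmem (input I) x]].
Proof.
set s := input I.
pose s1 := nset s 1 n; pose s2 := nset s1 16 (3 * n + 2).
have [|t [s' [e n' r' bt]]] := @Pin_loop (rmem s) (3 * n + 2) (3 * n + 2) s2 erefl (fun _ _ => erefl).
  by move=> y; lia.
have nE y : nmem s' y = if y == 16 then 0%N else if y == 1%N then n else if y == 0%N then n else 0%N.
  by rewrite n' /=; do 2 case: eqP => //.
exists (1 + (1 + t))%N, s', (World (fun j x => nmem s' (16 * x + j)%N) (fun j x => rmem s' (16 * x + j)%N)).
split=> //.
- apply: (@ExecSeq _ _ _ _ _ s1); first exact: (ExecNSet (NConst 1) (NCell (NConst 0)) s).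
  apply: (@ExecSeq _ _ _ _ _ s2) => //.
  have -> : s2 = nset s1 (neval s1 (NConst 16)) (neval s1 (NAdd (NCell (NConst 1))
     (NAdd (NCell (NConst 1)) (NAdd (NCell (NConst 1)) (NConst 2))))).
    by rewrite /s2 /=; congr (nset _ _ _); lia.
  exact: ExecNSet.
- lia.
- move=> j x hj; split=> //; rewrite /sz !nE /=.
  have h : (n <= pol kap n)%N by apply: leq_trans (pol_le n kap_gt0); rewrite /pol expn1 leq_addr.
  by case: eqP => // _; case: eqP => // _; case: eqP.
- by rewrite /sz nE.
- split=> /=; first by rewrite nE.
  + move=> j x hjx hj; rewrite nE; case: eqP => // _; case: eqP => [e1|_]; last by case: eqP => //; lia.
    exfalso; move: hj e1 hjx; clear => hj e1.
    have -> : j = 1%N by lia.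
    by have -> : x = 0%N by lia.
  + by move=> x hx; apply: r'.
Qed.

End InputOutput.

(** * Lengths of paths *)

Section PathLength.
Variables (R : realType) (T : Type) (d : T -> T -> R).

Fixpoint plf (x : T) (s : seq T) : R :=
  if s is y :: s' then d x y + plf y s' else 0.

Definition plen (s : seq T) : R := if s is x :: s' then plf x s' else 0.

Lemma plf_cat x s1 s2 : plf x (s1 ++ s2) = plf x s1 + plf (last x s1) s2.
Proof. by elim: s1 x => [|y s1 IH] x /=; rewrite ?add0r // IH addrA. Qed.

Lemma plf_rcons x s y : plf x (rcons s y) = plf x s + d (last x s) y.
Proof. by rewrite -cats1 plf_cat /= addr0. Qed.

Lemma plf_pairmap x s : \sum_(l <- pairmap d x s) l = plf x s.
Proof. by elim: s x => [|y s IH] x /=; rewrite ?big_nil // big_cons IH. Qed.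

Hypothesis d_ge0 : forall x y, 0 <= d x y.

Lemma plf_ge0 x s : 0 <= plf x s.
Proof. by elim: s x => [|y s IH] x //=; rewrite addr_ge0. Qed.

Lemma plen_ge0 s : 0 <= plen s.
Proof. by case: s => [|x s] //=; apply: plf_ge0. Qed.

Lemma plen_le_plf x s : plen s <= plf x s.
Proof. by case: s => [|y s] //=; rewrite lerDr. Qed.

Hypothesis d_tri : forall x y z, d x z <= d x y + d y z.

Lemma plf_tri x y s : plf x s <= d x y + plf y s.
Proof.
case: s => [|z s] /=; first by rewrite addr0.
by rewrite addrA lerD2r.
Qed.

End PathLength.

Lemma plf_subseq (R : realType) (T : eqType) (d : T -> T -> R) x s1 s2 :
    (forall x y, 0 <= d x y) -> (forall x y z, d x z <= d x y + d y z) ->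
  subseq s1 s2 -> plf d x s1 <= plf d x s2.
Proof.
move=> d0 dt; elim: s2 x s1 => [|y s2 IH] x s1; first by rewrite subseq0 => /eqP->.
case: s1 => [|a s1] /=; first by rewrite addr_ge0 ?plf_ge0.
case: eqP => [-> /IH h|_ h]; first by rewrite lerD2l.
apply: le_trans (IH x _ h) _; exact: plf_tri.
Qed.

Lemma plen_subseq (R : realType) (T : eqType) (d : T -> T -> R) s1 s2 :
    (forall x y, 0 <= d x y) -> (forall x y z, d x z <= d x y + d y z) ->
  subseq s1 s2 -> plen d s1 <= plen d s2.
Proof.
move=> d0 dt; elim: s2 s1 => [|y s2 IH] [|a s1] //=; first by rewrite plf_ge0.
case: eqP => [-> h|_ /IH h]; first exact: plf_subseq.
by apply: le_trans h _; apply: plen_le_plf.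
Qed.

Lemma plf_map (R : realType) (T T' : Type) (d : T -> T -> R) (f : T' -> T) x s :
  plf d (f x) (map f s) = plf (fun u v => d (f u) (f v)) x s.
Proof. by elim: s x => [|y s IH] x //=; rewrite IH. Qed.

Lemma plen_map (R : realType) (T T' : Type) (d : T -> T -> R) (f : T' -> T) s :
  plen d (map f s) = plen (fun u v => d (f u) (f v)) s.
Proof. by case: s => [|x s] //=; rewrite plf_map. Qed.

Section Euclid.
Variable R : realType.
Implicit Types p q r : R * R.

Lemma edist_ge0 p q : 0 <= edist p q.
Proof. exact: sqrtr_ge0. Qed.

Lemma edistxx p : edist p p = 0.
Proof. by rewrite /edist !subrr expr0n addr0 sqrtr0. Qed.

Lemma edistC p q : edist p q = edist q p.
Proof. by rewrite /edist -(opprB q.1) -(opprB q.2) !sqrrN. Qed.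

(** Cauchy-Schwarz, itself a consequence of Lagrange's identity, gives the inequality between the
    squares. *)
Lemma edist_tri p q r : edist p r <= edist p q + edist q r.
Proof.
rewrite /edist.
set a := p.1 - q.1; set b := p.2 - q.2; set c := q.1 - r.1; set e := q.2 - r.2.
have -> : p.1 - r.1 = a + c by rewrite /a /c; ring.
have -> : p.2 - r.2 = b + e by rewrite /b /e; ring.
have A0 : 0 <= a ^+ 2 + b ^+ 2 by rewrite addr_ge0 ?sqr_ge0.
have C0 : 0 <= c ^+ 2 + e ^+ 2 by rewrite addr_ge0 ?sqr_ge0.
set s := Num.sqrt (a ^+ 2 + b ^+ 2); set t := Num.sqrt (c ^+ 2 + e ^+ 2).
have s0 : 0 <= s by apply: sqrtr_ge0.
have t0 : 0 <= t by apply: sqrtr_ge0.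
have sE : s ^+ 2 = a ^+ 2 + b ^+ 2 by rewrite sqr_sqrtr.
have tE : t ^+ 2 = c ^+ 2 + e ^+ 2 by rewrite sqr_sqrtr.
have cs : a * c + b * e <= s * t.
  have [h|h] := lerP (a * c + b * e) 0; first by apply: le_trans h _; rewrite mulr_ge0.
  rewrite -(@ler_pXn2r _ 2) ?nnegrE ?mulr_ge0 ?(ltW h) // exprMn sE tE.
  rewrite -subr_ge0.
  have -> : (a ^+ 2 + b ^+ 2) * (c ^+ 2 + e ^+ 2) - (a * c + b * e) ^+ 2
     = (a * e - b * c) ^+ 2 by ring.
  exact: sqr_ge0.
rewrite -(@ler_pXn2r _ 2) ?nnegrE ?sqrtr_ge0 ?addr_ge0 //.
rewrite sqr_sqrtr ?addr_ge0 ?sqr_ge0 //.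
nra.
Qed.

Lemma edist_le1 p q : edist p q <= `|p.1 - q.1| + `|p.2 - q.2|.
Proof.
rewrite /edist; set a := p.1 - q.1; set b := p.2 - q.2.
rewrite -(@ler_pXn2r _ 2) ?nnegrE ?sqrtr_ge0 ?addr_ge0 //.
rewrite sqr_sqrtr ?addr_ge0 ?sqr_ge0 // -(real_normK (num_real a)) -(real_normK (num_real b)).
have := normr_ge0 a; have := normr_ge0 b; nra.
Qed.

Lemma edist_ge_x p q : `|p.1 - q.1| <= edist p q.
Proof. by rewrite /edist -sqrtr_sqr ler_wsqrtr // lerDl sqr_ge0. Qed.

Lemma edist_ge_y p q : `|p.2 - q.2| <= edist p q.
Proof. by rewrite /edist -sqrtr_sqr ler_wsqrtr // lerDr sqr_ge0. Qed.

End Euclid.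

Lemma tour_costE (R : realType) (O : R * R) p :
  tour_cost O p = plf (@edist R) O (rcons p O).
Proof. exact: plf_pairmap. Qed.

(** * Euler circuits *)

Local Close Scope ring_scope.

Section Euler.
Variable T : eqType.
Implicit Types (H W : seq (T * T)) (u v x y : T).

Definition eqe (e e' : T * T) : bool := (e == e') || (e == (e'.2, e'.1)).

Lemma eqe_sym e e' : eqe e e' = eqe e' e.
Proof.
case: e e' => [a b] [c f]; rewrite /eqe /= !xpair_eqE.
by rewrite (eq_sym c) (eq_sym f) (eq_sym c b) (eq_sym f a) (andbC (b == c)).
Qed.

Lemma eqe_trans : transitive eqe.
Proof.
move=> [c f] [a b] [g h]; rewrite /eqe /= !xpair_eqE.
by do 2![case/orP=> /andP[/eqP-> /eqP->]]; rewrite !eqxx ?orbT.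
Qed.

Definition dg H v : nat := \sum_(e <- H) ((e.1 == v) + (e.2 == v)).

Inductive conn H u : T -> Prop :=
| Conn0 : conn H u u
| ConnS v w : conn H u v -> ((v, w) \in H) || ((w, v) \in H) -> conn H u w.

Lemma conn_trans H u v w : conn H u v -> conn H v w -> conn H u w.
Proof. by move=> huv; elim=> [//|a b _ h /(ConnS h)]. Qed.

Lemma conn1 H u v : ((u, v) \in H) || ((v, u) \in H) -> conn H u v.
Proof. by apply: ConnS; apply: Conn0. Qed.

Lemma conn_sym H u v : conn H u v -> conn H v u.
Proof.
elim=> [|a b _ h hab]; first exact: Conn0.
by apply: conn_trans h; apply: conn1; rewrite orbC.
Qed.

Lemma conn_sub H H' u v : {subset H <= H'} -> conn H u v -> conn H' u v.
Proof.
move=> s; elim=> [|a b _ h hab]; first exact: Conn0.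
by apply: ConnS h _; case/orP: hab => /s->; rewrite ?orbT.
Qed.

(* The multisets of undirected edges [H] and [W] agree. *)
Definition er H W : Prop := forall e, count (eqe e) H = count (eqe e) W.

Lemma er_big (V : Type) (idx : V) (op : Monoid.com_law idx) (f : T * T -> V) H W :
  (forall a b, f (a, b) = f (b, a)) -> er H W ->
  \big[op/idx]_(e <- H) f e = \big[op/idx]_(e <- W) f e.
Proof.
move=> fs; elim: H W => [|e H IH] W h.
  case: W h => [|e W] h; first by rewrite !big_nil.
  by have := h e; rewrite /= /eqe eqxx.
have /hasP[e' e'W ee'] : has (eqe e) W by rewrite has_count -h /= /eqe eqxx.
rewrite (perm_big _ (perm_to_rem e'W)) !big_cons /=.
have -> : f e = f e'.
  by case: e e' ee' {h e'W} => [a b] [c g] /orP[/eqP->|/eqP[-> ->]] //=; rewrite fs.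
congr (op _ _); apply: IH => e0; have := h e0.
rewrite (permP (perm_to_rem e'W)) /=.
suff -> : eqe e0 e = eqe e0 e' by move/addnI.
by apply/idP/idP => h0; apply: eqe_trans h0 _ => //; rewrite eqe_sym.
Qed.

Lemma er_cons e H W : er H W -> er (e :: H) (e :: W).
Proof. by move=> h e0 /=; rewrite h. Qed.

Lemma er_perm H W : perm_eq H W -> er H W.
Proof. by move=> /permP h e. Qed.

Lemma er_trans H W W' : er H W -> er W W' -> er H W'.
Proof. by move=> h h' e; rewrite h. Qed.

Lemma er_size H W : er H W -> size H = size W.
Proof. by move=> h; rewrite -!sum1_size; apply: er_big. Qed.

Lemma er_dg H W v : er H W -> dg H v = dg W v.
Proof. by apply: er_big => a b /=; rewrite addnC. Qed.

Lemma er_mem H W a b : er H W -> (((a, b) \in H) || ((b, a) \in H)) =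
   (((a, b) \in W) || ((b, a) \in W)).
Proof.
have P (K : seq (T * T)) : (((a, b) \in K) || ((b, a) \in K)) = has (eqe (a, b)) K.
  apply/idP/hasP => [/orP[] h|[e eK]]; [by exists (a, b); rewrite // /eqe eqxx| |].
    by exists (b, a); rewrite // /eqe eqxx orbT.
  by case: e eK => [c g] h /orP[/eqP[-> ->]|/eqP[-> ->]]; rewrite h ?orbT.
by move=> h; rewrite !P !has_count h.
Qed.

Fixpoint ed u (s : seq T) : seq (T * T) :=
  if s is y :: s' then (u, y) :: ed y s' else [::].

Lemma ed_cat u s1 s2 : ed u (s1 ++ s2) = ed u s1 ++ ed (last u s1) s2.
Proof. by elim: s1 u => [|y s IH] u //=; rewrite IH. Qed.

Lemma ed_mem u s e : e \in ed u s -> (e.1 \in u :: s) && (e.2 \in u :: s).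
Proof.
elim: s u => [//|y s IH] u /=; rewrite inE => /orP[/eqP-> /=|/IH].
  by rewrite !inE !eqxx orbT.
by case/andP=> h1 h2; rewrite !(in_cons u) h1 h2 !orbT.
Qed.

Lemma dg_cons e H v : dg (e :: H) v = (e.1 == v) + (e.2 == v) + dg H v.
Proof. by rewrite /dg big_cons. Qed.

Lemma dg_cat H H' v : dg (H ++ H') v = dg H v + dg H' v.
Proof. by rewrite /dg big_cat. Qed.

Lemma dg_perm H H' v : perm_eq H H' -> dg H v = dg H' v.
Proof. by move=> /er_perm /er_dg. Qed.

Lemma dg_ed u s x : odd (dg (ed u s) x) = (u == x) (+) (last u s == x).
Proof.
elim: s u => [|y s IH] u; first by rewrite /dg big_nil addbb.
by rewrite dg_cons /= !oddD IH !oddb; case: (u == x); case: (y == x); case: (_ == x).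
Qed.

Lemma dg_mem H v : 0 < dg H v -> exists2 e, e \in H & (e.1 == v) || (e.2 == v).
Proof.
elim: H => [|e H IH]; first by rewrite /dg big_nil.
rewrite dg_cons; case E : ((e.1 == v) || (e.2 == v)).
  by exists e; rewrite ?mem_head.
case/norP: (negbT E) => /negPf-> /negPf-> /=; rewrite !add0n => /IH[e' h1 h2].
by exists e'; rewrite // inE h1 orbT.
Qed.

(** Greedy walk: the odd degree of [u] supplies an edge, and deleting it moves the odd vertex to the
    other end of that edge. The walk can therefore get stuck only at [v]. *)
Lemma trail n H u v : size H <= n -> u != v ->
    (forall x, odd (dg H x) = (u == x) (+) (v == x)) ->
  exists s W, last u s = v /\ er H (ed u s ++ W).
Proof.
elim: n H u => [|n IH] H u.
  rewrite leqn0 size_eq0 => /eqP-> nuv /(_ u).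
  by rewrite /dg big_nil eqxx eq_sym (negPf nuv).
move=> sH nuv par.
have [|e eH eu] := @dg_mem H u.
  by rewrite lt0n; apply/eqP => h; have := par u; rewrite h eqxx eq_sym (negPf nuv).
have pe := perm_to_rem eH; set H' := rem e H in pe.
have sH' : size H' <= n by move: sH; rewrite (perm_size pe) /=; lia.
have [w ee] : exists w, eqe e (u, w).
  case: e eu {eH pe H' sH'} => a b /= /orP[/eqP->|/eqP->].
    by exists b; rewrite /eqe eqxx.
  by exists a; rewrite /eqe eqxx orbT.
have erH : er H ((u, w) :: H').
  move=> e0; rewrite (permP pe) /=; congr addn.
  suff -> : eqe e0 e = eqe e0 (u, w) by [].
  by apply/idP/idP => h; apply: eqe_trans h _; rewrite // eqe_sym.
have par' x : odd (dg H' x) = (w == x) (+) (v == x).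
  have := par x; rewrite (er_dg x erH) dg_cons !oddD !oddb /=.
  by case: (u == x); case: (w == x); case: (v == x); case: (odd _).
have [wv|nwv] := eqVneq w v.
  by exists [:: v], H'; split=> //=; rewrite -wv.
have [s [W [ls h]]] := IH H' w sH' nwv par'.
exists (w :: s), W; split=> //=.
by apply: er_trans erH _; apply: er_cons.
Qed.

Lemma euler_circuit H u : (forall x, ~~ odd (dg H x)) ->
    (forall e, e \in H -> conn H u e.1) ->
  exists s, last u s = u /\ er H (ed u s).
Proof.
move=> par cn.
suff: forall n s W, size W <= n -> last u s = u -> er H (ed u s ++ W) ->
    exists s, last u s = u /\ er H (ed u s).
  by move/(_ (size H) [::] H (leqnn _) erefl); apply.
elim=> [|n IH] s W.
  by rewrite leqn0 size_eq0 => /eqP-> l; rewrite cats0; exists s.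
case: W => [|e0 W0]; first by move=> _ l; rewrite cats0; exists s.
set W := e0 :: W0 => sW ls erH.
have key z : conn H u z -> z \in u :: s \/
    exists2 e, e \in W & (e.1 \in u :: s) || (e.2 \in u :: s).
  elim=> [|a b _ [ha|]]; [by left; rewrite mem_head| |by right].
  rewrite (er_mem _ _ erH) !mem_cat => hab.
  have : ((a, b) \in ed u s) || ((b, a) \in ed u s) || ((a, b) \in W) || ((b, a) \in W).
    by move: hab; do 4 case: (_ \in _).
  case/orP; [case/orP; [case/orP|]|].
  - by case/ed_mem/andP; left.
  - by case/ed_mem/andP; left.
  - by move=> h; right; exists (a, b); rewrite //= ha.
  - by move=> h; right; exists (b, a); rewrite //= ha orbT.
have [e eW eS] : exists2 e, e \in W & (e.1 \in u :: s) || (e.2 \in u :: s).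
  have e0H : conn H u e0.1.
    have : ((e0.1, e0.2) \in H) || ((e0.2, e0.1) \in H).
      by rewrite (er_mem _ _ erH) !mem_cat /W -surjective_pairing mem_head orbT.
    case/orP=> [/cn//|/cn/= h].
    apply: conn_trans h _; apply: conn1.
    by rewrite (er_mem _ _ erH) !mem_cat /W -surjective_pairing mem_head !orbT.
  case: (key _ e0H) => // h; exists e0; first exact: mem_head.
  by rewrite h.
have pe := perm_to_rem eW; set W' := rem e W in pe.
have sW' : size W' <= n.
  by rewrite size_rem //; move: sW; rewrite /W /=; lia.
have parW x : ~~ odd (dg W x).
  have := par x; rewrite (er_dg x erH) dg_cat oddD dg_ed ls addbb.
  by [].
have [y [z [yS ee]]] : exists y z, y \in u :: s /\ eqe e (y, z).
  case: e eS {eW pe W' sW'} => a b /= /orP[h|h].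
    by exists a, b; rewrite /eqe eqxx.
  by exists b, a; rewrite /eqe eqxx orbT.
have erW : er W ((y, z) :: W').
  move=> e1; rewrite (permP pe) /=; congr addn.
  suff -> : eqe e1 e = eqe e1 (y, z) by [].
  by apply/idP/idP => h; apply: eqe_trans h _; rewrite // eqe_sym.
have [c [W2 [lc sW2 erc]]] : exists c W2, [/\ last y c = y, size W2 <= n & er W (ed y c ++ W2)].
  have [zy|nzy] := eqVneq z y.
    by exists [:: y], W'; split=> //=; rewrite -{2}zy.
  have parW' x : odd (dg W' x) = (z == x) (+) (y == x).
    have := parW x; rewrite (er_dg x erW) dg_cons !oddD !oddb /=.
    by case: (y == x); case: (z == x); case: (odd _).
  have [c [W2 [lc h]]] := trail sW' nzy parW'.
  exists (z :: c), W2; split=> //=.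
    by move: sW'; rewrite (er_size h) size_cat; lia.
  by apply: er_trans erW _; apply: er_cons.
have [s1 [s2 [es l1]]] : exists s1 s2, s = s1 ++ s2 /\ last u s1 = y.
  move: yS; rewrite inE => /orP[/eqP->|/splitPr[p1 p2]]; first by exists [::], s.
  by exists (rcons p1 y), p2; rewrite cat_rcons last_rcons.
apply: (IH (s1 ++ c ++ s2) W2 sW2).
  by rewrite !last_cat l1 lc -l1 -last_cat -es.
move=> e1; rewrite erH es !ed_cat l1 lc !count_cat erc count_cat.
by rewrite -!addnA; congr addn; rewrite addnCA; congr addn.
Qed.

Lemma conn_ed u s x : x \in u :: s -> conn (ed u s) u x.
Proof.
elim: s u => [|y s IH] u; first by rewrite inE => /eqP->; apply: Conn0.
rewrite inE => /orP[/eqP->|h]; first exact: Conn0.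
apply: (@conn_trans _ _ y); first by apply: conn1; rewrite /= mem_head.
by apply: conn_sub (IH y h) => e he; rewrite /= inE he orbT.
Qed.

Lemma conn_mono H H' u x : (forall e, e \in H -> conn H' e.1 e.2) -> conn H u x -> conn H' u x.
Proof.
move=> h; elim=> [|a b _ ua hab]; first exact: Conn0.
apply: conn_trans ua _; case/orP: hab => /h //=; exact: conn_sym.
Qed.

(** Keeping only the edges reachable from [u] changes no degree inside the component of [u], which
    makes the previous lemma applicable to any even graph. *)
Lemma euler_component H u : (forall x, ~~ odd (dg H x)) ->
  exists s K, [/\ last u s = u, subseq K H, er K (ed u s) & forall x, conn H u x -> x \in u :: s].
Proof.
move=> par; pose K := [seq e <- H | `[< conn H u e.1 >]].
have KH : subseq K H by apply: filter_subseq.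
have K2 e : e \in H -> conn H u e.1 -> e \in K.
  by move=> he h; rewrite mem_filter he andbT; apply/asboolP.
have cK x : conn H u x -> conn K u x.
  elim=> [|a b ha h hab]; first exact: Conn0.
  apply: ConnS h _; case/orP: hab => he; first by rewrite K2.
  rewrite (K2 (b, a)) ?orbT //; apply: ConnS ha _; by rewrite he orbT.
have dK x : dg K x = if `[< conn H u x >] then dg H x else 0.
  rewrite /dg /K big_filter; case: asboolP => hx.
    rewrite big_mkcond /= !big_seq; apply: eq_bigr => e he; case: asboolP => // ne.
    have n1 : e.1 != x by apply/eqP => e1; apply: ne; rewrite e1.
    have n2 : e.2 != x.
      apply/eqP => e2; apply: ne; apply: ConnS hx _.
      by rewrite -e2 -surjective_pairing he orbT.
    by rewrite (negPf n1) (negPf n2).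
  rewrite big_seq_cond big1 // => e /andP[he /asboolP h1].
  have n1 : e.1 != x by apply/eqP => e1; apply: hx; rewrite -e1.
  have n2 : e.2 != x.
    apply/eqP => e2; apply: hx; apply: ConnS h1 _.
    by rewrite -e2 -surjective_pairing he.
  by rewrite (negPf n1) (negPf n2).
have [||s [ls es]] := @euler_circuit K u.
- by move=> x; rewrite dK; case: asboolP.
- by move=> e; rewrite mem_filter => /andP[/asboolP/cK].
exists s, K; split=> // x /cK.
elim=> [|a b _ ha]; first exact: mem_head.
by rewrite (er_mem _ _ es) => /orP[] /ed_mem/andP[].
Qed.

End Euler.

Local Open Scope ring_scope.

(** * Bridges *)

Section Bridge.
Variables (R : realType) (T : eqType).
Variable d : T -> T -> R.
Hypothesis d_ge0 : forall x y, 0 <= d x y.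

Definition elen (H : seq (T * T)) : R := \sum_(e <- H) d e.1 e.2.

Lemma elen_cat H H' : elen (H ++ H') = elen H + elen H'.
Proof. by rewrite /elen big_cat. Qed.

Lemma elen_ge0 H : 0 <= elen H.
Proof. by apply: sumr_ge0 => e _; apply: d_ge0. Qed.

Lemma elen_ed u s : elen (ed u s) = plf d u s.
Proof.
by elim: s u => [|y s IH] u; rewrite /elen /= ?big_nil // big_cons /= -/(elen _) IH.
Qed.

(* A path through the points of [s] whose edges are doubled or not so that the
   degree of a vertex has the parity of the number of its marked occurrences;
   [b] is the parity still to be corrected at [u]. *)
Fixpoint bridge (u : T) (b : bool) (s : seq (T * bool)) : seq (T * T) :=
  if s is (y, c) :: s' then
    (if b then [:: (u, y)] else [:: (u, y); (u, y)]) ++ bridge y (b (+) c) s'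
  else [::].

Definition marks (s : seq (T * bool)) (v : T) : nat := \sum_(p <- s) (p.2 && (p.1 == v)).

Lemma bridge_dg u (b : bool) (s : seq (T * bool)) v :
  odd (nat_of_bool b + \sum_(p <- s) nat_of_bool p.2)%N = false ->
  odd (dg (bridge u b s) v) = odd ((b && (u == v)) + marks s v).
Proof.
elim: s u b => [|[y c] s IH] u b /=.
  by rewrite /marks !big_nil !addn0 /dg big_nil; case: b.
rewrite /marks !big_cons /= => h.
rewrite dg_cat oddD IH; last first.
  by move: h; rewrite !oddD !oddb; case: b; case: c; case: (odd _).
rewrite -/(marks s v) !oddD.
have -> : odd (dg (if b then [:: (u, y)] else [:: (u, y); (u, y)]) v) =
    (b && ((u == v) (+) (y == v))).
  by case: b h; rewrite /dg ?big_cons ?big_nil /=; case: (u == v); case: (y == v).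
clear h; rewrite !oddb; case: b; case: c; case: (u == v); case: (y == v); by case: (odd (marks s v)).
Qed.

Lemma bridge_conn u b s v : v \in u :: map fst s -> conn (bridge u b s) u v.
Proof.
elim: s u b => [|[y c] s IH] u b; first by rewrite /= inE => /eqP->; apply: Conn0.
rewrite inE => /orP[/eqP->|]; first exact: Conn0.
move=> h; apply: (@conn_trans _ _ _ y).
  by apply: conn1; rewrite /= mem_cat; case: b; rewrite !inE eqxx.
apply: conn_sub (IH y (b (+) c) h) => e he.
by rewrite /= mem_cat he orbT.
Qed.

Lemma bridge_mem u b s e : e \in bridge u b s ->
  (e.1 \in u :: map fst s) && (e.2 \in u :: map fst s).
Proof.
elim: s u b => [|[y c] s IH] u b //=.
rewrite mem_cat => /orP[h|/IH/andP[h1 h2]]; last by rewrite !(in_cons u) h1 h2 !orbT.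
have -> : e = (u, y) by move: h; case: b; rewrite !inE ?orbb => /eqP.
by rewrite /= !inE !eqxx orbT.
Qed.

Lemma bridge_len u b s : elen (bridge u b s) <= 2%:R * plf d u (map fst s).
Proof.
elim: s u b => [|[y c] s IH] u b; first by rewrite /elen big_nil mulr0.
rewrite elen_cat /= mulrDr lerD //.
have := d_ge0 u y; case: b; rewrite /elen !big_cons big_nil /=; lra.
Qed.

(* On a list sorted by the key [f], at most two bridge edges cross a level. *)
Lemma bridge_cross (f : T -> nat) u b s j : sorted leq (map f (u :: map fst s)) ->
  (count (fun e => (f e.1 < j)%N != (f e.2 < j)%N) (bridge u b s) <= 2)%N.
Proof.
elim: s u b => [|[y c] s IH] u b //=.
rewrite count_cat => /andP[uy srt].
have [yj|jy] := ltnP (f y) j.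
  have -> : count (fun e => (f e.1 < j)%N != (f e.2 < j)%N)
      (if b then [:: (u, y)] else [:: (u, y); (u, y)]) = 0%N.
    by have uj := leq_ltn_trans uy yj; case: b; rewrite /= uj yj.
  exact: IH.
rewrite (_ : count _ (bridge y _ s) = 0%N); last first.
  apply/eqP; rewrite -leqn0 leqNgt -has_count; apply/hasPn => e /bridge_mem.
  have al : all (fun x => j <= f x)%N (y :: map fst s).
    rewrite /= jy; move: srt; rewrite -map_comp path_sortedE; last exact: leq_trans.
    case/andP => h _; apply/allP => x /mapP[p ps ->].
    move/allP: h => /(_ (f p.1)) h; apply: leq_trans jy _; apply: h.
    by apply/mapP; exists p.
  by case/andP => /(allP al) h1 /(allP al) h2; rewrite !ltnNge h1 h2.
by rewrite addn0; case: b; rewrite /= ?addn0; case: (_ != _).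
Qed.

End Bridge.

Section SortedLength.
Variables (R : realType) (T : Type).

Lemma plf_sorted (f : T -> R) x s : path (fun x y => f x <= f y) x s ->
  plf (fun x y => `|f x - f y|) x s = f (last x s) - f x.
Proof.
elim: s x => [|y s IH] x /=; first by rewrite subrr.
by case/andP => xy /IH->; rewrite distrC ger0_norm ?subr_ge0 //; ring.
Qed.

End SortedLength.

(** * Guillotine decompositions *)

Definition co (R : realType) (b : bool) (p : R * R) : R := if b then p.1 else p.2.

Section Boxes.
Variable R : realType.
Notation T := (R * R)%type.
Variable pix : bool -> T -> nat.
Variable m : nat.

Notation elen := (elen (@edist R)).
Notation edge := (T * T)%type.

Lemma edist_co b (p q : T) : edist p q <= `|co b p - co b q| + `|co (~~ b) p - co (~~ b) q|.
Proof. by apply: le_trans (edist_le1 p q) _; case: b; rewrite //= addrC. Qed.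

Definition box := bool -> nat * nat.
Implicit Types (W U : box) (E H K F : seq edge) (e : edge) (b : bool) (i j : nat).

Definition lo W b := (W b).1.
Definition hi W b := (W b).2.
Definition upd W b i j : box := fun b' => if b' == b then (i, j) else W b'.
Definition lft W b i := upd W b (lo W b) i.
Definition rgt W b i := upd W b i (hi W b).
Definition inB W b (p : T) := (lo W b <= pix b p < hi W b)%N.
Definition inW W (p : T) := inB W true p && inB W false p.
Definition eW W e := inW W e.1 && inW W e.2.
Definition crs b i e := (pix b e.1 < i)%N != (pix b e.2 < i)%N.
Definition lve U H := count (fun e => inW U e.1 != inW U e.2) H.

Lemma inWb b W p : inW W p = inB W b p && inB W (~~ b) p.
Proof. by case: b; rewrite /inW //= andbC. Qed.

Lemma inW_cut W b i q : (lo W b < i < hi W b)%N ->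
  inW (lft W b i) q = inW W q && (pix b q < i)%N /\
  inW (rgt W b i) q = inW W q && ~~ (pix b q < i)%N.
Proof.
have nb : (~~ b == b) = false by case: (b).
rewrite !(inWb b) /inB /lft /rgt /upd /lo /hi eqxx nb /=.
move: (pix b q) (W b).1 (W b).2 (_ <= pix (~~ b) q < _)%N => x l h c hlh.
by split; apply/idP/idP; move: hlh; case: c; clear; lia.
Qed.

Inductive bsp : box -> Type :=
| BLeaf W : bsp W
| BNode W b i : (lo W b < i < hi W b)%N -> bsp (lft W b i) -> bsp (rgt W b i) -> bsp W.

Fixpoint isnode W (t : bsp W) (U : box) : Prop :=
  U = W \/ match t with
           | BLeaf _ => False
           | BNode _ _ _ _ t1 t2 => isnode t1 U \/ isnode t2 U
           end.

Fixpoint leaves_ok W (t : bsp W) : Prop :=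
  match t with
  | BLeaf W => forall b, (hi W b <= (lo W b).+1)%N
  | BNode _ _ _ _ t1 t2 => leaves_ok t1 /\ leaves_ok t2
  end.

Lemma node_sub W (t : bsp W) U b : isnode t U -> (lo W b <= lo U b)%N /\ (hi U b <= hi W b)%N.
Proof.
elim: t => {W} [W|W c i hi0 t1 IH1 t2 IH2] /= [->//|] //.
case=> [/IH1|/IH2]; rewrite /lft /rgt /upd /lo /hi; case: eqP => //= ->; move: hi0; rewrite /lo /hi; lia.
Qed.

(** Sides of [U] that are not on the boundary of [W]. Each of them lies on a cut made inside [W],
    and only there can edges leave [U]. *)
Definition unsh U W : nat := \sum_(b : bool) ((lo U b != lo W b) + (hi U b != hi W b)).

Lemma unshE U W b : unsh U W = ((lo U b != lo W b) + (hi U b != hi W b) +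
  ((lo U (~~ b) != lo W (~~ b)) + (hi U (~~ b) != hi W (~~ b))))%N.
Proof. by rewrite /unsh big_bool; case: b => //=; rewrite addnC. Qed.

(** A cut keeps at most [2 * m] crossing edges, and its bridge crosses each of the two perpendicular
    sides of a node box at most twice. *)
Definition kappa : nat := 2 * m + 4.

(** Parities and connectivity are all that an Euler circuit needs, so edge sets may be exchanged box
    by box and a tour recovered only at the end. [u] is the permitted extra length. *)
Record good W E H (t : bsp W) (u : R) : Prop := Good {
  good_in : forall e, e \in H -> eW W e;
  good_par : forall v, odd (dg H v) = odd (dg E v);
  good_conn : forall e, e \in E -> conn H e.1 e.2;
  good_len : elen H <= elen E + u;
  good_lve : forall U, isnode t U -> (lve U H <= kappa * unsh U W)%N }.

Lemma lve0 U H : (forall e, e \in H -> inW U e.1 = inW U e.2) -> lve U H = 0%N.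
Proof.
move=> h; apply/eqP; rewrite -leqn0 leqNgt -has_count; apply/hasPn => e /h->.
by rewrite eqxx.
Qed.

Lemma leave_side U b (F BL : seq edge) (touch : bool) : (size F <= 2 * m)%N ->
    (forall e, e \in F ++ BL -> ~~ touch -> inW U e.1 = false /\ inW U e.2 = false) ->
    (forall e, e \in BL -> pix b e.1 = pix b e.2) ->
    (forall j, (count (crs (~~ b) j) BL <= 2)%N) ->
  (lve U F + lve U BL <= kappa * touch)%N.
Proof.
move=> sF nt bl cr; case E : touch; last first.
  rewrite !lve0 ?muln0 // => e he.
    by have [] := nt e; rewrite ?mem_cat ?he ?orbT ?E // => -> ->.
  by have [] := nt e; rewrite ?mem_cat ?he ?orbT ?E // => -> ->.
rewrite muln1 /kappa; apply: leq_add; first exact: leq_trans (count_size _ _) sF.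
apply: leq_trans (_ : (count (crs (~~ b) (lo U (~~ b))) BL + count (crs (~~ b) (hi U (~~ b))) BL <= _)%N);
  last by apply: (@leq_trans (2 + 2)%N) => //; apply: leq_add.
rewrite -count_predUI; apply: leq_trans (leq_addr _ _).
rewrite /lve; rewrite -(@eq_in_count _ (fun e => (inW U e.1 != inW U e.2) && (e \in BL))); last first.
  by move=> e ->; rewrite andbT.
apply: sub_count => e /= /andP[+ he]; rewrite !(inWb b) /inB (bl e he) /crs.
case: (_ <= pix b e.2 < _)%N => //=.
rewrite !ltnNge; move: (pix _ e.1) (pix _ e.2) (lo _ _) (hi _ _) => a c l h.
by case: (leqP l a); case: (leqP l c); case: (leqP h a); case: (leqP h c).
Qed.

Lemma perm_cut W b i E : (lo W b < i < hi W b)%N -> (forall e, e \in E -> eW W e) ->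
  perm_eq E ([seq e <- E | eW (lft W b i) e] ++ [seq e <- E | eW (rgt W b i) e] ++
             [seq e <- E | crs b i e]).
Proof.
move=> hi0 hE; apply/permP => P; rewrite !count_cat !count_filter.
elim: E hE => [//|e E IH] hE /=.
rewrite {}IH; last by move=> e' he'; apply: hE; rewrite inE he' orbT.
have := hE e (mem_head _ _); rewrite /eW !(inWb b) /inB /crs => /andP[/andP[h1 h2] /andP[h3 h4]].
have q1 : hi (lft W b i) b = i by rewrite /hi /lft /upd eqxx.
have q2 : lo (lft W b i) b = lo W b by rewrite /lo /lft /upd eqxx.
have q3 : hi (rgt W b i) b = hi W b by rewrite /hi /rgt /upd eqxx.
have q4 : lo (rgt W b i) b = i by rewrite /lo /rgt /upd eqxx.
have nb : (~~ b == b) = false by case: (b).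
have q5 : lft W b i (~~ b) = W (~~ b) by rewrite /lft /upd nb.
have q6 : rgt W b i (~~ b) = W (~~ b) by rewrite /rgt /upd nb.
rewrite q1 q2 q3 q4 /lo /hi q5 q6 -/(lo W (~~ b)) -/(hi W (~~ b)) -/(lo W b) -/(hi W b) h2 h4.
case/andP: h1 => [-> ->]; case/andP: h3 => [-> ->] /=; rewrite !andbT !(leqNgt i).
by case: (pix b e.1 < i)%N; case: (pix b e.2 < i)%N; case: (P e) => /=; lia.
Qed.

(** Sampled edges are short enough to join equal or neighbouring pixels; one that crosses line [i]
    thus joins pixel index [i.-1] to [i] on that axis. *)
Definition adj e := forall b, (pix b e.1 <= (pix b e.2).+1)%N /\ (pix b e.2 <= (pix b e.1).+1)%N.

(** A node box inside one part can touch the cut along a single side only. The edges of the other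
    part and the bridge beyond the cut do not leave it; the crossing edges and the bridge on its own
    side can do so only if that side lies on the cut, and exactly then [unsh] grows by one. *)
Lemma assemble W b i (hi0 : (lo W b < i < hi W b)%N) E H1 H2 t1 t2 u1 u2 F BL BR x :
    (forall e, e \in E -> eW W e) -> (forall e, e \in E -> adj e) ->
    @good (lft W b i) [seq e <- E | eW (lft W b i) e] H1 t1 u1 ->
    @good (rgt W b i) [seq e <- E | eW (rgt W b i) e] H2 t2 u2 ->
    (size F <= 2 * m)%N -> (forall e, e \in F -> eW W e /\ crs b i e /\ adj e) ->
    (forall e, e \in BL -> eW W e /\ pix b e.1 = i.-1 /\ pix b e.2 = i.-1) ->
    (forall e, e \in BR -> eW W e /\ pix b e.1 = i /\ pix b e.2 = i) ->
    (forall j, (count (crs (~~ b) j) BL <= 2)%N) ->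
    (forall j, (count (crs (~~ b) j) BR <= 2)%N) ->
    (forall v, odd (dg (F ++ BL ++ BR) v) = odd (dg [seq e <- E | crs b i e] v)) ->
    (forall e, e \in [seq e <- E | crs b i e] -> conn (F ++ BL ++ BR) e.1 e.2) ->
    elen (F ++ BL ++ BR) <= elen [seq e <- E | crs b i e] + x ->
  @good W E (H1 ++ H2 ++ F ++ BL ++ BR) (@BNode W b i hi0 t1 t2) (u1 + u2 + x).
Proof.
move=> hE hA g1 g2 sF hF hBL hBR cBL cBR par cn len.
have pE := perm_cut hi0 hE.
have nb : (~~ b == b) = false by case: (b).
have subL p : inW (lft W b i) p -> inW W p /\ (pix b p < i)%N.
  rewrite !(inWb b) /inB /lo /hi /lft /upd eqxx nb /= => /andP[/andP[h1 h2] ->].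
  by rewrite h1 andbT; split=> //; move: hi0; rewrite /lo /hi; lia.
have subR p : inW (rgt W b i) p -> inW W p /\ (i <= pix b p)%N.
  rewrite !(inWb b) /inB /lo /hi /rgt /upd eqxx nb /= => /andP[/andP[h1 h2] ->].
  by rewrite h2 !andbT; split=> //; move: hi0; rewrite /lo /hi; lia.
have hH1 e : e \in H1 -> eW (lft W b i) e by apply: good_in g1 e.
have hH2 e : e \in H2 -> eW (rgt W b i) e by apply: good_in g2 e.
split.
- move=> e; rewrite !mem_cat => /orP[/hH1/andP[/subL[h _] /subL[h' _]]|]; first by rewrite /eW h.
  case/orP=> [/hH2/andP[/subR[h _] /subR[h' _]]|]; first by rewrite /eW h.
  by case/orP=> [/hF[]|/orP[/hBL[]|/hBR[]]].
- move=> v; rewrite (dg_perm v pE) [in RHS]dg_cat [in RHS]dg_cat [in LHS]dg_cat [in LHS](dg_cat H2).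
  by rewrite !oddD par (good_par g1) (good_par g2) -!oddD.
- move=> e; rewrite (perm_mem pE) !mem_cat => /orP[h|/orP[h|h]].
  + apply: conn_sub (good_conn g1 h) => e' he'; by rewrite mem_cat he'.
  + apply: conn_sub (good_conn g2 h) => e' he'; by rewrite !mem_cat he' orbT.
  + by apply: conn_sub (cn e h) => e' he'; rewrite !(mem_cat _ H1) (mem_cat _ H2) he' !orbT.
- rewrite !elen_cat in len *; rewrite /elen (perm_big _ pE) !big_cat /=.
  have := good_len g1; have := good_len g2; rewrite /elen in len *; lra.
- have eqB (C : bool) e : e \in (if C then BL else BR) -> pix b e.1 = pix b e.2.
    by case: C => [/hBL[_ [-> ->]]|/hBR[_ [-> ->]]].
  move=> U /= [->|].
    rewrite lve0 // => e he.
    suff /andP[-> ->] : eW W e by [].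
    move: he; rewrite !mem_cat => /orP[/hH1/andP[/subL[h _] /subL[h' _]]|]; first by rewrite /eW h.
    case/orP=> [/hH2/andP[/subR[h _] /subR[h' _]]|]; first by rewrite /eW h.
    by case/orP=> [/hF[]|/orP[/hBL[]|/hBR[]]].
  case=> hU; rewrite /lve !count_cat -!/(lve _ _).
  + have sub := fun b' => node_sub b' hU.
    have UL p : inW U p -> (pix b p < hi U b)%N /\ (hi U b <= i)%N.
      have [_] := sub b; rewrite {2}/hi /lft /upd eqxx /= (inWb b) /inB => h /andP[/andP[_ ->]].
      by [].
    rewrite (lve0 (H := H2)); last first.
      move=> e /hH2 /andP[/subR[_ h1] /subR[_ h2]].
      by case E1 : (inW U e.1); case E2 : (inW U e.2) => //; [have := UL _ E1 | have := UL _ E2]; lia.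
    rewrite (lve0 (H := BR)); last first.
      move=> e /hBR[_ [h1 h2]].
      by case E1 : (inW U e.1); case E2 : (inW U e.2) => //; [have := UL _ E1 | have := UL _ E2]; lia.
    have key := @leave_side U b F BL (hi U b == i) sF _ (eqB true) cBL.
    have {}key : (lve U F + lve U BL <= kappa * (hi U b == i))%N.
      apply: key => e; rewrite mem_cat => /orP[/hF[_ [h1 h2]]|/hBL[_ [h1 h2]]] /eqP ne.
        have [a1 a2] := h2 b; move: h1; rewrite /crs.
        by case E1 : (inW U e.1); case E2 : (inW U e.2) => //; try (have := UL _ E1); try (have := UL _ E2); lia.
      by case E1 : (inW U e.1); case E2 : (inW U e.2) => //; try (have := UL _ E1); try (have := UL _ E2); lia.
    (* The upper side of [U] is strictly inside [W], hence always counted for [W]; relative to the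
       left part it is uncounted exactly when it lies on the cut. *)
    have ue : unsh U W = (unsh U (lft W b i) + (hi U b == i))%N.
      have [_] := sub b; rewrite !(unshE _ _ b) /lo /hi /lft /upd eqxx nb /= => h1.
      have -> : (U b).2 != (W b).2 by apply/eqP; move: hi0; rewrite /lo /hi; lia.
      by case: (_ == i) => /=; ring.
    have := good_lve g1 hU; rewrite ue mulnDr; lia.
  + have sub := fun b' => node_sub b' hU.
    have UR p : inW U p -> (lo U b <= pix b p)%N /\ (i <= lo U b)%N.
      have [+ _] := sub b; rewrite {1}/lo /rgt /upd eqxx /= (inWb b) /inB => h /andP[/andP[->]].
      by [].
    rewrite (lve0 (H := H1)); last first.
      move=> e /hH1 /andP[/subL[_ h1] /subL[_ h2]].
      by case E1 : (inW U e.1); case E2 : (inW U e.2) => //; [have := UR _ E1 | have := UR _ E2]; lia.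
    rewrite (lve0 (H := BL)); last first.
      move=> e /hBL[_ [h1 h2]].
      by case E1 : (inW U e.1); case E2 : (inW U e.2) => //; [have := UR _ E1 | have := UR _ E2]; lia.
    have key := @leave_side U b F BR (lo U b == i) sF _ (eqB false) cBR.
    have {}key : (lve U F + lve U BR <= kappa * (lo U b == i))%N.
      apply: key => e; rewrite mem_cat => /orP[/hF[_ [h1 h2]]|/hBR[_ [h1 h2]]] /eqP ne.
        have [a1 a2] := h2 b; move: h1; rewrite /crs.
        by case E1 : (inW U e.1); case E2 : (inW U e.2) => //; try (have := UR _ E1); try (have := UR _ E2); lia.
      by case E1 : (inW U e.1); case E2 : (inW U e.2) => //; try (have := UR _ E1); try (have := UR _ E2); lia.
    have ue : unsh U W = (unsh U (rgt W b i) + (lo U b == i))%N.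
      have [+ _] := sub b; rewrite !(unshE _ _ b) /lo /hi /rgt /upd eqxx nb /= => h1.
      have -> : (U b).1 != (W b).1 by apply/eqP; move: hi0; rewrite /lo /hi; lia.
      by case: (_ == i) => /=; ring.
    have := good_lve g2 hU; rewrite ue mulnDr; lia.
Qed.

End Boxes.

Section Pixels.
Variable R : realType.
Notation T := (R * R)%type.
Variables (pix : bool -> T -> nat) (g B : R).
Hypothesis g_gt0 : 0 < g.
Hypothesis pixP : forall b i p, (0 < i)%N -> (pix b p < i)%N = (co b p < g * i%:R - B).
Implicit Types (b : bool) (p q : T).

Lemma pix_mono b p q : co b p <= co b q -> (pix b p <= pix b q)%N.
Proof.
move=> h; rewrite leqNgt; apply/negP => h'.
have h0 : (0 < pix b p)%N by apply: leq_trans h'.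
have := ltnn (pix b p); rewrite pixP // => /negbT; rewrite -leNgt => h1.
by move: h'; rewrite pixP //; lra.
Qed.

(** One pixel width more than the difference of the indices, since the positions within the two
    extreme pixels are unknown. *)
Lemma pix_dist b p q n : - B <= co b q -> (pix b p <= pix b q + n)%N ->
  co b p - co b q <= g * n.+1%:R.
Proof.
move=> dq h.
have h1 : co b p < g * (pix b p).+1%:R - B by rewrite -pixP.
have h2 : g * (pix b q)%:R - B <= co b q.
  case E : (pix b q) => [|k]; first by rewrite mulr0 add0r.
  by rewrite leNgt -E -pixP ?E // ltnn.
have h3 : ((pix b p).+1%:R : R) <= (pix b q)%:R + n.+1%:R by rewrite -natrD ler_nat; lia.
have : g * (pix b p).+1%:R <= g * ((pix b q)%:R + n.+1%:R) by rewrite ler_pM2l.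
lra.
Qed.

End Pixels.

(** * Bridging a cut *)

Section Cut.
Variable R : realType.
Notation T := (R * R)%type.
Variable pix : bool -> T -> nat.
Variables (g lam B : R) (m : nat).
Hypothesis g_gt0 : 0 < g.
Hypothesis lam_ge0 : 0 <= lam.
Hypothesis m_gt0 : (0 < m)%N.
Hypothesis pixP : forall b i p, (0 < i)%N -> (pix b p < i)%N = (co b p < g * i%:R - B).

Notation elen := (elen (@edist R)).
Notation edge := (T * T)%type.
Notation crs := (crs pix).
Notation eW := (eW pix).
Notation adj := (adj pix).
Notation good := (@good R pix m).
Implicit Types (W U : box) (E H K F : seq edge) (e : edge) (b : bool) (i j : nat).

(* Bridging the points of a list in the order of the coordinate [~~ b]. *)
Definition bord b (p q : T * bool) : bool := co (~~ b) p.1 <= co (~~ b) q.1.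
Definition bridges b (s : seq (T * bool)) : seq edge :=
  if sort (bord b) s is (y, c) :: s' then bridge y c s' else [::].

Lemma bord_total b : total (bord b).
Proof. by move=> p q; apply: le_total. Qed.

Lemma bridges_mem b s e : e \in bridges b s -> (e.1 \in map fst s) && (e.2 \in map fst s).
Proof.
rewrite /bridges; case E : (sort _ s) => [|[y c] s'] // /bridge_mem.
have ps : perm_eq (map fst s) (y :: map fst s').
  by rewrite -[y :: _]/(map fst ((y, c) :: s')) -E; apply: perm_map; rewrite perm_sym perm_sort.
by rewrite !(perm_mem ps).
Qed.

Lemma bridges_dg b (s : seq (T * bool)) v : ~~ odd (\sum_(p <- s) nat_of_bool p.2)%N ->
  odd (dg (bridges b s) v) = odd (marks s v).
Proof.
rewrite /bridges; have ps := permEl (perm_sort (bord b) s).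
rewrite /marks -!(perm_big _ ps) /=; case: (sort _ s) => [|[y c] s'].
  by rewrite !big_nil /dg big_nil.
by rewrite !big_cons /= => /negbTE h; rewrite bridge_dg.
Qed.

Lemma bridges_conn b s u v : u \in map fst s -> v \in map fst s -> conn (bridges b s) u v.
Proof.
rewrite /bridges; case E : (sort _ s) => [|[y c] s'].
  by have := size_sort (bord b) s; rewrite E => /esym/size0nil->.
have ps : perm_eq (map fst s) (y :: map fst s').
  by rewrite -[y :: _]/(map fst ((y, c) :: s')) -E; apply: perm_map; rewrite perm_sym perm_sort.
rewrite !(perm_mem ps) => hu hv.
by apply: (@conn_trans _ _ _ y); [apply: conn_sym|]; apply: bridge_conn.
Qed.

Lemma bridges_cross b s j : (count (crs (~~ b) j) (bridges b s) <= 2)%N.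
Proof.
rewrite /bridges; have := sort_sorted (@bord_total b) s.
case: (sort _ s) => [|[y c] s'] // srt.
apply: (@bridge_cross _ (pix (~~ b))).
rewrite -[y :: _]/(map fst ((y, c) :: s')) !sorted_map.
by apply: sub_sorted srt => p q; apply: (pix_mono pixP).
Qed.

(** In sorted order the distances along the cut telescope to at most [h], and each step deviates by
    at most [lam] across it; doubled edges give the factor 2. *)
Lemma bridges_len b s h :
    (forall p q, p \in map fst s -> q \in map fst s ->
       co (~~ b) p - co (~~ b) q <= h /\ `|co b p - co b q| <= lam) -> 0 <= h ->
  elen (bridges b s) <= 2%:R * (h + (size s)%:R * lam).
Proof.
move=> hs h0; rewrite /bridges; have := sort_sorted (@bord_total b) s.
have sz : size (sort (bord b) s) = size s by rewrite size_sort.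
have ms := mem_sort (bord b) s.
case E : (sort _ s) sz => [|[y c] s'] sz srt.
  by rewrite /elen big_nil mulr_ge0 // addr_ge0 // mulr_ge0.
apply: le_trans (bridge_len (@edist_ge0 R) y c s') _; rewrite ler_pM2l //.
have hp p : p \in y :: map fst s' -> p \in map fst s.
  by rewrite -[y :: _]/(map fst ((y, c) :: s')) -E => /mapP[q]; rewrite ms => hq ->; apply: map_f.
apply: le_trans (_ : plf (fun p q => `|co (~~ b) p - co (~~ b) q|) y (map fst s') +
  (size s')%:R * lam <= _); last first.
  rewrite lerD //; last by rewrite ler_wpM2r // ler_nat -sz /=.
  rewrite plf_sorted.
    by case: (hs (last y (map fst s')) y) => //; apply: hp; rewrite ?mem_head ?mem_last.
  change (sorted (fun p q => co (~~ b) p <= co (~~ b) q) (map fst ((y, c) :: s'))).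
  by rewrite sorted_map; apply: sub_sorted srt.
have {srt E ms sz}: {subset y :: map fst s' <= map fst s} by [].
elim: s' y {c} hp => [|[z c] s' IH] y _ hp /=; first by rewrite mul0r addr0.
have hz : {subset z :: map fst s' <= map fst s} by move=> p hq; apply: hp; rewrite inE hq orbT.
have := IH z hz hz; have := edist_co b y z.
have [_] := hs y z (hp _ (mem_head _ _)) (hz _ (mem_head _ _)).
by rewrite -natr1 mulrDl mul1r; lra.
Qed.

Definition orient b i e : edge := if (pix b e.1 < i)%N then e else (e.2, e.1).

Lemma er_orient b i M : er M (map (orient b i) M).
Proof.
elim: M => [//|e M IH] e0 /=; rewrite IH; congr addn.
suff -> : eqe e0 e = eqe e0 (orient b i e) by [].
have h : eqe e (orient b i e).
  by case: e => p q; rewrite /orient; case: ifP => _; rewrite /eqe eqxx ?orbT.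
by apply/idP/idP => h0; apply: eqe_trans h0 _; rewrite // eqe_sym.
Qed.

Lemma elen_er H K : er H K -> elen H = elen K.
Proof. by apply: er_big => p q /=; rewrite edistC. Qed.

Lemma elen_perm H K : perm_eq H K -> elen H = elen K.
Proof. by move=> /er_perm /elen_er. Qed.

Lemma good_le W E H t u u' : @good W E H t u -> u <= u' -> @good W E H t u'.
Proof. by case=> h1 h2 h3 h4 h5 uu; split=> //; lra. Qed.

(** Of the crossing edges, [K0] is kept in any case. If more than two others remain, one or two of
    them are kept and the rest dropped, and a bridge is built on each side of the cut through all
    their ends. Marking the ends of the dropped edges restores the parities, and a kept edge joins
    the two bridges. Each bridge costs at most [2%:R * (h + g)]. *)
Lemma cut_bridge W b i (hi0 : (lo W b < i < hi W b)%N) E H1 H2 t1 t2 u1 u2 K0 M h :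
    (forall e, e \in E -> eW W e) -> (forall e, e \in E -> adj e) ->
    (forall e, e \in E -> forall b', `|co b' e.1 - co b' e.2| <= lam) ->
    @good (lft W b i) [seq e <- E | eW (lft W b i) e] H1 t1 u1 ->
    @good (rgt W b i) [seq e <- E | eW (rgt W b i) e] H2 t2 u2 ->
    perm_eq [seq e <- E | crs b i e] (K0 ++ M) -> (size K0 <= 2 * m.-1)%N ->
    (forall p q, p \in map fst M ++ map snd M -> q \in map fst M ++ map snd M ->
       co (~~ b) p - co (~~ b) q <= h) -> 0 <= h ->
    (size M)%:R * lam <= g ->
  exists H, @good W E H (@BNode W b i hi0 t1 t2) (u1 + u2 + 4%:R * (h + g)).
Proof.
move=> hE hA hl g1 g2 pK sK0 win h0 sM.
have i0 : (0 < i)%N by case/andP: hi0 => h1 _; apply: leq_ltn_trans h1.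
have kE e : e \in K0 ++ M -> e \in E /\ crs b i e.
  by rewrite -(perm_mem pK) mem_filter => /andP[].
have x0 : 0 <= 4%:R * (h + g) by rewrite mulr_ge0 // addr_ge0 // ltW.
(* Two more edges are within the budget [2 * m], so that no bridge is built. *)
have [sM2|sM2] := leqP (size M) 2.
  exists (H1 ++ H2 ++ (K0 ++ M) ++ [::] ++ [::]).
  apply: good_le (_ : u1 + u2 + 0 <= _); last by rewrite lerD2l.
  apply: assemble => //.
  - by rewrite size_cat; move: m_gt0 sK0 sM2; clear; lia.
  - by move=> e /kE[eE c]; split; [apply: hE | split=> //; apply: hA].
  - by move=> v; rewrite !cats0 (dg_perm v pK).
  - move=> e he; apply: conn1; rewrite !cats0 -(perm_mem pK) -surjective_pairing he //.
  - by rewrite !cats0 addr0 (elen_perm pK).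
set M' := map (orient b i) M.
have oM e : e \in M' -> [/\ exists2 e0, e0 \in M & (e = e0 \/ e = (e0.2, e0.1)),
    eW W e, pix b e.1 = i.-1 & pix b e.2 = i].
  case/mapP => e0 e0M ->.
  have [eE c] : e0 \in E /\ crs b i e0 by apply: kE; rewrite mem_cat e0M orbT.
  have [a1 a2] := hA _ eE b; have ee := hE _ eE.
  rewrite /orient; move: c; rewrite /crs; case: ifP => h1 h2.
    split=> //; first by exists e0 => //; left.
      by move: h1 h2 a1 a2; clear; lia.
    by move: h1 h2 a1 a2; clear; lia.
  split=> /=; [by exists e0 => //; right| by move: ee; rewrite /eW andbC| |].
    by move: h1 h2 a1 a2; clear; lia.
  by move: h1 h2 a1 a2; clear; lia.
have mM e : e \in M' -> (e.1 \in map fst M ++ map snd M) && (e.2 \in map fst M ++ map snd M).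
  case/oM => [[e0 he0 h1] _ _ _]; rewrite !mem_cat.
  by case: h1 => -> /=; rewrite !(map_f fst he0) !(map_f snd he0) ?orbT.
have szM' : size M' = size M by rewrite size_map.
(* The number of dropped edges must be even, since a bridge can correct only an even number of
   marks. *)
pose k := if odd (size M') then 1%N else 2.
pose Mk := take k M'; pose Md := drop k M'.
have MkE : M' = Mk ++ Md by rewrite cat_take_drop.
pose mk (f : edge -> T) := [seq (f e, false) | e <- Mk] ++ [seq (f e, true) | e <- Md].
have mkfst f : map fst (mk f) = map f M'.
  by rewrite MkE /mk !map_cat -!map_comp.
have mksz f : size (mk f) = size M by rewrite -(size_map fst) mkfst size_map.
have mkodd f : ~~ odd (\sum_(p <- mk f) nat_of_bool p.2)%N.
  rewrite /mk big_cat !big_map /= big1_eq add0n sum1_size /Md size_drop /k.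
  move: (size M') sM2 szM' => n0 h1 h2; rewrite oddB; last by case: ifP; lia.
  by case: (odd n0).
have mkmarks f v : marks (mk f) v = (\sum_(e <- Md) (f e == v))%N.
  by rewrite /marks /mk big_cat !big_map /= big1_eq.
pose BL := bridges b (mk fst); pose BR := bridges b (mk snd).
have kpos : (0 < k <= 2)%N by rewrite /k; case: odd.
have [e0 e0k] : exists e0, e0 \in Mk.
  rewrite /Mk; case: M' szM' {oM mM Mk Md MkE mk mkfst mksz mkodd mkmarks BL BR} k kpos => [|e0 s] sz [|k'] //.
    by move: sM2; rewrite -sz.
  by exists e0; rewrite mem_head.
have e0M : e0 \in M' by rewrite MkE mem_cat e0k.
(* The left ends lie below the cut line and the right ends above it, all within [lam] of it, because
   the edges cross the line; hence the bound [lam] across the cut. *)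
have bl f : (f = fst \/ f = snd) -> forall p q, p \in map fst (mk f) -> q \in map fst (mk f) ->
   co (~~ b) p - co (~~ b) q <= h /\ `|co b p - co b q| <= lam.
  move=> ff p q; rewrite mkfst => /mapP[e1 h1 ->] /mapP[e2 h2 ->].
  have /andP[m1 m2] := mM _ h1; have /andP[m3 m4] := mM _ h2.
  split; first by case: ff => ->; apply: win.
  have [[e1' e1M d1] _ p1 p2] := oM _ h1; have [[e2' e2M d2] _ p3 p4] := oM _ h2.
  have l1 : `|co b e1.1 - co b e1.2| <= lam.
    have [] := kE e1' _; first by rewrite mem_cat e1M orbT.
    by move=> /hl/(_ b) + _; case: d1 => -> //=; rewrite distrC.
  have l2 : `|co b e2.1 - co b e2.2| <= lam.
    have [] := kE e2' _; first by rewrite mem_cat e2M orbT.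
    by move=> /hl/(_ b) + _; case: d2 => -> //=; rewrite distrC.
  have q1 : co b e1.1 < g * i%:R - B by rewrite -pixP // p1 ltn_predL.
  have q3 : co b e2.1 < g * i%:R - B by rewrite -pixP // p3 ltn_predL.
  have q2 : g * i%:R - B <= co b e1.2 by rewrite leNgt -pixP // p2 ltnn.
  have q4 : g * i%:R - B <= co b e2.2 by rewrite leNgt -pixP // p4 ltnn.
  move: l1 l2; rewrite !ler_norml => /andP[a1 a2] /andP[a3 a4].
  by case: ff => ->; apply/andP; split; lra.
exists (H1 ++ H2 ++ (K0 ++ Mk) ++ BL ++ BR).
apply: assemble => //.
- rewrite size_cat; have : (size Mk <= 2)%N by rewrite /Mk size_take_min geq_min; case/andP: kpos => _ ->.
  by move: (size Mk) (size K0) m_gt0 sK0; clear; lia.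
- move=> e; rewrite mem_cat => /orP[h1|h1].
    by have [eE c] : e \in E /\ crs b i e by [apply: kE; rewrite mem_cat h1]; split; [apply: hE | split=> //; apply: hA].
  have eM' : e \in M' by rewrite MkE mem_cat h1.
  have [[e1 e1M d] ee p1 p2] := oM e eM'.
  have [e1E _] : e1 \in E /\ crs b i e1 by apply: kE; rewrite mem_cat e1M orbT.
  split=> //; split; first by rewrite /crs p1 p2 ltn_predL i0 ltnn.
  move=> b'; have [] := hA _ e1E b'; by case: d => ->.
- move=> e /bridges_mem; rewrite mkfst => /andP[/mapP[e1 h1 q1] /mapP[e2 h2 q2]].
  have [_ w1 p1 _] := oM _ h1; have [_ w2 p2 _] := oM _ h2; rewrite /eW q1 q2 p1 p2.
  by split=> //; case/andP: w1 => -> _; case/andP: w2 => -> _.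
- move=> e /bridges_mem; rewrite mkfst => /andP[/mapP[e1 h1 q1] /mapP[e2 h2 q2]].
  have [_ w1 _ p1] := oM _ h1; have [_ w2 _ p2] := oM _ h2; rewrite /eW q1 q2 p1 p2.
  by split=> //; case/andP: w1 => _ ->; case/andP: w2 => _ ->.
- exact: bridges_cross.
- exact: bridges_cross.
- move=> v; rewrite (dg_perm v pK) !dg_cat !oddD !bridges_dg // !mkmarks.
  rewrite (er_dg v (er_orient b i M)) -/M' MkE dg_cat !oddD.
  by rewrite /(dg Md v) big_split /= oddD !addbA.
- have cn e : e \in M' -> conn ((K0 ++ Mk) ++ BL ++ BR) e.1 e.2.
    move=> he; apply: (@conn_trans _ _ _ e0.1).
      apply: conn_sub (bridges_conn b (s := mk fst) _ _); rewrite ?mkfst ?map_f //.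
      by move=> e' he'; rewrite !mem_cat he' !orbT.
    apply: (@conn_trans _ _ _ e0.2).
      by apply: conn1; rewrite -surjective_pairing !mem_cat e0k !orbT.
    apply: conn_sub (bridges_conn b (s := mk snd) _ _); rewrite ?mkfst ?map_f //.
    by move=> e' he'; rewrite !mem_cat he' !orbT.
  move=> e; rewrite (perm_mem pK) mem_cat => /orP[he|he].
    by apply: conn1; rewrite -surjective_pairing !mem_cat he.
  have := cn _ (map_f (orient b i) he); rewrite /orient; case: ifP => //= _.
  exact: conn_sym.
- rewrite (elen_perm pK) !elen_cat (elen_er (er_orient b i M)) -/M' MkE elen_cat.
  have := @bridges_len b (mk fst) h (bl fst (or_introl erefl)) h0.
  have := @bridges_len b (mk snd) h (bl snd (or_intror erefl)) h0.
  rewrite !mksz -/BL -/BR; have := elen_ge0 (@edist_ge0 R) Md.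
  move: (elen BL) (elen BR) (elen Md) (elen Mk) (elen K0) => x1 x2 x3 x4 x5; lra.
Qed.

End Cut.

Lemma count_sum (T : Type) (a : pred T) s : count a s = (\sum_(x <- s) a x)%N.
Proof. by elim: s => [|x s IH]; rewrite ?big_nil // big_cons /= IH. Qed.

Lemma iota_split lo i hi : (lo < i < hi)%N ->
  index_iota lo.+1 hi = index_iota lo.+1 i ++ i :: index_iota i.+1 hi.
Proof.
move=> /andP[h1 h2]; rewrite /index_iota.
have -> : (hi - lo.+1 = (i - lo.+1) + (hi - i))%N by lia.
rewrite iotaD; congr cat; have -> : (lo.+1 + (i - lo.+1) = i)%N by lia.
by have -> : (hi - i = (hi - i.+1).+1)%N by lia.
Qed.

(** Otherwise the opposite strict inequalities, summed over all rows and over all columns,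
    contradict each other: each pair of sums counts the same incidences in exchanged order. *)
Lemma favourable_entry (I J : seq nat) (D1 D2 : nat -> nat -> bool) : (0 < size I + size J)%N ->
  (exists2 i, i \in I & (count (D1 i) J <= count (D2 i) J)%N) \/
  (exists2 j, j \in J & (count (D2^~ j) I <= count (D1^~ j) I)%N).
Proof.
move=> ne.
case h1 : (has (fun i => count (D1 i) J <= count (D2 i) J)%N I).
  by left; case/hasP: h1 => i; exists i.
case h2 : (has (fun j => count (D2^~ j) I <= count (D1^~ j) I)%N J).
  by right; case/hasP: h2 => i; exists i.
exfalso.
have a1 : (\sum_(i <- I) count (D2 i) J + size I <= \sum_(i <- I) count (D1 i) J)%N.
  move/hasPn: (negbT h1) => h; rewrite -sum1_size -big_split /= !big_seq.
  by apply: leq_sum => i /h; rewrite -ltnNge addn1.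
have a2 : (\sum_(j <- J) count (D1^~ j) I + size J <= \sum_(j <- J) count (D2^~ j) I)%N.
  move/hasPn: (negbT h2) => h; rewrite -sum1_size -big_split /= !big_seq.
  by apply: leq_sum => i /h; rewrite -ltnNge addn1.
have ex (D : nat -> nat -> bool) : (\sum_(i <- I) count (D i) J = \sum_(j <- J) count (D^~ j) I)%N.
  under eq_bigr do rewrite count_sum.
  by rewrite exchange_big /=; under [RHS]eq_bigr do rewrite count_sum.
by move: a1 a2; rewrite !ex; lia.
Qed.

(** * Favourable cuts and the potential that pays for bridges *)

Section Potential.
Variable R : realType.
Notation T := (R * R)%type.
Variable pix : bool -> T -> nat.
Variable m : nat.

Notation elen := (elen (@edist R)).
Notation edge := (T * T)%type.
Notation crs := (crs pix).
Notation eW := (eW pix).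
Notation adj := (adj pix).
Notation good := (@good R pix m).
Implicit Types (W U : box) (E H K F : seq edge) (e : edge) (b : bool) (i j : nat).

Definition bel b j e := (pix b e.1 < j)%N && (pix b e.2 < j)%N.
Definition abo b j e := (j <= pix b e.1)%N && (j <= pix b e.2)%N.

(* The point of intersection of the lines [i] (across axis [b]) and [j] is dark
   along the first line. *)
Definition Dk E b i j : bool :=
  (m <= count (fun e => crs b i e && bel (~~ b) j e) E)%N &&
  (m <= count (fun e => crs b i e && abo (~~ b) j e) E)%N.

Definition rng W b := index_iota (lo W b).+1 (hi W b).

(** The excess [Phi] over [m] crossings per line pays for bridged dark stretches; the total [Xi]
    pays the fixed part of the cost of a bridge. *)
Definition Phi W E : nat := \sum_(b : bool) \sum_(j <- rng W b) (count (crs b j) E - m).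
Definition Xi W E : nat := \sum_(b : bool) \sum_(j <- rng W b) count (crs b j) E.

Lemma mem_rng W b i : (i \in rng W b) = (lo W b < i < hi W b)%N.
Proof. exact: mem_index_iota. Qed.

(** Mitchell's favourable cuts: the dark points along the cut, which cost bridge length, are at most
    as many as the lines across it that are dark where they meet it, which can be charged. *)
Lemma favourable W E : (exists b, (lo W b).+1 < hi W b)%N -> exists b i, (lo W b < i < hi W b)%N /\
  (count (Dk E b i) (rng W (~~ b)) <= count (fun j => Dk E (~~ b) j i) (rng W (~~ b)))%N.
Proof.
move=> [b0 hb0].
have ne : (0 < size (rng W true) + size (rng W false))%N.
  by rewrite /rng !size_iota; case: b0 hb0; lia.
have [[i hi0 h]|[j hj h]] := favourable_entry (fun i j => Dk E true i j) (fun i j => Dk E false j i) ne.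
  by exists true, i; rewrite -mem_rng.
by exists false, j; rewrite -mem_rng.
Qed.

Lemma cut_ranges W b i : (lo W b < i < hi W b)%N ->
  [/\ rng W b = rng (lft W b i) b ++ i :: rng (rgt W b i) b,
      rng (lft W b i) (~~ b) = rng W (~~ b) & rng (rgt W b i) (~~ b) = rng W (~~ b)].
Proof.
move=> h; have nb : (~~ b == b) = false by case: (b).
rewrite /rng /lft /rgt /lo /hi /upd eqxx nb /=; split=> //.
exact: iota_split.
Qed.

Lemma sum_axes (f : bool -> nat) b : (\sum_(c : bool) f c = f b + f (~~ b))%N.
Proof. by rewrite big_bool; case: b => //=; rewrite addnC. Qed.

(** If a line of the other axis is dark where it meets the cut, both parts inherit at least [m] of
    its crossings; the allowance [m] is then subtracted twice instead of once, so the excess drops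
    by [m]. The crossings of the cut line itself disappear from both parts. *)
Lemma potential_drop W b i E : (lo W b < i < hi W b)%N -> (forall e, e \in E -> eW W e) ->
  let E1 := [seq e <- E | eW (lft W b i) e] in let E2 := [seq e <- E | eW (rgt W b i) e] in
  (Phi (lft W b i) E1 + Phi (rgt W b i) E2 +
     m * count (fun j => Dk E (~~ b) j i) (rng W (~~ b)) <= Phi W E)%N /\
  (Xi (lft W b i) E1 + Xi (rgt W b i) E2 + count (crs b i) E <= Xi W E)%N.
Proof.
move=> hi0 hE E1 E2; have pE := perm_cut hi0 hE; rewrite -/E1 -/E2 in pE.
have [r1 r2 r3] := cut_ranges hi0.
have nb : (~~ b == b) = false by case: (b).
have c12 P : (count P E1 + count P E2 <= count P E)%N.
  by have := permP pE P; rewrite !count_cat => ->; rewrite addnA leq_addr.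
have q1 j : count (fun e => crs (~~ b) j e && bel b i e) E = count (crs (~~ b) j) E1.
  rewrite /E1 count_filter; apply: eq_in_count => e /hE he /=; congr andb.
  move: he; rewrite /eW !(inWb _ b) /inB /bel /lo /hi /lft /upd eqxx nb /=.
  by case/andP=> /andP[/andP[-> _] ->] /andP[/andP[-> _] ->]; rewrite !andbT.
have q2 j : count (fun e => crs (~~ b) j e && abo b i e) E = count (crs (~~ b) j) E2.
  rewrite /E2 count_filter; apply: eq_in_count => e /hE he /=; congr andb.
  move: he; rewrite /eW !(inWb _ b) /inB /abo /lo /hi /rgt /upd eqxx nb /=.
  by case/andP=> /andP[/andP[_ ->] ->] /andP[/andP[_ ->] ->]; rewrite !andbT.
rewrite /Phi /Xi !(sum_axes _ b) r1 r2 r3 !big_cat !big_cons /=; split.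
- have h1 : (\sum_(j <- rng (lft W b i) b) (count (crs b j) E1 - m) <=
     \sum_(j <- rng (lft W b i) b) (count (crs b j) E - m))%N.
    by apply: leq_sum => j _; have := c12 (crs b j); lia.
  have h2 : (\sum_(j <- rng (rgt W b i) b) (count (crs b j) E2 - m) <=
     \sum_(j <- rng (rgt W b i) b) (count (crs b j) E - m))%N.
    by apply: leq_sum => j _; have := c12 (crs b j); lia.
  have h3 : (\sum_(j <- rng W (~~ b)) (count (crs (~~ b) j) E1 - m) +
     \sum_(j <- rng W (~~ b)) (count (crs (~~ b) j) E2 - m) +
     m * count (fun j => Dk E (~~ b) j i) (rng W (~~ b)) <=
     \sum_(j <- rng W (~~ b)) (count (crs (~~ b) j) E - m))%N.
    rewrite count_sum big_distrr /= -!big_split /=; apply: leq_sum => j _.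
    rewrite /Dk negbK q1 q2; have := c12 (crs (~~ b) j).
    move: (count _ E1) (count _ E2) (count _ E) => x1 x2 x.
    by case: (leqP m x1); case: (leqP m x2) => /=; rewrite ?muln1 ?muln0; lia.
  move: h1 h2 h3; lia.
- have h1 : (\sum_(j <- rng (lft W b i) b) count (crs b j) E1 <=
     \sum_(j <- rng (lft W b i) b) count (crs b j) E)%N.
    by apply: leq_sum => j _; have := c12 (crs b j); lia.
  have h2 : (\sum_(j <- rng (rgt W b i) b) count (crs b j) E2 <=
     \sum_(j <- rng (rgt W b i) b) count (crs b j) E)%N.
    by apply: leq_sum => j _; have := c12 (crs b j); lia.
  have h3 : (\sum_(j <- rng W (~~ b)) count (crs (~~ b) j) E1 +
     \sum_(j <- rng W (~~ b)) count (crs (~~ b) j) E2 <=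
     \sum_(j <- rng W (~~ b)) count (crs (~~ b) j) E)%N.
    by rewrite -big_split /=; apply: leq_sum => j _; apply: c12.
  move: h1 h2 h3; lia.
Qed.

(** The weights match the cost [4 * (s + 4)], in units of [g], of a bridge over [s] dark points:
    [4 * Phi] releases [4 * m * s], and since only cuts with more than [2 * m] crossings are
    bridged, [8 * Xi] releases [16 * m]. *)
Definition Psi W E : nat := 4 * Phi W E + 8 * Xi W E.

End Potential.

(** * Decomposition by favourable and by forced cuts *)

Section Guillotine.
Variable R : realType.
Notation T := (R * R)%type.
Variable pix : bool -> T -> nat.
Variables (g lam B : R) (m : nat).
Hypothesis g_gt0 : 0 < g.
Hypothesis lam_ge0 : 0 <= lam.
Hypothesis m_gt0 : (0 < m)%N.
Hypothesis pixP : forall b i p, (0 < i)%N -> (pix b p < i)%N = (co b p < g * i%:R - B).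

Notation elen := (elen (@edist R)).
Notation edge := (T * T)%type.
Notation crs := (crs pix).
Notation eW := (eW pix).
Notation adj := (adj pix).
Notation good := (@good R pix m).
Implicit Types (W U : box) (E H K F : seq edge) (e : edge) (b : bool) (i j : nat).

Notation Dk := (Dk pix m).
Notation Phi := (Phi pix m).
Notation Psi := (Psi pix m).
Notation Xi := (Xi pix).
Notation bel := (bel pix).
Notation abo := (abo pix).

(** [l'] is the last position with fewer than [m] crossing edges below it, [h'] the first with fewer
    than [m] above it. With these edges set aside in [K0], the ends of the others lie in a window
    all of whose inner positions are dark, so the dark count bounds its length. *)
Lemma window W b i E : (forall e, e \in E -> eW W e /\ adj e) ->
  let c := ~~ b in
  exists K0 M a, [/\ perm_eq [seq e <- E | crs b i e] (K0 ++ M), (size K0 <= 2 * m.-1)%N &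
    forall p, p \in map fst M ++ map snd M ->
      (a <= pix c p <= a + count (Dk E b i) (rng W c) + 2)%N].
Proof.
move=> hE c; set K := [seq e <- E | crs b i e].
case: (posnP (size K)) => [/size0nil->|Kpos].
  by exists [::], [::], 0%N; split.
have KE e : e \in K -> [/\ (lo W c <= pix c e.1 < hi W c)%N, (lo W c <= pix c e.2 < hi W c)%N & adj e].
  rewrite mem_filter => /andP[_ /hE[h ha]]; split=> //; move: h; rewrite /eW !(inWb _ b) /inB -/c;
  by case/andP => /andP[_ h1] /andP[_ h2].
have lh : (lo W c < hi W c)%N.
  case E0 : K Kpos => [//|e K'] _.
  by have [] := KE e; rewrite ?E0 ?mem_head //; lia.
pose P j := (m <= count (bel c j) K)%N; pose Q j := (m <= count (abo c j) K)%N.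
have Pl : ~~ P (lo W c).
  rewrite /P -ltnNge (_ : count _ K = 0%N) //; apply/eqP; rewrite -leqn0 leqNgt -has_count.
  by apply/hasPn => e /KE[h1 h2 _]; rewrite /bel; lia.
have Qh : ~~ Q (hi W c).
  rewrite /Q -ltnNge (_ : count _ K = 0%N) //; apply/eqP; rewrite -leqn0 leqNgt -has_count.
  by apply/hasPn => e /KE[h1 h2 _]; rewrite /abo; lia.
have [l' /andP[l1 l2] lmax] : exists2 j, (lo W c <= j < hi W c)%N && ~~ P j &
    forall j, (lo W c <= j < hi W c)%N && ~~ P j -> (j <= j)%N /\ (j <= hi W c)%N.
  by exists (lo W c) => [|j /andP[/andP[h1 h2] _]]; rewrite ?leqnn ?lh ?Pl //; split=> //; apply: ltnW.
have exP : exists j, (lo W c <= j < hi W c)%N && ~~ P j by exists l'; rewrite l1 l2.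
have ubP j : (lo W c <= j < hi W c)%N && ~~ P j -> (j <= hi W c)%N by case/lmax.
case: (ex_maxnP exP ubP) => {l' l1 l2 lmax} l' /andP[l1 l2] lmax.
have exQ : exists j, (lo W c < j <= hi W c)%N && ~~ Q j by exists (hi W c); rewrite lh leqnn Qh.
case: (ex_minnP exQ) => h' /andP[h1 h2] hmin.
pose S := predU (bel c l') (abo c h').
exists (filter S K), (filter (predC S) K), l'.-1; split.
- by rewrite perm_sym; apply/permPl/perm_filterC.
- rewrite size_filter; have := count_predUI (bel c l') (abo c h') K.
  by move: l2 h2; rewrite /P /Q /S -!ltnNge; lia.
have cnt : (h' - l'.+1 <= count (Dk E b i) (rng W c))%N.
  rewrite -(size_iota l'.+1 (h' - l'.+1)) -size_filter; apply: uniq_leq_size; first exact: iota_uniq.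
  move=> j; rewrite mem_iota mem_filter mem_rng => hj; apply/andP; split; last by lia.
  have [Pj Qj] : P j /\ Q j.
    split; apply: contraT => hn; first by have := lmax j; rewrite hn andbT; lia.
    by have := hmin j; rewrite hn andbT; lia.
  move: Pj Qj; rewrite /P /Q /K !count_filter /Dk -/c => h3 h4; apply/andP; split.
    by apply: leq_trans h3 _; apply: sub_count => e /andP[x1 x2] /=; rewrite x1 x2.
  by apply: leq_trans h4 _; apply: sub_count => e /andP[x1 x2] /=; rewrite x1 x2.
have wE e : e \in filter (predC S) K -> forall p, (p == e.1) || (p == e.2) ->
    (l'.-1 <= pix c p <= h')%N.
  rewrite mem_filter /S /bel /abo /= => /andP[ns /KE[k1 k2 /(_ c)[a1 a2]]] p.
  by case/orP => /eqP->; move: ns; lia.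
move=> p; rewrite mem_cat => /orP[] /mapP[e /wE h ->].
  have /andP[h3 h4] : (l'.-1 <= pix c e.1 <= h')%N by apply: h; rewrite eqxx.
  by rewrite h3 /=; apply: leq_trans h4 _; move: cnt; clear; lia.
have /andP[h3 h4] : (l'.-1 <= pix c e.2 <= h')%N by apply: h; rewrite eqxx orbT.
by rewrite h3 /=; apply: leq_trans h4 _; move: cnt; clear; lia.
Qed.

(* The hypotheses on the edges that are inherited by sub-boxes. *)
Record steps E : Prop := Steps {
  st_adj : forall e, e \in E -> adj e;
  st_len : forall e, e \in E -> forall b, `|co b e.1 - co b e.2| <= lam;
  st_dom : forall e, e \in E -> forall b, - B <= co b e.1 /\ - B <= co b e.2;
  st_crs : forall b i, (count (crs b i) E)%:R * lam <= g }.

Lemma steps_filter P E : steps E -> steps (filter P E).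
Proof.
case=> h1 h2 h3 h4; split=> [e|e|e|b i]; rewrite ?mem_filter; try by case/andP => _; auto.
apply: le_trans (h4 b i); rewrite ler_wpM2r // ler_nat count_filter.
by apply: sub_count => e /andP[].
Qed.

(** Induction on the total width of the box. A favourable cut crossed by at most [2 * m] edges is
    free. Otherwise the window measures at most [s.+3] pixel widths and the bridge costs [4 * s.+4]
    of them, paid by the drop of [Psi]. *)
Lemma guillotine W E : steps E -> (forall e, e \in E -> eW W e) ->
  exists t H u, [/\ @good W E H t (g * u%:R), leaves_ok t & (m * u <= Psi W E)%N].
Proof.
have [n] := ubnP (\sum_(b : bool) (hi W b - lo W b))%N.
elim: n W E => // n IH W E sn sE hE.
have [/existsP[b0 hb0]|/existsPn hl] := boolP [exists b, (lo W b).+1 < hi W b]%N; last first.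
  exists (BLeaf W), E, 0%N; split=> //=.
  - split=> //; last by move=> U [->|//]; rewrite (lve0 (H := E)) // => e /hE/andP[-> ->].
    + by move=> e he; apply: conn1; rewrite -surjective_pairing he.
    + by rewrite mulr0 addr0.
  - by move=> b; rewrite leqNgt.
  - by rewrite muln0.
have [b [i [hi0 fav]]]   := @favourable R pix m W E (ex_intro _ b0 hb0).
have [r1 r2 r3] := cut_ranges hi0.
have nb : (~~ b == b) = false by case: (b).
have [||t1 [H1 [u1 [g1 l1 p1]]]] := IH (lft W b i) [seq e <- E | eW (lft W b i) e] _ (steps_filter _ sE).
- apply: (@leq_trans (\sum_(b0 : bool) (hi W b0 - lo W b0))%N); last by rewrite -ltnS.
  rewrite !(sum_axes _ b) /lft /upd /lo /hi eqxx nb /=.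
  by move: hi0; rewrite /lo /hi; clear; lia.
- by move=> e; rewrite mem_filter => /andP[].
have [||t2 [H2 [u2 [g2 l2 p2]]]] := IH (rgt W b i) [seq e <- E | eW (rgt W b i) e] _ (steps_filter _ sE).
- apply: (@leq_trans (\sum_(b0 : bool) (hi W b0 - lo W b0))%N); last by rewrite -ltnS.
  rewrite !(sum_axes _ b) /rgt /upd /lo /hi eqxx nb /=.
  by move: hi0; rewrite /lo /hi; clear; lia.
- by move=> e; rewrite mem_filter => /andP[].
have [d1 d2] := potential_drop m hi0 hE.
set K := [seq e <- E | crs b i e].
have [sK|sK] := leqP (size K) (2 * m).
  exists (BNode hi0 t1 t2), (H1 ++ H2 ++ K ++ [::] ++ [::]), (u1 + u2)%N; split=> //.
  - apply: good_le (_ : g * u1%:R + g * u2%:R + 0 <= _); last by rewrite addr0 natrD mulrDr.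
    apply: assemble => //.
    + by move=> e /(st_adj sE).
    + by move=> e; rewrite mem_filter => /andP[c he]; split; [apply: hE|split=> //; apply: (st_adj sE)].
    + by move=> v; rewrite !cats0.
    + by move=> e he; apply: conn1; rewrite !cats0 -surjective_pairing he.
    + by rewrite !cats0 addr0.
  - rewrite mulnDr /Psi; move: p1 p2; rewrite /Psi; lia.
have [K0 [M [a [pK sK0 hM]]]] := @window W b i E (fun e he => conj (hE e he) (st_adj sE he)).
set s := count (Dk E b i) (rng W (~~ b)) in fav hM.
have dM p : p \in map fst M ++ map snd M -> - B <= co (~~ b) p.
  have ME e : e \in M -> e \in E.
    move=> he; have : e \in K by rewrite (perm_mem pK) mem_cat he orbT.
    by rewrite mem_filter => /andP[].
  by rewrite mem_cat => /orP[] /mapP[e /ME/(st_dom sE)/(_ (~~ b))[h1 h2] ->].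
have sM : (size M)%:R * lam <= g.
  apply: le_trans (st_crs sE b i); rewrite ler_wpM2r // ler_nat -size_filter -/K (perm_size pK).
  by rewrite size_cat leq_addl.
have [||H gH] := @cut_bridge R pix g lam B m g_gt0 lam_ge0 m_gt0 pixP W b i hi0 E H1 H2 t1 t2 _ _ K0 M
   (g * s.+3%:R) hE (st_adj sE) (st_len sE) g1 g2 pK sK0 _ _ sM.
- move=> p q hp hq; apply: (pix_dist g_gt0 pixP (dM q hq)).
  by move: (hM p hp) (hM q hq); clear; lia.
- by rewrite mulr_ge0 // ltW.
exists (BNode hi0 t1 t2), H, (u1 + u2 + 4 * s.+4)%N; split=> //.
- apply: good_le gH _; rewrite !natrD natrM -!(natr1 s.+3) -!(natr1 s.+2) -!(natr1 s.+1) -!(natr1 s).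
  by lra.
- have sKE : size K = count (crs b i) E by rewrite size_filter.
  move: p1 p2; rewrite /Psi => p1 p2.
  have e1 : (m * s <= m * count (fun j => Dk E (~~ b) j i) (rng W (~~ b)))%N by rewrite leq_mul2l fav orbT.
  rewrite !mulnDr; have -> : (m * (4 * s.+4) = 4 * (m * s) + 16 * m)%N by ring.
  move: d1 d2 e1 p1 p2 sK; rewrite -sKE.
  move: (m * u1)%N (m * u2)%N (m * s)%N (m * count _ _)%N (Phi _ _) (Phi _ _) (Phi _ _) (Xi _ _) (Xi _ _) (Xi _ _).
  by move: (size K); clear; lia.
Qed.

Variable Hh : R.
Hypothesis Hh_ge0 : 0 <= Hh.

(** [ks b] lists the lines of axis [b] to be cut before any favourable cut, so that the cells they
    form become nodes. No window is available for a forced cut: each of the [k] bridges may run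
    along the whole extent [Hh]. *)
Definition sol E W (ks : bool -> seq nat) (k : nat) : Prop :=
  exists t H u, [/\ @good W [seq e <- E | eW W e] H t (4%:R * (Hh + g) * k%:R + g * u%:R),
    leaves_ok t, (m * u <= Psi W [seq e <- E | eW W e])%N &
    forall p, inW pix W p -> exists2 U, isnode t U & forall q, inW pix U q <->
      inW pix W q /\ forall b i, i \in ks b -> (pix b p < i)%N = (pix b q < i)%N].

Definition setk (ks : bool -> seq nat) b s : bool -> seq nat :=
  fun b' => if b' == b then s else ks b'.

Lemma eW_sub W b i e : (lo W b < i < hi W b)%N ->
  (eW (lft W b i) e -> eW W e) /\ (eW (rgt W b i) e -> eW W e).
Proof.
move=> hi0; have nb : (~~ b == b) = false by case: (b).
rewrite /eW !(inWb _ b) /inB /lo /hi /lft /rgt /upd eqxx nb /=.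
move: hi0; rewrite /lo /hi; lia.
Qed.

(** The smallest forced line is cut first: no forced line of this axis is left below it, and the
    list [s] above it. All its crossing edges go to the bridge, that is, [K0] is empty. *)
Lemma sol_cut E W b i (ks : bool -> seq nat) s k1 k2 : steps E -> (lo W b < i < hi W b)%N ->
    (forall e p q, e \in E -> eW W e -> inW pix W p -> inW pix W q -> - B <= co (~~ b) q -> 
       co (~~ b) p - co (~~ b) q <= Hh) ->
    all (ltn i) s ->
    sol E (lft W b i) (setk ks b [::]) k1 -> sol E (rgt W b i) (setk ks b s) k2 ->
  sol E W (setk ks b (i :: s)) (k1 + k2).+1.
Proof.
move=> sE hi0 hH sS [t1 [H1 [u1 [g1 l1 p1 c1]]]] [t2 [H2 [u2 [g2 l2 p2 c2]]]].
set EW := [seq e <- E | eW W e].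
have hEW e : e \in EW -> eW W e by rewrite mem_filter => /andP[].
have sEW : steps EW by apply: steps_filter.
have nb : (~~ b == b) = false by case: (b).
have f1 : [seq e <- E | eW (lft W b i) e] = [seq e <- EW | eW (lft W b i) e].
  rewrite -filter_predI; apply: eq_filter => e /=.
  by case h : (eW _ e) => //=; rewrite (eW_sub e hi0).1.
have f2 : [seq e <- E | eW (rgt W b i) e] = [seq e <- EW | eW (rgt W b i) e].
  rewrite -filter_predI; apply: eq_filter => e /=.
  by case h : (eW (rgt W b i) e) => //=; rewrite (eW_sub e hi0).2.
rewrite f1 in g1 p1; rewrite f2 in g2 p2.
have [d1 d2] := potential_drop m hi0 hEW.
have [||||H gH] := @cut_bridge R pix g lam B m g_gt0 lam_ge0 m_gt0 pixP W b i hi0 EW H1 H2 t1 t2 _ _ [::]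
   [seq e <- EW | crs b i e] Hh hEW (st_adj sEW) (st_len sEW) g1 g2 (perm_refl _).
- by [].
- have me p : p \in map fst [seq e <- EW | crs b i e] ++ map snd [seq e <- EW | crs b i e] ->
      exists e, [/\ e \in E, eW W e, inW pix W p & - B <= co (~~ b) p].
    rewrite mem_cat => /orP[] /mapP[e]; rewrite mem_filter => /andP[_]; rewrite mem_filter => /andP[w he] ->;
    exists e; (have [h1 h2] := st_dom sE he (~~ b)); by split=> //; case/andP: w.
  move=> p q /me[e [e1 e2 e3 e4]] /me[_ [_ _ e5 e6]]; exact: hH e1 e2 e3 e5 e6.
- by [].
- by have := st_crs sEW b i; rewrite size_filter.
exists (BNode hi0 t1 t2), H, (u1 + u2)%N; split=> //.
- apply: good_le gH _; rewrite -natr1 !natrD; lra.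
- rewrite mulnDr -/EW; move: p1 p2 d1 d2; rewrite /Psi.
  by move: (Phi _ _) (Phi _ _) (Phi _ _) (Xi _ _) (Xi _ _) (Xi _ _) (m * u1)%N (m * u2)%N; clear; lia.
move=> p pW.
have inl q := (inW_cut pix q hi0).1.
have inr q := (inW_cut pix q hi0).2.
have [pi|ip] := boolP (pix b p < i)%N.
- have [|U hU hq] := c1 p; first by rewrite inl pW.
  exists U; first by right; left.
  move=> q; rewrite hq inl; split.
  + case=> /andP[qW qi] h; split=> // b' j; rewrite /setk; case: eqP => [->|ne] hj; last first.
      by apply: h; rewrite /setk; case: eqP.
    have ij : (i <= j)%N by move: hj; rewrite inE => /orP[/eqP->//|/(allP sS)/= /ltnW].
    by rewrite (leq_trans pi ij) (leq_trans qi ij).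
  + case=> qW h; rewrite qW -(h b i) ?pi; last by rewrite /setk eqxx mem_head.
    split=> // b' j; rewrite /setk; case: eqP => // ne hj.
    by apply: h; rewrite /setk; case: eqP.
- have [|U hU hq] := c2 p; first by rewrite inr pW.
  exists U; first by right; right.
  move=> q; rewrite hq inr; split.
  + case=> /andP[qW qi] h; split=> // b' j; rewrite /setk; case: eqP => [e|ne] hj; last first.
      by apply: h; rewrite /setk; case: eqP.
    move: hj; rewrite inE => /orP[/eqP->|hj]; first by rewrite e (negPf ip) (negPf qi).
    by apply: h; rewrite /setk e eqxx.
  + case=> qW h; rewrite qW -(h b i) ?ip; last by rewrite /setk eqxx mem_head.
    split=> // b' j hj; apply: h; move: hj; rewrite /setk; case: eqP => // _ hj.
    by rewrite inE hj orbT.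
Qed.

(** Each of the [(size s).+1] strips needs the [k0] forced cuts of what remains, besides the
    [size s] cuts that separate the strips. *)
Lemma sol_axis E b (ks : bool -> seq nat) s k0 : steps E -> forall W, sorted ltn s ->
    all (fun i => lo W b < i < hi W b)%N s ->
    (forall W', W' (~~ b) = W (~~ b) -> (hi W' b <= hi W b)%N -> sol E W' (setk ks b [::]) k0) ->
    (forall W', W' (~~ b) = W (~~ b) -> forall p q, inW pix W' p -> inW pix W' q -> - B <= co (~~ b) q ->
       co (~~ b) p - co (~~ b) q <= Hh) ->
  sol E W (setk ks b s) (size s * k0.+1 + k0).
Proof.
move=> sE; elim: s => [|i s IH] W; first by move=> _ _ h _; apply: h.
rewrite /= path_sortedE; last exact: ltn_trans.
case/andP=> ial srt /andP[hi0 al] h hH.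
have nb : (~~ b == b) = false by case: (b).
have -> : ((size s).+1 * k0.+1 + k0 = (k0 + (size s * k0.+1 + k0)).+1)%N by rewrite mulSn; lia.
apply: sol_cut => //.
- by move=> e p q _ _; apply: hH.
- apply: h; rewrite /lft /upd ?nb // /hi eqxx /=.
  by move: hi0 => /andP[_ /ltnW].
- apply: IH => //.
  + apply/allP => j hj; move/allP: al => /(_ j hj); move/allP: ial => /(_ j hj) /=.
    by rewrite /rgt /upd /lo /hi eqxx /=; clear; lia.
  + move=> W' e e'; apply: h; first by rewrite e /rgt /upd nb.
    by apply: leq_trans e' _; rewrite /rgt /upd /hi eqxx.
  + by move=> W' e; apply: hH; rewrite e /rgt /upd nb.
Qed.

Lemma sol0 E W : steps E -> sol E W (fun _ => [::]) 0.
Proof.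
move=> sE; have [|t [H [u [h1 h2 h3]]]] := @guillotine W _ (steps_filter (eW W) sE).
  by move=> e; rewrite mem_filter => /andP[].
exists t, H, u; split=> //; first by rewrite mulr0 add0r.
move=> p pW; exists W; first by case: (t) => [?|? ? ? ? ? ?]; left.
by move=> q; split=> [|[]].
Qed.

End Guillotine.

(** * Sampling a tour *)

Section Sampling.
Variable R : realType.
Notation T := (R * R)%type.
Variable N : nat.
Hypothesis N_gt0 : (0 < N)%N.

Definition sub (p q : T) (k : nat) : T :=
  (p.1 + k%:R / N%:R * (q.1 - p.1), p.2 + k%:R / N%:R * (q.2 - p.2)).

(** Subdividing the edges preserves the length of the tour and makes every edge short against the
    pixels. *)
Fixpoint smp (p : T) (s : seq T) : seq T :=
  if s is q :: s' then [seq sub p q k | k <- iota 1 N] ++ smp q s' else [::].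

Lemma NR_gt0 : 0 < N%:R :> R. Proof. by rewrite ltr0n. Qed.

Lemma co_sub b p q k : co b (sub p q k) = co b p + k%:R / N%:R * (co b q - co b p).
Proof. by case: b. Qed.

Lemma sub0 p q : sub p q 0 = p.
Proof. by case: p => a b; rewrite /sub /= !mul0r !addr0. Qed.

Lemma subN p q : sub p q N = q.
Proof.
case: q => a b; have N0 : N%:R != 0 :> R by rewrite gt_eqF // NR_gt0.
by rewrite /sub /= !divff // !mul1r; congr (_, _); ring.
Qed.

Lemma last_sub p q : last p [seq sub p q k | k <- iota 1 N] = q.
Proof.
case: N N_gt0 subN => // n _ h; rewrite -[n.+1]addn1 iotaD map_cat last_cat /=.
by rewrite add1n h.
Qed.

Lemma last_smp p s : last p (smp p s) = last p s.
Proof. by elim: s p => [|q s IH] p //=; rewrite last_cat last_sub IH. Qed.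

Lemma mem_last_smp p s q : q \in s -> q \in smp p s.
Proof.
elim: s p => [//|q' s IH] p; rewrite inE /= mem_cat => /orP[/eqP->|/IH->]; last by rewrite orbT.
apply/orP; left; rewrite -[X in X \in _](last_sub p q'); by case: N N_gt0 => // n _ /=; rewrite mem_last.
Qed.

Lemma edist_sub p q k : edist (sub p q k) (sub p q k.+1) = edist p q / N%:R.
Proof.
rewrite /edist /sub /=.
have N0 : N%:R != 0 :> R by rewrite gt_eqF // NR_gt0.
set a := p.1; set b := q.1; set c := p.2; set e := q.2.
have -> : (a + k%:R / N%:R * (b - a) - (a + k.+1%:R / N%:R * (b - a))) ^+ 2 +
   (c + k%:R / N%:R * (e - c) - (c + k.+1%:R / N%:R * (e - c))) ^+ 2 =
   ((a - b) ^+ 2 + (c - e) ^+ 2) * (N%:R ^- 1) ^+ 2 by rewrite -natr1; field.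
rewrite sqrtrM ?addr_ge0 ?sqr_ge0 // sqrtr_sqr ger0_norm //.
by rewrite invr_ge0 ler0n.
Qed.

Lemma map_iota_rec (p q : T) k m : ed (sub p q k) [seq sub p q i | i <- iota k.+1 m] =
  [seq (sub p q i, sub p q i.+1) | i <- iota k m].
Proof. by elim: m k => [|m IH] k //=; rewrite IH. Qed.

Lemma ed_sub (p q : T) : ed p [seq sub p q i | i <- iota 1 N] =
  [seq (sub p q i, sub p q i.+1) | i <- iota 0 N].
Proof. by rewrite -{1}(sub0 p q) map_iota_rec. Qed.

Lemma ed_smp p s : ed p (smp p s) =
  flatten [seq [seq (sub e.1 e.2 i, sub e.1 e.2 i.+1) | i <- iota 0 N] | e <- ed p s].
Proof. by elim: s p => [|q s IH] p //=; rewrite ed_cat last_sub IH ed_sub. Qed.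

Lemma elen_smp p s : elen (@edist R) (ed p (smp p s)) = plf (@edist R) p s.
Proof.
elim: s p => [|q s IH] p /=; first by rewrite /elen big_nil.
rewrite ed_cat elen_cat last_sub IH; congr (_ + _).
rewrite ed_sub /elen big_map (eq_bigr (fun _ => edist p q / N%:R)); last first.
  by move=> k _; rewrite edist_sub.
rewrite big_const_seq count_predT size_iota iter_addr_0 -[_ *+ N]mulr_natr divfK //.
by rewrite gt_eqF // NR_gt0.
Qed.

Lemma frac01 k : (k <= N)%N -> 0 <= k%:R / N%:R :> R /\ k%:R / N%:R <= 1 :> R.
Proof.
move=> h; split; first by rewrite divr_ge0.
by rewrite ler_pdivrMr ?NR_gt0 // mul1r ler_nat.
Qed.

Lemma mem_smp p s e : e \in ed p (smp p s) -> exists2 f, f \in ed p s &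
  exists2 k, (k < N)%N & e = (sub f.1 f.2 k, sub f.1 f.2 k.+1).
Proof.
rewrite ed_smp => /flattenP[l /mapP[f hf ->] /mapP[k]].
by rewrite mem_iota add0n => /andP[_ hk] ->; exists f => //; exists k.
Qed.

(** Along a straight segment the side of a line changes monotonically, so the samples of one segment
    cross a given line at most once. *)
Lemma mono_changes (f : nat -> bool) n : (forall k, f k -> f k.+1) \/ (forall k, f k.+1 -> f k) ->
  count (fun k => f k != f k.+1) (iota 0 n) = (f 0%N != f n).
Proof.
have m1 : (forall k, f k -> f k.+1) -> forall k, f 0%N -> f k.
  by move=> h1; elim=> // k IH /IH /h1.
have m2 : (forall k, f k.+1 -> f k) -> forall k, f k -> f 0%N.
  by move=> h1; elim=> // k IH /h1 /IH.
move=> h; elim: n => [|n IH]; first by rewrite eqxx.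
rewrite -[n.+1]addn1 iotaD count_cat IH /= addn0 add0n addn1.
case: h => h; [move: (m1 h n) (h n)|move: (m2 h n) (h n)];
  case: (f 0%N); case: (f n); case: (f n.+1) => //= a1 a2;
  by [have := a1 isT | have := a2 isT].
Qed.

Section Root.
Variables (g B lam : R) (n : nat).
Hypothesis g_gt0 : 0 < g.
Hypothesis lam_gt0 : 0 < lam.
Hypothesis lam_g : lam <= g.
Hypothesis B_gt0 : 0 < B.
Hypothesis nlam : n%:R * lam <= g.
Hypothesis N_big : 2%:R * B <= lam * N%:R.

(** The rounding that the machine lacks is harmless here, as pixels occur only in the analysis. The
    shift by [B] makes the coordinates in use nonnegative, where truncation is the floor. *)
Definition pixel (b : bool) (p : T) : nat := Num.truncn ((co b p + B) / g).

Lemma pixelP b i p : (0 < i)%N -> (pixel b p < i)%N = (co b p < g * i%:R - B).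
Proof.
case: i => // i _; rewrite /pixel ltnS truncn_le_nat ltr_pdivrMr // mulrC.
by rewrite ltrBrDr.
Qed.

Lemma pixel_diff b p q : co b p <= co b q -> - B <= co b p ->
  g * (pixel b q - pixel b p)%:R <= co b q - co b p + g.
Proof.
move=> pq dp; have [h|h] := leqP (pixel b q) (pixel b p).
  by rewrite (eqP h) mulr0 addr_ge0 ?subr_ge0 // ltW.
have h1 : co b p < g * (pixel b p).+1%:R - B by rewrite -pixelP.
have h2 : g * (pixel b q)%:R - B <= co b q.
  by rewrite leNgt -pixelP ?ltnn // (leq_trans _ h).
rewrite natrB ?(ltnW h) // mulrBr; move: h1; rewrite -natr1 mulrDr mulr1; lra.
Qed.

(** A line is crossed at most once by each original edge, hence at most [n] times, and
    [n%:R * lam <= g] turns this into the last clause of [steps]. *)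
Lemma smp_steps p s : (forall q b, q \in p :: s -> `|co b q| <= B) -> (size s <= n)%N ->
  steps pixel g lam B (ed p (smp p s)).
Proof.
move=> hB sn.
have N0 : 0 < N%:R :> R by apply: NR_gt0.
have dom f b : f \in ed p s -> [/\ - B <= co b f.1, co b f.1 <= B, - B <= co b f.2 & co b f.2 <= B].
  by move=> /ed_mem/andP[/(hB _ b) + /(hB _ b)]; rewrite !ler_norml => /andP[-> ->] /andP[-> ->].
have len f k b : f \in ed p s -> `|co b (sub f.1 f.2 k) - co b (sub f.1 f.2 k.+1)| <= lam.
  move=> /(dom _ b)[d1 d2 d3 d4]; rewrite !co_sub.
  have -> : co b f.1 + k%:R / N%:R * (co b f.2 - co b f.1) -
     (co b f.1 + k.+1%:R / N%:R * (co b f.2 - co b f.1)) = (co b f.1 - co b f.2) / N%:R.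
    by rewrite -natr1; field; rewrite gt_eqF.
  rewrite normrM [X in _ * X]ger0_norm ?invr_ge0 ?(ltW N0) // ler_pdivrMr //.
  by apply: le_trans N_big; rewrite ler_norml; apply/andP; split; lra.
split.
- move=> e /mem_smp[f hf [k hk ->]] b; have := len f k b hf; rewrite /= ler_norml => /andP[h1 h2].
  set x := sub _ _ k; set y := sub _ _ k.+1.
  rewrite -/x -/y in h1 h2; have aux u v : `|co b u - co b v| <= g -> (pixel b u <= (pixel b v).+1)%N.
    rewrite ler_norml => /andP[h3 h4].
    rewrite -ltnS pixelP //; have := @pixelP b (pixel b v).+1 v isT; rewrite ltnSn => /esym h5.
    by rewrite -natr1; lra.
  by split; apply: aux; rewrite ler_norml; apply/andP; split; move: lam_g; lra.
- by move=> e /mem_smp[f hf [k hk ->]] b; apply: len.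
- move=> e /mem_smp[f hf [k hk ->]] b /=; have [d1 d2 d3 d4] := dom f b hf.
  have cv j : (j <= N)%N -> - B <= co b (sub f.1 f.2 j).
    move=> /frac01[j0 j1]; rewrite co_sub.
    have -> : co b f.1 + j%:R / N%:R * (co b f.2 - co b f.1) =
      (1 - j%:R / N%:R) * co b f.1 + j%:R / N%:R * co b f.2 by ring.
    nra.
  by split; apply: cv => //; apply: ltnW.
- move=> b i; apply: le_trans nlam; rewrite ler_pM2r // ler_nat.
  apply: leq_trans sn; rewrite ed_smp count_flatten.
  have -> : size s = size (ed p s) by elim: (s) (p : T) => //= q s' IH p'; rewrite (IH q).
  rewrite -map_comp sumnE big_map -sum1_size; apply: leq_sum => f _ /=.
  rewrite count_map; set ff := (fun k => pixel b (sub f.1 f.2 k) < i)%N.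
  rewrite (@mono_changes ff); first by case: (_ != _).
  have mo k l : (k <= l)%N -> (k%:R / N%:R : R) <= l%:R / N%:R.
    by move=> kl; rewrite ler_pM2r ?invr_gt0 // ler_nat.
  have [h|h] := lerP (co b f.1) (co b f.2).
    right => k; rewrite /ff; apply: leq_ltn_trans; apply: (pix_mono pixelP).
    by rewrite !co_sub lerD2l ler_wpM2r ?subr_ge0 // mo.
  left => k; rewrite /ff; apply: leq_ltn_trans; apply: (pix_mono pixelP).
  by rewrite !co_sub lerD2l ler_wnM2r ?subr_le0 ?(ltW h) // mo.
Qed.

(** An edge crosses at most one line more than its extent divided by [g], on each axis; the two axes
    give the factor 2, the additional line the term [g * size s]. *)
Lemma smp_Xi (W : box) p s : (forall q b, q \in p :: s -> `|co b q| <= B) ->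
  g * (Xi pixel W (ed p (smp p s)))%:R <= 2%:R * (plf (@edist R) p s + g * (size s)%:R).
Proof.
move=> hB.
have key b : g * (\sum_(j <- rng W b) count (crs pixel b j) (ed p (smp p s)))%N%:R <=
    plf (@edist R) p s + g * (size s)%:R.
  rewrite ed_smp.
  under eq_bigr => j _ do rewrite count_flatten -map_comp sumnE big_map.
  rewrite exchange_big /=.
  elim: s p hB => [|q s IH] p hB /=; first by rewrite big_nil !mulr0 addr0.
  rewrite big_cons natrD mulrDr.
  have {}IH : g * (\sum_(e <- ed q s) \sum_(i <- rng W b) count (crs pixel b i)
     [seq (sub e.1 e.2 i0, sub e.1 e.2 i0.+1) | i0 <- iota 0 N])%N%:R <=
     plf (@edist R) q s + g * (size s)%:R.
    by apply: IH => q' b' hq; apply: hB; rewrite inE hq orbT.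
  suff h : g * (\sum_(i <- rng W b) count (crs pixel b i)
     [seq (sub p q i0, sub p q i0.+1) | i0 <- iota 0 N])%N%:R <= edist p q + g.
    by rewrite -natr1; lra.
  have mo k l : (k <= l)%N -> (k%:R / N%:R : R) <= l%:R / N%:R.
    by move=> kl; rewrite ler_pM2r ?invr_gt0 ?NR_gt0 // ler_nat.
  have cnt i : count (crs pixel b i) [seq (sub p q k, sub p q k.+1) | k <- iota 0 N] =
      ((pixel b p < i)%N != (pixel b q < i)%N).
    rewrite count_map; set ff := (fun k => pixel b (sub p q k) < i)%N.
    rewrite (@mono_changes ff) ?/ff ?sub0 ?subN //.
    have [h|h] := lerP (co b p) (co b q).
      right => k; rewrite /ff; apply: leq_ltn_trans; apply: (pix_mono pixelP).
      by rewrite !co_sub lerD2l ler_wpM2r ?subr_ge0 // mo.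
    left => k; rewrite /ff; apply: leq_ltn_trans; apply: (pix_mono pixelP).
    by rewrite !co_sub lerD2l ler_wnM2r ?subr_le0 ?(ltW h) // mo.
  under eq_bigr => i _ do rewrite cnt.
  have bd (x y : nat) : (\sum_(i <- rng W b) ((x < i)%N != (y < i)%N) <= (y - x) + (x - y))%N.
    rewrite -count_sum -size_filter -(size_iota (minn x y).+1 (y - x + (x - y))).
    apply: uniq_leq_size; first by rewrite filter_uniq // iota_uniq.
    by move=> i; rewrite mem_filter mem_iota => /andP[h _]; move: h; clear; lia.
  have e1 := edist_ge_x p q; have e2 := edist_ge_y p q.
  have e3 : `|co b p - co b q| <= edist p q by case: (b).
  apply: (@le_trans _ _ (g * ((pixel b q - pixel b p) + (pixel b p - pixel b q))%N%:R)).
    by rewrite ler_pM2l // ler_nat bd.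
  have [h|h] := lerP (co b p) (co b q).
    have -> : (pixel b p - pixel b q = 0)%N by apply/eqP; apply: (pix_mono pixelP).
    rewrite addn0; apply: le_trans (pixel_diff h _) _.
      by have := hB p b (mem_head _ _); rewrite ler_norml => /andP[].
    by rewrite lerD2r; apply: le_trans e3; rewrite distrC ler_norm.
  have -> : (pixel b q - pixel b p = 0)%N by apply/eqP; apply: (pix_mono pixelP); apply: ltW.
  rewrite add0n; apply: le_trans (pixel_diff (ltW h) _) _.
    by have := hB q b; rewrite !inE eqxx orbT ler_norml => /(_ isT)/andP[].
  by rewrite lerD2r; apply: le_trans e3; rewrite ler_norm.
by rewrite /Xi big_bool natrD mulrDr; have := key true; have := key false; lra.
Qed.

End Root.

End Sampling.

(** For nested predicates equal counts force equality. Applied to thresholds, this lets the number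
    of forced lines below a point identify its strip. *)
Lemma count_sub_eq (T : eqType) (a b : pred T) s : (forall x, x \in s -> a x -> b x) ->
  count a s = count b s -> forall x, x \in s -> a x = b x.
Proof.
elim: s => [//|y s IH] h /= e x.
have hs : forall z, z \in s -> a z -> b z by move=> z zs; apply: h; rewrite inE zs orbT.
have le : (count a s <= count b s)%N.
  rewrite -(@eq_in_count _ (predI a (mem s)) a) -?(@eq_in_count _ (predI b (mem s)) b).
  - by apply: sub_count => z /= /andP[az zs]; rewrite zs (hs z zs az).
  - by move=> z zs /=; rewrite zs andbT.
  - by move=> z zs /=; rewrite zs andbT.
have hy := h y (mem_head _ _).
have [ey es] : a y = b y /\ count a s = count b s.
  by move: e hy le; case: (a y); case: (b y) => /= e1 e2; try lia; by have := e2 isT.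
by rewrite inE => /orP[/eqP->//|]; apply: IH.
Qed.

Lemma small_below (R : realType) (s : seq R) (x0 : R) : 0 < x0 ->
  exists2 g, 0 < g <= x0 & forall x, x \in s -> 0 < x -> g <= x.
Proof.
move=> x00; elim: s => [|y s [g /andP[g0 gx] hg]]; first by exists x0; rewrite ?x00 ?lexx.
have [y0|y0] := ltP 0 y; last first.
  exists g; first by rewrite g0.
  by move=> x; rewrite inE => /orP[/eqP->|/hg//]; rewrite ltNge y0.
exists (Num.min g y); first by rewrite lt_min g0 y0 ge_min gx.
move=> x; rewrite inE => /orP[/eqP-> _|/hg h x1]; first by rewrite ge_min lexx orbT.
by rewrite ge_min h.
Qed.

(** * The structure theorem for travelling salesman tours *)

Section Structure.
Variable R : realType.
Notation T := (R * R)%type.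

(** The number of forced cuts: the lines of one axis, and those of the other axis once in every
    strip between them. *)
Definition cuts (f : bool -> seq R) : nat :=
  size (f true) * (size (f false)).+1 + size (f false).

Lemma elen_subseq (d : T -> T -> R) (K H : seq (T * T)) : (forall x y, 0 <= d x y) ->
  subseq K H -> elen d K <= elen d H.
Proof.
move=> d0; elim: H K => [|e H IH] K; first by rewrite subseq0 => /eqP->.
case: K => [|f K] /=; first by rewrite /elen big_nil big_cons addr_ge0 // sumr_ge0.
rewrite {2}/elen big_cons; case: eqP => [->|_] h.
  by rewrite /elen big_cons lerD2l; apply: IH.
by apply: le_trans (IH _ h) _; rewrite lerDr.
Qed.

(** The sampled tour is decomposed along the forced lines and then by favourable cuts. Parities and
    connectivity being preserved, an Euler circuit through all points exists, and shortcutting it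
    gives [pi]. Discretization errors are collected in [zeta], which can be taken arbitrarily
    small. *)
Theorem tsp_structure (p0 : T) (ps : seq T) (f : bool -> seq R) (B zeta : R) (m : nat) :
    let pts := p0 :: ps in let L := plf (@edist R) p0 (rcons ps p0) in
    uniq pts -> (forall q b, q \in pts -> `|co b q| <= B) -> 0 < B -> 0 < zeta -> (0 < m)%N ->
  exists (pix : bool -> T -> nat) (W : box) (t : bsp W) (pi : seq T) (cell : T -> nat),
    [/\ (forall b p q, co b p <= co b q -> (pix b p <= pix b q)%N),
        leaves_ok t /\ (forall p, p \in pts -> inW pix W p),
        (forall p q, p \in pts -> q \in pts -> p != q -> exists b, pix b p != pix b q),
        [/\ perm_eq pi pts,
            (forall U, isnode t U ->
              plen (fun u v => (inW pix U u != inW pix U v)%:R : R) pi <= (4 * kappa m)%:R) &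
            plen (@edist R) pi <= L + 24%:R / m%:R * L + 16%:R * B * (cuts f)%:R + zeta] &
        [/\ (forall p, (cell p < (size (f true)).+1 * (size (f false)).+1)%N),
            (forall p, p \in pts -> exists2 U, isnode t U &
              forall q, q \in pts -> inW pix U q = (cell q == cell p)) &
            (forall p q, p \in pts -> q \in pts -> cell p = cell q ->
              forall b F, F \in f b -> ~ (co b p + zeta <= F <= co b q))]].
Proof.
move=> pts L upts hB B0 z0 m0.
pose n := (size pts).+1.
have n0 : 0 < n%:R :> R by rewrite ltr0n.
(* The bound [zeta / (24 * n)] on the pixel size [g] makes the additive term of the crossing count
   at most [zeta]. By [gS], [g] is also at most every nonzero difference of coordinates, so that
   pixels separate points. *)
pose x0 := Num.min B (Num.min zeta (zeta / (24%:R * n%:R))).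
have x00 : 0 < x0.
  by rewrite /x0 !lt_min B0 z0 divr_gt0 // mulr_gt0.
have [g /andP[g0 gx] gS] := @small_below R
  [seq `|co e.1 e.2.1 - co e.1 e.2.2| | e <- [seq (b, pq) | b <- [:: true; false], pq <- [seq (p, q) | p <- pts, q <- pts]]] x0 x00.
have gB : g <= B by apply: le_trans gx _; rewrite /x0 ge_min lexx.
have gz : g <= zeta by apply: le_trans gx _; rewrite /x0 !ge_min lexx !orbT.
have gz' : g <= zeta / (24%:R * n%:R) by apply: le_trans gx _; rewrite /x0 !ge_min lexx !orbT.
pose lam := g / n%:R.
have lam0 : 0 < lam by rewrite divr_gt0.
have lamg : lam <= g by rewrite ler_pdivrMr // ler_peMr ?(ltW g0) // ler1n.
have nlam : n%:R * lam <= g by rewrite mulrC divfK // gt_eqF.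
pose N := (Num.truncn (2%:R * B / lam)).+1.
have N0 : (0 < N)%N by [].
have Nbig : 2%:R * B <= lam * N%:R.
  by rewrite [lam * _]mulrC -ler_pdivrMr //; apply/ltW/truncnS_gt.
pose pix := pixel g B.
have pP := pixelP B g0 : forall b i p, _.
pose S := smp N p0 (rcons ps p0); pose E := ed p0 S.
have sE : steps pix g lam B E.
  apply: (@smp_steps R N N0 g B lam n) => //; last by rewrite size_rcons.
  by move=> q b hq; apply: hB; move: hq; rewrite inE mem_rcons !inE => /orP[->|/orP[->|->]] //; rewrite orbT.
have hBE e b : e \in E -> - B <= co b e.1 /\ - B <= co b e.2 by move=> /(st_dom sE).
have lastE : last p0 S = p0 by rewrite /S last_smp // last_rcons.
pose Nr := (Num.truncn (2%:R * B / g)).+1.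
have Nr1 : 2%:R * B < g * Nr%:R by rewrite [g * _]mulrC -ltr_pdivrMr //; apply: truncnS_gt.
have Nr2 : g * Nr%:R <= 3%:R * B.
  rewrite /Nr -natr1 mulrDr mulr1.
  have : (Num.truncn (2%:R * B / g))%:R <= 2%:R * B / g by rewrite truncn_le divr_ge0 ?mulr_ge0 // ltW.
  by rewrite ler_pdivlMr // mulrC => h; lra.
pose W : box := fun _ => (0%N, Nr).
have inWW p : (forall b, co b p <= B) -> inW pix W p.
  by move=> h; rewrite /inW /inB /W /lo /hi /= !pP //; have := h true; have := h false; rewrite !ltrBrDr => h1 h2; apply/andP; split; lra.
have coE e b : e \in E -> co b e.1 <= B /\ co b e.2 <= B.
  move=> /(mem_smp N0)[h hf [k hk ->]] /=.
  have hin q : q \in p0 :: rcons ps p0 -> forall b, `|co b q| <= B.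
    by rewrite inE mem_rcons !inE => hq b'; apply: hB; move: hq; rewrite !inE => /orP[->|/orP[->|->]] //; rewrite orbT.
  have /andP[/hin h1 /hin h2] := ed_mem hf.
  have cv j : (j <= N)%N -> co b (sub N h.1 h.2 j) <= B.
    move=> /(@frac01 R N N0)[j0 j1]; rewrite co_sub.
    have := h1 b; have := h2 b; rewrite !ler_norml => /andP[_ a1] /andP[_ a2].
    have -> : co b h.1 + j%:R / N%:R * (co b h.2 - co b h.1) =
      (1 - j%:R / N%:R) * co b h.1 + j%:R / N%:R * co b h.2 by ring.
    nra.
  by split; apply: cv => //; apply: ltnW.
have EWW : [seq e <- E | eW pix W e] = E.
  by apply/all_filterP/allP => e he; rewrite /eW !inWW // => b; have [] := coE e b he.
(* Forced lines are moved down to pixel boundaries; of these only the ones strictly inside the root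
   box [W] are cut. *)
pose thr b := [seq pix b (F, F) | F <- f b].
pose srt b := sort leq (undup [seq i <- thr b | (0 < i < Nr)%N]).
have ssrt b : sorted ltn (srt b).
  by rewrite ltn_sorted_uniq_leq sort_uniq undup_uniq sort_sorted //; apply: leq_total.
have srtin b : all (fun i => lo W b < i < hi W b)%N (srt b).
  by apply/allP => i; rewrite mem_sort mem_undup mem_filter => /andP[].
have srtsz b : (size (srt b) <= size (f b))%N.
  rewrite size_sort; apply: leq_trans (size_undup _) _.
  by rewrite size_filter; apply: leq_trans (count_size _ _) _; rewrite size_map.
have Hh0 : 0 <= 3%:R * B by rewrite mulr_ge0 // ltW.
have Hwin b (W' : box) : W' (~~ b) = W (~~ b) -> forall p q, inW pix W' p -> inW pix W' q ->
    - B <= co (~~ b) q -> co (~~ b) p - co (~~ b) q <= 3%:R * B.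
  move=> e p q; rewrite !(inWb _ b) /inB /lo /hi e /= => /andP[_ h] _ h2.
  by move: h; rewrite pP // => h; move: Nr2; lra.
have s0 W' : sol pix g m (3%:R * B) E W' (fun _ => [::]) 0.
  by apply: sol0 sE; rewrite // ltW.
have s1 (W' : box) : (hi W' true <= Nr)%N -> W' false = W false ->
    sol pix g m (3%:R * B) E W' (setk (fun _ => [::]) false (srt false)) (size (srt false)).
  move=> e1 e2; have := @sol_axis R pix g lam B m g0 (ltW lam0) m0 pP (3%:R * B) Hh0 E false (fun _ => [::])
    (srt false) 0 sE W' (ssrt false).
  rewrite muln1 addn0; apply.
  - by have := srtin false; rewrite /lo /hi e2.
  - by move=> W'' _ _; rewrite (_ : setk _ _ _ = fun _ => [::]) //; apply/funext => -[].
  - move=> W'' e p q; rewrite /inW /inB /hi e => /andP[/andP[_ h] _] _ h2.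
    have : (pix true p < Nr)%N by apply: leq_trans h e1.
    by rewrite pP // => h3; move: Nr2 h2 h3 => /=; lra.
have := @sol_axis R pix g lam B m g0 (ltW lam0) m0 pP (3%:R * B) Hh0 E true
    (setk (fun _ => [::]) false (srt false)) (srt true) (size (srt false)) sE W (ssrt true) (srtin true).
case=> [W' e e'|W' e|t [H [u [gH lH uH cH]]]].
- rewrite (_ : setk _ true _ = setk (fun _ => [::]) false (srt false)); last by apply/funext => -[].
  exact: s1.
- exact: Hwin.
rewrite EWW in gH uH.
set k := (size (srt true) * _ + _)%N in gH.
have kc : (k <= cuts f)%N by rewrite /k /cuts leq_add // leq_mul // ltnS.
have evH : forall v, ~~ odd (dg H v).
  by move=> v; rewrite (good_par gH) dg_ed lastE addbb.
have p0E : forall q, q \in pts -> conn H p0 q.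
  move=> q hq; apply: conn_mono (good_conn gH) _; apply: conn_ed.
  move: hq; rewrite !inE => /orP[->//|hq]; rewrite mem_last_smp ?orbT //.
  by rewrite mem_rcons inE hq orbT.
have [s [K [sl sK sE2 sC]]] := @euler_component _ H p0 evH.
pose pi := [seq x <- undup (p0 :: s) | x \in pts].
have piP : perm_eq pi pts.
  apply: uniq_perm => //; first by rewrite filter_uniq // undup_uniq.
  move=> x; rewrite mem_filter mem_undup; case hx : (x \in pts) => //=.
  by apply: sC; apply: p0E.
have piS : subseq pi (p0 :: s) by apply: subseq_trans (filter_subseq _ _) (undup_subseq _).
(* Shortcutting works for every semimetric. It is used for the Euclidean distance, to bound the
   length, and for the indicator of being separated by a box, to bound the crossings of that box. *)
have piL (d : T -> T -> R) : (forall x y, 0 <= d x y) -> (forall x y z, d x z <= d x y + d y z) ->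
    (forall x y, d x y = d y x) -> plen d pi <= elen d H.
  move=> d0 dt dC; apply: le_trans (plen_subseq d0 dt piS) _.
  rewrite /= -elen_ed /elen -(er_big _ _ sE2); last by move=> a b /=; rewrite dC.
  exact: elen_subseq.
have Lp : elen (@edist R) E = L by apply: elen_smp.
have gXi : g * (Xi pix W E)%:R <= 2%:R * (L + g * n%:R).
  apply: le_trans (@smp_Xi R N N0 g B g0 W p0 (rcons ps p0) _) _.
    by move=> q b hq; apply: hB; move: hq; rewrite inE mem_rcons !inE => /orP[->|/orP[->|->]] //; rewrite orbT.
  by rewrite ler_pM2l // lerD2l ler_pM2l // ler_nat size_rcons.
have L0 : 0 <= L by apply: plf_ge0; apply: edist_ge0.
(* [Phi <= Xi] gives [Psi <= 12 * Xi], and [g * Xi] is at most [2 * (L + g * n)]; hence the constant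
   24. *)
have gu : g * u%:R <= 24%:R / m%:R * L + zeta.
  have mR : 0 < m%:R :> R by rewrite ltr0n.
  have m1 : 1 <= m%:R :> R by rewrite ler1n.
  have PX : (m * u <= 12 * Xi pix W E)%N.
    apply: leq_trans uH _; rewrite /Psi; suff : (Phi pix m W E <= Xi pix W E)%N by clear; lia.
    by apply: leq_sum => b _; apply: leq_sum => j _; apply: leq_subr.
  have h1 : m%:R * u%:R <= 12%:R * (Xi pix W E)%:R :> R by rewrite -!natrM ler_nat.
  have h2 : g * n%:R * 24%:R <= zeta.
    by move: gz'; rewrite ler_pdivlMr ?mulr_gt0 // (mulrC 24%:R) mulrA.
  have h3 : m%:R * (g * u%:R) <= 24%:R * L + m%:R * zeta.
    have : g * (m%:R * u%:R) <= g * (12%:R * (Xi pix W E)%:R) by rewrite ler_pM2l.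
    have : zeta <= m%:R * zeta by rewrite ler_peMl // ltW.
    move: h2 gXi; rewrite (mulrCA g m%:R) (mulrCA g 12%:R); lra.
  rewrite -(ler_pM2l mR); apply: le_trans h3 _; rewrite mulrDr lerD2r mulrA mulrCA divff ?mulr1 //.
  by rewrite gt_eqF.
pose cnt b p := count (fun i => (i <= pix b p)%N) (srt b).
have cntS b p : (cnt b p <= size (f b))%N by apply: leq_trans (count_size _ _) (srtsz b).
pose cell p := (cnt true p * (size (f false)).+1 + cnt false p)%N.
have cellE p q : cell p = cell q -> forall b, cnt b p = cnt b q.
  rewrite /cell => e; have e1 := cntS false p; have e2 := cntS false q.
  have d1 : cnt true p = cnt true q.
    have := congr1 (fun z => z %/ (size (f false)).+1)%N e.
    by rewrite !divnMDl // !divn_small ?ltnS // !addn0.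
  by case; [exact: d1 | move: e; rewrite d1 => /addnI].
have cntE b p q : cnt b p = cnt b q -> forall i, i \in srt b -> (i <= pix b p)%N = (i <= pix b q)%N.
  have [h|/ltnW h] := leqP (pix b p) (pix b q) => e i hi.
    by apply: (@count_sub_eq _ (fun i => i <= pix b p)%N (fun i => i <= pix b q)%N (srt b)) => // x _ hx; apply: leq_trans h.
  apply/esym.
  by apply: (@count_sub_eq _ (fun i => i <= pix b q)%N (fun i => i <= pix b p)%N (srt b)) => // x _ hx; apply: leq_trans h.
have ksE b : setk (setk (fun _ => [::]) false (srt false)) true (srt true) b = srt b by case: b.
have ptsW p : p \in pts -> inW pix W p.
  by move=> hp; apply: inWW => b; have := hB p b hp; rewrite ler_norml => /andP[].
exists pix, W, t, pi, cell; split.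
- by move=> b p q; apply: (pix_mono pP).
- by split.
- move=> p q hp hq; apply: contraNP => /forallNP h.
  have {}h b : pix b p = pix b q by have := h b; case: eqP.
  have cb b : co b p = co b q.
    apply/eqP; apply: contraT => ne.
    have hg : g <= `|co b p - co b q|.
      apply: gS; last by rewrite normr_gt0 subr_eq0.
      apply/mapP; exists (b, (p, q)) => //; apply: allpairs_f; first by case: (b).
      exact: allpairs_f.
    have aux p' q' : p' \in pts -> q' \in pts -> pix b p' = pix b q' -> co b p' - co b q' < g.
      move=> hp' hq' e.
      have h1 : co b p' < g * (pix b p').+1%:R - B by rewrite -pP.
      have h2 : g * (pix b q')%:R - B <= co b q'.
        case E1 : (pix b q') => [|i].
          by rewrite mulr0 add0r; have := hB q' b hq'; rewrite ler_norml => /andP[].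
        by rewrite leNgt -(pP b i.+1 q' isT); move: E1; rewrite /pix => ->; rewrite ltnn.
      by move: h1; rewrite -natr1 e; lra.
    have := aux p q hp hq (h b); have := aux q p hq hp (esym (h b)).
    by move: hg; rewrite ler_normr => /orP[]; lra.
  by have := cb true; have := cb false; case: (p) (q) => a1 a2 [b1 b2] /= -> ->.
- split=> //.
  + move=> U hU; apply: le_trans (piL _ _ _ _) _ => [x y|x y z|x y|].
    * exact: ler0n.
    * rewrite -natrD ler_nat; case: (inW _ _ x); case: (inW _ _ y); by case: (inW _ _ z).
    * by rewrite eq_sym.
    rewrite /elen (eq_bigr (fun e => (nat_of_bool (inW pix U e.1 != inW pix U e.2))%:R)) // -natr_sum -count_sum.
    rewrite ler_nat; apply: leq_trans (good_lve gH hU) _.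
    rewrite mulnC leq_mul2r; apply/orP; right; rewrite /unsh big_bool.
    by do 4 case: (_ != _).
  + apply: le_trans (piL _ (@edist_ge0 R) _ (@edistC R)) _; first by move=> x y z; apply: edist_tri.
    have h1 := good_len gH; rewrite Lp in h1.
    (* The root box extends over at most [3 * B]; with [g <= B] a forced bridge costs at most
       [16 * B]. *)
    have h2 : 4%:R * (3%:R * B + g) * k%:R <= 16%:R * B * (cuts f)%:R.
      have k1 : k%:R <= (cuts f)%:R :> R by rewrite ler_nat.
      have k0 : 0 <= k%:R :> R by rewrite ler0n.
      apply: (@le_trans _ _ (16%:R * B * k%:R)); first by apply: ler_wpM2r => //; lra.
      by apply: ler_wpM2l => //; rewrite mulr_ge0 // ltW.
    by apply: le_trans h1 _; lra.
- split.
  + move=> p; rewrite /cell; have e1 := cntS true p; have e2 := cntS false p.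
    apply: (@leq_trans ((cnt true p).+1 * (size (f false)).+1)); last by rewrite leq_mul2r ltnS e1 orbT.
    by rewrite mulSn addnC ltn_add2r ltnS.
  + move=> p hp; have [U hU h] := cH p (ptsW p hp); exists U => // q hq.
    apply/idP/eqP => [/h[_ hs]|e].
      have ce b : cnt b q = cnt b p.
        by apply: eq_in_count => i hi; have := hs b i; rewrite ksE => /(_ hi); rewrite !ltnNge => /negb_inj.
      by rewrite /cell !ce.
    apply/h; split; first exact: ptsW.
    by move=> b i; rewrite ksE => hi; rewrite !ltnNge (@cntE b p q) //; apply: cellE.
  (* The cell only records the pixel boundary below [F]; as [g <= zeta], a point that is [zeta]
     below [F] is below this boundary as well. *)
  + move=> p q hp hq e b F hF /andP[h1 h2].
    have cF : co b (F, F) = F by case: (b).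
    have bp : - B <= co b p by have := hB p b hp; rewrite ler_norml => /andP[].
    have bq : co b q <= B by have := hB q b hq; rewrite ler_norml => /andP[].
    pose i := pix b (F, F).
    have i0 : (0 < i)%N.
      by rewrite lt0n -leqn0 -ltnS pP // cF mulr1 -leNgt; move: gz; lra.
    have iN : (i < Nr)%N by rewrite pP // cF; move: Nr1; lra.
    have ib : i \in srt b.
      rewrite mem_sort mem_undup mem_filter i0 iN /=; apply/mapP; exists F => //.
    have l1 : (pix b p < i)%N.
      rewrite pP //; have : (i < i.+1)%N by [].
      by rewrite {1}/i pP // cF -natr1; move: gz; lra.
    have l2 : (i <= pix b q)%N by apply: (pix_mono pP); rewrite cF.
    by have := cntE b p q (cellE _ _ e b) i ib; rewrite l2 leqNgt l1.
Qed.

End Structure.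

(** * Blocks of an order *)

Section Blocks.
Variable V : eqType.
Implicit Types (A : pred V) (s : seq V) (bl : seq (seq V)).

(* The maximal blocks of consecutive elements of [s] in [A]; the first component
   is the block, possibly empty, at the beginning of [s]. *)
Fixpoint bk A s : seq V * seq (seq V) :=
  if s is v :: s' then
    let: (h, r) := bk A s' in
    if A v then (v :: h, r) else ([::], if h is [::] then r else h :: r)
  else ([::], [::]).

Definition cons_ne (h : seq V) bl := if h is [::] then bl else h :: bl.
Definition blk A s := cons_ne (bk A s).1 (bk A s).2.

(* [link a b]: the system of paths [b] is obtained from [a] by concatenating
   paths. *)
Inductive link : seq (seq V) -> seq (seq V) -> Prop :=
| LinkRefl a b : perm_eq a b -> link a b
| LinkStep a x y r b : perm_eq a (x :: y :: r) -> link ((x ++ y) :: r) b -> link a b.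

Lemma link_perml a a' b : perm_eq a a' -> link a' b -> link a b.
Proof.
move=> h l; case: l h => [c e h'|c x y r e h' l] h.
  by apply: LinkRefl; apply: perm_trans h'.
by apply: LinkStep l; apply: perm_trans h'.
Qed.

Lemma link_trans a b c : link a b -> link b c -> link a c.
Proof.
elim=> [{}a {}b h|{}a x y r {}b h _ IH]; first exact: link_perml.
by move=> /IH; apply: LinkStep.
Qed.

Lemma link_cons z a b : link a b -> link (z :: a) (z :: b).
Proof.
elim=> [{}a {}b h|{}a x y r {}b h _ IH]; first by apply: LinkRefl; rewrite perm_cons.
apply: (@LinkStep _ x y (z :: r)).
  apply: perm_trans (_ : perm_eq (z :: a) (z :: x :: y :: r)) _; first by rewrite perm_cons.
  apply/permP => P /=; lia.
apply: link_perml IH; apply/permP => P /=; lia.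
Qed.

(** Every block of [A] is a concatenation of blocks of [A1] and [A2]. The block still open at the
    front of the scan is kept apart: it begins with the open block of [A1] or of [A2], never of
    both, and [e] is the rest of it. *)
Lemma bk_link A A1 A2 s : (forall v, A v = A1 v || A2 v) -> (forall v, ~~ (A1 v && A2 v)) ->
  let: (h1, r1) := bk A1 s in let: (h2, r2) := bk A2 s in let: (h, r) := bk A s in
  exists e, [/\ h = h1 ++ h2 ++ e, (h1 == [::]) || (h2 == [::]),
    (h1 == [::]) && (h2 == [::]) ==> (e == [::]) & link (r1 ++ r2) (cons_ne e r)].
Proof.
move=> hA hd; elim: s => [|v s] /=.
  by exists [::]; split=> //; apply: LinkRefl.
case: (bk A1 s) (bk A2 s) (bk A s) => [h1 r1] [h2 r2] [h r] [e [-> hh he l]].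
rewrite hA; have := hd v; case: (A1 v) => /=; case: (A2 v) => //= _.
- case: h2 hh he => [|a h2] hh he /=.
    by exists e; split=> //=; rewrite ?andbF.
  move: hh; rewrite orbF => /eqP->; exists ((a :: h2) ++ e); split=> //=; rewrite ?orbT ?andbF //.
  apply: (@link_trans _ ((a :: h2) :: cons_ne e r)).
    apply: link_perml (link_cons _ l); apply/permP => P; rewrite /= !count_cat /=; lia.
  case: e {he l} => [|b e] /=; first by rewrite cats0; apply: LinkRefl.
  by apply: (@LinkStep _ (a :: h2) (b :: e) r) => //; apply: LinkRefl.
- case: h1 hh he => [|a h1] hh he /=.
    by exists e; split=> //=; rewrite ?andbF.
  move: hh; rewrite /= => /eqP->; exists ((a :: h1) ++ e); split=> //=; rewrite ?orbT ?andbF //.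
  apply: (@link_trans _ ((a :: h1) :: cons_ne e r)); first exact: (link_cons (a :: h1) l).
  case: e {he l} => [|b e] /=; first by rewrite cats0; apply: LinkRefl.
  by apply: (@LinkStep _ (a :: h1) (b :: e) r) => //; apply: LinkRefl.
- exists [::]; split=> //=.
  have aux x : link (cons_ne x (cons_ne e r)) (cons_ne (x ++ e) r).
    case: x => [|a x] /=; first by apply: LinkRefl.
    case: e {he l} => [|b e] /=; first by rewrite cats0; apply: LinkRefl.
    by apply: (@LinkStep _ (a :: x) (b :: e) r) => //; apply: LinkRefl.
  case: h1 hh he => [|a h1] /= hh he.
    case: h2 he => [|a h2] /= he.
      by move/eqP: he l => ->; apply.
    apply: (@link_trans _ ((a :: h2) :: cons_ne e r)); last exact: (aux (a :: h2)).
    apply: link_perml (link_cons _ l); apply/permP => P; rewrite /= !count_cat /=; lia.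
  move/eqP: hh => ->.
  apply: (@link_trans _ ((a :: h1) :: cons_ne e r)); last exact: (aux (a :: h1)).
  exact: (link_cons (a :: h1) l).
Qed.

Lemma blk_link A A1 A2 s : (forall v, A v = A1 v || A2 v) -> (forall v, ~~ (A1 v && A2 v)) ->
  link (blk A1 s ++ blk A2 s) (blk A s).
Proof.
move=> hA hd; have := bk_link s hA hd; rewrite /blk.
case: (bk A1 s) (bk A2 s) (bk A s) => [h1 r1] [h2 r2] [h r] /= [e [-> hh he l]].
have aux x : link (cons_ne x (cons_ne e r)) (cons_ne (x ++ e) r).
  case: x => [|a x] /=; first by apply: LinkRefl.
  case: e {he l} => [|b e] /=; first by rewrite cats0; apply: LinkRefl.
  by apply: (@LinkStep _ (a :: x) (b :: e) r) => //; apply: LinkRefl.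
case: h1 hh he => [|a h1] /= hh he.
  case: h2 he => [|a h2] /= he; first by move/eqP: he l => ->.
  apply: (@link_trans _ ((a :: h2) :: cons_ne e r)); last exact: (aux (a :: h2)).
  apply: link_perml (link_cons _ l); apply/permP => P; rewrite /= !count_cat /=; lia.
move/eqP: hh => ->.
apply: (@link_trans _ ((a :: h1) :: cons_ne e r)); last exact: (aux (a :: h1)).
exact: (link_cons (a :: h1) l).
Qed.

Lemma blk_flatten A s : flatten (blk A s) = filter A s.
Proof.
rewrite /blk; have aux : (bk A s).1 ++ flatten (bk A s).2 = filter A s.
  elim: s => [|v s] //=; case: (bk A s) => [h r] /= <-.
  by case: (A v) => //=; case: h.
by rewrite -aux; case: (bk A s) => [[|a h] r].
Qed.

Lemma blk_ne A s x : x \in blk A s -> x != [::].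
Proof.
suff h : forall x, x \in (bk A s).2 -> x != [::].
  by rewrite /blk; case: (bk A s) h => [[|a h] r] /= hr; [apply: hr | rewrite inE => /orP[/eqP->|/hr]].
elim: s => [|v s] //=; case: (bk A s) => [h r] /= IH z; case: (A v) => /=; first exact: IH.
by case: h => [|a h]; [apply: IH | rewrite inE => /orP[/eqP->|/IH]].
Qed.

Variables (R : realType) (d : V -> V -> R).

Fixpoint pairsum (A : pred V) v s : R :=
  if s is u :: s' then (if A v && A u then d v u else 0) + pairsum A u s' else 0.

Lemma blk_plen A s : \sum_(x <- blk A s) plen d x = if s is v :: s' then pairsum A v s' else 0.
Proof.
have aux t : \sum_(x <- blk A t) plen d x = plen d (bk A t).1 + \sum_(x <- (bk A t).2) plen d x.
  by rewrite /blk; case: (bk A t) => [[|a h] r] /=; rewrite ?add0r // big_cons.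
rewrite aux; elim: s => [|v s IH] /=; first by rewrite big_nil addr0.
case: s IH => [|u s] IH; first by rewrite /=; case: (A v); rewrite /= big_nil addr0.
have -> : pairsum A v (u :: s) = (if A v && A u then d v u else 0) + pairsum A u s by [].
rewrite -{}IH; have -> : bk A (u :: s) = let: (h, r) := bk A s in
    if A u then (u :: h, r) else ([::], if h is [::] then r else h :: r) by [].
case: (bk A s) => [h r]; case: (A u); rewrite ?andbF ?andbT.
  by case: (A v) => /=; rewrite ?big_cons /= ?add0r ?addrA.
by case: (A v) => /=; case: h => [|a h] /=; rewrite ?add0r.
Qed.

(** Every block is entered by a change of membership, except one at the very beginning. Counting
    that one only if the head lies in [A] strengthens the statement enough for the induction. *)
Lemma blk_size A s :
  (size (blk A s))%:R <= 1 + plen (fun u v => (A u != A v)%:R : R) s.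
Proof.
pose d' u v := (A u != A v)%:R : R.
suff : (size (blk A s))%:R <= (if s is v :: _ then A v else true)%:R + plen d' s.
  move/le_trans; apply; rewrite lerD2r; case: s => [|v s]; rewrite ?lexx //.
  by case: (A v); rewrite ?lexx ?ler01.
have aux t : size (blk A t) = (((bk A t).1 != [::]) + size (bk A t).2)%N.
  by rewrite /blk; case: (bk A t) => [[|a h] r].
rewrite aux; elim: s => [|v s IH] /=; first by rewrite addr0 ler01.
case: s IH => [|u s] IH; first by rewrite /=; case: (A v); rewrite /= addr0 ?lexx.
move: IH; rewrite [bk A (u :: s)]/= [plen d' (u :: s)]/= [plf d' v _]/=.
case: (bk A s) => [h r]; rewrite /d'; case: (A u) => /= IH; case: (A v) => /=; move: IH.
- by rewrite !add1n !add0r.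
- by rewrite !add1n !add0n add0r.
- case: h => [|a h] /=; rewrite !add1n !add0n !add0r -?natr1; lra.
- by case: h => [|a h] /=; rewrite !add0n !add0r.
Qed.

End Blocks.

(** * Dynamic programming over boxes *)

(** Bounded sums and quantifiers get names because the proofs of computability recognize them by
    their head symbol. *)
Definition nsum (b : nat) (F : nat -> nat) : nat := (\sum_(i < b) F i)%N.
Definition nall (b : nat) (P : nat -> bool) : bool := all P (iota 0 b).
Definition nhas (b : nat) (P : nat -> bool) : bool := has P (iota 0 b).

Lemma nallP b (P : nat -> bool) : reflect (forall i, (i < b)%N -> P i) (nall b P).
Proof.
by apply: (iffP allP) => h i; [move=> ib; apply: h; rewrite mem_iota | rewrite mem_iota; apply: h].
Qed.

Lemma nhasP b (P : nat -> bool) : reflect (exists2 i, (i < b)%N & P i) (nhas b P).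
Proof.
by apply: (iffP hasP) => -[i hi Pi]; exists i; rewrite ?mem_iota in hi *.
Qed.

Definition dgt (b k idx : nat) : nat := (idx %/ b ^ k %% b)%N.
Fixpoint enc (b : nat) (ds : seq nat) : nat := if ds is x :: ds' then (x + b * enc b ds')%N else 0%N.

Lemma enc_lt b ds : (0 < b)%N -> all (fun x => x < b)%N ds -> (enc b ds < b ^ size ds)%N.
Proof.
move=> b0; elim: ds => [|x ds IH] //= /andP[xb /IH h].
rewrite expnS; apply: (@leq_trans (b * (enc b ds).+1)); last by rewrite leq_mul2l h orbT.
by rewrite mulnS -addSn leq_add.
Qed.

Lemma dgt_enc b ds k : (0 < b)%N -> all (fun x => x < b)%N ds -> dgt b k (enc b ds) = nth 0%N ds k.
Proof.
move=> b0; elim: ds k => [|x ds IH] k /=; first by rewrite /dgt div0n mod0n nth_nil.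
case/andP=> xb h; case: k => [|k].
  by rewrite /dgt expn0 divn1 addnC mulnC modnMDl modn_small.
rewrite /= -(IH k h) /dgt expnS divnMA; congr (_ %/ _ %% _)%N.
by rewrite addnC mulnC divnMDl // divn_small ?addn0.
Qed.

Lemma dgt_lt b k idx : (0 < b)%N -> (dgt b k idx < b)%N.
Proof. by move=> b0; rewrite /dgt ltn_mod. Qed.

Section DP.
Variable R : realType.
Variables (n S : nat) (P : nat -> R * R).
Notation d := (fun u v => edist (P u) (P v)).
Implicit Types (A : pred nat) (bl : seq (seq nat)) (idx z u v x y : nat).

(** A row is a number in base [n.+1]: four digits name terminals spanning a box, and two digits for
    each of up to [S] paths name its ends. The digit [n] is a blank, which yields an empty box or no
    path. *)
Definition tsize : nat := n.+1 ^ (4 + 2 * S).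
Notation dg k idx := (dgt n.+1 k idx).

Definition inb4 (l r b t v : nat) : bool :=
  [&& l < n, r < n, b < n & t < n]%N &&
  [&& (P l).1 <= (P v).1, (P v).1 <= (P r).1, (P b).2 <= (P v).2 & (P v).2 <= (P t).2].
Definition inb idx v := inb4 (dg 0 idx) (dg 1 idx) (dg 2 idx) (dg 3 idx) v.
Definition cnt idx x y : nat :=
  nsum S (fun i => nat_of_bool ((dg (4 + 2 * i) idx == x) && (dg (5 + 2 * i) idx == y))).

(** Validity, cost, and the relation of preceding or being equal on a common path. Paths are not
    stored as lists: positions are recovered from the relation by counting, and concatenating two
    paths is a Boolean formula in it. *)
Record table := Table { tv : nat -> bool; tc : nat -> R; tb : nat -> nat -> nat -> bool }.
Implicit Types tab : table.

Definition union_ok tab idx i j : bool :=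
  [&& tv tab i, tv tab j,
    nall n (fun v => ~~ (inb i v && inb j v) && (inb idx v == inb i v || inb j v)) &
    nall n (fun x => nall n (fun y => cnt idx x y == cnt i x y + cnt j x y)%N)].
(** Paths are known by their ends only. Disjoint paths have different heads, so [x != x'] is what
    guarantees that two different paths are concatenated. *)
Definition link_ok tab idx i x y x' y' : bool :=
  [&& tv tab i, [&& x < n, y < n, x' < n & y' < n]%N, x != x',
    [&& (0 < cnt i x y)%N, (0 < cnt i x' y')%N & nall n (fun v => inb idx v == inb i v)] &
    nall n (fun s => nall n (fun t => cnt idx s t + (((s == x) && (t == y)) + ((s == x') && (t == y'))) ==
      cnt i s t + ((s == x) && (t == y')))%N)].

(* A candidate is a number [z = i + T (j + T o)]: the union of the rows [i] and
   [j] for [o = 0], and otherwise the result of concatenating two paths of the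
   row [i] whose ends are read in the first four digits of [j]. *)
Definition zi z := (z %% tsize)%N.
Definition zj z := (z %/ tsize %% tsize)%N.
Definition zo z := (z %/ tsize %/ tsize)%N.
Definition ok tab idx z : bool :=
  if zo z == 0%N then union_ok tab idx (zi z) (zj z)
  else link_ok tab idx (zi z) (dg 0 (zj z)) (dg 1 (zj z)) (dg 2 (zj z)) (dg 3 (zj z)).
Definition cc tab z : R :=
  if zo z == 0%N then tc tab (zi z) + tc tab (zj z)
  else tc tab (zi z) + edist (P (dg 1 (zj z))) (P (dg 2 (zj z))).
Definition bb tab z u v : bool :=
  if zo z == 0%N then tb tab (zi z) u v || tb tab (zj z) u v
  else tb tab (zi z) u v || (tb tab (zi z) u (dg 1 (zj z)) && tb tab (zi z) (dg 2 (zj z)) v).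
Definition choice tab idx := amin (ok tab idx) (cc tab) (2 * tsize * tsize).
Definition step tab : table :=
  Table (fun idx => choice tab idx != 0%N) (fun idx => cc tab (choice tab idx).-1)
        (fun idx => bb tab (choice tab idx).-1).

Definition valid0 idx : bool :=
  (nall n (fun v => ~~ inb idx v) && nall n (fun x => nall n (fun y => cnt idx x y == 0%N)))
  || nhas n (fun v => nall n (fun u => inb idx u == (u == v)) &&
       nall n (fun x => nall n (fun y => cnt idx x y == ((x == v) && (y == v))))).
Definition tab0 : table := Table valid0 (fun _ => 0) (fun idx u v => (u == v) && inb idx u).

Definition ends bl x y : nat := count (fun p => (head n p == x) && (last n p == y)) bl.
Definition befs u v (p : seq nat) : bool := [&& u \in p, v \in p & (index u p <= index v p)%N].
Definition wfb bl : Prop := uniq (flatten bl) /\ forall p, p \in bl -> p != [::] /\ all (fun v => v < n)%N p.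
Definition rep idx A bl : Prop :=
  (forall v, (v < n)%N -> inb idx v = A v) /\
  (forall x y, (x < n)%N -> (y < n)%N -> cnt idx x y = ends bl x y).
Definition path_bound bl : R := \sum_(p <- bl) plen d p.

Definition sound_at tab idx : Prop := exists bl, [/\ wfb bl,
  (forall v, (v \in flatten bl) = (v < n)%N && inb idx v),
  (forall x y, (x < n)%N -> (y < n)%N -> cnt idx x y = ends bl x y),
  tc tab idx = path_bound bl &
  forall u v, (u < n)%N -> (v < n)%N -> tb tab idx u v = has (befs u v) bl].
Definition sound tab : Prop := forall idx, tv tab idx -> sound_at tab idx.

Lemma ends_perm a b x y : perm_eq a b -> ends a x y = ends b x y.
Proof. by move=> h; apply/permP. Qed.

Lemma ends_cat a b x y : ends (a ++ b) x y = (ends a x y + ends b x y)%N.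
Proof. exact: count_cat. Qed.

Lemma wfb_perm a b : perm_eq a b -> wfb a -> wfb b.
Proof.
move=> h [h1 h2]; split; last by move=> p; rewrite -(perm_mem h); apply: h2.
by rewrite -(perm_uniq (perm_flatten h)).
Qed.

Lemma wfb_ends bl p : wfb bl -> p \in bl -> (head n p < n)%N /\ (last n p < n)%N.
Proof.
move=> [_ h] /h[]; case: p => [//|x p] _ /= /andP[xn /allP pn]; split=> //.
by have := mem_last x p; rewrite inE => /orP[/eqP->|/pn].
Qed.

Lemma sound0 : sound tab0.
Proof.
move=> idx /= /orP[/andP[/nallP h1 /nallP h2]|/nhasP[v vn /andP[/nallP h1 /nallP h2]]].
  exists [::]; split=> //.
  - by move=> v; rewrite in_nil; case: ltnP => // vn; apply/esym/negbTE/h1.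
  - by move=> x y xn yn; apply/eqP; apply: (nallP _ _ (h2 x xn)).
  - by rewrite /path_bound big_nil.
  - by move=> u v un vn /=; case: eqP => // ->; apply/negbTE/h1.
exists [:: [:: v]]; split=> //.
- by split=> // p; rewrite inE => /eqP-> /=; rewrite vn.
- by move=> u; rewrite inE; case: ltnP => un; [rewrite (eqP (h1 u un)) | case: eqP un => // ->; rewrite leqNgt vn].
- by move=> x y xn yn; rewrite (eqP (nallP _ _ (h2 x xn) y yn)) /ends /= addn0 !(eq_sym v).
- by rewrite /path_bound big_seq1.
- move=> u w un wn /=; rewrite orbF /befs !inE (eqP (h1 u un)).
  case: (u =P v) => [->|_]; last by rewrite andbF.
  by rewrite andbT eq_sym; case: eqP => [->|//]; rewrite leqnn.
Qed.

Lemma befs_cat u v p q : uniq (p ++ q) ->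
  befs u v (p ++ q) = [|| befs u v p, befs u v q | (u \in p) && (v \in q)].
Proof.
rewrite cat_uniq => /and3P[_ /hasPn h _].
have h' w : w \in q -> (w \in p) = false by move=> /h/negbTE.
rewrite /befs !mem_cat !index_cat.
case up : (u \in p); case vp : (v \in p) => /=.
- case vq : (v \in q); first by rewrite h' in vp.
  by rewrite andbF !orbF.
- case vq : (v \in q); rewrite ?andbF ?orbT //=.
  by apply: leq_trans (leq_addr _ _); apply/ltnW; rewrite index_mem.
- case uq : (u \in q) => //=; rewrite (_ : v \in q = false) //=; last by apply/negP => /h'; rewrite vp.
  by apply/negbTE; rewrite -ltnNge; apply: leq_trans (leq_addr _ _); rewrite index_mem.
- by rewrite leq_add2l orbF.
Qed.

Lemma befs_last u p x : uniq (x :: p) -> befs u (last x p) (x :: p) = (u \in x :: p).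
Proof.
move=> up; rewrite /befs mem_last andTb; have [h|//] := boolP (u \in x :: p).
by rewrite andTb index_last // -ltnS -[X in (_ < X)%N]/(size (x :: p)) index_mem.
Qed.

Lemma befs_head v p x : befs x v (x :: p) = (v \in x :: p).
Proof. by rewrite /befs mem_head /= eqxx andbT. Qed.

Lemma has_uniq_block (f : seq nat -> bool) bl p v : uniq (flatten bl) -> p \in bl -> v \in p ->
  (forall q, f q -> v \in q) -> has f bl = f p.
Proof.
move=> + hp vp hf; elim: bl hp => [//|q bl IH]; rewrite inE /= cat_uniq => hp /and3P[_ /hasPn h uf].
case/orP: hp => [/eqP e|hp].
  rewrite -e; case: (f p) => //=; apply/hasPn => q' hq'; apply/negP => /hf vq'.
  by have := h v; rewrite -e vp => /(_ _)/negP; apply => //; apply/flattenP; exists q'.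
rewrite (IH hp uf); case E : (f q) => //=; apply/esym.
have /h : v \in flatten bl by apply/flattenP; exists p.
by rewrite (hf _ E).
Qed.

Lemma len_cat a b : path_bound (a ++ b) = path_bound a + path_bound b.
Proof. by rewrite /path_bound big_cat. Qed.

Lemma plen_cat (p q : seq nat) x y : p = x :: behead p -> q = y :: behead q ->
  plen d (p ++ q) = plen d p + d (last n p) y + plen d q.
Proof.
move=> -> -> /=; rewrite plf_cat /=; ring.
Qed.

(** The end counts certify that paths with the prescribed ends occur in the realization of row [i].
    As these paths are disjoint, the relation at their ends tests membership in them, which is all
    that the formula for the concatenation uses. *)
Lemma sound_step tab : sound tab -> sound (step tab).
Proof.
move=> hS idx /= hv; have := aminP (ok tab idx) (cc tab) (2 * tsize * tsize).
rewrite -/(choice tab idx); case E : (choice tab idx) hv => [//|z] _ [_ okz _].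
rewrite /sound_at /= E /=; move: okz; rewrite /ok /cc /bb; case: (zo z == 0)%N.
  case/and4P=> /hS[b1 [w1 m1 e1 l1 f1]] /hS[b2 [w2 m2 e2 l2 f2]] /nallP hb /nallP hc.
  have dj v : (v < n)%N -> inb (zi z) v && inb (zj z) v = false by move=> /hb/andP[/negbTE].
  exists (b1 ++ b2); split.
  - split; last by move=> p; rewrite mem_cat => /orP[]; [apply: w1.2|apply: w2.2].
    rewrite flatten_cat cat_uniq w1.1 w2.1 andbT; apply/hasPn => v; rewrite m2 => /andP[vn v2].
    by rewrite /= m1 vn /=; have := dj v vn; rewrite v2 andbT => ->.
  - by move=> v; rewrite flatten_cat mem_cat m1 m2; case: ltnP => //= vn; have /andP[_ /eqP->] := hb v vn.
  - by move=> x y xn yn; rewrite ends_cat -e1 // -e2 //; apply/eqP; apply: (nallP _ _ (hc x xn)).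
  - by rewrite len_cat l1 l2.
  - by move=> u v un vn; rewrite has_cat f1 // f2.
set x := dg 0 _; set y := dg 1 _; set x' := dg 2 _; set y' := dg 3 _.
case/and5P=> /hS[b1 [w1 m1 e1 l1 f1]] /and4P[xn yn x'n y'n] nx /and3P[c1 c2 /nallP hb] /nallP hc.
have : exists2 p, p \in b1 & (head n p == x) && (last n p == y).
  by move: c1; rewrite e1 // -has_count => /hasP[p hp h]; exists p.
case=> p pb /andP[/eqP hp /eqP lp].
have : exists2 p, p \in b1 & (head n p == x') && (last n p == y').
  by move: c2; rewrite e1 // -has_count => /hasP[q hq h]; exists q.
case=> q qb /andP[/eqP hq /eqP lq].
have pq : q != p by apply: contraNneq nx => e; rewrite -hp -hq e.
have p1 : perm_eq b1 (p :: q :: rem q (rem p b1)).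
  apply: perm_trans (perm_to_rem pb) _; rewrite perm_cons; apply: perm_to_rem.
  by have := perm_mem (perm_to_rem pb) q; rewrite qb inE (negPf pq).
set r := rem q _ in p1.
have [w2 w3] := wfb_perm p1 w1.
have pE : p = x :: behead p by have [] := w3 p; rewrite ?mem_head // -hp; case: (p).
have qE : q = x' :: behead q by have [] := w3 q; rewrite ?inE ?eqxx ?orbT // -hq; case: (q).
have up : uniq p by move: w2; rewrite /= cat_uniq => /and3P[].
have upq : uniq (p ++ q) by move: w2; rewrite /= catA cat_uniq => /and3P[].
exists ((p ++ q) :: r); split.
- split; first by rewrite /= -catA.
  move=> s; rewrite inE => /orP[/eqP->|hs]; last by apply: w3; rewrite !inE hs !orbT.
  rewrite all_cat; have [] := w3 p; rewrite ?mem_head // => h1 ->; have [|_ ->] := w3 q; rewrite ?inE ?eqxx ?orbT //.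
  by split=> //; rewrite pE.
- move=> v; have -> : (v \in flatten ((p ++ q) :: r)) = (v \in flatten b1).
    by rewrite (perm_mem (perm_flatten p1)) /= catA.
  by rewrite m1; case: ltnP => //= vn; rewrite (eqP (hb v vn)).
- move=> s t sn tn; have /eqP := nallP _ _ (hc s sn) t tn.
  rewrite e1 // (ends_perm _ _ p1) /ends /= hp lp hq lq.
  have -> : head n (p ++ q) = x by rewrite pE.
  have -> : last n (p ++ q) = y' by rewrite last_cat -lq qE.
  rewrite !(eq_sym x) !(eq_sym y) !(eq_sym x') !(eq_sym y').
  by move: ((s == x) && _) ((s == x) && _) ((s == x') && _) (count _ _) (cnt _ _ _); clear; case; case; case; lia.
- rewrite l1 /path_bound (perm_big _ p1) !big_cons /= (plen_cat pE qE) lp; ring.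
move=> u v un vn.
have aux (s0 : seq nat) a c : s0 = a :: behead s0 -> last n s0 = c -> uniq s0 ->
    befs u c s0 = (u \in s0) /\ c \in s0.
  by case: s0 => // a' s0 _ /= <- us; split; [apply: befs_last | apply: mem_last].
have [ax1 ax2] := aux p x y pE lp up.
have hby : tb tab (zi z) u y = (u \in p).
  rewrite f1 //; rewrite (has_uniq_block w1.1 pb (v := y)).
  - exact: ax1.
  - exact: ax2.
  - by move=> s /and3P[].
have hbx : tb tab (zi z) x' v = (v \in q).
  rewrite f1 //; rewrite (has_uniq_block w1.1 qb (v := x')).
  - by rewrite qE befs_head -qE.
  - by rewrite qE mem_head.
  - by move=> s /and3P[].
rewrite hby hbx f1 // (perm_has _ p1) /= befs_cat //.
by case: (befs u v p); case: (befs u v q); case: (has _ r); rewrite ?orbT ?orbF.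
Qed.

Lemma tsize_gt0 : (0 < tsize)%N. Proof. by rewrite expn_gt0. Qed.

Lemma sound_iter r : sound (iter r step tab0).
Proof. by elim: r => [|r IH]; [exact: sound0 | apply: sound_step]. Qed.

(** The counterpart of soundness: every row encoding the system is valid and no more expensive than
    it. All encodings are covered, since paths may be listed in any order and one box may be spanned
    by different terminals. *)
Definition att tab A bl : Prop :=
  forall idx, (idx < tsize)%N -> rep idx A bl -> tv tab idx /\ tc tab idx <= path_bound bl.
Definition boxy A : Prop := exists l r b t, [/\ l < n.+1, r < n.+1, b < n.+1 & t < n.+1]%N /\
  forall v, (v < n)%N -> inb4 l r b t v = A v.

Lemma key_exists A bl : boxy A -> wfb bl -> (size bl <= S)%N ->
  exists2 idx, (idx < tsize)%N & rep idx A bl.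
Proof.
move=> [l [r [b [t [[ln rn bn tn] hA]]]]] wf sb.
pose f k := if k is k'.+4 then (if odd k' then last n (nth [::] bl k'./2) else head n (nth [::] bl k'./2))
  else nth 0%N [:: l; r; b; t] k.
have fn k : (f k < n.+1)%N.
  case: k => [|[|[|[|k]]]] //=.
  have [h|h] := leqP (size bl) k./2; first by rewrite nth_default // if_same.
  by have [h1 h2] := wfb_ends wf (mem_nth [::] h); case: odd; apply: ltnW.
pose ds := mkseq f (4 + 2 * S).
have ads : all (fun x => x < n.+1)%N ds by apply/allP => x /mapP[k _ ->].
have dE k : (k < 4 + 2 * S)%N -> dg k (enc n.+1 ds) = f k.
  by move=> hk; rewrite dgt_enc // nth_mkseq.
exists (enc n.+1 ds); first by have := enc_lt (ltn0Sn n) ads; rewrite size_mkseq.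
split=> [v vn|x y xn yn]; first by rewrite /inb !dE // hA.
rewrite /cnt /nsum (eq_bigr (fun i : 'I_S => nat_of_bool ((head n (nth [::] bl i) == x) && (last n (nth [::] bl i) == y)))).
  rewrite -(big_mkord xpredT (fun i => nat_of_bool ((head n (nth [::] bl i) == x) && (last n (nth [::] bl i) == y)))).
  rewrite (@big_cat_nat _ _ _ (size bl)) //= [X in (_ + X)%N]big1_seq ?addn0; last first.
    by move=> i; rewrite mem_index_iota => /andP[_ /andP[h _]]; rewrite nth_default //= (gtn_eqF xn).
  rewrite /ends -sum1_count [in RHS]big_mkcond [in RHS](big_nth [::]) /=.
  by apply: eq_bigr => i _; case: (_ && _).
move=> i _; have h : (2 * i + 1 < 2 * S)%N by have := ltn_ord i; clear; lia.
rewrite !dE; [|by move: h; clear; lia..].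
by rewrite /f /= !add0n mul2n odd_double doubleK uphalf_double.
Qed.

Lemma step_le tab idx z : (z < 2 * tsize * tsize)%N -> ok tab idx z ->
  tv (step tab) idx /\ tc (step tab) idx <= cc tab z.
Proof.
move=> hz okz; have := aminP (ok tab idx) (cc tab) (2 * tsize * tsize).
rewrite /= -/(choice tab idx); case: (choice tab idx) => [/(_ z hz)|z' [_ _ /(_ z hz okz)]] //.
by rewrite okz.
Qed.

Lemma zE i j o : (i < tsize)%N -> (j < tsize)%N ->
  let z := (i + tsize * (j + tsize * o))%N in [/\ zi z = i, zj z = j & zo z = o].
Proof.
move=> hi hj z; have T0 := tsize_gt0.
have e1 : (z %/ tsize = j + tsize * o)%N.
  by rewrite /z addnC mulnC divnMDl // divn_small ?addn0.
rewrite /zi /zj /zo e1; split.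
- by rewrite /z addnC mulnC modnMDl modn_small.
- by rewrite addnC mulnC modnMDl modn_small.
- by rewrite addnC mulnC divnMDl // divn_small ?addn0.
Qed.

Lemma z_lt i j o : (i < tsize)%N -> (j < tsize)%N -> (o < 2)%N ->
  (i + tsize * (j + tsize * o) < 2 * tsize * tsize)%N.
Proof. by move: tsize => T; nia. Qed.

Lemma att_union tab A A1 A2 a b : boxy A1 -> boxy A2 -> wfb a -> wfb b ->
    (size a <= S)%N -> (size b <= S)%N ->
    (forall v, (v < n)%N -> A v = A1 v || A2 v) -> (forall v, (v < n)%N -> ~~ (A1 v && A2 v)) ->
  att tab A1 a -> att tab A2 b -> att (step tab) A (a ++ b).
Proof.
move=> x1 x2 w1 w2 s1 s2 hA hd h1 h2 idx idxT [r1 r2].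
have [i iT ri] := key_exists x1 w1 s1; have [j jT rj] := key_exists x2 w2 s2.
have [vi ci] := h1 i iT ri; have [vj cj] := h2 j jT rj.
have [e1 e2 e3] := zE 0 iT jT; have := @step_le tab idx _ (z_lt iT jT (ltn0Sn 1)).
rewrite /ok /cc e1 e2 e3 /= => h; have {}h := h _; case: h => [|h3 h4].
  rewrite /union_ok vi vj /=; apply/andP; split.
    by apply/nallP => v vn; rewrite r1 // ri.1 // rj.1 // hA // hd //=.
  by apply/nallP => x xn; apply/nallP => y yn; rewrite r2 // ends_cat ri.2 // rj.2.
by split=> //; apply: le_trans h4 _; rewrite len_cat lerD.
Qed.

Lemma att_eq tab A B a b : (forall v, (v < n)%N -> A v = B v) -> perm_eq a b ->
  att tab A a -> att tab B b.
Proof.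
move=> e p h idx iT [r1 r2]; have [|h1 h2] := h idx iT.
  by split=> [v vn|x y xn yn]; rewrite ?r1 ?e ?r2 // (ends_perm _ _ p).
by split=> //; rewrite -/(path_bound b) /path_bound -(perm_big _ p).
Qed.

Lemma att_link tab A (x y : seq nat) (r : seq (seq nat)) : boxy A -> wfb (x :: y :: r) -> ((size r).+2 <= S)%N ->
  att tab A (x :: y :: r) -> att (step tab) A ((x ++ y) :: r).
Proof.
move=> bA w s h idx iT [r1 r2].
have [i iT' ri] := key_exists bA w s; have [vi ci] := h i iT' ri.
have [n1 x1] := wfb_ends w (mem_head _ _).
have [|n2 x2] := wfb_ends (p := y) w; first by rewrite !inE eqxx orbT.
have [xE _] := w.2 x (mem_head _ _).
have [|yE _] := w.2 y; first by rewrite !inE eqxx orbT.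
pose ds := [:: head n x; last n x; head n y; last n y].
have ads : all (fun x => x < n.+1)%N ds by apply/and5P; split=> //; apply: ltnW.
pose j := enc n.+1 ds.
have jT : (j < tsize)%N.
  by apply: leq_trans (enc_lt (ltn0Sn n) ads) _; rewrite leq_pexp2l.
have [e1 e2 e3] := zE 1 iT' jT; have := @step_le tab idx _ (z_lt iT' jT (ltnSn 1)).
rewrite /ok /cc e1 e2 e3 /= !dgt_enc //= => h'; have {}h' := h' _; case: h' => [|h3 h4].
  rewrite /link_ok vi n1 n2 x1 x2 /=; apply/and3P; split.
  - have := w.1; rewrite /= catA cat_uniq cat_uniq; case: (x) xE => [//|a x'] _; case: (y) yE => [//|b y'] _ /=.
    case/and3P=> /and3P[_ /norP[hb _] _] _ _.
    by apply: contraNneq hb => ->; rewrite mem_head.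
  - apply/and3P; split; last by apply/nallP => v vn; rewrite r1 // ri.1.
      by rewrite ri.2 // /ends /= !eqxx.
    by rewrite ri.2 // /ends /= !eqxx /= addnCA.
  - apply/nallP => s' sn; apply/nallP => t tn; rewrite r2 // ri.2 // /ends /=.
    have -> : head n (x ++ y) = head n x by case: (x) xE.
    have -> : last n (x ++ y) = last n y by rewrite last_cat; case: (y) yE.
    rewrite !(eq_sym s') !(eq_sym t); apply/eqP.
    by move: (_ && _) (_ && _) (_ && _) (count _ _) => a b c e; rewrite -!plusE; clear; lia.
split=> //; apply: le_trans h4 _; rewrite /path_bound big_cons.
have -> : plen d (x ++ y) = plen d x + d (last n x) (head n y) + plen d y.
  case: (x) xE => //= a x'' _; case: (y) yE => //= b y'' _.
  by rewrite plf_cat /=; ring.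
by move: ci; rewrite /path_bound !big_cons; lra.
Qed.

Notation tabs r := (iter r step tab0).

Lemma boxy0 : boxy pred0.
Proof. by exists n, n, n, n; split=> // v vn; rewrite /inb4 ltnn. Qed.

Lemma wfb0 : wfb [::]. Proof. by []. Qed.

Lemma att0 r : att (tabs r) pred0 [::].
Proof.
elim: r => [|r IH] /=.
  move=> idx _ [h1 h2]; split; last by rewrite /path_bound big_nil.
  apply/orP; left; apply/andP; split; first by apply/nallP => v vn; rewrite h1.
  by apply/nallP => x xn; apply/nallP => y yn; rewrite h2.
by have := @att_union _ pred0 pred0 pred0 [::] [::] boxy0 boxy0 wfb0 wfb0 (leq0n _) (leq0n _) _ _ IH IH; apply.
Qed.

(** Each round recomputes the whole table, so an entry persists as the union of itself with the
    empty system. *)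
Lemma att_mono r k A a : boxy A -> wfb a -> (size a <= S)%N -> att (tabs r) A a -> att (tabs (k + r)) A a.
Proof.
move=> bA w s h; elim: k => [//|k IH] /=; rewrite -[a]cats0.
by apply: (@att_union _ A A pred0 a [::] bA boxy0 w wfb0 s (leq0n _) _ _ IH (att0 _)) => v vn; rewrite ?orbF ?andbF.
Qed.

Lemma att1 v : (v < n)%N -> att tab0 (pred1 v) [:: [:: v]].
Proof.
move=> vn idx _ [h1 h2]; split; last by rewrite /path_bound big_seq1.
apply/orP; right; apply/nhasP; exists v => //; apply/andP; split.
  by apply/nallP => u un; rewrite h1.
by apply/nallP => x xn; apply/nallP => y yn; rewrite h2 // /ends /= addn0 !(eq_sym v).
Qed.

Lemma att_links r A a b : boxy A -> link a b -> wfb a -> (size a <= S)%N ->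
  att (tabs r) A a -> att (tabs (size a + r)) A b.
Proof.
move=> bA l; elim: l r => {a b} [a b p|a x y s b p l IH] r w sa h.
  by apply: att_eq (_ : perm_eq a b) _ => //; apply: att_mono.
have w' := wfb_perm p w; have sE : size a = (size s).+2 by rewrite (perm_size p).
rewrite sE in sa *; rewrite addSnnS.
apply: (IH r.+1) => //=; last first.
- apply: att_link => //; exact: att_eq h.
- by apply: leq_trans sa.
case: w' => /= w1 w2; split; first by rewrite /= -catA.
move=> q; rewrite inE => /orP[/eqP->|hq]; last by apply: w2; rewrite !inE hq !orbT.
have [xE xa] := w2 x (mem_head _ _); have [|yE ya] := w2 y; first by rewrite !inE eqxx orbT.
by rewrite all_cat xa ya; split=> //; case: (x) xE.
Qed.

Lemma link_flatten (a : seq (seq nat)) : (0 < size a)%N -> link a [:: flatten a].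
Proof.
case: a => // x a _; elim: a x => [|y a IH] x; first by rewrite /= cats0; apply: LinkRefl.
apply: (@LinkStep _ _ x y a) => //=; rewrite catA; exact: IH.
Qed.

End DP.

Lemma flatten_nil (T : eqType) (a : seq (seq T)) : (forall x, x \in a -> x != [::]) ->
  flatten a = [::] -> a = [::].
Proof. by case: a => [|[|y x] a] // /(_ [::] (mem_head _ _)). Qed.

Lemma flatten_single (T : eqType) (a : seq (seq T)) v : (forall x, x \in a -> x != [::]) ->
  flatten a = [:: v] -> a = [:: [:: v]].
Proof.
case: a => [|[|y x] a] //; first by move=> /(_ [::] (mem_head _ _)).
move=> h /= [-> /eqP]; case: x h => [|z x] //= h /eqP e; rewrite (@flatten_nil _ a) //.
by move=> w wa; apply: h; rewrite inE wa orbT.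
Qed.

Lemma blk_ext (V : eqType) (A B : pred V) s : {in s, A =1 B} -> blk A s = blk B s.
Proof.
move=> h; rewrite /blk; suff -> : bk A s = bk B s by [].
elim: s h => [//|v s IH] h /=; rewrite IH ?(h v (mem_head _ _)) // => u us.
by apply: h; rewrite inE us orbT.
Qed.

Lemma ex_argmin (R : realType) (T : eqType) (f : T -> R) s : s != [::] ->
  exists2 x, x \in s & forall y, y \in s -> f x <= f y.
Proof.
elim: s => [//|a s IH] _; case: s IH => [|b s] IH.
  by exists a; rewrite ?mem_head // => y; rewrite inE => /eqP->.
have [x xs h] := IH isT; have [l|l] := lerP (f a) (f x).
  by exists a; rewrite ?mem_head // => y; rewrite inE => /orP[/eqP->//|/h]; apply: le_trans.
exists x; first by rewrite inE xs orbT.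
by move=> y; rewrite inE => /orP[/eqP->|/h//]; apply: ltW.
Qed.

Lemma node_subtree W (t : bsp W) U : leaves_ok t -> isnode t U ->
  exists t' : bsp U, leaves_ok t' /\ forall U', isnode t' U' -> isnode t U'.
Proof.
elim: t U => {W} [W|W b i hi0 t1 IH1 t2 IH2] U.
  by move=> l [->|//]; exists (BLeaf W); split=> // U' [->|//]; left.
move=> [l1 l2]; case=> [->|[/IH1|/IH2]].
- by exists (BNode hi0 t1 t2).
- by case=> // t' [l' h]; exists t'; split=> // U' /h; right; left.
- by case=> // t' [l' h]; exists t'; split=> // U' /h; right; right.
Qed.

(** * The dynamic programme along a decomposition *)

Section Tree.
Variable R : realType.
Variables (n S K : nat) (P : nat -> R * R) (pi : seq nat).
Variable pix : bool -> R * R -> nat.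
Hypothesis pi_perm : perm_eq pi (iota 0 n).
Hypothesis pix_mono : forall b p q, co b p <= co b q -> (pix b p <= pix b q)%N.
Hypothesis pix_inj : forall u v, (u < n)%N -> (v < n)%N -> (forall b, pix b (P u) = pix b (P v)) -> u = v.
Hypothesis SK : (2 * K <= S)%N.
Notation d := (fun u v => edist (P u) (P v)).

Definition AU (U : box) (v : nat) : bool := inW pix U (P v).

Lemma mem_pi v : (v \in pi) = (v < n)%N.
Proof. by rewrite (perm_mem pi_perm) mem_iota. Qed.

Lemma uniq_pi : uniq pi. Proof. by rewrite (perm_uniq pi_perm) iota_uniq. Qed.

(** The extreme terminals of a node box span a box with the same terminals, because pixel indices
    are monotone in the coordinates. This is how boxes of the analysis acquire names in the
    program. *)
Lemma boxy_AU U : boxy n P (AU U).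
Proof.
pose s := filter (AU U) (iota 0 n).
have ms v : (v \in s) = AU U v && (v < n)%N by rewrite mem_filter mem_iota.
have [s0|s0] := eqVneq s [::].
  exists n, n, n, n; split=> // v vn; rewrite /inb4 ltnn /=.
  by have := ms v; rewrite s0 vn andbT.
have [l /[!ms] /andP[lU ln] hl] := ex_argmin (fun v => (P v).1) s0.
have [r /[!ms] /andP[rU rn] hr] := ex_argmin (fun v => - (P v).1) s0.
have [b /[!ms] /andP[bU bn] hb] := ex_argmin (fun v => (P v).2) s0.
have [t /[!ms] /andP[tU tn] ht] := ex_argmin (fun v => - (P v).2) s0.
exists l, r, b, t; split; first by split; apply: leqW.
move=> v vn; rewrite /inb4 ln rn bn tn /=; apply/idP/idP.
  case/and4P=> h1 h2 h3 h4.
  have := lU; have := rU; have := bU; have := tU; rewrite /AU /inW /inB.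
  have := @pix_mono true (P l) (P v) h1; have := @pix_mono true (P v) (P r) h2.
  have := @pix_mono false (P b) (P v) h3; have := @pix_mono false (P v) (P t) h4.
  by clear; lia.
move=> vU; have vs : v \in s by rewrite ms vU.
by have := hl v vs; have := hr v vs; have := hb v vs; have := ht v vs; rewrite !lerN2 => -> -> -> ->.
Qed.

Lemma wfb_blk A : wfb n (blk A pi).
Proof.
split; first by rewrite blk_flatten filter_uniq // uniq_pi.
move=> p hp; split; first exact: blk_ne hp.
apply/allP => v vp; rewrite -mem_pi.
have : v \in flatten (blk A pi) by apply/flattenP; exists p.
by rewrite blk_flatten mem_filter => /andP[].
Qed.

(** One round for a union and at most [2 * K] for the links that follow it. *)
Definition rho : nat := 2 * K + 1.
Notation tabs r := (iter r (step n S P) (tab0 n S P)).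

Lemma att_blk_ext r A B : (forall v, (v < n)%N -> A v = B v) ->
  att n S P (tabs r) A (blk A pi) -> att n S P (tabs r) B (blk B pi).
Proof.
move=> e; apply: att_eq => //; rewrite (@blk_ext _ A B) //.
by move=> v; rewrite mem_pi; apply: e.
Qed.

(** A node with an empty part needs no round of its own, and the nodes that really split their
    terminals are fewer than the terminals. The number of rounds is thus linear in the terminals,
    whatever the depth of the decomposition. *)
Lemma bsp_att W (t : bsp W) : leaves_ok t -> (forall U, isnode t U -> (size (blk (AU U) pi) <= K)%N) ->
  att n S P (tabs (rho * size (filter (AU W) pi))) (AU W) (blk (AU W) pi).
Proof.
have KS : (K <= S)%N by apply: leq_trans SK; rewrite mul2n -addnn leq_addr.
elim: t => {W} [W|W b i hi0 t1 IH1 t2 IH2] /= lo hK.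
- case E : (filter (AU W) pi) => [|v [|u s]].
  + have E0 : blk (AU W) pi = [::].
      by apply: flatten_nil; [apply: blk_ne | rewrite blk_flatten E].
    rewrite E0; have h0 := @att0 R n S P (rho * size (@nil nat)).
    apply: (att_eq _ (perm_refl _) h0) => v vn.
    have : v \notin filter (AU W) pi by rewrite E.
    by rewrite mem_filter mem_pi vn andbT => /negbTE->.
  + have E0 : blk (AU W) pi = [:: [:: v]].
      by apply: flatten_single; [apply: blk_ne | rewrite blk_flatten E].
    have mv u : (u < n)%N -> AU W u = (u == v).
      by move=> un; rewrite -mem_seq1 -E mem_filter mem_pi un andbT.
    have vn : (v < n)%N by have : v \in filter (AU W) pi by [rewrite E mem_head]; rewrite mem_filter mem_pi => /andP[].
    rewrite E0 -[(rho * _)%N]addn0; apply: att_mono => //.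
    * exact: boxy_AU.
    * by have := wfb_blk (AU W); rewrite E0.
    * by apply: leq_trans KS; apply: leq_trans (hK W _); [rewrite E0 | left].
    * have h1 := @att1 R n S P v vn; apply: (att_eq _ (perm_refl _) h1) => u un; by rewrite mv.
  + have uv : uniq (filter (AU W) pi) by rewrite filter_uniq // uniq_pi.
    have mv w : w \in [:: v, u & s] -> AU W w /\ (w < n)%N.
      by rewrite -E mem_filter mem_pi => /andP[].
    have [v1 v2] := mv v (mem_head _ _); have [|u1 u2] := mv u; first by rewrite !inE eqxx orbT.
    (* A leaf is a single pixel, and pixels separate terminals. *)
    suff e : v = u by move: uv; rewrite E e /= mem_head.
    apply: pix_inj => // c; move: v1 u1 (lo c); rewrite /AU !(inWb _ c) /inB.
    by case/andP=> + _ /andP[+ _]; clear; lia.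
have hA v : AU W v = AU (lft W b i) v || AU (rgt W b i) v /\ ~~ (AU (lft W b i) v && AU (rgt W b i) v).
  have [e1 e2] := inW_cut pix (P v) hi0; rewrite /AU e1 e2.
  by case: (inW _ _ _); case: (_ < i)%N.
have {}IH1 := IH1 lo.1 (fun U h => hK U (or_intror (or_introl h))).
have {}IH2 := IH2 lo.2 (fun U h => hK U (or_intror (or_intror h))).
have k1 : (size (blk (AU (lft W b i)) pi) <= K)%N.
  by apply: hK; right; left; case: (t1) => *; left.
have k2 : (size (blk (AU (rgt W b i)) pi) <= K)%N.
  by apply: hK; right; right; case: (t2) => *; left.
set A1 := AU (lft W b i) in hA IH1 k1; set A2 := AU (rgt W b i) in hA IH2 k2.
have cE : size (filter (AU W) pi) = (size (filter A1 pi) + size (filter A2 pi))%N.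
  rewrite !size_filter -count_predUI -[LHS]addn0; congr (_ + _)%N.
    by apply: eq_count => v /=; rewrite (hA v).1.
  by apply/esym/eqP; rewrite -leqn0 leqNgt -has_count; apply/hasPn => v _; apply: (hA v).2.
have ne A v : (v < n)%N -> size (filter A pi) = 0%N -> A v = false.
  move=> vn /size0nil E; have : v \notin filter A pi by rewrite E.
  by rewrite mem_filter mem_pi vn andbT => /negbTE.
have [e1|e1] := posnP (size (filter A1 pi)).
  rewrite cE e1 add0n; apply: att_blk_ext IH2 => v vn.
  by rewrite (hA v).1 (ne A1).
have [e2|e2] := posnP (size (filter A2 pi)).
  rewrite cE e2 addn0; apply: att_blk_ext IH1 => v vn.
  by rewrite (hA v).1 (ne A2) // orbF.
have [w1 w2] := (wfb_blk A1, wfb_blk A2).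
have [s1 s2] := (leq_trans k1 KS, leq_trans k2 KS).
(* Both parts are nonempty, so each is ready at least [rho] rounds before the whole is due; these
   rounds pay for the union and the links. *)
pose r := (rho * (size (filter A1 pi) + size (filter A2 pi)).-1)%N.
have f1 : att n S P (tabs r) A1 (blk A1 pi).
  rewrite -(@subnK (rho * size (filter A1 pi)) r); first by apply: att_mono (boxy_AU _) w1 s1 IH1.
  by rewrite /r leq_mul2l -ltnS prednK ?addn_gt0 ?e1 // -{1}[size _]addn0 ltn_add2l e2 orbT.
have f2 : att n S P (tabs r) A2 (blk A2 pi).
  rewrite -(@subnK (rho * size (filter A2 pi)) r); first by apply: att_mono (boxy_AU _) w2 s2 IH2.
  by rewrite /r leq_mul2l -ltnS prednK ?addn_gt0 ?e1 // -{1}[size _]add0n ltn_add2r e1 orbT.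
have w12 : wfb n (blk A1 pi ++ blk A2 pi).
  split; last by move=> p; rewrite mem_cat => /orP[]; [apply: w1.2 | apply: w2.2].
  rewrite flatten_cat cat_uniq w1.1 w2.1 andbT; apply/hasPn => v; rewrite !blk_flatten !mem_filter.
  by case/andP=> a2 _; have := (hA v).2; rewrite a2 andbT => /negbTE->.
have f3 : att n S P (tabs r.+1) (AU W) (blk A1 pi ++ blk A2 pi).
  apply: att_union (boxy_AU _) (boxy_AU _) w1 w2 s1 s2 _ _ f1 f2 => v vn; first exact: (hA v).1.
  exact: (hA v).2.
have s12 : (size (blk A1 pi ++ blk A2 pi) <= 2 * K)%N by rewrite size_cat mul2n -addnn leq_add.
have f4 := att_links (boxy_AU W) (blk_link pi (fun v => (hA v).1) (fun v => (hA v).2)) w12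
  (leq_trans s12 SK) f3.
rewrite cE -(@subnK (size (blk A1 pi ++ blk A2 pi) + r.+1) (rho * _)).
  apply: att_mono f4; [exact: boxy_AU | exact: wfb_blk |].
  by apply: leq_trans KS; apply: hK; left.
have -> : (rho * (size (filter A1 pi) + size (filter A2 pi)) = rho + r)%N.
  by rewrite /r -mulnS prednK // addn_gt0 e1.
by rewrite /rho; move: s12; clear; lia.
Qed.

Lemma node_att W (t : bsp W) U : leaves_ok t -> (forall U, isnode t U -> (size (blk (AU U) pi) <= K)%N) ->
  isnode t U -> att n S P (tabs (rho * n)) (AU U) (blk (AU U) pi).
Proof.
move=> l hK hU; have [t' [l' ht']] := node_subtree l hU.
have h := bsp_att l' (fun U' h => hK U' (ht' U' h)).
rewrite -(@subnK (rho * size (filter (AU U) pi)) (rho * n)).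
  apply: att_mono h; first exact: boxy_AU.
    exact: wfb_blk.
  by apply: leq_trans (hK U hU) _; apply: leq_trans SK; rewrite mul2n -addnn leq_addr.
rewrite leq_mul2l; apply/orP; right.
by rewrite size_filter -(size_iota 0 n) -(perm_size pi_perm) count_size.
Qed.

(** A cell is a node, so its at most [K] blocks are attained, and [K] more rounds concatenate them
    to the restriction of [pi] to the cell. By soundness the entry of the corresponding row is
    realized by actual paths, and its end counts leave room for one path only. *)
Theorem dp_cells W (t : bsp W) (cell : nat -> nat) : leaves_ok t ->
    (forall U, isnode t U -> (size (blk (AU U) pi) <= K)%N) -> (0 < K)%N ->
    (forall v, (v < n)%N -> exists2 U, isnode t U & forall u, (u < n)%N -> AU U u = (cell u == cell v)) ->
  forall c, exists idx p, [/\ (idx < tsize n S)%N, uniq p,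
    forall v, (v \in p) = (v < n)%N && (cell v == c),
    forall v, (v < n)%N -> inb n P idx v = (cell v == c) &
    (forall u v, (u < n)%N -> (v < n)%N -> tb (tabs (K + rho * n)) idx u v = befs u v p) /\
    plen d p <= plen d [seq v <- pi | cell v == c]].
Proof.
move=> l hK K0 hc c.
have KS : (K <= S)%N by apply: leq_trans SK; rewrite mul2n -addnn leq_addr.
have [/hasP[v0 + /eqP e0]|/hasPn none] := boolP (has (fun v => cell v == c) pi); last first.
  have [|idx iT hr] := @key_exists R n S P pred0 [::] (boxy0 n P) (wfb0 n); first by [].
  have [vi ci] := @att0 R n S P (K + rho * n) idx iT hr.
  have [bl [w m e cl f]] := sound_iter vi.
  have hv v : (v < n)%N -> (cell v == c) = false by rewrite -mem_pi => /none/negbTE.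
  have bl0 : bl = [::].
    apply: flatten_nil => [x /(w.2)[]//|].
    case E : (flatten bl) => [//|v s]; have := m v; rewrite E mem_head => /esym/andP[vn].
    by rewrite hr.1.
  exists idx, [::]; split=> //.
  - by move=> v; rewrite in_nil; case: ltnP => // vn; rewrite hv.
  - by move=> v vn; rewrite hv // hr.1.
  - split; first by move=> u v un vn; rewrite f // bl0.
    by rewrite plen_ge0 // => x y; apply: edist_ge0.
rewrite mem_pi => v0n; have [U hU hUc] := hc v0 v0n; rewrite e0 in hUc.
have fE : filter (AU U) pi = [seq v <- pi | cell v == c].
  by apply: eq_in_filter => v; rewrite mem_pi; apply: hUc.
have sb : (0 < size (blk (AU U) pi))%N.
  rewrite lt0n size_eq0; apply/eqP => E; have : v0 \in flatten (blk (AU U) pi).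
    by rewrite blk_flatten mem_filter mem_pi v0n hUc // e0 eqxx.
  by rewrite E.
have h1 := node_att l hK hU.
have h2 := att_links (boxy_AU U) (link_flatten sb) (wfb_blk _) (leq_trans (hK U hU) KS) h1.
rewrite blk_flatten fE in h2; set q := [seq v <- pi | cell v == c] in h2 fE *.
have wq : wfb n [:: q].
  split; first by rewrite /= cats0 filter_uniq // uniq_pi.
  move=> x; rewrite inE => /eqP->; split; last by apply/allP => v; rewrite mem_filter mem_pi => /andP[].
  by apply/eqP => E; have : v0 \in q by [rewrite mem_filter mem_pi v0n e0 eqxx]; rewrite E.
have h3 : att n S P (tabs (K + rho * n)) (AU U) [:: q].
  rewrite -(@subnK (size (blk (AU U) pi) + rho * n) (K + rho * n)) ?leq_add2r ?hK //.
  by apply: att_mono h2 => //; [apply: boxy_AU | apply: leq_trans KS].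
have [|idx iT hr] := @key_exists R n S P (AU U) [:: q] (boxy_AU U) wq; first exact: leq_trans KS.
have [vi ci] := h3 idx iT hr.
have [bl [w m e cl f]] := sound_iter vi.
have hi v : (v < n)%N -> inb n P idx v = (cell v == c) by move=> vn; rewrite hr.1 // hUc.
have [h1n h2n] := wfb_ends wq (mem_head _ _).
have ee x y : (x < n)%N -> (y < n)%N -> ends n bl x y = (head n q == x) && (last n q == y) :> nat.
  by move=> xn yn; rewrite -e // hr.2 // /ends /= addn0.
have : exists p, bl = [:: p].
  have ep p : p \in bl -> (head n q == head n p) && (last n q == last n p).
    move=> pb; have [p1 p2] := wfb_ends w pb; have := ee _ _ p1 p2.
    case: (_ && _) => // /eqP; rewrite /ends -leqn0 leqNgt -has_count => /hasPn/(_ p pb).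
    by rewrite !eqxx.
  case: (bl) w ee ep => [|p [|p' bl']] w' ee ep; last 2 first.
  - by exists p.
  - have := ee _ _ h1n h2n; rewrite !eqxx /ends /=.
    have /andP[/eqP<- /eqP<-] := ep p (mem_head _ _).
    have /andP[/eqP<- /eqP<-] := ep p' (mem_behead (s := [:: p, p' & bl']) (mem_head _ _)).
    by rewrite !eqxx.
  by have := ee _ _ h1n h2n; rewrite !eqxx.
case=> p blE; exists idx, p; split=> //.
- by have := w.1; rewrite blE /= cats0.
- move=> v; have := m v; rewrite blE /= cats0 => ->.
  by case: ltnP => //= vn; rewrite hi.
- split; first by move=> u v un vn; rewrite f // blE /= orbF.
  by move: ci; rewrite cl blE /path_bound !big_seq1.
Qed.

End Tree.

Section Split.
Variable R : realType.
Variables (V : eqType) (d : V -> V -> R) (cell : V -> nat) (Dm : R).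
Hypothesis d_ge0 : forall x y, 0 <= d x y.

Lemma plen_flatten (bl : seq (seq V)) : (forall x y, x \in flatten bl -> y \in flatten bl -> d x y <= Dm) -> 0 <= Dm ->
  plen d (flatten bl) <= \sum_(p <- bl) plen d p + (size bl)%:R * Dm.
Proof.
move=> hD D0; elim: bl hD => [|p bl IH] hD /=; first by rewrite big_nil mul0r addr0.
have {}IH : plen d (flatten bl) <= \sum_(p <- bl) plen d p + (size bl)%:R * Dm.
  by apply: IH => x y hx hy; apply: hD; rewrite /= mem_cat ?hx ?hy orbT.
rewrite big_cons -natr1; case: p hD => [|x p] hD /=; first by lra.
rewrite plf_cat; case E : (flatten bl) IH => [|y s] /= IH; first by lra.
have : d (last x p) y <= Dm.
  by apply: hD; rewrite /= ?E -cat_cons mem_cat ?mem_last // mem_head orbT.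
by move: IH; lra.
Qed.

(** Each step of [s] stays inside at most one cell and is counted for no other. *)
Lemma blk_cells N s : \sum_(c < N) \sum_(x <- blk (fun v => cell v == c) s) plen d x <= plen d s.
Proof.
under eq_bigr => c _ do rewrite blk_plen.
case: s => [|v s]; first by rewrite big1_eq.
elim: s v => [|u s IH] v /=; first by rewrite big1_eq.
rewrite big_split /= lerD //.
have [h|h] := ltnP (cell v) N; last first.
  rewrite big1 ?d_ge0 // => c _; case: eqP => //= e; by move: h; rewrite e leqNgt ltn_ord.
rewrite (bigD1 (Ordinal h)) //= big1 ?addr0; first by case: ifP.
by move=> c /eqP nc; case: eqP => //= e; case: nc; apply/val_inj.
Qed.

End Split.

(** * Decoding *)

Definition rsum (R : realType) (b : nat) (F : nat -> R) : R := \sum_(i < b) F i.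

(* Listing every [s] exactly [u s] times, for [s = 0, 1, ...], the item of
   index [k] is [find u N k]. *)
Definition find (u : nat -> nat) (N k : nat) : nat := nsum N (fun s => nat_of_bool (nsum s.+1 u <= k)%N).

Lemma nsumS N F : nsum N.+1 F = (nsum N F + F N)%N.
Proof. exact: big_ord_recr. Qed.

Lemma nsum_le N F G : (forall i, (i < N)%N -> (F i <= G i)%N) -> (nsum N F <= nsum N G)%N.
Proof. by move=> h; apply: leq_sum => i _; apply: h. Qed.

Lemma nsum_mono N M F : (N <= M)%N -> (nsum N F <= nsum M F)%N.
Proof. by move/subnK <-; elim: (M - N)%N => [//|k IH]; rewrite addSn nsumS (leq_trans IH) ?leq_addr. Qed.

Lemma nsum_count N (a : pred nat) : nsum N (fun i => nat_of_bool (a i)) = count a (iota 0 N).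
Proof. by elim: N => [|N IH]; rewrite ?nsumS ?IH -?[N.+1]addn1 ?iotaD ?count_cat /nsum ?big_ord0 //= addn0. Qed.

Lemma find_mono u N k l : (k <= l)%N -> (find u N k <= find u N l)%N.
Proof. by move=> kl; apply: nsum_le => s _; case E : (nsum s.+1 u <= k)%N => //; rewrite (leq_trans E kl). Qed.

Lemma find_all u N k : (nsum N u <= k)%N -> find u N k = N.
Proof.
elim: N => [|N IH] h; first by rewrite /find /nsum big_ord0.
by rewrite /find nsumS -/(find u N k) h IH ?addn1 // (leq_trans (nsum_mono _ (leqnSn N)) h).
Qed.

Lemma find_spec u N k : (k < nsum N u)%N ->
  [/\ (find u N k < N)%N, (nsum (find u N k) u <= k)%N & (k < nsum (find u N k).+1 u)%N].
Proof.
elim: N => [|N IH] h; first by rewrite /nsum big_ord0 in h.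
rewrite /find nsumS -/(find u N k); move: (h); rewrite ltnNge => /negbTE->; rewrite addn0.
have [h2|h2] := leqP (nsum N u) k; first by rewrite find_all.
by have [h3 h4 h5] := IH h2; split=> //; apply: ltnW.
Qed.

Lemma find_eq u N k l : (k < nsum N u)%N -> (l < nsum N u)%N -> (forall s, (u s <= 1)%N) ->
  find u N k = find u N l -> k = l.
Proof.
move=> /find_spec[_ a b] /find_spec[_ a' b'] u1 e; move: a b a' b'; rewrite e !nsumS.
by have := u1 (find u N l); move: (nsum _ _) (u _); clear; lia.
Qed.

Lemma find_pos u N k : (k < nsum N u)%N -> (0 < u (find u N k))%N.
Proof. by move=> /find_spec[_ a]; rewrite nsumS; move: a; move: (nsum _ _) (u _); clear; lia. Qed.

Module Decode.
Section Decoder.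
Variable R : realType.
Variables (n : nat) (P : nat -> R * R) (O : R * R) (dem : nat -> R).
Variables (H J Nc m : nat).
Variables (inbx : nat -> nat -> bool) (bef : nat -> nat -> nat -> bool) (wid : nat -> nat).
Variables (sc sl sq : nat -> nat).
Implicit Types (u v c s j i k : nat).

Definition cellv v := nsum Nc (fun c => if inbx c v then c else 0%N).
(** Positions are counted from 1, as the relation [bef] is reflexive on a path. *)
Definition posv v := nsum n (fun u => nat_of_bool (bef (cellv v) u v)).
Definition large v : bool := ~~ (H%:R * dem v <= 1).
(** Ties are broken by the index, which gives the large items of a cell distinct ranks. *)
Definition heavier u v : bool := (dem v <= dem u) && (~~ (dem u <= dem v) || (u < v)%N).
Definition rk v := nsum n (fun u => nat_of_bool [&& large u, cellv u == cellv v & heavier u v]).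
Definition grp v := (rk v %/ wid (cellv v))%N.
Definition rem v := (rk v %% wid (cellv v))%N.
Definition pre v : R := rsum n (fun u =>
  if [&& ~~ large u, cellv u == cellv v & (posv u < posv v)%N] then dem u else 0).
(** The floor of [H * pre v], that is, the unit of size 1/H in which [v] begins on its path; it is
    obtained by counting for want of rounding. *)
Definition kv v := nsum n (fun k => nat_of_bool (k.+1%:R <= H%:R * pre v)).
(** Labels are shifted by one: label 0 is left for slots without a large item. *)
Definition uL v s : nat := nat_of_bool ((sc s == cellv v) && (sl s == (grp v).+1)).
Definition uS v s : nat := if sc s == cellv v then sq s else 0%N.
(** Large items of a group take one matching slot each, by their index in the group; small items are
    poured into the units of the slots of their cell in the order of the path. *)
Definition sig v :=
  if large v then find (uL v) (m * J) (rem v) else find (uS v) (m * J) (kv v).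
Definition trip v := (sig v %/ J)%N.
Definition load j : R := rsum n (fun v => if trip v == j then dem v else 0).
Definition okd : bool := nall n (fun v => sig v < m * J)%N && nall m (fun j => load j <= 1).
(** Lexicographic order by slot, then by position on the path, packed in base [n.+1]; ranking the
    terminals by this key lists them tour by tour. *)
Definition key v := ((sig v * n.+1 + posv v) * n.+1 + v)%N.
Definition rank v := nsum n (fun u => nat_of_bool (key u < key v)%N).
Definition ordv i := nsum n (fun v => if rank v == i then v else 0%N).
Definition len j := nsum n (fun v => nat_of_bool (trip v == j)).
Definition off j := nsum n (fun v => nat_of_bool (trip v < j)%N).
Definition pt j i : R * R := if (0 < i <= len j)%N then P (ordv (off j + i.-1)) else O.
Definition costd : R := rsum m (fun j => rsum (len j).+1 (fun i => edist (pt j i) (pt j i.+1))).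

Definition tl j := mkseq (fun i => ordv (off j + i)) (len j).

Lemma posv_le v : (posv v <= n)%N.
Proof. by rewrite /posv nsum_count -[X in (_ <= X)%N](size_iota 0) count_size. Qed.

Lemma key_lt u v : (u < n)%N -> (v < n)%N -> (key u < key v)%N =
  [|| sig u < sig v, (sig u == sig v) && (posv u < posv v) |
      [&& sig u == sig v, posv u == posv v & u < v]]%N.
Proof.
move=> un vn; have h x y a b : (a < n.+1)%N -> (b < n.+1)%N ->
    (x * n.+1 + a < y * n.+1 + b)%N = (x < y)%N || ((x == y) && (a < b)%N).
  by move=> h1 h2; apply/idP/idP; nia.
rewrite /key !h ?ltnS ?posv_le ?(ltnW un) ?(ltnW vn) //.
rewrite -orbA; congr (_ || (_ || _)).
rewrite andbA; congr (_ && _); apply/eqP/andP => [e|[/eqP-> /eqP->//]].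
have := congr1 (fun z => z %/ n.+1)%N e; rewrite /= !divnMDl // !divn_small ?ltnS ?posv_le // !addn0 => e1.
by move: e; rewrite e1 => /addnI->; rewrite !eqxx.
Qed.

Lemma key_inj u v : (u < n)%N -> (v < n)%N -> key u = key v -> u = v.
Proof.
move=> un vn e; have := key_lt un vn; have := key_lt vn un; rewrite e ltnn.
by move: (sig u) (sig v) (posv u) (posv v); clear; lia.
Qed.

Lemma rank_count v : rank v = count (fun u => key u < key v)%N (iota 0 n).
Proof. exact: nsum_count. Qed.

Lemma rank_lt v : (v < n)%N -> (rank v < n)%N.
Proof.
move=> vn; rewrite rank_count -[X in (_ < X)%N](size_iota 0 n) ltn_neqAle count_size andbT.
by rewrite -all_count; apply/allPn; exists v; rewrite ?mem_iota // ltnn.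
Qed.

Lemma rank_mono u v : (u < n)%N -> (v < n)%N -> (rank u < rank v)%N = (key u < key v)%N.
Proof.
have aux a b : (a < n)%N -> (key a < key b)%N -> (rank a < rank b)%N.
  move=> an ab; rewrite !rank_count.
  have -> : count (fun u => key u < key b)%N (iota 0 n) =
    (count (fun u => key u < key a)%N (iota 0 n) +
     count (fun u => key a <= key u < key b)%N (iota 0 n))%N.
    rewrite -count_predUI [X in (_ = _ + X)%N](_ : _ = 0%N) ?addn0.
      by apply: eq_count => x /=; move: ab; clear; lia.
    by apply/eqP; rewrite -leqn0 leqNgt -has_count; apply/hasPn => x _ /=; clear; lia.
  by rewrite -addn1 leq_add2l -has_count; apply/hasP; exists a; rewrite ?mem_iota //= leqnn.
move=> un vn; apply/idP/idP; last exact: aux.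
apply: contraTT; rewrite -leqNgt leq_eqVlt => /orP[/eqP/esym/(key_inj un vn)->|h]; first by rewrite ltnn.
by rewrite -leqNgt; apply/ltnW/aux.
Qed.

Lemma rank_inj u v : (u < n)%N -> (v < n)%N -> rank u = rank v -> u = v.
Proof.
move=> un vn e; apply: key_inj => //.
by case: (ltngtP (key u) (key v)) => //; rewrite -rank_mono // e ltnn.
Qed.

Lemma rank_surj i : (i < n)%N -> exists2 v, (v < n)%N & rank v = i.
Proof.
move=> ni; have : i \in [seq rank v | v <- iota 0 n].
  have h1 : uniq [seq rank v | v <- iota 0 n].
    by rewrite map_inj_in_uniq ?iota_uniq // => u v; rewrite !mem_iota => un vn; apply: rank_inj.
  have h2 : {subset [seq rank v | v <- iota 0 n] <= iota 0 n}.
    by move=> x /mapP[v]; rewrite !mem_iota => vn ->; rewrite /= rank_lt.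
  have [|_ e] := uniq_min_size h1 h2; first by rewrite size_map.
  by rewrite e mem_iota.
by case/mapP=> v; rewrite mem_iota => vn ->; exists v.
Qed.

Lemma ordvE v : (v < n)%N -> ordv (rank v) = v.
Proof.
move=> vn; rewrite /ordv /nsum (bigD1 (Ordinal vn)) //= eqxx big1 ?addn0 // => u /eqP nu.
case: eqP => // e; case: nu; apply/val_inj => /=; exact: rank_inj.
Qed.

Lemma trip_key u v : (u < n)%N -> (v < n)%N -> (trip u < trip v)%N -> (key u < key v)%N.
Proof.
move=> un vn h; rewrite key_lt //; suff -> : (sig u < sig v)%N by [].
by rewrite ltnNge; apply: contraL h => h; rewrite -leqNgt leq_div2r.
Qed.

Lemma offS j : off j.+1 = (off j + len j)%N.
Proof.
rewrite /off /len /nsum -big_split /=; apply: eq_bigr => v _.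
by move: (trip v); clear; lia.
Qed.

Lemma rank_trip v : (v < n)%N -> (off (trip v) <= rank v < off (trip v) + len (trip v))%N.
Proof.
move=> vn; rewrite -offS; apply/andP; split.
  by apply: nsum_le => u un; case: ltnP => // h; rewrite trip_key.
rewrite /off /nsum (bigD1 (Ordinal vn)) //= ltnSn add1n ltnS /rank /nsum (bigD1 (Ordinal vn)) //= ltnn add0n.
apply: leq_sum => u _; case: ltnP => // h; rewrite ltnS.
by have [//|h'] := leqP (trip u) (trip v); have := trip_key vn (ltn_ord u) h'; rewrite ltnNge (ltnW h).
Qed.

Lemma off_le j : (off j <= n)%N.
Proof. by rewrite /off nsum_count -[X in (_ <= X)%N](size_iota 0) count_size. Qed.

Lemma off_mono j j' : (j <= j')%N -> (off j <= off j')%N.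
Proof. by move=> h; apply: nsum_le => v _; case: ltnP => // h'; rewrite (leq_trans h' h). Qed.

Lemma ordv_tl j i : (i < len j)%N -> exists v, [/\ (v < n)%N, rank v = (off j + i)%N, trip v = j & ordv (off j + i) = v].
Proof.
move=> hi; have [|v vn e] := @rank_surj (off j + i).
  by apply: leq_trans (off_le j.+1); rewrite offS ltn_add2l.
exists v; split=> //; last by rewrite -e ordvE.
have := rank_trip vn; rewrite e -offS.
have [h|h|//] := ltngtP (trip v) j.
  by have := off_mono h; move: hi; clear; lia.
by have := off_mono h; rewrite offS; move: hi; clear; lia.
Qed.

Lemma mem_tl j v : (v \in tl j) = (v < n)%N && (trip v == j).
Proof.
apply/mapP/andP => [[i]|[vn /eqP e]].
  by rewrite mem_iota => hi ->; have [w [wn _ tw ->]] := ordv_tl hi; rewrite tw eqxx.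
have := rank_trip vn; rewrite e => /andP[h1 h2].
by exists (rank v - off j)%N; rewrite ?subnKC ?ordvE // mem_iota /= add0n ltn_subLR.
Qed.

Lemma sorted_tl j : sorted (fun u v => key u < key v)%N (tl j).
Proof.
apply/(sortedP 0%N) => i; rewrite size_mkseq => hi; rewrite !nth_mkseq ?(ltnW hi) //.
have [v [vn rv _ ->]] := ordv_tl (ltnW hi); have [w [wn rw _ ->]] := ordv_tl hi.
by rewrite -rank_mono // rv rw ltn_add2l.
Qed.

Lemma uniq_tl j : uniq (tl j).
Proof.
by apply: sorted_uniq (sorted_tl j) => [u v w|u]; [apply: ltn_trans | rewrite ltnn].
Qed.

Lemma costdE : costd = \sum_(j < m) plf (@edist R) O (rcons (map P (tl j)) O).
Proof.
apply: eq_bigr => j _; rewrite -plf_pairmap (big_nth 0) size_pairmap size_rcons size_map size_mkseq big_mkord.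
apply: eq_bigr => i _; rewrite (nth_pairmap O) ?size_rcons ?size_map ?size_iota ?size_mkseq //.
have e k : nth O (rcons (map P (tl j)) O) k = pt j k.+1.
  rewrite nth_rcons size_map size_mkseq /pt /=; case: ltnP => h; last by rewrite if_same.
  by rewrite (nth_map 0%N) ?size_mkseq // nth_mkseq.
by case: i => [[|i] hi] /=; rewrite !e // /pt.
Qed.

End Decoder.
End Decode.
Import Decode.

Lemma count_floor (R : realType) n (x : R) : x < n.+1%:R ->
  nsum n (fun k => nat_of_bool (k.+1%:R <= x)) = Num.truncn x.
Proof.
move=> h; rewrite /nsum; have e k : (k.+1%:R <= x) = (k < Num.truncn x)%N.
  by have := truncn_le_nat x k; rewrite leqNgt ltNge => /negb_inj.
under eq_bigr => k _ do rewrite e.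
by rewrite sum_lt; apply/minn_idPr; rewrite -ltnS ltnNge -e -ltNge.
Qed.

Lemma filter_nil (T : eqType) (a : pred T) s : (forall x, x \in s -> ~~ a x) -> filter a s = [::].
Proof.
move=> h; apply/eqP; rewrite -size_eq0 size_filter -leqn0 leqNgt -has_count.
exact/hasPn.
Qed.

Lemma sorted_split (T : eqType) (f : T -> nat) a s : sorted (relpre f leq) s ->
    (forall v, v \in s -> a <= f v)%N ->
  s = [seq v <- s | f v == a] ++ [seq v <- s | (a < f v)%N].
Proof.
elim: s => [//|v s IH] srt h /=; have hv := h v (mem_head _ _).
have {}IH := IH (path_sorted srt) (fun u us => h u (mem_behead (s := v :: s) us)).
have [e|ne] := eqVneq (f v) a; first by rewrite e ltnn {1}IH.
have lt : (a < f v)%N by rewrite ltn_neqAle eq_sym ne.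
have al : all (fun u => a < f u)%N s.
  apply/allP => u us; apply: leq_trans lt _; move: srt => /=; rewrite path_sortedE.
    by case/andP=> /allP/(_ u us).
  by move=> x y z; apply: leq_trans.
rewrite lt (all_filterP al) (_ : [seq u <- s | f u == a] = [::]) //.
by apply/eqP; rewrite -(negbK (_ == _)) -has_filter; apply/hasPn => u /(allP al); rewrite ltn_neqAle eq_sym => /andP[].
Qed.

Lemma sorted_slots (T : eqType) (f : T -> nat) a J s : sorted (relpre f leq) s ->
    (forall v, v \in s -> a <= f v < a + J)%N ->
  s = flatten [seq [seq v <- s | f v == i] | i <- iota a J].
Proof.
elim: J a s => [|J IH] a s srt h.
  by case: s {srt} h => // v s /(_ v (mem_head _ _)); rewrite addn0 ltnNge => /andP[->].
have h1 v : v \in s -> (a <= f v)%N by move=> /h/andP[].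
rewrite {1}(sorted_split srt h1) /=; congr (_ ++ _).
rewrite {1}(IH a.+1 [seq v <- s | (a < f v)%N]).
- congr flatten; apply/eq_in_map => i; rewrite mem_iota => /andP[ai _].
  by rewrite -filter_predI; apply: eq_filter => v /=; case: eqP => // ->.
- by apply: sorted_filter srt => x y z; apply: leq_trans.
- by move=> v; rewrite mem_filter => /andP[av /h/andP[_]]; rewrite av addSnnS.
Qed.

Lemma plen_mono_filter (R : realType) (T : eqType) (d : T -> T -> R) (f : T -> nat) N s :
    (forall x y, 0 <= d x y) -> sorted (relpre f leq) s ->
  \sum_(i < N) plen d [seq v <- s | f v == i] <= plen d s.
Proof.
move=> d0; elim: s => [|v s IH] srt; first by rewrite big1_eq.
have {}IH := IH (path_sorted srt); case: s IH srt => [|u s] IH srt.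
  by rewrite big1 // => i _ /=; case: ifP.
apply: (@le_trans _ _ (\sum_(i < N) ((if f v == i then d v u else 0) + plen d [seq w <- u :: s | f w == i]))).
  apply: ler_sum => i _; have [e|ne] := eqVneq (f v) i; last by rewrite add0r [X in plen d X <= _]/= (negPf ne).
  have [e2|ne2] := eqVneq (f u) i; first by rewrite /= e e2 eqxx /=.
  have E : [seq w <- u :: s | f w == i] = [::].
    apply: filter_nil => w wus.
    have : (f v < f w)%N.
      move: srt; rewrite /= path_sortedE; last by move=> x y z; apply: leq_trans.
      case/and3P=> vu /allP al _.
      have vu' : (f v < f u)%N by rewrite ltn_neqAle vu andbT e eq_sym.
      move: wus; rewrite inE => /orP[/eqP->//|ws]; apply: leq_trans vu' _.
      exact: al.
    by rewrite -e ltn_neqAle eq_sym => /andP[].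
  have -> : [seq w <- v :: u :: s | f w == i] = v :: [seq w <- u :: s | f w == i] by rewrite [LHS]/= e eqxx.
  by rewrite E /= addr0.
rewrite big_split /= lerD //.
have [h|h] := ltnP (f v) N; last by rewrite big1 // => i _; case: eqP => // e; move: (ltn_ord i); rewrite -e ltnNge h.
by rewrite (bigD1 (Ordinal h)) //= eqxx big1 ?addr0 // => i /eqP ni; case: eqP => // e; case: ni; apply/val_inj.
Qed.

(** Instead of stopping at [r i], the walk goes from there to the block, follows it and returns,
    which adds at most [2%:R * dl i] to the length of the block. *)
Lemma polygon (R : realType) (O : R * R) (B : nat -> seq (R * R)) (r : nat -> R * R) (dl : nat -> R) s x :
    (forall i, 0 <= dl i) -> (forall i y, i \in s -> y \in B i -> edist y (r i) <= dl i) ->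
  plf (@edist R) x (flatten [seq B i | i <- s] ++ [:: O]) <=
  plf (@edist R) x ([seq r i | i <- s] ++ [:: O]) + \sum_(i <- s) (2%:R * dl i + plen (@edist R) (B i)).
Proof.
move=> dl0; elim: s x => [|i s IH] x hB; first by rewrite big_nil addr0.
rewrite big_cons /= -catA; have {}IH y := IH y (fun j z js => hB j z (mem_behead (s := i :: s) js)).
have {}hB := hB i _ (mem_head _ _).
set rest := flatten _ ++ _ in IH *; set rr := _ ++ _ in IH *.
have tr y := @plf_tri R _ (@edist R) (@edist_ge0 R) (@edist_tri R) y (r i) rest.
have IHi := IH (r i).
case: (B i) hB => [|b B'] hB /=; first by have := tr x; have := dl0 i; lra.
rewrite plf_cat; have h1 := hB b (mem_head _ _); have h2 := hB (last b B') (mem_last _ _).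
have h3 := edist_tri x (r i) b; rewrite (edistC (r i) b) in h3.
by have := tr (last b B'); lra.
Qed.

(** * Feasibility and cost of a decoded plan *)

Section Good.
Variable R : realType.
Variables (n : nat) (P : nat -> R * R) (O : R * R) (dem : nat -> R).
Variables (H J Nc m : nat).
Variables (inbx : nat -> nat -> bool) (bef : nat -> nat -> nat -> bool) (wid : nat -> nat).
Variables (sc sl sq : nat -> nat).
Variables (cell : nat -> nat) (p : nat -> seq nat) (cap dl : nat -> R) (rep : nat -> nat).
Implicit Types (u v c s j i k : nat).
Notation cellv := (cellv Nc inbx).
Notation posv := (posv n Nc inbx bef).
Notation large := (large dem H).
Notation heavier := (heavier dem).
Notation rk := (rk n dem H Nc inbx).
Notation grp := (grp n dem H Nc inbx wid).
Notation rem := (rem n dem H Nc inbx wid).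
Notation pre := (pre n dem H Nc inbx bef).
Notation kv := (kv n dem H Nc inbx bef).
Notation uL := (uL n dem H Nc inbx wid sc sl).
Notation uS := (uS Nc inbx sc sq).
Notation sig := (sig n dem H J Nc m inbx bef wid sc sl sq).
Notation trip := (trip n dem H J Nc m inbx bef wid sc sl sq).
Notation load := (load n dem H J Nc m inbx bef wid sc sl sq).
Notation okd := (okd n dem H J Nc m inbx bef wid sc sl sq).
Notation key := (key n dem H J Nc m inbx bef wid sc sl sq).
Notation costd := (costd n P O dem H J Nc m inbx bef wid sc sl sq).
Notation tl := (tl n dem H J Nc m inbx bef wid sc sl sq).
Notation d := (fun u v => edist (P u) (P v)).

(** A slot of [sq s] units reserves one more, because the last item beginning in these units may
    stick out by up to 1/H. *)
Definition room s : R :=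
  if (0 < sl s)%N then cap s else if (0 < sq s)%N then (sq s).+1%:R / H%:R else 0.

Hypothesis dem_gt0 : forall v, (v < n)%N -> 0 < dem v.
Hypothesis H_gt0 : (0 < H)%N.
Hypothesis J_gt0 : (0 < J)%N.
Hypothesis cell_lt : forall v, (v < n)%N -> (cell v < Nc)%N.
Hypothesis inbxE : forall c v, (c < Nc)%N -> (v < n)%N -> inbx c v = (cell v == c).
Hypothesis p_uniq : forall c, (c < Nc)%N -> uniq (p c).
Hypothesis mem_p : forall c v, (c < Nc)%N -> (v \in p c) = (v < n)%N && (cell v == c).
Hypothesis befE : forall c u v, (c < Nc)%N -> (u < n)%N -> (v < n)%N -> bef c u v = befs u v (p c).
Hypothesis slq : forall s, (s < m * J)%N -> (0 < sl s)%N -> sq s = 0%N.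
Hypothesis enoughL : forall v, (v < n)%N -> large v -> (rem v < nsum (m * J) (uL v))%N.
Hypothesis enoughS : forall v, (v < n)%N -> ~~ large v -> (kv v < nsum (m * J) (uS v))%N.
Hypothesis cap_ge0 : forall s, 0 <= cap s.
Hypothesis capE : forall v s, (v < n)%N -> large v -> (s < m * J)%N -> sc s = cell v ->
  sl s = (grp v).+1 -> dem v <= cap s.
Hypothesis loadJ : forall j, (j < m)%N -> \sum_(i < J) room (j * J + i) <= 1.
Hypothesis dl_ge0 : forall s, 0 <= dl s.
Hypothesis repE : forall v s, (v < n)%N -> (s < m * J)%N -> sc s = cell v ->
  (0 < sl s)%N || (0 < sq s)%N -> edist (P v) (P (rep s)) <= dl s.

Lemma HR : 0 < H%:R :> R. Proof. by rewrite ltr0n. Qed.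

Lemma cellvE v : (v < n)%N -> cellv v = cell v.
Proof.
move=> vn; rewrite /Decode.cellv /nsum (bigD1 (Ordinal (cell_lt vn))) //=.
rewrite inbxE ?cell_lt // eqxx big1 ?addn0 // => c /eqP nc.
by rewrite inbxE //; case: eqP => // e; case: nc; apply/val_inj.
Qed.

Lemma posvE v : (v < n)%N -> posv v = (index v (p (cell v))).+1.
Proof.
move=> vn; have cn := cell_lt vn; rewrite /Decode.posv cellvE // nsum_count.
set q := p (cell v); have vq : v \in q by rewrite mem_p // vn eqxx.
rewrite (@eq_in_count _ _ (fun u => (u \in q) && (index u q <= index v q)%N)); last first.
  by move=> u; rewrite mem_iota /= => un; rewrite befE // /befs vq.
have -> : count (fun u => (u \in q) && (index u q <= index v q)%N) (iota 0 n) =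
    count (fun u => index u q <= index v q)%N q.
  have -> : count (fun u => (u \in q) && (index u q <= index v q)%N) (iota 0 n) =
      count (fun u => index u q <= index v q)%N (filter (mem q) (iota 0 n)).
    by rewrite count_filter; apply: eq_count => u /=; rewrite andbC.
  apply/permP; apply: uniq_perm; rewrite ?filter_uniq ?iota_uniq ?p_uniq // => u.
  apply/idP/idP; rewrite mem_filter mem_iota /=; first by case/andP.
  by move=> uq; rewrite uq; move: uq; rewrite mem_p // => /andP[].
rewrite -(count_map (index^~ q) (fun i => i <= index v q)%N).
have -> : map (index^~ q) q = iota 0 (size q).
  apply: (@eq_from_nth _ 0%N); first by rewrite size_map size_iota.
  move=> i; rewrite size_map => hi; rewrite (nth_map 0%N) // nth_iota // index_uniq ?p_uniq //.
have := vq; rewrite -index_mem; move: (index v q) (size q) => k N kN.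
rewrite -(subnKC kN) iotaD count_cat (_ : count _ (iota 0 k.+1) = k.+1).
  rewrite (_ : count _ _ = 0%N) ?addn0 //; apply/eqP; rewrite -leqn0 leqNgt -has_count.
  by apply/hasPn => i; rewrite mem_iota add0n -ltnNge => /andP[].
rewrite -[RHS](size_iota 0 k.+1); apply/eqP; rewrite -all_count; apply/allP => i.
by rewrite mem_iota add0n ltnS => /andP[].
Qed.

Lemma posv_inj u v : (u < n)%N -> (v < n)%N -> cell u = cell v -> posv u = posv v -> u = v.
Proof.
move=> un vn e; rewrite !posvE // e => -[]; set q := p _ => h.
have hu : u \in q by rewrite mem_p ?cell_lt // un e eqxx.
have hv : v \in q by rewrite mem_p ?cell_lt // vn eqxx.
by rewrite -[LHS](nth_index 0%N hu) -[RHS](nth_index 0%N hv) h.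
Qed.

Lemma sigL v : (v < n)%N -> large v ->
  [/\ (sig v < m * J)%N, sc (sig v) = cell v & sl (sig v) = (grp v).+1].
Proof.
move=> vn lv; have h := enoughL vn lv; rewrite /Decode.sig lv.
have [h1 _ _] := find_spec h; have := find_pos h; rewrite {1}/Decode.uL cellvE //.
by case: andP => // -[/eqP e1 /eqP e2].
Qed.

Lemma sigS v : (v < n)%N -> ~~ large v ->
  [/\ (sig v < m * J)%N, sc (sig v) = cell v, (0 < sq (sig v))%N & sl (sig v) = 0%N].
Proof.
move=> vn lv; have h := enoughS vn lv; rewrite /Decode.sig (negPf lv).
have [h1 _ _] := find_spec h; have := find_pos h; rewrite {1}/Decode.uS cellvE //.
case: eqP => // e q0; split=> //; apply/eqP; rewrite -leqn0 leqNgt; apply/negP => /(slq h1).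
by move=> e'; rewrite e' in q0.
Qed.

Lemma sig_lt v : (v < n)%N -> (sig v < m * J)%N.
Proof. by move=> vn; case: (boolP (large v)) => [/(sigL vn)[]|/(sigS vn)[]]. Qed.

Lemma sig_cell v : (v < n)%N -> sc (sig v) = cell v.
Proof. by move=> vn; case: (boolP (large v)) => [/(sigL vn)[]|/(sigS vn)[]]. Qed.

Lemma rk_lt u v : (u < n)%N -> (v < n)%N -> large u -> cell u = cell v -> heavier u v -> (rk u < rk v)%N.
Proof.
move=> un vn lu e h; have tr a b c : heavier a b -> heavier b c -> heavier a c.
  rewrite /Decode.heavier => /andP[h1 h2] /andP[h3 h4]; rewrite (le_trans h3 h1) /=.
  case: (boolP (dem a <= dem c)) => //= ac; move: h2 h4; rewrite (le_trans ac h3) (le_trans h1 ac) /=.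
  exact: ltn_trans.
rewrite /Decode.rk /nsum (bigD1 (Ordinal un)) //= [X in (_ < X)%N](bigD1 (Ordinal un)) //= !cellvE // e eqxx lu h /=.
rewrite (_ : heavier u u = false) /=; last by rewrite /Decode.heavier lexx ltnn.
rewrite add0n add1n ltnS; apply: leq_sum => w _; case: and3P => // -[-> -> /=] h'.
by rewrite (tr _ _ _ h' h).
Qed.

Lemma rk_inj u v : (u < n)%N -> (v < n)%N -> large u -> large v -> cell u = cell v -> rk u = rk v -> u = v.
Proof.
move=> un vn lu lv e er; apply/eqP; apply: contraT => ne.
have : heavier u v || heavier v u.
  rewrite /Decode.heavier; case: (ltgtP (dem u) (dem v)) => //= _; by case: (ltngtP u v) ne.
by case/orP=> [/(rk_lt un vn lu e)|/(rk_lt vn un lv (esym e))]; rewrite er ltnn.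
Qed.

(** Equal slots have equal cell and label, hence equal group; inside a group [find] is injective,
    since every slot is offered at most once. *)
Lemma large_slot u v : (u < n)%N -> (v < n)%N -> sig u = sig v -> (0 < sl (sig v))%N -> u = v.
Proof.
move=> un vn e s0.
have lg w : (w < n)%N -> sig w = sig v -> large w.
  move=> wn ew; apply: contraT => /(sigS wn)[_ _ _]; rewrite ew => e0; by rewrite e0 in s0.
have [lu lv] := (lg u un e, lg v vn erefl).
have [_ c1 l1] := sigL un lu; have [_ c2 l2] := sigL vn lv.
have ec : cell u = cell v by rewrite -c1 e.
have eg : grp u = grp v by apply: succn_inj; rewrite -l1 -l2 e.
apply: rk_inj => //; rewrite (divn_eq (rk u) (wid (cellv u))) (divn_eq (rk v) (wid (cellv v))).
rewrite -/(grp u) -/(grp v) -/(rem u) -/(rem v) eg !cellvE // ec; congr (_ + _)%N.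
have eu : uL u = uL v by apply/funext => s; rewrite /Decode.uL !cellvE // ec eg.
have hu := enoughL un lu; have hv := enoughL vn lv; move: hu; rewrite eu => hu.
apply: (find_eq hu hv); first by move=> s; rewrite /Decode.uL; case: (_ && _).
by move: e; rewrite /Decode.sig lu lv eu.
Qed.

Lemma preE v : (v < n)%N -> pre v = \sum_(u < n | [&& ~~ large u, cell u == cell v & (posv u < posv v)%N]) dem u.
Proof. by move=> vn; rewrite [RHS]big_mkcond; apply: eq_bigr => u _; rewrite !cellvE. Qed.

Lemma pre_mono u v : (u < n)%N -> (v < n)%N -> cell u = cell v -> (posv u <= posv v)%N -> pre u <= pre v.
Proof.
move=> un vn e h; apply: ler_sum => w _; rewrite !cellvE // e.
case: (~~ _) => //=; case: (_ == _) => //=; case: ltnP => h1; case: ltnP => h2 //; last first.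
  by apply: ltW; apply: dem_gt0.
by move: (leq_trans h1 h); rewrite ltnNge h2.
Qed.

Lemma pre_ge0 v : 0 <= pre v.
Proof. by apply: sumr_ge0 => w _; case: ifP => // _; apply/ltW/dem_gt0. Qed.

Lemma kvP v : (kv v)%:R <= H%:R * pre v < (kv v).+1%:R.
Proof.
have h0 : 0 <= H%:R * pre v by rewrite mulr_ge0 ?ler0n ?pre_ge0.
rewrite /Decode.kv count_floor; first by rewrite truncn_le h0 truncnS_gt.
apply: (@le_lt_trans _ _ n%:R); last by rewrite ltr_nat.
rewrite /Decode.pre /rsum mulr_sumr -[X in _ <= X%:R](card_ord n) -sum1_card natr_sum.
apply: ler_sum => u _; case: and3P => [[su _ _]|_]; last by rewrite mulr0 ler0n.
by move: su; rewrite /Decode.large negbK.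
Qed.

Lemma kv_mono u v : (u < n)%N -> (v < n)%N -> cell u = cell v -> (posv u <= posv v)%N -> (kv u <= kv v)%N.
Proof.
move=> un vn e h; apply: nsum_le => k _; case E : (_ <= _) => //.
by rewrite (le_trans E) // ler_pM2l ?HR // pre_mono.
Qed.

(** The small items of the slot lie between the first and the last of them, [vm] and [vM], on one
    path. Both begin in units of this slot, so their prefix sums differ by less than [sq s] units,
    and the demand of [vM] adds at most one unit. *)
Lemma slot_load s : (s < m * J)%N -> \sum_(v < n | sig v == s) dem v <= room s.
Proof.
move=> sJ; rewrite /room; case: ltnP => sl0.
  case: (pickP (fun v : 'I_n => sig v == s)) => [v /eqP vs|none]; last by rewrite big_pred0.
  rewrite (big_pred1 v); last first.
    move=> u; apply/eqP/eqP => [us|->//]; apply/val_inj; apply: large_slot => //=; by rewrite ?us ?vs.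
  have vn := ltn_ord v; have lv : large v.
    by apply: contraT => /(sigS vn)[_ _ _]; rewrite vs => e; rewrite e in sl0.
  by have [h1 h2 h3] := sigL vn lv; rewrite vs in h1 h2 h3; apply: capE.
have sm (v : 'I_n) : sig v == s -> [/\ ~~ large v, cell v = sc s & (0 < sq s)%N].
  move=> /eqP vs; case: (boolP (large v)) => [/(sigL (ltn_ord v))[_ _]|].
    by rewrite vs => e; rewrite e in sl0.
  by move=> /[dup] lv /(sigS (ltn_ord v))[_ e q _]; rewrite -vs.
case: (pickP (fun v : 'I_n => sig v == s)) => [v0 v0s|none]; last first.
  by rewrite big_pred0 //; case: ifP => // _; rewrite divr_ge0.
have [_ c0 ->] := sm v0 v0s.
have [vM vMs hM] := @arg_maxnP 'I_n v0 (fun v : 'I_n => sig v == s) (fun v : 'I_n => posv v) v0s.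
have {}hM (j : 'I_n) : sig j == s -> (posv j <= posv vM)%N by move=> /hM.
have [vm vms hm] := @arg_minnP 'I_n v0 (fun v : 'I_n => sig v == s) (fun v : 'I_n => posv v) v0s.
have [lM cM _] := sm _ vMs; have [lm cm _] := sm _ vms.
have eS : uS vM = uS vm by apply/funext => t; rewrite /Decode.uS !cellvE // cM cm.
have [_ _ k1] := find_spec (enoughS (ltn_ord vM) lM).
have [_ k2 _] := find_spec (enoughS (ltn_ord vm) lm).
move: (vMs) (vms); rewrite {1 2}/Decode.sig (negPf lM) (negPf lm) => /eqP e1 /eqP e2.
rewrite e1 nsumS in k1; rewrite e2 -eS in k2.
have uq : uS vM s = sq s by rewrite /Decode.uS cellvE // cM eqxx.
rewrite uq in k1.
have /andP[_ p1] := kvP vM; have /andP[p2 _] := kvP vm.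
have key : pre vm + \sum_(v < n | sig v == s) dem v <= pre vM + dem vM.
  rewrite (bigD1 vM) //= addrCA addrC lerD2r !preE // [X in X + _]big_mkcond [X in _ + X]big_mkcond [X in _ <= X]big_mkcond.
  rewrite -big_split /=; apply: ler_sum => u _; have d0 := ltW (dem_gt0 (ltn_ord u)).
  have [us|nus] := boolP (sig u == s); last first.
    rewrite addr0 cM cm; case: (~~ large u) => //=; case: (_ == _) => //=.
    case: ltnP => h1; case: ltnP => h2 //; move: (leq_trans h1 (hm _ vMs)); by rewrite ltnNge h2.
  have [lu cu _] := sm u us; rewrite lu cu cM cm eqxx /=.
  have -> : (posv u < posv vm)%N = false by apply/negbTE; rewrite -leqNgt hm.
  rewrite add0r; case: (u =P vM) => [->|ne] /=; first by rewrite ltnn.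
  rewrite ltn_neqAle hM // andbT; case: eqP => //= e; case: ne; apply/val_inj.
  exact: (posv_inj (ltn_ord u) (ltn_ord vM) (etrans cu (esym cM)) e).
have hd : H%:R * dem vM <= 1 by move: lM; rewrite /Decode.large negbK.
rewrite ler_pdivlMr ?HR // mulrC.
have q1 : (kv vM).+1%:R <= (nsum s (uS vM))%:R + (sq s)%:R :> R by rewrite -natrD ler_nat.
have q2 : (nsum s (uS vM))%:R <= (kv vm)%:R :> R by rewrite ler_nat.
have : H%:R * (pre vm + \sum_(v < n | sig v == s) dem v) <= H%:R * (pre vM + dem vM) by rewrite ler_pM2l ?HR.
by rewrite -natr1 !mulrDr; lra.
Qed.

Lemma good_ok : okd.
Proof.
apply/andP; split; first by apply/nallP => v; apply: sig_lt.
apply/nallP => j jm; apply: le_trans (loadJ jm); rewrite /Decode.load /rsum.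
apply: (@le_trans _ _ (\sum_(v < n) \sum_(i < J) if sig v == (j * J + i)%N then dem v else 0)).
  apply: ler_sum => v _; have d0 := ltW (dem_gt0 (ltn_ord v)); case: eqP => [e|_]; last first.
    by apply: sumr_ge0 => i _; case: ifP.
  rewrite (bigD1 (Ordinal (ltn_pmod (sig v) J_gt0))) //= -e /Decode.trip -divn_eq eqxx lerDl.
  by apply: sumr_ge0 => i _; case: ifP.
rewrite exchange_big /=; apply: ler_sum => i _; rewrite -big_mkcond /=; apply: slot_load.
by have := ltn_ord i; move: jm; clear; nia.
Qed.

Definition block s := [seq v <- tl (s %/ J) | sig v == s].

Lemma tl_blocks j : tl j = flatten [seq block s | s <- iota (j * J) J].
Proof.
rewrite {1}(@sorted_slots _ sig (j * J) J (tl j)).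
- congr flatten; apply/eq_in_map => s; rewrite mem_iota => /andP[h1 h2]; rewrite /block.
  have -> // : (s %/ J = j)%N.
  by rewrite -(subnKC h1) divnMDl // divn_small ?addn0 // ltn_subLR.
- apply: (@sub_in_sorted _ (mem (tl j)) (fun u v => key u < key v)%N) (sorted_tl _ _ _ _ _ _ _ _ _ _ _ _ _); last first.
    exact/allP.
  move=> u v /=; rewrite !mem_tl => /andP[un _] /andP[vn _]; rewrite key_lt //.
  by case/or3P=> [/ltnW//|/andP[/eqP->]|/and3P[/eqP->]].
- move=> v; rewrite mem_tl => /andP[_ /eqP e]; rewrite -{1 2}e /Decode.trip leq_divM /= -mulSnr.
  by rewrite ltn_ceil.
Qed.

Lemma mem_block s v : (v \in block s) = (v < n)%N && (sig v == s).
Proof.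
rewrite mem_filter mem_tl andbC -andbA; case: (v < n)%N => //=.
by case: (sig v =P s) => [<-|]; rewrite ?andbF // eqxx.
Qed.

Definition blockS c s := [seq v <- [seq v <- p c | ~~ large v] | sig v == s].

Lemma index_sorted (q : seq nat) : uniq q -> sorted (fun u v => index u q < index v q)%N q.
Proof.
move=> uq; apply/(sortedP 0%N) => i hi; rewrite !index_uniq //; exact: ltnW.
Qed.

Lemma block_small s : (s < m * J)%N -> sl s = 0%N -> (sc s < Nc)%N -> block s = blockS (sc s) s.
Proof.
move=> sJ sl0 cs; apply: (@irr_sorted_eq _ (fun u v => key u < key v)%N).
- by move=> u v w; apply: ltn_trans.
- by move=> u; rewrite /= ltnn.
- by apply: sorted_filter (sorted_tl _ _ _ _ _ _ _ _ _ _ _ _ _) => u v w; apply: ltn_trans.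
- apply: (@sub_in_sorted _ (mem (blockS (sc s) s)) (fun u v => index u (p (sc s)) < index v (p (sc s)))%N).
  + move=> u v /=; rewrite !mem_filter !mem_p // => /and4P[/eqP us _ un /eqP cu] /and4P[/eqP vs _ vn /eqP cv] h.
    by rewrite key_lt // us vs ltnn eqxx /= !posvE // cu cv ltnS h.
  + exact/allP.
  + apply: sorted_filter; last apply: sorted_filter; last exact: index_sorted (p_uniq cs);
    by move=> u v w; apply: ltn_trans.
- move=> v; rewrite mem_block !mem_filter mem_p //.
  case: (ltnP v n) => vn; rewrite ?andbF //=; case: eqP => //= vs.
  have lv : ~~ large v by apply/negP => /(sigL vn)[_ _]; rewrite vs sl0.
  by rewrite lv -(sig_cell vn) vs eqxx.
Qed.

Lemma block_plen s : (s < m * J)%N -> plen d (block s) <= \sum_(c < Nc) plen d (blockS c s).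
Proof.
move=> sJ; have d0 u v : 0 <= d u v by apply: edist_ge0.
have S0 (X : 'I_Nc -> seq nat) : 0 <= \sum_(c < Nc) plen d (X c) by apply: sumr_ge0 => c _; apply: plen_ge0.
have [|sl0] := posnP (sl s); last first.
  case E : (block s) => [|u [|v w]]; [exact: S0|exact: S0|].
  have : u \in block s by rewrite E mem_head.
  have : v \in block s by rewrite E !inE eqxx orbT.
  rewrite !mem_block => /andP[vn /eqP vs] /andP[un /eqP us].
  have uv : u = v by apply: large_slot; rewrite ?us ?vs.
  have : uniq (block s) by rewrite filter_uniq // uniq_tl.
  by rewrite E uv /= mem_head.
move=> sl0; case E : (block s) => [|u w]; first exact: S0.
have : u \in block s by rewrite E mem_head.
rewrite mem_block => /andP[un /eqP us].
have cs : (sc s < Nc)%N by rewrite -us sig_cell // cell_lt.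
rewrite -E block_small // (bigD1 (Ordinal cs)) //= lerDl.
by apply: sumr_ge0 => c _; apply: plen_ge0.
Qed.

(** [kv] is monotone along the path, and so is the slot: the slots cut the sequence of small items
    into consecutive pieces. *)
Lemma blockS_sum c : (c < Nc)%N -> \sum_(s < m * J) plen d (blockS c s) <= plen d (p c).
Proof.
move=> cn; have d0 u v : 0 <= d u v by apply: edist_ge0.
apply: (@le_trans _ _ (plen d [seq v <- p c | ~~ large v])); last first.
  by apply: plen_subseq => //; [move=> x y z; apply: edist_tri | apply: filter_subseq].
apply: plen_mono_filter => //.
apply: (@sub_in_sorted _ (mem [seq v <- p c | ~~ large v]) (fun u v => index u (p c) < index v (p c))%N).
- move=> u v /=; rewrite !mem_filter !mem_p // => /and3P[lu un /eqP cu] /and3P[lv vn /eqP cv] h.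
  rewrite /Decode.sig (negPf lu) (negPf lv).
  have -> : uS u = uS v by apply/funext => t; rewrite /Decode.uS !cellvE // cu cv.
  by apply: find_mono; apply: kv_mono; rewrite ?cu ?cv // !posvE // cu cv ltnS ltnW.
- exact/allP.
- by apply: sorted_filter; [move=> u v w; apply: ltn_trans | apply: index_sorted (p_uniq cn)].
Qed.

Lemma sum_slots (F : nat -> R) : \sum_(j < m) \sum_(i < J) F (j * J + i)%N = \sum_(s < m * J) F s.
Proof.
rewrite -(big_mkord xpredT F); elim: m => [|m' IH]; first by rewrite big_ord0 mul0n big_geq.
have -> : (m'.+1 * J = m' * J + J)%N by rewrite mulSn addnC.
rewrite big_ord_recr /= IH [RHS](@big_cat_nat _ _ _ (m' * J)) ?leq_addr //=; apply: f_equal2 => //.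
rewrite -{2}[(m' * J)%N]add0n big_addn addnC addnK big_mkord; apply: eq_bigr => i _.
by rewrite addnC.
Qed.

(** Each tour visits the representatives of its slots, makes detours to the terminals placed there,
    and follows the cell path inside a slot. The last contribution is bounded for all tours together
    by [blockS_sum]. *)
Lemma good_cost : costd <= \sum_(j < m) (plf (@edist R) O ([seq P (rep s) | s <- iota (j * J) J] ++ [:: O]) +
    \sum_(i < J) 2%:R * dl (j * J + i)) + \sum_(c < Nc) plen d (p c).
Proof.
rewrite costdE.
apply: (@le_trans _ _ (\sum_(j < m) (plf (@edist R) O ([seq P (rep s) | s <- iota (j * J) J] ++ [:: O]) +
    \sum_(i < J) (2%:R * dl (j * J + i) + plen d (block (j * J + i)))))).
  apply: ler_sum => j _; rewrite -cats1 tl_blocks map_flatten -map_comp.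
  apply: le_trans (@polygon R O (fun s => map P (block s)) (fun s => P (rep s)) dl (iota (j * J) J) O dl_ge0 _) _.
    move=> s y _ /mapP[v]; rewrite mem_block => /andP[vn /eqP vs] ->.
    have sJ : (s < m * J)%N by rewrite -vs sig_lt.
    apply: repE => //; first by rewrite -vs sig_cell.
    case: (boolP (large v)) => [/(sigL vn)[_ _]|/(sigS vn)[_ _]]; rewrite vs; first by move=> ->.
    by move=> ->; rewrite orbT.
  rewrite lerD2l -[X in iota X]addn0 iotaDl big_map -[X in iota 0 X](subn0 J) big_mkord.
  by apply: ler_sum => i _; rewrite lerD2l plen_map.
under eq_bigr => j _ do rewrite big_split addrA.
rewrite big_split /= lerD2l (sum_slots (fun s => plen d (block s))).
apply: (@le_trans _ _ (\sum_(s < m * J) \sum_(c < Nc) plen d (blockS c s))).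
  by apply: ler_sum => s _; apply: block_plen.
by rewrite exchange_big /=; apply: ler_sum => c _; apply: blockS_sum.
Qed.

End Good.

(** * Plans *)

(* A slot [(c, l, (q, r))] of a tour accepts one large item with label [l] of
   the cell [c], or [q] units of small items of [c]; [r] is a terminal of [c]
   (for a padding slot, of another cell). *)
Notation slot := (nat * nat * (nat * nat))%type.
Definition slot0 : slot := (0, 0, (0, 0))%N.
Definition slotat (J : nat) (cf : seq (seq slot)) (s : nat) : slot :=
  nth slot0 (nth [::] cf (s %/ J)) (s %% J).

Lemma slotatE J cf j i : (i < J)%N -> slotat J cf (j * J + i) = nth slot0 (nth [::] cf j) i.
Proof.
move=> iJ; have J0 : (0 < J)%N by apply: leq_ltn_trans iJ.
by rewrite /slotat divnMDl // divn_small // addn0 modnMDl modn_small.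
Qed.

Lemma sum_slots2 (V : Type) (idx : V) (op : Monoid.law idx) (J m : nat) (F : nat -> V) :
  \big[op/idx]_(s < m * J) F s = \big[op/idx]_(j < m) \big[op/idx]_(i < J) F (j * J + i)%N.
Proof.
rewrite -(big_mkord xpredT F); elim: m => [|m IH]; first by rewrite big_ord0 mul0n big_geq.
have -> : (m.+1 * J = m * J + J)%N by rewrite mulSn addnC.
rewrite big_ord_recr /= -IH (@big_cat_nat _ _ _ (m * J)) ?leq_addr //=; apply: f_equal2 => //.
rewrite -{1}[(m * J)%N]add0n big_addn addnC addnK big_mkord; apply: eq_bigr => i _.
by rewrite addnC.
Qed.

Lemma sum_slotat (V : Type) (idx : V) (op : Monoid.law idx) (J : nat) cf (F : slot -> V) :
    (forall pl, pl \in cf -> size pl = J) ->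
  \big[op/idx]_(s < size cf * J) F (slotat J cf s) = \big[op/idx]_(pl <- cf) \big[op/idx]_(s <- pl) F s.
Proof.
move=> sz; rewrite (sum_slots2 _ _ _ (fun s => F (slotat J cf s))) [RHS](big_nth [::]) big_mkord; apply: eq_bigr => j _.
rewrite (big_nth slot0) big_mkord sz ?mem_nth //; apply: eq_bigr => i _.
by rewrite slotatE.
Qed.

Section GoodList.
Variable R : realType.
Variables (n : nat) (P : nat -> R * R) (O : R * R) (dem : nat -> R).
Variables (H J Nc : nat).
Variables (inbx : nat -> nat -> bool) (bef : nat -> nat -> nat -> bool) (wid : nat -> nat).
Variables (cell : nat -> nat) (p : nat -> seq nat) (cap dl : slot -> R).
Notation large := (large dem H).
Notation grp := (grp n dem H Nc inbx wid).
Notation rem := (rem n dem H Nc inbx wid).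
Notation kv := (kv n dem H Nc inbx bef).
Notation d := (fun u v => edist (P u) (P v)).
Variable cf : seq (seq slot).

Definition roomS (s : slot) : R :=
  if (0 < s.1.2)%N then cap s else if (0 < s.2.1)%N then s.2.1.+1%:R / H%:R else 0.
Notation sc := (fun s => (slotat J cf s).1.1).
Notation sl := (fun s => (slotat J cf s).1.2).
Notation sq := (fun s => (slotat J cf s).2.1).

Hypothesis dem_gt0 : forall v, (v < n)%N -> 0 < dem v.
Hypothesis H_gt0 : (0 < H)%N.
Hypothesis J_gt0 : (0 < J)%N.
Hypothesis cell_lt : forall v, (v < n)%N -> (cell v < Nc)%N.
Hypothesis inbxE : forall c v, (c < Nc)%N -> (v < n)%N -> inbx c v = (cell v == c).
Hypothesis p_uniq : forall c, (c < Nc)%N -> uniq (p c).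
Hypothesis mem_p : forall c v, (c < Nc)%N -> (v \in p c) = (v < n)%N && (cell v == c).
Hypothesis befE : forall c u v, (c < Nc)%N -> (u < n)%N -> (v < n)%N -> bef c u v = befs u v (p c).
Hypothesis cf_size : forall pl, pl \in cf -> size pl = J.
Hypothesis cf_slq : forall pl s, pl \in cf -> s \in pl -> (0 < s.1.2)%N -> s.2.1 = 0%N.
Hypothesis cf_large : forall v, (v < n)%N -> large v ->
  (rem v < \sum_(pl <- cf) \sum_(s <- pl) ((s.1.1 == cell v) && (s.1.2 == (grp v).+1)))%N.
Hypothesis cf_small : forall v, (v < n)%N -> ~~ large v ->
  (kv v < \sum_(pl <- cf) \sum_(s <- pl) (if s.1.1 == cell v then s.2.1 else 0))%N.
Hypothesis cap_ge0 : forall s, 0 <= cap s.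
Hypothesis cf_cap : forall pl s v, pl \in cf -> s \in pl -> (v < n)%N -> large v -> s.1.1 = cell v ->
  s.1.2 = (grp v).+1 -> dem v <= cap s.
Hypothesis cf_room : forall pl, pl \in cf -> \sum_(s <- pl) roomS s <= 1.
Hypothesis dl_ge0 : forall s, 0 <= dl s.
Hypothesis cf_rep : forall pl s v, pl \in cf -> s \in pl -> (v < n)%N -> s.1.1 = cell v ->
  (0 < s.1.2)%N || (0 < s.2.1)%N -> edist (P v) (P s.2.2) <= dl s.

Lemma slotat_mem s : (s < size cf * J)%N -> exists2 pl, pl \in cf & slotat J cf s \in pl.
Proof.
move=> h; have h1 : (s %/ J < size cf)%N by rewrite ltn_divLR.
exists (nth [::] cf (s %/ J)); first exact: mem_nth.
by apply: mem_nth; rewrite cf_size ?mem_nth // ltn_pmod.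
Qed.

Lemma goodL_ok : okd n dem H J Nc (size cf) inbx bef wid sc sl sq.
Proof.
apply: (good_ok (cell := cell) (p := p) (cap := fun s => cap (slotat J cf s))) => //.
- by move=> s /slotat_mem[pl h1 h2]; apply: cf_slq h1 h2.
- move=> v vn lv; rewrite /nsum /uL (cellvE (cell := cell) cell_lt inbxE vn).
  by rewrite (@sum_slotat _ _ _ J cf (fun s : slot => nat_of_bool ((s.1.1 == cell v) && (s.1.2 == (grp v).+1)))) //; apply: cf_large.
- move=> v vn lv; rewrite /nsum /uS (cellvE (cell := cell) cell_lt inbxE vn).
  by rewrite (@sum_slotat _ _ _ J cf (fun s : slot => if s.1.1 == cell v then s.2.1 else 0%N)) //; apply: cf_small.
- by move=> v s vn lv /slotat_mem[pl h1 h2]; apply: cf_cap h1 h2 vn lv.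
- move=> j jm; have jc := mem_nth [::] jm; apply: le_trans (cf_room jc).
  rewrite (big_nth slot0) big_mkord cf_size //; apply: ler_sum => i _.
  by rewrite /room /roomS slotatE.
Qed.

Lemma goodL_cost : costd n P O dem H J Nc (size cf) inbx bef wid sc sl sq <=
  \sum_(pl <- cf) (plf (@edist R) O ([seq P s.2.2 | s <- pl] ++ [:: O]) + \sum_(s <- pl) 2%:R * dl s) +
  \sum_(c < Nc) plen d (p c).
Proof.
apply: (@le_trans _ _ (\sum_(j < size cf) (plf (@edist R) O ([seq P (slotat J cf s).2.2 | s <- iota (j * J) J] ++ [:: O]) +
    \sum_(i < J) 2%:R * dl (slotat J cf (j * J + i))) + \sum_(c < Nc) plen d (p c))).
apply: (@good_cost R n P O dem H J Nc (size cf) inbx bef wid sc sl sq cell p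
   (fun s => dl (slotat J cf s)) (fun s => (slotat J cf s).2.2)) => //.
- by move=> s /slotat_mem[pl h1 h2]; apply: cf_slq h1 h2.
- move=> v vn lv; rewrite /nsum /uL (cellvE (cell := cell) cell_lt inbxE vn).
  by rewrite (@sum_slotat _ _ _ J cf (fun s : slot => nat_of_bool ((s.1.1 == cell v) && (s.1.2 == (grp v).+1)))) //; apply: cf_large.
- move=> v vn lv; rewrite /nsum /uS (cellvE (cell := cell) cell_lt inbxE vn).
  by rewrite (@sum_slotat _ _ _ J cf (fun s : slot => if s.1.1 == cell v then s.2.1 else 0%N)) //; apply: cf_small.
- by move=> v s vn /slotat_mem[pl h1 h2]; apply: cf_rep h1 h2 vn.
rewrite lerD2r [X in _ <= X](big_nth [::]) big_mkord; apply: ler_sum => j _.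
have jc := mem_nth [::] (ltn_ord j); have sz := cf_size jc; rewrite lerD //.
  rewrite (_ : [seq _ | s <- iota _ _] = [seq P s.2.2 | s <- nth [::] cf j]) //.
  apply: (@eq_from_nth _ O); rewrite size_map size_iota; first by rewrite size_map sz.
  by move=> i iJ; rewrite (nth_map 0%N) ?size_iota // nth_iota // slotatE // (nth_map slot0) ?sz.
rewrite (big_nth slot0) big_mkord sz; apply: ler_sum => i _.
by rewrite slotatE.
Qed.

End GoodList.

(** * Balancing the reservations of small items over the cells *)

Section Balance.
Variable R : realType.
Variables (n N : nat) (dem : nat -> R) (small : nat -> bool) (cell : nat -> nat).
Implicit Types (o : seq nat) (v c : nat).

Definition smc o c : R := \sum_(v <- o | small v && (cell v == c)) dem v.
Definition sms o : R := \sum_(v <- o | small v) dem v.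
Definition imb (oa : seq (seq nat * nat)) c : R :=
  \sum_(x <- oa) (smc x.1 c - (if cell x.2 == c then sms x.1 else 0)).

Hypothesis dem_gt0 : forall v, (v < n)%N -> 0 < dem v.
Hypothesis cell_lt : forall v, (v < n)%N -> (cell v < N)%N.

Lemma smc_sum o : (forall v, v \in o -> (v < n)%N) -> \sum_(c < N) smc o c = sms o.
Proof.
move=> ho; rewrite /smc /sms (exchange_big_dep (fun v => small v)) /=; last by move=> v c _ /andP[].
rewrite [LHS]big_seq_cond [RHS]big_seq_cond; apply: eq_bigr => v /andP[vo sv].
rewrite (big_pred1 (Ordinal (cell_lt (ho v vo)))) // => c /=; rewrite sv /=.
by rewrite eq_sym; apply/eqP/eqP => [e|->//]; apply/val_inj.
Qed.

Lemma smc_ge0 o c : (forall v, v \in o -> (v < n)%N) -> 0 <= smc o c.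
Proof. by move=> ho; rewrite /smc big_seq_cond; apply: sumr_ge0 => v /andP[/ho/dem_gt0/ltW]. Qed.

(** Greedy choice against the sum of squares: a tour reserves in the cell of that small item of its
    own whose imbalance is currently largest. The linear term of the change is then at most 0, and
    the quadratic one at most 2, as a tour carries small demand at most 1. The value [n] stands for
    no choice, in a tour without small items. *)
Lemma balance (ts : seq (seq nat)) :
    (forall o, o \in ts -> (forall v, v \in o -> (v < n)%N) /\ sms o <= 1) ->
  exists oa : seq (seq nat * nat), [/\ map fst oa = ts,
    (forall x, x \in oa -> (x.2 \in x.1) && small x.2 \/ x.2 = n /\ forall v, v \in x.1 -> ~~ small v) &
    \sum_(c < N) imb oa c ^+ 2 <= 2%:R * (size ts)%:R].
Proof.
elim: ts => [|o ts IH] hts.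
  by exists [::]; split=> //; rewrite big1 ?mulr0 // => c _; rewrite /imb big_nil expr0n.
have [|oa [e hoa pot]] := IH; first by move=> o' ho'; apply: hts; rewrite inE ho' orbT.
have [ho s1] := hts o (mem_head _ _).
pose y c := imb oa c.
have [o0|[a ao am]] : [seq v <- o | small v] = [::] \/
    exists2 a, a \in [seq v <- o | small v] & forall v, v \in [seq v <- o | small v] -> y (cell v) <= y (cell a).
  case: (eqVneq [seq v <- o | small v] [::]) => [|ne]; [by left | right].
  by have [a ha h] := ex_argmin (fun v => - y (cell v)) ne; exists a => // v /h; rewrite lerN2.
- have ns v : v \in o -> ~~ small v.
    move=> vo; apply/negP => sv; have : v \in [seq v <- o | small v] by rewrite mem_filter sv.
    by rewrite o0.
  have z c : smc o c = 0 by rewrite /smc big_seq_cond big_pred0 // => v; case vo : (v \in o) => //=; rewrite (negPf (ns v vo)).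
  have z' : sms o = 0 by rewrite /sms big_seq_cond big_pred0 // => v; case vo : (v \in o) => //=; rewrite (negPf (ns v vo)).
  exists ((o, n) :: oa); split.
  + by rewrite /= e.
  + by move=> x; rewrite inE => /orP[/eqP->|/hoa//]; right.
  + under eq_bigr => c _ do rewrite /imb big_cons /= z z' if_same subrr add0r.
    apply: le_trans pot _; rewrite [size (o :: ts)]/= -natr1; lra.
move: ao; rewrite mem_filter => /andP[sa ao].
exists ((o, a) :: oa); split.
- by rewrite /= e.
- by move=> x; rewrite inE => /orP[/eqP->|/hoa//]; left; rewrite /= ao.
have an := ho a ao; pose ca := Ordinal (cell_lt an).
pose D (c : nat) : R := smc o c - (if cell a == c then sms o else 0).
have -> : \sum_(c < N) imb ((o, a) :: oa) c ^+ 2 = \sum_(c < N) y c ^+ 2 + 2%:R * \sum_(c < N) y c * D c + \sum_(c < N) D c ^+ 2.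
  rewrite mulr_sumr -!big_split /=; apply: eq_bigr => c _; rewrite /imb big_cons /= -/(imb oa c) -/(y c) -/(D c); ring.
have c0 c : 0 <= smc o c by apply: smc_ge0.
have ss := smc_sum ho.
(* The reservation removes the total [sms o] at the maximal coordinate, while the items enter at
   coordinates that are no larger. *)
have D1 : \sum_(c < N) y c * D c <= 0.
  have -> : \sum_(c < N) y c * D c = \sum_(c < N) y c * smc o c - y (cell a) * sms o.
    rewrite (eq_bigr (fun c : 'I_N => y c * smc o c - (if c == ca then y c * sms o else 0))); last first.
      move=> c _; rewrite /D mulrBr; congr (_ - _); rewrite -(inj_eq val_inj) /= eq_sym.
      by case: eqP => // _; rewrite mulr0.
    by rewrite big_split /= sumrN -big_mkcond big_pred1_eq.
  rewrite subr_le0 -ss mulr_sumr; apply: ler_sum => c _.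
  have [|v0] := eqVneq (smc o c) 0; first by move=> ->; rewrite !mulr0.
  have : exists2 v, v \in o & small v && (cell v == c).
    apply/hasP; apply: contraNT v0 => /hasPn h; rewrite /smc big_seq_cond big_pred0 // => v.
    by case vo : (v \in o) => //=; apply/negbTE/h.
  case=> v vo /andP[sv /eqP <-]; apply: ler_wpM2r => //; apply: am.
  by rewrite mem_filter sv.
have D2 : \sum_(c < N) D c ^+ 2 <= 2%:R.
  rewrite (bigD1 ca) //=; have -> : (2%:R : R) = 1 + 1 by ring.
  have sc1 c : smc o c <= sms o.
    have [cN|cN] := ltnP c N; first by rewrite -ss (bigD1 (Ordinal cN)) //= lerDl sumr_ge0.
    rewrite /smc big_seq_cond big_pred0 ?/sms; last first.
      move=> v; case vo : (v \in o) => //=; apply/negbTE/negP => /andP[_ /eqP ec].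
      by move: cN; rewrite leqNgt -ec cell_lt // ho.
    by rewrite big_seq_cond; apply: sumr_ge0 => v /andP[/ho/dem_gt0/ltW].
  have sg0 : 0 <= sms o by apply: le_trans (sc1 0%N).
  apply: lerD.
    rewrite /D eqxx; have := c0 (cell a); have := sc1 (cell a); nra.
  apply: (le_trans _ s1); rewrite -ss [X in _ <= X](bigD1 ca) //=; apply: le_trans (_ : \sum_(i < N | i != ca) smc o i <= _).
    apply: ler_sum => c; rewrite -(inj_eq val_inj) /= eq_sym /D => /negPf->; rewrite subr0.
    by rewrite expr2 ler_piMl //; have := sc1 c; lra.
  by rewrite lerDr.
rewrite [size (o :: ts)]/= -natr1; move: pot D1 D2; rewrite /y; lra.
Qed.

End Balance.

Lemma closed_ge (R : realType) (O : R * R) (s : seq (R * R)) x : x \in s ->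
  2%:R * edist O x <= plf (@edist R) O (s ++ [:: O]).
Proof.
move=> xs; have h : subseq [:: x; O] (s ++ [:: O]).
  by rewrite -[[:: x; O]]/([:: x] ++ [:: O]) cat_subseq // sub1seq.
apply: le_trans (plf_subseq _ (@edist_ge0 R) (@edist_tri R) h).
by rewrite /= addr0 (edistC x O); lra.
Qed.

(** Plans are brought to the common length [H] by repeating the representative of the last slot,
    which adds no length to the tour; label 0 with 0 units accepts nothing. *)
Definition pad (H : nat) (l : seq slot) : seq slot :=
  l ++ nseq (H - size l) (0, 0, (0, (last slot0 l).2.2))%N.

Lemma size_pad H l : (size l <= H)%N -> size (pad H l) = H.
Proof. by move=> h; rewrite size_cat size_nseq subnKC. Qed.

Lemma big_pad (V : Type) (idx : V) (op : Monoid.law idx) H l (F : slot -> V) :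
  (forall r, F (0, 0, (0, r))%N = idx) -> \big[op/idx]_(s <- pad H l) F s = \big[op/idx]_(s <- l) F s.
Proof.
move=> F0; rewrite big_cat /= [X in op _ X]big1_seq ?Monoid.mulm1 // => s /andP[_].
by rewrite mem_nseq => /andP[_ /eqP->].
Qed.

Lemma mem_pad H l s : s \in pad H l -> s \in l \/ exists r, s = (0, 0, (0, r))%N.
Proof.
rewrite mem_cat => /orP[|]; first by left.
by rewrite mem_nseq => /andP[_ /eqP->]; right; exists (last slot0 l).2.2.
Qed.

Lemma plf_pad (R : realType) (P : nat -> R * R) O H l : l != [::] ->
  plf (@edist R) O ([seq P s.2.2 | s <- pad H l] ++ [:: O]) = plf (@edist R) O ([seq P s.2.2 | s <- l] ++ [:: O]).
Proof.
move=> l0; rewrite /pad map_cat -catA !plf_cat; congr (_ + _).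
rewrite map_nseq /=; set x := P _; have -> : last O [seq P s.2.2 | s <- l] = x.
  by case: l l0 @x => // s l _ /=; rewrite -(last_map (fun s => P s.2.2)).
by elim: (H - size l)%N => [|k IH] /=; rewrite ?edistxx add0r.
Qed.

Lemma big_flat_nseq (V : Type) (idx : V) (op : Monoid.law idx) (T : Type) (k : nat -> nat) (f : nat -> T) s (F : T -> V) :
  \big[op/idx]_(x <- flatten [seq nseq (k c) (f c) | c <- s]) F x =
  \big[op/idx]_(c <- s) iter (k c) (op (F (f c))) idx.
Proof. by rewrite big_flatten big_map; apply: eq_bigr => c _; rewrite big_nseq. Qed.

(** * Rounding given tours into plans *)

Section Exist.
Variable R : realType.
Variables (n : nat) (P : nat -> R * R) (O : R * R) (dem : nat -> R).
Variables (H Nc : nat).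
Variables (inbx : nat -> nat -> bool) (bef : nat -> nat -> nat -> bool) (wid : nat -> nat).
Variables (cell : nat -> nat) (p : nat -> seq nat) (dlt Dm : R).
Variables (ts : seq (seq nat)).
Notation large := (large dem H).
Notation small := (fun v => ~~ large v).
Notation cellv := (cellv Nc inbx).
Notation rk := (rk n dem H Nc inbx).
Notation grp := (grp n dem H Nc inbx wid).
Notation rem := (rem n dem H Nc inbx wid).
Notation pre := (pre n dem H Nc inbx bef).
Notation kv := (kv n dem H Nc inbx bef).
Notation d := (fun u v => edist (P u) (P v)).
Notation nL c := (count (fun v => large v && (cell v == c)) (iota 0 n)).
Notation tour o := (plf (@edist R) O ([seq P v | v <- o] ++ [:: O])).

Hypothesis dem_in : forall v, (v < n)%N -> 0 < dem v <= 1.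
Hypothesis H_gt1 : (1 < H)%N.
Hypothesis cell_lt : forall v, (v < n)%N -> (cell v < Nc)%N.
Hypothesis inbxE : forall c v, (c < Nc)%N -> (v < n)%N -> inbx c v = (cell v == c).
Hypothesis p_uniq : forall c, (c < Nc)%N -> uniq (p c).
Hypothesis mem_p : forall c v, (c < Nc)%N -> (v \in p c) = (v < n)%N && (cell v == c).
Hypothesis befE : forall c u v, (c < Nc)%N -> (u < n)%N -> (v < n)%N -> bef c u v = befs u v (p c).
Hypothesis widE : forall c, (c < Nc)%N -> wid c = (nL c %/ H ^ 2).+1.
Hypothesis dlt_ge0 : 0 <= dlt.
Hypothesis dltP : forall u v, (u < n)%N -> (v < n)%N -> cell u = cell v ->
  edist (P u) (P v) <= dlt * edist O (P v).
Hypothesis DmP : forall v, (v < n)%N -> edist O (P v) <= Dm.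
Hypothesis Dm_ge0 : 0 <= Dm.
Hypothesis ts_perm : perm_eq (flatten ts) (iota 0 n).
Hypothesis ts_load : forall o, o \in ts -> \sum_(v <- o) dem v <= 1.
Hypothesis ts_ne : forall o, o \in ts -> o != [::].

Let H0 : (0 < H)%N. Proof. exact: ltnW. Qed.
Let HR : 0 < H%:R :> R. Proof. by rewrite ltr0n. Qed.
Let dem_gt0 v : (v < n)%N -> 0 < dem v. Proof. by move=> /dem_in/andP[]. Qed.

(** Label 1, the first group, gets tours of its own, hence capacity 1. Any other label takes the
    place of an item of the preceding group, the representative of the slot, whose demand is at
    least as large. The absolute value keeps the capacity nonnegative for arbitrary slots. *)
Definition capS (s : slot) : R := if s.1.2 == 1%N then 1 else `|dem s.2.2|.
Definition dlS (s : slot) : R := dlt * edist O (P s.2.2).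
Definition baseS (pl : seq slot) : R := plf (@edist R) O ([seq P s.2.2 | s <- pl] ++ [:: O]).

Definition plans_ok (cf : seq (seq slot)) : Prop :=
  [/\ (forall pl, pl \in cf -> size pl = H /\ \sum_(s <- pl) roomS H capS s <= 1),
      (forall v, (v < n)%N -> large v ->
        (rem v < \sum_(pl <- cf) \sum_(s <- pl) ((s.1.1 == cell v) && (s.1.2 == (grp v).+1)))%N),
      (forall v, (v < n)%N -> ~~ large v ->
        (kv v < \sum_(pl <- cf) \sum_(s <- pl) (if s.1.1 == cell v then s.2.1 else 0))%N) &
      (forall pl s, pl \in cf -> s \in pl ->
        [/\ (s.1.1 < Nc)%N, (s.1.2 <= H ^ 2 + 1)%N, (s.2.1 <= H)%N, (0 < s.1.2)%N -> s.2.1 = 0%N &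
         (forall v, (v < n)%N -> s.1.1 = cell v ->
           (large v -> s.1.2 = (grp v).+1 -> dem v <= capS s) /\
           ((0 < s.1.2)%N || (0 < s.2.1)%N -> edist (P v) (P s.2.2) <= dlS s))])].

Lemma plans_ok_perm a b : perm_eq a b -> plans_ok a -> plans_ok b.
Proof.
move=> h [h1 h2 h3 h4]; split.
- by move=> pl; rewrite -(perm_mem h); apply: h1.
- by move=> v vn lv; rewrite -(perm_big _ h); apply: h2.
- by move=> v vn lv; rewrite -(perm_big _ h); apply: h3.
- by move=> pl s; rewrite -(perm_mem h); apply: h4.
Qed.

Lemma mem_ts o v : o \in ts -> v \in o -> (v < n)%N.
Proof.
move=> ho vo; have : v \in flatten ts by apply/flattenP; exists o.
by rewrite (perm_mem ts_perm) mem_iota.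
Qed.

Lemma uniq_ts o : o \in ts -> uniq o.
Proof.
have : uniq (flatten ts) by rewrite (perm_uniq ts_perm) iota_uniq.
elim: (ts) => [//|o' ts' IH] /=; rewrite cat_uniq inE => /and3P[u1 _ u2] /orP[/eqP->//|].
exact: IH.
Qed.

Lemma sum_ts (V : Type) (idx : V) (op : Monoid.com_law idx) (F : nat -> V) :
  \big[op/idx]_(o <- ts) \big[op/idx]_(v <- o) F v = \big[op/idx]_(v < n) F v.
Proof. by rewrite -big_flatten (perm_big _ ts_perm) -[X in iota 0 X](subn0 n) big_mkord. Qed.

Let cvE v : (v < n)%N -> cellv v = cell v.
Proof. exact: (cellvE (cell := cell) cell_lt inbxE). Qed.

Lemma rk_bound v : (v < n)%N -> large v -> (rk v < nL (cell v))%N.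
Proof.
move=> vn lv; rewrite /Decode.rk nsum_count.
apply: (@leq_trans (count (fun u => [&& large u, cell u == cell v & u != v]) (iota 0 n)).+1).
  rewrite ltnS (@eq_in_count _ _ (fun u => [&& large u, cell u == cell v & heavier dem u v])); last first.
    by move=> u; rewrite mem_iota /= => un; rewrite !cvE.
  apply: sub_count => u /= /and3P[-> -> h] /=; apply: contraTneq h => ->.
  by rewrite /heavier lexx ltnn.
rewrite -size_filter -[X in (_ <= X)%N]size_filter.
apply: (@leq_trans (size (v :: [seq x <- iota 0 n | [&& large x, cell x == cell v & x != v]]))) => //.
apply: uniq_leq_size; first by rewrite /= mem_filter !eqxx /= !andbF filter_uniq // iota_uniq.
move=> u; rewrite inE !mem_filter => /orP[/eqP->|/andP[/and3P[-> ->]]] //.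
by rewrite lv eqxx mem_iota.
Qed.

Lemma wid_gt0 c : (c < Nc)%N -> (0 < wid c)%N.
Proof. by move=> h; rewrite widE. Qed.

Lemma grp_lt v : (v < n)%N -> large v -> (grp v < H ^ 2)%N.
Proof.
move=> vn lv; rewrite /Decode.grp cvE // ltn_divLR ?wid_gt0 ?cell_lt //.
apply: leq_trans (rk_bound vn lv) _; rewrite widE ?cell_lt // mulnC.
by apply/ltnW/ltn_ceil; rewrite expn_gt0 H0.
Qed.

(** The ranks of the large items of a cell fill an initial segment of the integers, so a group
    followed by a nonempty one is full. *)
Lemma grp_full v g : (v < n)%N -> large v -> grp v = g.+1 ->
  (wid (cell v) <= count (fun u => [&& large u, cell u == cell v & grp u == g]) (iota 0 n))%N.
Proof.
move=> vn lv eg; set c := cell v; have cN : (c < Nc)%N by apply: cell_lt.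
pose L := [seq u <- iota 0 n | large u && (cell u == c)].
have mL u : u \in L -> [/\ (u < n)%N, large u & cell u = c].
  by rewrite mem_filter mem_iota => /andP[/andP[lu /eqP cu] un].
have uL : uniq (map rk L).
  rewrite map_inj_in_uniq ?filter_uniq ?iota_uniq // => u w /mL[un lu cu] /mL[wn lw cw].
  by apply: (rk_inj (cell := cell) cell_lt inbxE); rewrite ?cu ?cw.
have [||_ eL] := uniq_min_size (s2 := iota 0 (size L)) uL.
- by move=> i /mapP[u /mL[un lu cu] ->]; rewrite mem_iota /= size_filter -cu rk_bound.
- by rewrite size_map size_iota.
have -> : count (fun u => [&& large u, cell u == c & grp u == g]) (iota 0 n) =
   count (fun i => i %/ wid c == g)%N (map rk L).
  rewrite count_map count_filter; apply: eq_in_count => u; rewrite mem_iota /= => un.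
  rewrite [RHS]andbC -[RHS]andbA; case: (large u) => //=; case: eqP => //= cu; by rewrite /Decode.grp cvE // cu.
apply: (@leq_trans (size (iota (g * wid c) (wid c)))); first by rewrite size_iota.
rewrite -size_filter; apply: uniq_leq_size; first exact: iota_uniq.
move=> i; rewrite mem_iota mem_filter eL mem_iota /= add0n => /andP[i1 i2]; apply/andP; split.
  by rewrite eqn_leq leq_divRL ?wid_gt0 // i1 -ltnS ltn_divLR ?wid_gt0 // mulSn addnC i2.
apply: leq_trans i2 _; apply: (@leq_trans (rk v)); last by rewrite size_filter ltnW // rk_bound.
by rewrite addnC -mulSn -eg /Decode.grp cvE // leq_divM.
Qed.

Lemma heavier_dem u v : (u < n)%N -> (v < n)%N -> large u -> large v -> cell u = cell v ->
  (grp u < grp v)%N -> dem v <= dem u.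
Proof.
move=> un vn lu lv e h; rewrite leNgt; apply/negP => uv.
have : (rk v < rk u)%N.
  by apply: (rk_lt (cell := cell) cell_lt inbxE) => //; rewrite /heavier (ltW uv) -ltNge uv.
move=> h'; move: h; rewrite ltnNge /Decode.grp !cvE // e => /negP; apply.
by apply: leq_div2r; apply: ltnW.
Qed.

Definition so (o : seq nat) : R := sms dem small o.
(** One unit less than fits, to pay for the overhang reserved by [room]. *)
Definition qo (o : seq nat) : nat := (Num.truncn (H%:R * so o)).-1.
(** An item of group [g] leaves its place to group [g + 1], whose label is [g + 2]. A small item, if
    chosen, stands for all small items of the tour. *)
Definition slotof (o : seq nat) (v : nat) : slot :=
  if large v then (cell v, (grp v).+2, (0, v))%N else (cell v, 0, (qo o, v))%N.
Definition chosen (x : seq nat * nat) : seq nat := [seq v <- x.1 | large v || (v == x.2)].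
Definition planO (x : seq nat * nat) : seq slot := pad H [seq slotof x.1 v | v <- chosen x].
Definition rc (c : nat) : nat := head 0%N [seq v <- iota 0 n | cell v == c].
Definition planL (c : nat) : seq slot := pad H [:: (c, 1, (0, rc c))%N].
(** [H.-1] units together with the overhang fill a tour exactly. *)
Definition planS (c : nat) : seq slot := pad H [:: (c, 0, (H.-1, rc c))%N].

Lemma rcP c : (exists2 v, (v < n)%N & cell v = c) -> (rc c < n)%N /\ cell (rc c) = c.
Proof.
case=> v vn vc; have : v \in [seq v <- iota 0 n | cell v == c] by rewrite mem_filter vc eqxx mem_iota.
rewrite /rc; case E : [seq v <- iota 0 n | cell v == c] => [//|u s] _ /=.
have : u \in [seq v <- iota 0 n | cell v == c] by rewrite E mem_head.
by rewrite mem_filter mem_iota => /andP[/eqP].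
Qed.

Lemma so_ge0 o : o \in ts -> 0 <= so o.
Proof. by move=> ho; rewrite /so /sms big_seq_cond; apply: sumr_ge0 => v /andP[/(mem_ts ho)/dem_gt0/ltW]. Qed.

Lemma so_split o : \sum_(v <- o) dem v = \sum_(v <- o | large v) dem v + so o.
Proof. by rewrite (bigID (fun v => large v)) /=. Qed.

Lemma so_le1 o : o \in ts -> so o <= 1.
Proof.
move=> ho; have := ts_load ho; rewrite so_split; apply: le_trans; rewrite lerDr big_seq_cond.
by apply: sumr_ge0 => v /andP[/(mem_ts ho)/dem_gt0/ltW].
Qed.

(** Large items weigh more than 1/H each. Together with the single slot for small items, a tour thus
    needs at most [H] slots. *)
Lemma large_count o : o \in ts -> (count large o < H)%N.
Proof.
move=> ho; have := ts_load ho; rewrite so_split => h.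
have l1 : \sum_(v <- o | large v) dem v <= 1 by have := so_ge0 ho; lra.
have : (count large o)%:R <= H%:R * \sum_(v <- o | large v) dem v.
  rewrite -sum1_count natr_sum mulr_sumr; apply: ler_sum => v; rewrite /Decode.large -ltNge.
  exact: ltW.
case: (posnP (count large o)) => [-> //|c0].
have : (count large o)%:R < H%:R * \sum_(v <- o | large v) dem v.
  rewrite -has_count in c0; case/hasP: c0 => v vo lv.
  rewrite -sum1_count natr_sum mulr_sumr (perm_big _ (perm_to_rem vo)) [X in _ < X](perm_big _ (perm_to_rem vo)) /=.
  rewrite !big_cons lv; apply: ltr_leD; first by move: lv; rewrite /Decode.large -ltNge.
  by apply: ler_sum => u; rewrite /Decode.large -ltNge; apply: ltW.
move=> h2 _; rewrite -(ltr_nat R); apply: lt_le_trans h2 _.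
by rewrite ler_piMr // ltW.
Qed.

Definition star_ok (x : seq nat * nat) : Prop :=
  (x.2 \in x.1) && small x.2 \/ x.2 = n /\ forall v, v \in x.1 -> ~~ small v.

Lemma size_sel x : x.1 \in ts -> star_ok x -> (size (chosen x) <= H)%N.
Proof.
move=> ho st; rewrite size_filter; apply: leq_trans (_ : count large x.1 + count_mem x.2 x.1 <= _)%N.
  by rewrite -count_predUI -[X in (X <= _)%N]addn0 leq_add // ; apply: eq_leq; apply: eq_count => v /=.
have h1 := large_count ho.
have h2 : (count_mem x.2 x.1 <= 1)%N by rewrite count_uniq_mem ?uniq_ts ?leq_b1.
by move: h1 h2; clear; lia.
Qed.

Lemma sel_ne x : x.1 \in ts -> star_ok x -> chosen x != [::].
Proof.
move=> ho st; case: st => [/andP[a1 a2]|[_ al]].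
  by apply: contraTneq (a1) => E; have : x.2 \notin chosen x by [rewrite E]; rewrite mem_filter eqxx orbT.
have := ts_ne ho; case E : x.1 => [//|v o] _.
have lv : large v by have := al v; rewrite E mem_head negbK; apply.
by rewrite /chosen E /= lv.
Qed.

Lemma qo_le o : o \in ts -> (qo o <= H)%N.
Proof.
move=> ho; rewrite /qo; apply: leq_trans (leq_pred _) _.
rewrite truncn_le_nat; apply: (@le_lt_trans _ _ (H%:R)); last by rewrite ltr_nat.
by rewrite ler_piMr ?so_le1 // ltW.
Qed.

Lemma qo_room o : o \in ts -> (0 < qo o)%N -> (qo o).+1%:R / H%:R <= so o.
Proof.
move=> ho q0; rewrite ler_pdivrMr // mulrC.
have -> : (qo o).+1 = Num.truncn (H%:R * so o) by rewrite /qo prednK //; move: q0; rewrite /qo; clear; lia.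
by rewrite truncn_le mulr_ge0 ?so_ge0 // ltW.
Qed.

Lemma qo_ge o : o \in ts -> H%:R * so o - 2%:R <= (qo o)%:R.
Proof.
move=> ho; have := truncnS_gt (H%:R * so o); rewrite /qo.
by case: (Num.truncn _) => [|k] /=; rewrite -?natr1; lra.
Qed.

Lemma planO_ok x : x.1 \in ts -> star_ok x -> \sum_(s <- planO x) roomS H capS s <= 1.
Proof.
move=> ho st; rewrite /planO big_pad //= big_map /chosen big_filter.
apply: le_trans (ts_load ho); rewrite so_split.
rewrite (bigID (fun v => large v)) /= lerD //.
  rewrite big_seq_cond [X in _ <= X]big_seq_cond.
  rewrite (eq_bigl (fun v => (v \in x.1) && large v)); last by move=> v /=; case: (large v); rewrite ?orTb ?andbT ?andbF.
  apply: ler_sum => v /andP[vo lv]; rewrite /slotof lv /roomS /capS /= ger0_norm //.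
  by apply/ltW/dem_gt0/(mem_ts ho).
rewrite (eq_bigl (fun v => (v == x.2) && ~~ large v)); last by move=> v; case: (Decode.large _ _ v); rewrite ?andbF ?andbT.
have s0 := so_ge0 ho.
case: st => [/andP[a1 a2]|[e al]]; last first.
  rewrite big_seq_cond big_pred0 // => v; case vo : (v \in x.1) => //=.
  by have := al v vo; rewrite negbK => ->; rewrite andbF.
rewrite (eq_bigl (fun v => v == x.2)); last by move=> v; case: eqP => // ->; rewrite a2.
rewrite (perm_big _ (perm_to_rem a1)) big_cons eqxx /= big_seq_cond big_pred0 ?addr0.
  rewrite /slotof (negPf a2) /roomS /=; case: ifP => // q0; exact: qo_room.
by move=> v /=; rewrite mem_rem_uniq ?uniq_ts // inE; case: eqP; rewrite ?andbF.
Qed.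

Lemma sum_planO_label x v : x.1 \in ts -> (\sum_(s <- planO x) ((s.1.1 == cell v) && (s.1.2 == (grp v).+1)) =
  \sum_(u <- x.1) ([&& large u, cell u == cell v & (grp u).+1 == grp v]))%N.
Proof.
move=> ho; rewrite /planO big_pad; last by move=> r /=; rewrite andbF.
rewrite big_map /chosen big_filter [RHS](bigID (fun u => large u || (u == x.2))) /= [X in (_ = _ + X)%N]big1 ?addn0; last first.
  by move=> u; rewrite negb_or => /andP[/negPf-> _].
by apply: eq_bigr => u _; rewrite /slotof; case: (Decode.large _ _ u); rewrite /= ?andbF.
Qed.

Lemma sum_planO_units x v : x.1 \in ts -> star_ok x ->
  (\sum_(s <- planO x) (if s.1.1 == cell v then s.2.1 else 0) =
   if (x.2 \in x.1) && (cell x.2 == cell v) then qo x.1 else 0)%N.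
Proof.
move=> ho st; rewrite /planO big_pad; last by move=> r /=; rewrite if_same.
rewrite big_map /chosen big_filter (bigID (fun u => large u)) /= [X in (X + _)%N]big1 ?add0n; last first.
  by move=> u /andP[_ lu]; rewrite /slotof lu /= if_same.
case: st => [/andP[a1 a2]|[e al]]; last first.
  have -> : x.2 \in x.1 = false by rewrite e; apply/negP => /(mem_ts ho); rewrite ltnn.
  rewrite big_seq_cond big_pred0 // => u; case uo : (u \in x.1) => //=.
  by have := al u uo; rewrite negbK => ->; rewrite andbF.
rewrite (eq_bigl (fun u => u == x.2)); last first.
  by move=> u; case: eqP => [->|_]; rewrite ?a2 ?orbT // orbF andbN.
rewrite (perm_big _ (perm_to_rem a1)) big_cons eqxx /= big_seq_cond big_pred0 ?addn0.
  by rewrite a1 /slotof (negPf a2).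
by move=> u /=; rewrite mem_rem_uniq ?uniq_ts // inE; case: eqP; rewrite ?andbF.
Qed.

Definition hasL c := has (fun v => large v && (cell v == c)) (iota 0 n).
Definition hasS c := has (fun v => small v && (cell v == c)) (iota 0 n).
Definition imbc oa c : R := imb dem small cell oa c.
Definition stars (oa : seq (seq nat * nat)) c : nat :=
  (\sum_(x <- oa) nat_of_bool ((x.2 \in x.1) && (cell x.2 == c)))%N.
(** The shortage of units in cell [c]: its imbalance, and up to two units for each tour reserving
    there, one lost by rounding down and one by the overhang. *)
Definition need oa c : R := Num.max 0 (H%:R * imbc oa c + 2%:R * (stars oa c)%:R).
Definition ec oa c : nat := (Num.truncn (need oa c / H.-1%:R)).+1.
Arguments ec : simpl never.
Definition plans oa : seq (seq slot) := map planO oa ++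
  (flatten [seq nseq (wid c) (planL c) | c <- [seq c <- iota 0 Nc | hasL c]] ++
   flatten [seq nseq (ec oa c) (planS c) | c <- [seq c <- iota 0 Nc | hasS c]]).

Lemma hasL_rc c : hasL c -> (rc c < n)%N /\ cell (rc c) = c.
Proof. by move=> /hasP[v]; rewrite mem_iota => vn /andP[_ /eqP vc]; apply: rcP; exists v. Qed.

Lemma hasS_rc c : hasS c -> (rc c < n)%N /\ cell (rc c) = c.
Proof. by move=> /hasP[v]; rewrite mem_iota => vn /andP[_ /eqP vc]; apply: rcP; exists v. Qed.

Lemma sum_cells (V : Type) (idx : V) (op : Monoid.law idx) (Q : pred nat) (F : nat -> V) :
  \big[op/idx]_(c <- [seq c <- iota 0 Nc | Q c]) F c = \big[op/idx]_(c < Nc | Q c) F c.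
Proof. by rewrite big_filter -[X in iota 0 X](subn0 Nc) big_mkord. Qed.

Lemma mem_plans oa pl : pl \in plans oa -> [\/ exists2 x, x \in oa & pl = planO x,
  exists c, [/\ (c < Nc)%N, hasL c & pl = planL c] | exists c, [/\ (c < Nc)%N, hasS c & pl = planS c]].
Proof.
rewrite !mem_cat => /or3P[/mapP[x hx ->]|/flattenP[l /mapP[c]]|/flattenP[l /mapP[c]]].
- by constructor 1; exists x.
- rewrite mem_filter mem_iota add0n => /andP[h /andP[_ hc]] ->; rewrite mem_nseq => /andP[_ /eqP->].
  by constructor 2; exists c.
- rewrite mem_filter mem_iota add0n => /andP[h /andP[_ hc]] ->; rewrite mem_nseq => /andP[_ /eqP->].
  by constructor 3; exists c.
Qed.

Section Advice.
Variable oa : seq (seq nat * nat).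
Hypothesis oa_ts : map fst oa = ts.
Hypothesis oa_star : forall x, x \in oa -> star_ok x.

Lemma oa_mem x : x \in oa -> x.1 \in ts.
Proof. by move=> h; rewrite -oa_ts map_f. Qed.

Lemma sum_oa (V : Type) (idx : V) (op : Monoid.com_law idx) (F : nat -> V) :
  \big[op/idx]_(x <- oa) \big[op/idx]_(v <- x.1) F v = \big[op/idx]_(v < n) F v.
Proof. by rewrite -sum_ts -oa_ts big_map. Qed.

Lemma stars_units c : (\sum_(x <- oa) (if (x.2 \in x.1) && (cell x.2 == c) then qo x.1 else 0))%N%:R >=
  H%:R * (\sum_(v < n | small v && (cell v == c)) dem v - imbc oa c) - 2%:R * (stars oa c)%:R :> R.
Proof.
have -> : \sum_(v < n | small v && (cell v == c)) dem v - imbc oa c =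
    \sum_(x <- oa) (if cell x.2 == c then so x.1 else 0).
  rewrite big_mkcond -(sum_oa _ (fun v => if small v && (cell v == c) then dem v else 0)).
  rewrite /imbc /imb -sumrB; apply: eq_bigr => x _; rewrite -big_mkcond /smc /so.
  by rewrite opprB addrC subrK.
rewrite /stars !natr_sum !mulr_sumr -sumrB big_seq [X in _ <= X]big_seq; apply: ler_sum => x hx.
have ho := oa_mem hx; have [/andP[a1 a2]|[e al]] := oa_star hx.
  rewrite a1 /=; case: (_ == c); last by rewrite !mulr0 subrr.
  by rewrite mulr1; apply: qo_ge.
have s0 : so x.1 = 0.
  rewrite /so /sms big_seq_cond big_pred0 // => v; case vo : (v \in x.1) => //=.
  by apply/negbTE/al.
by rewrite s0 if_same mulr0 add0r; apply: (@le_trans _ _ 0); rewrite ?ler0n // oppr_le0 mulr_ge0 ?ler0n.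
Qed.

Lemma H1R : 0 < H.-1%:R :> R.
Proof. by rewrite ltr0n; case: (H) H_gt1 => [|[]]. Qed.

Lemma need_ge0 c : 0 <= need oa c.
Proof. by rewrite /need le_max lexx. Qed.

Lemma plans_okP : plans_ok (plans oa).
Proof.
split.
- move=> pl /mem_plans[[x hx ->]|[c [cN hc ->]]|[c [cN hc ->]]].
  + split; last by apply: planO_ok (oa_mem hx) (oa_star hx).
    by rewrite size_pad // size_map size_sel ?oa_mem //; apply: oa_star.
  + by split; [rewrite size_pad | rewrite /planL big_pad // big_seq1 /roomS /capS /= lexx].
  + split; [by rewrite size_pad | rewrite /planS big_pad // big_seq1 /roomS /=].
    by rewrite -subn1 subn_gt0 H_gt1 subn1 prednK // divff // gt_eqF.
(* The first group is served by the extra tours [planL], a later one by the places of the group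
   before it, which is full. *)
- move=> v vn lv; rewrite /plans !big_cat /=; case E : (grp v) => [|g].
    apply: leq_trans (leq_addl _ _); apply: leq_trans (leq_addr _ _).
    rewrite big_flat_nseq sum_cells (bigD1 (Ordinal (cell_lt vn))) /=; last first.
      by apply/hasP; exists v; rewrite ?mem_iota // lv eqxx.
    apply: leq_trans (leq_addr _ _); rewrite iter_addn_0 /planL big_pad; last by move=> r /=; rewrite andbF.
    rewrite big_seq1 /= eqxx /= mul1n.
    by rewrite /Decode.rem cvE // ltn_pmod // wid_gt0 // cell_lt.
  apply: leq_trans (leq_addr _ _); rewrite -E big_map.
  rewrite (eq_big_seq (fun x => \sum_(u <- x.1) ([&& large u, cell u == cell v & (grp u).+1 == grp v]))%N); last first.
    by move=> x hx; apply: sum_planO_label; apply: oa_mem.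
  rewrite (sum_oa _ (fun u => nat_of_bool [&& large u, cell u == cell v & (grp u).+1 == grp v])).
  apply: leq_trans (_ : wid (cell v) <= _)%N; first by rewrite /Decode.rem cvE // ltn_pmod // wid_gt0 // cell_lt.
  apply: leq_trans (grp_full vn lv E) _; rewrite -nsum_count; apply: leq_sum => u _.
  by rewrite E eqSS.
- move=> v vn lv; rewrite /plans !big_cat /= -(ltr_nat R).
  have hS : hasS (cell v) by apply/hasP; exists v; rewrite ?mem_iota // lv eqxx.
  rewrite !natrD.
  have u1 : (\sum_(pl <- map planO oa) \sum_(s <- pl) (if s.1.1 == cell v then s.2.1 else 0))%N%:R >=
     H%:R * (\sum_(u < n | small u && (cell u == cell v)) dem u - imbc oa (cell v)) - 2%:R * (stars oa (cell v))%:R :> R.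
    apply: le_trans (stars_units (cell v)) _; rewrite ler_nat big_map.
    rewrite [X in (_ <= X)%N]big_seq [X in (X <= _)%N]big_seq; apply: leq_sum => x hx.
    by rewrite (sum_planO_units _ (oa_mem hx)) //; apply: oa_star.
  have u3 : need oa (cell v) <= (\sum_(pl <- flatten [seq nseq (ec oa c) (planS c) | c <- [seq c <- iota 0 Nc | hasS c]])
     \sum_(s <- pl) (if s.1.1 == cell v then s.2.1 else 0))%N%:R.
    apply: (@le_trans _ _ ((ec oa (cell v))%:R * H.-1%:R)).
      by rewrite -ler_pdivrMr ?H1R //; apply/ltW/truncnS_gt.
    rewrite -natrM ler_nat big_flat_nseq sum_cells; move: (ec oa) => k.
    rewrite (bigD1 (Ordinal (cell_lt vn))) //=.
    apply: leq_trans (leq_addr _ _); rewrite iter_addn_0 /planS big_pad; last by move=> r; rewrite if_same.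
    by rewrite big_seq1 /= eqxx mulnC.
  have u4 : H%:R * imbc oa (cell v) + 2%:R * (stars oa (cell v))%:R <= need oa (cell v).
    by rewrite /need le_max lexx orbT.
  have u2 : 0 <= (\sum_(pl <- flatten [seq nseq (wid c) (planL c) | c <- [seq c <- iota 0 Nc | hasL c]])
     \sum_(s <- pl) (if s.1.1 == cell v then s.2.1 else 0))%N%:R :> R by rewrite ler0n.
  (* Strict, since the positive demand of [v] does not belong to its own prefix sum. *)
  have u5 : (kv v)%:R < H%:R * \sum_(u < n | small u && (cell u == cell v)) dem u.
    have /andP[k1 _] := @kvP R n dem H Nc inbx bef dem_gt0 v.
    apply: le_lt_trans k1 _; rewrite ltr_pM2l //.
    rewrite (bigD1 (Ordinal vn)) ?lv ?eqxx //=; apply: (@le_lt_trans _ _ (\sum_(u < n | small u && (cell u == cell v) && (u != Ordinal vn)) dem u)).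
      rewrite /Decode.pre /rsum [X in _ <= X]big_mkcond; apply: ler_sum => u _; rewrite !cvE //.
      case: ifP => [/and3P[-> -> h] /=|_]; last by case: ifP => // _; apply/ltW/dem_gt0.
      by case: eqP => //= e; move: h; rewrite e ltnn.
    by rewrite ltrDr dem_gt0.
  by move: u1 u3 u4 u2 u5; rewrite mulrBr; lra.
- move=> pl s /mem_plans[[x hx ->]|[c [cN hc ->]]|[c [cN hc ->]]] /mem_pad[].
  + move=> /mapP[u]; rewrite mem_filter => /andP[_ ux] ->.
    have un := mem_ts (oa_mem hx) ux; rewrite /slotof; case: (boolP (large u)) => lu /=; split=> //=.
    * exact: cell_lt.
    * by rewrite addn1 ltnS grp_lt.
    * move=> v vn e; split; last by move=> _; rewrite /dlS; apply: dltP.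
      move=> lv [eg]; rewrite /capS /= ger0_norm ?(ltW (dem_gt0 un)) //.
      by apply: heavier_dem; rewrite // -eg.
    * exact: cell_lt.
    * by apply: qo_le; apply: oa_mem.
    * by move=> v vn e; split=> // _; rewrite /dlS; apply: dltP.
  + have [v0 v0x] : exists v, v \in x.1.
      by have := ts_ne (oa_mem hx); case: (x.1) => // v o _; exists v; rewrite mem_head.
    case=> r -> /=; split=> //=; apply: leq_ltn_trans (cell_lt (mem_ts (oa_mem hx) v0x)); exact: leq0n.
  + have [rn rcc] := hasL_rc hc; rewrite inE => /eqP-> /=; split=> //=; first by rewrite addn1.
    move=> v vn e; split; last by move=> _; rewrite /dlS; apply: dltP; rewrite ?rcc.
    by move=> _ _; have /andP[] := dem_in vn.
  + by case=> r -> /=; split=> //=; apply: leq_ltn_trans cN.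
  + have [rn rcc] := hasS_rc hc; rewrite inE => /eqP-> /=; split=> //=; first exact: leq_pred.
    by move=> v vn e; split=> // _; rewrite /dlS; apply: dltP; rewrite ?rcc.
  + by case=> r -> /=; split=> //=; apply: leq_ltn_trans cN.
Qed.

Definition optc : R := \sum_(o <- ts) tour o.

Lemma tour_ge0 o : 0 <= tour o.
Proof. exact: plf_ge0 (@edist_ge0 R) _ _. Qed.

Lemma optc_oa : \sum_(x <- oa) tour x.1 = optc.
Proof. by rewrite /optc -oa_ts big_map. Qed.

Lemma rc_dist c v : (rc c < n)%N -> cell (rc c) = c -> (v < n)%N -> cell v = c ->
  edist O (P (rc c)) <= (1 + dlt) * edist O (P v).
Proof.
move=> rn rcc vn e; have h : edist (P (rc c)) (P v) <= dlt * edist O (P v) by apply: dltP; rewrite ?rcc.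
by have := edist_tri O (P v) (P (rc c)); rewrite (edistC (P v)); lra.
Qed.

(** A point of a closed tour is within half its length of the depot, so each of the [H] detours
    costs at most the fraction [dlt] of the tour. *)
Lemma plan_cost pl : size pl = H ->
  baseS pl + \sum_(s <- pl) 2%:R * dlS s <= (1 + dlt * H%:R) * baseS pl.
Proof.
move=> sz; rewrite mulrDl mul1r lerD2l -sz -sum1_size natr_sum mulr_sumr mulr_suml.
rewrite big_seq [X in _ <= X]big_seq; apply: ler_sum => s sp; rewrite mulr1 /dlS mulrCA ler_wpM2l //.
by apply: closed_ge; apply: map_f.
Qed.

Lemma baseO x : x \in oa -> baseS (planO x) <= tour x.1.
Proof.
move=> hx; rewrite /baseS /planO plf_pad; last first.
  by have := sel_ne (oa_mem hx) (oa_star hx); case: (chosen x).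
rewrite -map_comp (eq_map (g := P)); last by move=> v; rewrite /= /slotof; case: ifP.
apply: plf_subseq (@edist_ge0 R) (@edist_tri R) _.
by apply: cat_subseq => //; apply: map_subseq; apply: filter_subseq.
Qed.

Lemma base1 c a b : baseS (pad H [:: (c, a, (b, rc c))]) = 2%:R * edist O (P (rc c)).
Proof. by rewrite /baseS plf_pad //= addr0 (edistC _ O); ring. Qed.

Lemma natr_div_le (a b : nat) : (0 < b)%N -> (a %/ b)%:R <= a%:R / b%:R :> R.
Proof. by move=> b0; rewrite ler_pdivlMr ?ltr0n // -natrM ler_nat leq_divM. Qed.

(** A cell opens about one extra tour per [H ^ 2] large items, each costing at most [1 + dlt] times
    any tour that visits the cell; as a tour holds fewer than [H] large items, a fraction 1/H of the
    total remains. Rounding up in [wid] gives the additive term. *)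
Lemma costL : \sum_(c < Nc | hasL c) (wid c)%:R * (2%:R * edist O (P (rc c))) <=
  (1 + dlt) / H%:R * optc + Nc%:R * (2%:R * Dm).
Proof.
apply: (@le_trans _ _ (\sum_(c < Nc | hasL c) ((nL c)%:R * (2%:R * edist O (P (rc c))) / (H ^ 2)%:R + 2%:R * Dm))).
  apply: ler_sum => c hc; have [rn rcc] := hasL_rc hc; rewrite widE // -natr1 mulrDl mul1r lerD //.
    rewrite [X in _ <= X]mulrAC; apply: ler_wpM2r; first by rewrite mulr_ge0 ?edist_ge0.
    by apply: natr_div_le; rewrite expn_gt0 H0.
  by rewrite ler_pM2l // DmP.
rewrite big_split /= lerD //; last first.
  rewrite sumr_const -[X in X <= _]mulr_natl ler_wpM2r ?mulr_ge0 //.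
  by rewrite ler_nat -[X in (_ <= X)%N](card_ord Nc) max_card.
rewrite -mulr_suml ler_pdivrMr ?ltr0n ?expn_gt0 ?H0 //.
have -> : (1 + dlt) / H%:R * optc * (H ^ 2)%:R = (1 + dlt) * (H%:R * optc).
  by rewrite natrX; field; rewrite gt_eqF.
apply: (@le_trans _ _ (\sum_(v < n | large v) (1 + dlt) * (2%:R * edist O (P v)))).
  rewrite (partition_big (fun v : 'I_n => Ordinal (cell_lt (ltn_ord v))) (fun c : 'I_Nc => hasL c)) /=; last first.
    by move=> v lv; apply/hasP; exists (val v); rewrite ?mem_iota ?ltn_ord // lv eqxx.
  apply: ler_sum => c hc; have [rn rcc] := hasL_rc hc.
  rewrite -nsum_count /nsum natr_sum mulr_suml [X in _ <= X]big_mkcond; apply: ler_sum => v _.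
  rewrite -(inj_eq val_inj) /=; case: ifP => [/andP[lv /eqP vc]|]; rewrite ?mul0r //.
  by rewrite mul1r mulrCA ler_pM2l // rc_dist.
rewrite -mulr_sumr ler_wpM2l ?addr_ge0 // big_mkcond -(sum_ts _ (fun v => if large v then 2%:R * edist O (P v) else 0)).
rewrite /optc mulr_sumr big_seq [X in _ <= X]big_seq; apply: ler_sum => o ho.
rewrite -big_mkcond; apply: (@le_trans _ _ (\sum_(v <- o | large v) tour o)).
  rewrite big_seq_cond [X in _ <= X]big_seq_cond; apply: ler_sum => v /andP[vo _].
  by apply: closed_ge; apply: map_f.
rewrite big_const_seq iter_addr_0 -[X in X <= _]mulr_natl ler_wpM2r ?tour_ge0 // ler_nat.
by apply: ltnW; apply: large_count.
Qed.

(** A tour reserves in at most one cell, and it visits that cell. *)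
Lemma stars_cost : \sum_(c < Nc | hasS c) (stars oa c)%:R * (2%:R * edist O (P (rc c))) <= (1 + dlt) * optc.
Proof.
rewrite -optc_oa mulr_sumr.
apply: (@le_trans _ _ (\sum_(x <- oa) \sum_(c < Nc | hasS c)
   ((x.2 \in x.1) && (cell x.2 == c))%:R * (2%:R * edist O (P (rc c))))).
  by rewrite exchange_big /=; apply: ler_sum => c hc; rewrite /stars natr_sum mulr_suml.
rewrite big_seq [X in _ <= X]big_seq; apply: ler_sum => x hx.
case: (boolP (x.2 \in x.1)) => [x2|_] /=; last first.
  by rewrite big1 ?mulr_ge0 ?addr_ge0 ?tour_ge0 // => c _; rewrite mul0r.
have x2n := mem_ts (oa_mem hx) x2.
have t0 : 2%:R * edist O (P x.2) <= tour x.1 by apply: closed_ge; apply: map_f.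
apply: (@le_trans _ _ (\sum_(c < Nc) if c == Ordinal (cell_lt x2n) then (1 + dlt) * tour x.1 else 0)); last first.
  by rewrite -big_mkcond big_pred1_eq.
rewrite [X in X <= _]big_mkcond; apply: ler_sum => c _; rewrite -(inj_eq val_inj) /= [_ == val c]eq_sym.
case: ifP => [hc|_]; last by case: ifP => // _; rewrite mulr_ge0 ?addr_ge0 ?tour_ge0.
case: eqP => [e|_]; last by rewrite mul0r.
rewrite mul1r; have [rn rcc] := hasS_rc hc.
have := rc_dist rn rcc x2n (esym e); have : 0 <= 1 + dlt by rewrite addr_ge0.
move: t0; move: (edist _ _) (edist _ _) (plf _ _ _) => a b t h1 h2 h3.
apply: (@le_trans _ _ ((1 + dlt) * (2%:R * b))); last by rewrite ler_wpM2l.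
by rewrite mulrCA ler_pM2l.
Qed.

(** Passes from the l2 bound on the imbalances to an l1 bound; the free parameter [l] weighs the
    number of tours against the number of cells and is fixed only with the other parameters. *)
Lemma amgm (l y : R) : 0 < l -> Num.max 0 y <= l * y ^+ 2 + (4%:R * l)^-1.
Proof.
move=> l0; have l4 : 0 < 4%:R * l by rewrite mulr_gt0.
have h : y <= l * y ^+ 2 + (4%:R * l)^-1.
  rewrite -subr_ge0 -(pmulr_rge0 _ l4).
  have -> : 4%:R * l * (l * y ^+ 2 + (4%:R * l)^-1 - y) = (2%:R * l * y - 1) ^+ 2.
    by field; rewrite gt_eqF.
  exact: sqr_ge0.
rewrite ge_max h andbT; apply: addr_ge0; first by rewrite mulr_ge0 ?sqr_ge0 // ltW.
by rewrite invr_ge0 ltW.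
Qed.

(** The two units lost per tour are charged to that tour, a fraction of order 1/H of its length; the
    imbalances are charged to [Dm], through [amgm]. *)
Lemma costS (l : R) : 0 < l -> \sum_(c < Nc) imbc oa c ^+ 2 <= 2%:R * (size ts)%:R ->
  \sum_(c < Nc | hasS c) (ec oa c)%:R * (2%:R * edist O (P (rc c))) <=
  2%:R / H.-1%:R * (1 + dlt) * optc +
  2%:R * Dm * (Nc%:R + 2%:R * (2%:R * l * (size ts)%:R + Nc%:R / (4%:R * l))).
Proof.
move=> l0 pot; have H1 := H1R.
apply: (@le_trans _ _ (\sum_(c < Nc | hasS c) (2%:R / H.-1%:R * ((stars oa c)%:R * (2%:R * edist O (P (rc c)))) +
   2%:R * Dm * (1 + 2%:R * (l * imbc oa c ^+ 2 + (4%:R * l)^-1))))).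
  apply: ler_sum => c hc; have [rn rcc] := hasS_rc hc.
  have D0 : 0 <= 2%:R * edist O (P (rc c)) by rewrite mulr_ge0 ?edist_ge0.
  have DD : 2%:R * edist O (P (rc c)) <= 2%:R * Dm by rewrite ler_pM2l // DmP.
  have e1 : (ec oa c)%:R <= 2%:R / H.-1%:R * (stars oa c)%:R + (1 + 2%:R * (l * imbc oa c ^+ 2 + (4%:R * l)^-1)).
    rewrite /ec -natr1 addrCA [X in X <= _]addrC lerD2l.
    apply: (@le_trans _ _ (need oa c / H.-1%:R)).
      by rewrite truncn_le divr_ge0 ?need_ge0 // ltW.
    rewrite ler_pdivrMr // mulrDl mulrAC divfK ?gt_eqF //.
    have h1 := amgm (imbc oa c) l0; set z := _ + (4%:R * l)^-1 in h1 *.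
    have hH : H%:R <= 2%:R * H.-1%:R :> R by rewrite -natrM ler_nat; move: H_gt1; clear; lia.
    have m0 : 0 <= Num.max 0 (imbc oa c) by rewrite le_max lexx.
    have m1 : imbc oa c <= Num.max 0 (imbc oa c) by rewrite le_max lexx orbT.
    have z0 : 0 <= z by apply: le_trans h1.
    rewrite /need ge_max; apply/andP; split; first by rewrite addr_ge0 ?mulr_ge0 // ltW.
    rewrite addrC lerD2l.
    apply: (@le_trans _ _ (H%:R * z)); last first.
      by rewrite [X in _ <= X]mulrAC ler_wpM2r.
    by rewrite ler_pM2l //; apply: le_trans m1 h1.
  apply: le_trans (ler_wpM2r D0 e1) _; rewrite mulrDl -!mulrA lerD2l mulrC mulrA.
  have : 0 <= 1 + 2%:R * (l * imbc oa c ^+ 2 + (4%:R * l)^-1).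
    have := amgm (imbc oa c) l0; have : 0 <= Num.max 0 (imbc oa c) by rewrite le_max lexx.
    by lra.
  by move=> h; apply: ler_wpM2r.
rewrite big_split /= lerD //.
  rewrite -mulr_sumr -mulrA ler_wpM2l ?divr_ge0 ?(ltW H1) //; exact: stars_cost.
rewrite -mulr_sumr ler_wpM2l ?mulr_ge0 //.
apply: (@le_trans _ _ (\sum_(c < Nc) (1 + 2%:R * (l * imbc oa c ^+ 2 + (4%:R * l)^-1)))).
  rewrite [X in X <= _]big_mkcond; apply: ler_sum => c _; case: ifP => // _.
  have := amgm (imbc oa c) l0; have : 0 <= Num.max 0 (imbc oa c) by rewrite le_max lexx.
  by lra.
rewrite big_split /= sumr_const card_ord lerD2l -mulr_sumr ler_pM2l // big_split /= sumr_const card_ord.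
rewrite -[X in _ + X <= _]mulr_natl -mulr_sumr lerD // -mulrA mulrCA ler_pM2l //.
Qed.

Lemma plans_cost (l : R) : 0 < l -> \sum_(c < Nc) imbc oa c ^+ 2 <= 2%:R * (size ts)%:R ->
  \sum_(pl <- plans oa) (baseS pl + \sum_(s <- pl) 2%:R * dlS s) <=
  (1 + dlt * H%:R) * ((1 + (1 + dlt) / H%:R + 2%:R / H.-1%:R * (1 + dlt)) * optc +
     2%:R * Dm * (2%:R * Nc%:R + 2%:R * (2%:R * l * (size ts)%:R + Nc%:R / (4%:R * l)))).
Proof.
move=> l0 pot; have d0 : 0 <= 1 + dlt * H%:R by rewrite addr_ge0 ?mulr_ge0.
apply: (@le_trans _ _ (\sum_(pl <- plans oa) (1 + dlt * H%:R) * baseS pl)).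
  rewrite big_seq [X in _ <= X]big_seq; apply: ler_sum => pl hpl; apply: plan_cost.
  by have [h _ _ _] := plans_okP; have [] := h pl hpl.
rewrite -mulr_sumr ler_wpM2l // /plans !big_cat big_map !big_flat_nseq !sum_cells /=.
have e1 : \sum_(x <- oa) baseS (planO x) <= optc.
  rewrite -optc_oa big_seq [X in _ <= X]big_seq; apply: ler_sum => x; exact: baseO.
have e2 : \sum_(c < Nc | hasL c) iter (wid c) (+%R (baseS (planL c))) 0 <= (1 + dlt) / H%:R * optc + Nc%:R * (2%:R * Dm).
  apply: le_trans _ costL; apply: ler_sum => c _; by rewrite iter_addr_0 -[X in X <= _]mulr_natl /planL base1.
have e3 := costS l0 pot.
have e4 : \sum_(c < Nc | hasS c) iter (ec oa c) (+%R (baseS (planS c))) 0 <= \sum_(c < Nc | hasS c) (ec oa c)%:R * (2%:R * edist O (P (rc c))).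
  by apply: ler_sum => c _; rewrite iter_addr_0 -[X in X <= _]mulr_natl /planS base1.
move: e1 e2 e3 e4; lra.
Qed.

(** A crude bound suffices: its purpose is to make every multiplicity a digit in base [tsize]. *)
Lemma size_plans : (size (plans oa) <= n.+1 * (1 + (H + 4) * Nc))%N.
Proof.
have sts : (size oa <= n)%N.
  rewrite -(size_map fst) oa_ts -(size_iota 0 n) -(perm_size ts_perm) size_flatten sumnE big_map.
  rewrite -sum1_size big_seq [X in (_ <= X)%N]big_seq; apply: leq_sum => o /ts_ne.
  by case: o.
have imn c : imbc oa c <= n%:R.
  apply: (@le_trans _ _ (\sum_(x <- oa) (size x.1)%:R)).
    rewrite /imbc /imb big_seq [X in _ <= X]big_seq; apply: ler_sum => x hx; have ho := oa_mem hx.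
    apply: (@le_trans _ _ (smc dem small cell x.1 c)).
      by rewrite gerBl; case: ifP => // _; apply: so_ge0.
    rewrite /smc -sum1_size natr_sum big_mkcond big_seq [X in _ <= X]big_seq; apply: ler_sum => v vo.
    by case: ifP => // _; have /dem_in/andP[] := mem_ts ho vo.
  rewrite -natr_sum ler_nat; have e : (\sum_(x <- oa) \sum_(v <- x.1) 1 = \sum_(v < n) 1)%N by apply: sum_oa.
  rewrite sum1_card card_ord in e; rewrite -e.
  by apply: leq_sum => x _; rewrite sum1_size.
have stn c : (stars oa c <= n)%N.
  apply: leq_trans sts; rewrite -sum1_size; apply: leq_sum => x _; exact: leq_b1.
have ecn c : (ec oa c <= (H + 2) * n + 1)%N.
  rewrite /ec addn1 ltnS truncn_le_nat ltr_pdivrMr ?H1R //.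
  apply: (@lt_le_trans _ _ ((H + 2) * n).+1%:R); last first.
    by rewrite ler_peMr ?ler0n // ler1n -ltnS prednK.
  rewrite -natr1 natrM natrD /need; have := imn c; have : (stars oa c)%:R <= n%:R :> R by rewrite ler_nat.
  move=> h1 h2; have h3 : H%:R * imbc oa c <= H%:R * n%:R by rewrite ler_pM2l.
  rewrite gt_max; apply/andP; split; first by rewrite ltr_wpDl // mulr_ge0 ?addr_ge0 ?ler0n.
  by move: h1 h3; lra.
have szf (k : nat -> nat) (f : nat -> seq slot) Q B : (forall c, (k c <= B)%N) ->
    (size (flatten [seq nseq (k c) (f c) | c <- [seq c <- iota 0 Nc | Q c]]) <= B * Nc)%N.
  move=> kB; rewrite size_flatten /shape -map_comp sumnE big_map.
  apply: leq_trans (_ : \sum_(c <- [seq c <- iota 0 Nc | Q c]) B <= _)%N.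
    by apply: leq_sum => c _; rewrite /= size_nseq.
  rewrite big_const_seq iter_addn_0 leq_mul2l count_predT size_filter; apply/orP; right.
  by rewrite -[X in (_ <= X)%N](size_iota 0 Nc) count_size.
have wn c : ((if (c < Nc)%N then wid c else 0) <= n.+1)%N.
  case: ifP => // cN; rewrite widE // ltnS; apply: leq_trans (leq_div _ _) _.
  by rewrite -[X in (_ <= X)%N](size_iota 0 n) count_size.
rewrite /plans !size_cat size_map.
have -> : flatten [seq nseq (wid c) (planL c) | c <- [seq c <- iota 0 Nc | hasL c]] =
    flatten [seq nseq (if (c < Nc)%N then wid c else 0%N) (planL c) | c <- [seq c <- iota 0 Nc | hasL c]].
  by congr flatten; apply/eq_in_map => c; rewrite mem_filter mem_iota add0n => /andP[_ /andP[_ ->]].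
have a1 := szf _ planL hasL _ wn; have a2 := szf (ec oa) planS hasS _ ecn.
move: sts a1 a2; move: (size _) (size _) (size _) => x y z; clear; nia.
Qed.

End Advice.

Theorem plans_exist (l : R) : 0 < l -> exists cf, [/\ plans_ok cf, (size cf <= n.+1 * (1 + (H + 4) * Nc))%N &
  \sum_(pl <- cf) (baseS pl + \sum_(s <- pl) 2%:R * dlS s) <=
  (1 + dlt * H%:R) * ((1 + (1 + dlt) / H%:R + 2%:R / H.-1%:R * (1 + dlt)) * optc +
     2%:R * Dm * (2%:R * Nc%:R + 2%:R * (2%:R * l * (size ts)%:R + Nc%:R / (4%:R * l))))].
Proof.
move=> l0; have [o ho|oa [e st pot]] := @balance R n Nc dem small cell dem_gt0 cell_lt ts.
  by split; [move=> v; apply: mem_ts ho | apply: so_le1 ho].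
exists (plans oa); split.
- exact: plans_okP.
- exact: size_plans.
- exact: plans_cost.
Qed.

End Exist.

(** * The dynamic programme on the machine *)

Section Closure4.
Variable R : realType.
Implicit Types (G : ctx R).

Lemma nc_bool G (b : car G -> bool) : bcomp b -> ncomp (fun a : car G => nat_of_bool (b a)).
Proof. by []. Qed.

Lemma nc_nsum G (b : car G -> nat) (F : car G -> nat -> nat) :
    ncomp b -> (forall d k, ncomp (fun x : car (ext G d k) => F x.1 x.2)) ->
  ncomp (fun a => nsum (b a) (F a)).
Proof. exact: nc_sum. Qed.

Lemma nc_nsumc G N (F : car G -> nat -> nat) :
  (forall i, ncomp (fun a : car G => F a i)) -> ncomp (fun a : car G => nsum N (F a)).
Proof.
move=> h; elim: N => [|N IH].
  by apply: (@nc_ext _ _ (fun _ => 0%N)); [move=> a; rewrite /nsum big_ord0 | apply: nc_const].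
apply: (@nc_ext _ _ (fun a => nsum N (F a) + F a N)%N); first by move=> a; rewrite nsumS.
by apply: nc_add.
Qed.

Lemma rc_rsum G (b : car G -> nat) (F : car G -> nat -> R) :
    ncomp b -> (forall d k, rcomp (fun x : car (ext G d k) => F x.1 x.2)) ->
  rcomp (fun a => rsum (b a) (F a)).
Proof. exact: rc_sum. Qed.

Lemma bc_nall G (b : car G -> nat) (F : car G -> nat -> bool) :
    ncomp b -> (forall d k, bcomp (fun x : car (ext G d k) => F x.1 x.2)) ->
  bcomp (fun a => nall (b a) (F a)).
Proof. exact: bc_all. Qed.

Lemma bc_nhas G (b : car G -> nat) (F : car G -> nat -> bool) :
    ncomp b -> (forall d k, bcomp (fun x : car (ext G d k) => F x.1 x.2)) ->
  bcomp (fun a => nhas (b a) (F a)).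
Proof.
move=> hb hF; apply: (@nc_ext _ _ (fun a => nat_of_bool (~~ nall (b a) (fun i => ~~ F a i)))).
  by move=> a; rewrite /nall all_predC negbK.
by apply: bc_not; apply: bc_nall => // d k; apply: bc_not.
Qed.

Lemma nc_pred G (f : car G -> nat) : ncomp f -> ncomp (fun a => (f a).-1).
Proof.
move=> h; apply: (@nc_ext _ _ (fun a => f a - 1)%N); first by move=> a; rewrite subn1.
by apply: nc_sub => //; apply: nc_const.
Qed.

Lemma nc_dgt G (b : car G -> nat) k (f : car G -> nat) :
  ncomp b -> ncomp f -> ncomp (fun a => dgt (b a) k (f a)).
Proof. by move=> hb hf; apply: nc_mod => //; apply: nc_div => //; apply: nc_exp. Qed.

(** Computability under substitution, in every context: the arguments may involve loop variables
    that are introduced only where the function is used. *)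
Definition NC1 (f : world R -> nat -> nat) : Prop :=
  forall G (x : car G -> nat), ncomp x -> ncomp (fun a => f (cw a) (x a)).
Definition NC2 (f : world R -> nat -> nat -> nat) : Prop :=
  forall G (x y : car G -> nat), ncomp x -> ncomp y -> ncomp (fun a => f (cw a) (x a) (y a)).
Definition NC3 (f : world R -> nat -> nat -> nat -> nat) : Prop :=
  forall G (x y z : car G -> nat), ncomp x -> ncomp y -> ncomp z ->
  ncomp (fun a => f (cw a) (x a) (y a) (z a)).
Definition BC1 (f : world R -> nat -> bool) : Prop :=
  forall G (x : car G -> nat), ncomp x -> bcomp (fun a => f (cw a) (x a)).
Definition BC2 (f : world R -> nat -> nat -> bool) : Prop :=
  forall G (x y : car G -> nat), ncomp x -> ncomp y -> bcomp (fun a => f (cw a) (x a) (y a)).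
Definition BC3 (f : world R -> nat -> nat -> nat -> bool) : Prop :=
  forall G (x y z : car G -> nat), ncomp x -> ncomp y -> ncomp z ->
  bcomp (fun a => f (cw a) (x a) (y a) (z a)).
Definition BC4 (f : world R -> nat -> nat -> nat -> nat -> bool) : Prop :=
  forall G (x y z t : car G -> nat), ncomp x -> ncomp y -> ncomp z -> ncomp t ->
  bcomp (fun a => f (cw a) (x a) (y a) (z a) (t a)).
Definition RC1 (f : world R -> nat -> R) : Prop :=
  forall G (x : car G -> nat), ncomp x -> rcomp (fun a => f (cw a) (x a)).
Definition RC2 (f : world R -> nat -> nat -> R) : Prop :=
  forall G (x y : car G -> nat), ncomp x -> ncomp y -> rcomp (fun a => f (cw a) (x a) (y a)).
Definition RC3 (f : world R -> nat -> nat -> nat -> R) : Prop :=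
  forall G (x y z : car G -> nat), ncomp x -> ncomp y -> ncomp z ->
  rcomp (fun a => f (cw a) (x a) (y a) (z a)).

Definition nW (w : world R) : nat := wN w 1 0.
Definition PW (w : world R) (v : nat) : R * R := (wR w 1 (2 + 3 * v), wR w 1 (3 + 3 * v)).
Definition OW (w : world R) : R * R := (wR w 1 0, wR w 1 1).
Definition demW (w : world R) (v : nat) : R := wR w 1 (4 + 3 * v).

Lemma nc_nW G : ncomp (fun a : car G => nW (cw a)).
Proof. by apply: (@nc_read R G 1 (fun _ => 0%N)) => //; apply: nc_const. Qed.

End Closure4.

Ltac nclift h := first
  [ exact h
  | exact (@nc_lift _ _ _ _ _ h)
  | exact (@nc_lift _ _ _ _ _ (@nc_lift _ _ _ _ _ h))
  | exact (@nc_lift _ _ _ _ _ (@nc_lift _ _ _ _ _ (@nc_lift _ _ _ _ _ h))) ].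
Ltac nchyp := match goal with
  | h : ncomp _ |- _ => nclift h
  end.
Ltac ncvar := first
  [ exact (@nc_var _ _ _ _)
  | exact (@nc_lift _ _ _ _ _ (@nc_var _ _ _ _))
  | exact (@nc_lift _ _ _ _ _ (@nc_lift _ _ _ _ _ (@nc_var _ _ _ _))) ].
(** Syntax-directed compilation: the head symbol of the function selects the closure property, and
    hypotheses or loop variables end the recursion. *)
Ltac ncbase := first [ lazymatch goal with
  | |- bcomp (fun a => andb (@?f a) (@?g a)) => apply: bc_and
  | |- bcomp (fun a => orb (@?f a) (@?g a)) => apply: bc_or
  | |- bcomp (fun a => negb (@?f a)) => apply: bc_not
  | |- bcomp (fun a => leq (@?f a) (@?g a)) => apply: bc_leq
  | |- bcomp (fun a => eq_op (@?f a) (@?g a)) => apply: bc_eqn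
  | |- bcomp (fun a => nall (@?f a) (@?g a)) => apply: bc_nall => [|? ?]
  | |- bcomp (fun a => nhas (@?f a) (@?g a)) => apply: bc_nhas => [|? ?]
  | |- bcomp (fun a => Order.le (@?f a) (@?g a)) => apply: nc_rle
  | |- bcomp (fun a => Order.lt (@?f a) (@?g a)) => apply: bc_rlt
  | |- ncomp (fun a => nat_of_bool (@?f a)) => apply: nc_bool
  | |- ncomp (fun a => addn (@?f a) (@?g a)) => apply: nc_add
  | |- ncomp (fun a => muln (@?f a) (@?g a)) => apply: nc_mul
  | |- ncomp (fun a => subn (@?f a) (@?g a)) => apply: nc_sub
  | |- ncomp (fun a => divn (@?f a) (@?g a)) => apply: nc_div
  | |- ncomp (fun a => modn (@?f a) (@?g a)) => apply: nc_mod
  | |- ncomp (fun a => S (@?f a)) => apply: nc_succ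
  | |- ncomp (fun a => predn (@?f a)) => apply: nc_pred
  | |- ncomp (fun a => nsum (@?f a) (@?g a)) => apply: nc_nsum => [|? ?]
  | |- ncomp (fun a => dgt (@?f a) ?k (@?g a)) => apply: nc_dgt
  | |- ncomp (fun a => nW (@?f a)) => apply: nc_nW
  | |- ncomp (fun a => wN (@?f a) ?j (@?g a)) => apply: nc_read; first by []
  | |- ncomp (fun a => ?k) => apply: nc_const
  | |- ncomp _ => apply: nc_if
  | |- rcomp (fun a => wR (@?f a) ?j (@?g a)) => apply: rc_read; first by []
  | |- rcomp (fun a => rsum (@?f a) (@?g a)) => apply: rc_rsum => [|? ?]
  | |- rcomp _ => first [apply: rc_const | apply: rc_sub | apply: rc_add | apply: rc_mul | apply: rc_sqrt | apply: rc_nat | apply: rc_if]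
  end | nchyp | ncvar ].

Section DPcomp.
Variable R : realType.
Variable S : nat.
Implicit Types (w : world R) (G : ctx R).

Notation tsz w := (tsize (nW w) S).

Lemma nc_tsz G : ncomp (fun a : car G => tsz (cw a)).
Proof. by apply: (@nc_exp R G (fun a => (nW (cw a)).+1)); ncbase; ncbase. Qed.

Lemma bc_inb4 G (l r b t v : car G -> nat) : ncomp l -> ncomp r -> ncomp b -> ncomp t -> ncomp v ->
  bcomp (fun a => inb4 (nW (cw a)) (PW (cw a)) (l a) (r a) (b a) (t a) (v a)).
Proof. by move=> hl hr hb ht hv; rewrite /inb4 /PW /=; repeat ncbase. Qed.

Definition inbW w idx v := inb (nW w) (PW w) idx v.
Definition cntW w idx x y := cnt (nW w) S idx x y.
Definition tabW w : table R := Table (fun idx => wN w 2 idx != 0%N) (fun idx => wR w 2 idx)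
  (fun idx u v => wN w 4 ((idx * nW w + u) * nW w + v) != 0%N).

Lemma bc_inbW : BC2 inbW.
Proof. by move=> G x y hx hy; apply: bc_inb4 => //; repeat ncbase. Qed.

Lemma nc_cntW : NC3 cntW.
Proof. by move=> G x y z hx hy hz; apply: nc_nsumc => i; repeat ncbase. Qed.

Definition edW w u v := edist (PW w u) (PW w v).

Lemma rc_edW : RC2 edW.
Proof. by move=> G x y hx hy; rewrite /edW /edist /PW /=; repeat ncbase. Qed.

Lemma bc_if G (b c e : car G -> bool) : bcomp b -> bcomp c -> bcomp e ->
  bcomp (fun a => if b a then c a else e a).
Proof.
move=> hb hc he; apply: (@nc_ext _ _ (fun a => if b a then nat_of_bool (c a) else nat_of_bool (e a))).
  by move=> a; case: (b a).
exact: nc_if.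
Qed.

Ltac ncdp := first [lazymatch goal with
  | |- ncomp (fun a => tsize (nW (@?w a)) ?S) => apply: nc_tsz
  | |- ncomp (fun a => cntW (@?w a) (@?x a) (@?y a) (@?z a)) => apply: nc_cntW
  | |- bcomp (fun a => inbW (@?w a) (@?x a) (@?y a)) => apply: bc_inbW
  | |- rcomp (fun a => edW (@?w a) (@?x a) (@?y a)) => apply: rc_edW
  end | ncbase].

Definition ziW w z := zi (nW w) S z.
Definition zjW w z := zj (nW w) S z.
Definition zoW w z := zo (nW w) S z.
Definition okW w idx z := ok (nW w) S (PW w) (tabW w) idx z.
Definition ccW w z := cc (nW w) S (PW w) (tabW w) z.
Definition bbW w z u v := bb (nW w) S (tabW w) z u v.
Definition choiceW w idx := choice (nW w) S (PW w) (tabW w) idx.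
Definition valid0W w idx := valid0 (nW w) S (PW w) idx.

Lemma nc_ziW : NC1 ziW.
Proof. by move=> G x hx; rewrite /ziW /zi; repeat ncdp. Qed.
Lemma nc_zjW : NC1 zjW.
Proof. by move=> G x hx; rewrite /zjW /zj; repeat ncdp. Qed.
Lemma nc_zoW : NC1 zoW.
Proof. by move=> G x hx; rewrite /zoW /zo; repeat ncdp. Qed.

Ltac ncdp2 := first [lazymatch goal with
  | |- ncomp (fun a => ziW (@?w a) (@?x a)) => apply: nc_ziW
  | |- ncomp (fun a => zjW (@?w a) (@?x a)) => apply: nc_zjW
  | |- ncomp (fun a => zoW (@?w a) (@?x a)) => apply: nc_zoW
  end | ncdp].

Lemma bc_valid0W : BC1 valid0W.
Proof.
move=> G x hx; rewrite /valid0W /valid0.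
(* Equality of truth values is restated as equality of integers, for which there is a closure
   property. *)
have -> : (fun a : car G => (nall (nW (cw a)) (fun v => ~~ inb (nW (cw a)) (PW (cw a)) (x a) v) &&
   nall (nW (cw a)) (fun x0 => nall (nW (cw a)) (fun y => cnt (nW (cw a)) S (x a) x0 y == 0%N)))
  || nhas (nW (cw a)) (fun v => nall (nW (cw a)) (fun u => inb (nW (cw a)) (PW (cw a)) (x a) u == (u == v)) &&
     nall (nW (cw a)) (fun x0 => nall (nW (cw a)) (fun y => cnt (nW (cw a)) S (x a) x0 y == ((x0 == v) && (y == v)))))) =
  (fun a : car G => (nall (nW (cw a)) (fun v => ~~ inbW (cw a) (x a) v) &&
   nall (nW (cw a)) (fun x0 => nall (nW (cw a)) (fun y => cntW (cw a) (x a) x0 y == 0%N)))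
  || nhas (nW (cw a)) (fun v => nall (nW (cw a)) (fun u => nat_of_bool (inbW (cw a) (x a) u) == nat_of_bool (u == v)) &&
     nall (nW (cw a)) (fun x0 => nall (nW (cw a)) (fun y => cntW (cw a) (x a) x0 y == ((x0 == v) && (y == v)))))).
  apply/funext => a; congr (_ || _); apply: eq_has => v; congr (_ && _); apply: eq_all => u.
  by rewrite /inbW; case: (inb _ _ _ _); case: (u == v).
by repeat ncdp2.
Qed.

Lemma bc_okW : BC2 okW.
Proof.
move=> G x y hx hy; rewrite /okW /ok.
apply: bc_if; first by apply: bc_eqn; [apply: (@nc_zoW G y) | apply: nc_const].
  have -> : (fun a : car G => union_ok (nW (cw a)) S (PW (cw a)) (tabW (cw a)) (x a) (zi (nW (cw a)) S (y a)) (zj (nW (cw a)) S (y a))) =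
    (fun a : car G => [&& ~~ (wN (cw a) 2 (ziW (cw a) (y a)) == 0%N), ~~ (wN (cw a) 2 (zjW (cw a) (y a)) == 0%N),
    nall (nW (cw a)) (fun v => ~~ (inbW (cw a) (ziW (cw a) (y a)) v && inbW (cw a) (zjW (cw a) (y a)) v) &&
       (nat_of_bool (inbW (cw a) (x a) v) == nat_of_bool (inbW (cw a) (ziW (cw a) (y a)) v || inbW (cw a) (zjW (cw a) (y a)) v))) &
    nall (nW (cw a)) (fun s => nall (nW (cw a)) (fun t => cntW (cw a) (x a) s t == cntW (cw a) (ziW (cw a) (y a)) s t + cntW (cw a) (zjW (cw a) (y a)) s t)%N)]).
    apply/funext => a; rewrite /union_ok; congr [&& _, _, _ & _]; apply: eq_all => v; congr (_ && _).
    by rewrite /inbW; case: (inb _ _ _ _); case: (_ || _).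
  by repeat ncdp2.
have -> : (fun a : car G => link_ok (nW (cw a)) S (PW (cw a)) (tabW (cw a)) (x a) (zi (nW (cw a)) S (y a))
     (dgt (nW (cw a)).+1 0 (zj (nW (cw a)) S (y a))) (dgt (nW (cw a)).+1 1 (zj (nW (cw a)) S (y a)))
     (dgt (nW (cw a)).+1 2 (zj (nW (cw a)) S (y a))) (dgt (nW (cw a)).+1 3 (zj (nW (cw a)) S (y a)))) =
  (fun a : car G => let n := nW (cw a) in let x1 := dgt n.+1 0 (zjW (cw a) (y a)) in
    let y1 := dgt n.+1 1 (zjW (cw a) (y a)) in let x2 := dgt n.+1 2 (zjW (cw a) (y a)) in
    let y2 := dgt n.+1 3 (zjW (cw a) (y a)) in let i := ziW (cw a) (y a) in
    [&& ~~ (wN (cw a) 2 i == 0%N), [&& x1 < n, y1 < n, x2 < n & y2 < n]%N, ~~ (x1 == x2),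
    [&& (0 < cntW (cw a) i x1 y1)%N, (0 < cntW (cw a) i x2 y2)%N &
       nall n (fun v => nat_of_bool (inbW (cw a) (x a) v) == nat_of_bool (inbW (cw a) i v))] &
    nall n (fun s => nall n (fun t => cntW (cw a) (x a) s t + (nat_of_bool ((s == x1) && (t == y1)) + nat_of_bool ((s == x2) && (t == y2))) ==
      cntW (cw a) i s t + nat_of_bool ((s == x1) && (t == y2)))%N)]).
  apply/funext => a; rewrite /link_ok; congr [&& _, _, _, _ & _]; congr [&& _, _ & _]; apply: eq_all => v.
  by rewrite /inbW; case: (inb _ _ _ _); case: (inb _ _ _ _).
by rewrite /=; repeat ncdp2.
Qed.

Lemma rc_ccW : RC1 ccW.
Proof.
move=> G x hx; rewrite /ccW /cc.
apply: rc_if; first by apply: bc_eqn; [apply: (@nc_zoW G x) | apply: nc_const].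
  by apply: (@rc_ext _ _ (fun a : car G => wR (cw a) 2 (ziW (cw a) (x a)) + wR (cw a) 2 (zjW (cw a) (x a)))) => //; repeat ncdp2.
apply: (@rc_ext _ _ (fun a : car G => wR (cw a) 2 (ziW (cw a) (x a)) +
   edW (cw a) (dgt (nW (cw a)).+1 1 (zjW (cw a) (x a))) (dgt (nW (cw a)).+1 2 (zjW (cw a) (x a))))) => //.
by repeat ncdp2.
Qed.

Definition tbW w i u v : bool := ~~ (wN w 4 ((i * nW w + u) * nW w + v) == 0%N).

Lemma bc_tbW : BC3 tbW.
Proof. by move=> G x y z hx hy hz; rewrite /tbW; repeat ncdp2. Qed.

Lemma bc_bbW : BC3 bbW.
Proof.
move=> G x y z hx hy hz; rewrite /bbW /bb.
apply: bc_if; first by apply: bc_eqn; [apply: (@nc_zoW G x) | apply: nc_const].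
  apply: (@nc_ext _ _ (fun a : car G => nat_of_bool (tbW (cw a) (ziW (cw a) (x a)) (y a) (z a) ||
    tbW (cw a) (zjW (cw a) (x a)) (y a) (z a)))) => //.
  by apply: bc_or; apply: bc_tbW; repeat ncdp2.
apply: (@nc_ext _ _ (fun a : car G => nat_of_bool (tbW (cw a) (ziW (cw a) (x a)) (y a) (z a) ||
    (tbW (cw a) (ziW (cw a) (x a)) (y a) (dgt (nW (cw a)).+1 1 (zjW (cw a) (x a))) &&
     tbW (cw a) (ziW (cw a) (x a)) (dgt (nW (cw a)).+1 2 (zjW (cw a) (x a))) (z a))))) => //.
by apply: bc_or; [|apply: bc_and]; apply: bc_tbW; repeat ncdp2.
Qed.

Lemma nc_choiceW : NC1 choiceW.
Proof.
move=> G x hx; apply: (@nc_amin R G (fun a => 2 * tsz (cw a) * tsz (cw a))%N (fun a => okW (cw a) (x a)) (fun a => ccW (cw a))).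
- by repeat ncdp2.
- by move=> d k; apply: (@bc_okW (ext G d k) (fun a => x a.1) (fun a => a.2)); repeat ncdp2.
- by move=> d k; apply: (@rc_ccW (ext G d k) (fun a => a.2)); repeat ncdp2.
Qed.

Lemma leq_exp2r' a b D : (a <= b)%N -> (a ^ D <= b ^ D)%N.
Proof. by case: D => [|D] h; rewrite ?expn0 // leq_exp2r. Qed.

Section Passes.
Variable kap : nat.
Hypothesis kapS : (2 * (4 + 2 * S) + 1 <= kap)%N.
Notation tcomp := (@tcomp R kap).
Notation base := (@base R kap).
Notation tn2 w := (tsz w * nW w * nW w)%N.

Lemma pol_bool (b : bool) w : (b <= pol kap (nW w))%N.
Proof. by apply: leq_trans (leq_b1 _) _; rewrite /pol expn_gt0 addn2. Qed.

Lemma choice_bound w idx : (choiceW w idx <= pol kap (nW w))%N.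
Proof.
apply: leq_trans (amin_le _ _ _) _.
apply: leq_trans (_ : (nW w + 2) ^ (2 * (4 + 2 * S) + 1) <= _)%N; last first.
  by rewrite /pol leq_pexp2l // addn2.
have -> : (2 * (4 + 2 * S) + 1 = (4 + 2 * S) + (4 + 2 * S) + 1)%N by rewrite mul2n -addnn.
rewrite /tsize; move: (4 + 2 * S)%N => D.
rewrite expnD expnD expn1 -mulnA mulnC; apply: leq_mul; last by rewrite addn2.
by apply: leq_mul; apply: leq_exp2r'; rewrite addn2.
Qed.

(** A step reads the old table throughout, so choices and costs go to array 3 and the relation to
    array 6; arrays 2 and 4 are replaced only when all of these are computed. A choice is positive
    exactly for a valid row and doubles as the validity flag. *)
Definition pass1 w := setN w 3 (tsz w) (choiceW w).
Definition pass2 w := setR w 3 (tsz w) (fun i => ccW w (wN w 3 i).-1).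
Definition pass3 w := setN w 6 (tn2 w) (fun i => nat_of_bool (bbW w (wN w 3 (i %/ nW w %/ nW w)).-1 (i %/ nW w %% nW w) (i %% nW w))).
Definition pass4 w := setR w 2 (tsz w) (fun i => wR w 3 i).
Definition pass5 w := setN w 2 (tsz w) (fun i => wN w 3 i).
Definition pass6 w := setN w 4 (tn2 w) (fun i => wN w 6 i).
Definition stepW w := pass6 (pass5 (pass4 (pass3 (pass2 (pass1 w))))).
Definition init1 w := setN w 2 (tsz w) (fun i => nat_of_bool (valid0W w i)).
Definition init2 w := setR w 2 (tsz w) (fun _ => 0%:R).
Definition init3 w := setN w 4 (tn2 w) (fun i => nat_of_bool ((i %/ nW w %% nW w == i %% nW w)%N && inbW w (i %/ nW w %/ nW w) (i %/ nW w %% nW w))).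
Definition initW w := init3 (init2 (init1 w)).

Lemma nc_tn2 G : ncomp (fun a : car G => tn2 (cw a)).
Proof. by repeat ncdp2. Qed.

Lemma tc_stepW : tcomp stepW.
Proof.
apply: (@tc_comp R kap (fun w => pass5 (pass4 (pass3 (pass2 (pass1 w))))) pass6); last first.
  apply: (@tc_wn R kap 4 (fun w => tn2 w) (fun w i => wN w 6 i)) => //; first exact: nc_tn2.
  - by move=> d k; repeat ncdp2.
  - by move=> w i h _; apply: h.
apply: (@tc_comp R kap (fun w => pass4 (pass3 (pass2 (pass1 w)))) pass5); last first.
  apply: (@tc_wn R kap 2 (fun w => tsz w) (fun w i => wN w 3 i)) => //; first exact: nc_tsz.
  - by move=> d k; repeat ncdp2.
  - by move=> w i h _; apply: h.
apply: (@tc_comp R kap (fun w => pass3 (pass2 (pass1 w))) pass4); last first.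
  apply: (@tc_wr R kap 2 (fun w => tsz w) (fun w i => wR w 3 i)) => //; first exact: nc_tsz.
  by move=> d k; repeat ncdp2.
apply: (@tc_comp R kap (fun w => pass2 (pass1 w)) pass3); last first.
  apply: (@tc_wn R kap 6 (fun w => tn2 w) (fun w i => nat_of_bool (bbW w (wN w 3 (i %/ nW w %/ nW w)).-1 (i %/ nW w %% nW w) (i %% nW w)))) => //; first exact: nc_tn2.
  - by move=> d k; apply: nc_bool; apply: (@bc_bbW (ext base d k) (fun a => (wN (cw a) 3 (a.2 %/ nW (cw a) %/ nW (cw a))).-1) (fun a => a.2 %/ nW (cw a) %% nW (cw a))%N (fun a => a.2 %% nW (cw a))%N); repeat ncdp2.
  - by move=> w i _ _; apply: pol_bool.
apply: (@tc_comp R kap pass1 pass2).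
  apply: (@tc_wn R kap 3 (fun w => tsz w) choiceW) => //; first exact: nc_tsz.
  - by move=> d k; apply: (@nc_choiceW (ext base d k) (fun a => a.2)); repeat ncdp2.
  - by move=> w i _ _; apply: choice_bound.
apply: (@tc_wr R kap 3 (fun w => tsz w) (fun w i => ccW w (wN w 3 i).-1)) => //; first exact: nc_tsz.
by move=> d k; apply: (@rc_ccW (ext base d k) (fun a => (wN (cw a) 3 a.2).-1)); repeat ncdp2.
Qed.

Lemma tc_initW : tcomp initW.
Proof.
apply: (@tc_comp R kap (fun w => init2 (init1 w)) init3); last first.
  apply: (@tc_wn R kap 4 (fun w => tn2 w) (fun w i => nat_of_bool ((i %/ nW w %% nW w == i %% nW w)%N && inbW w (i %/ nW w %/ nW w) (i %/ nW w %% nW w)))) => //; first exact: nc_tn2.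
  - by move=> d k; repeat ncdp2.
  - by move=> w i _ _; apply: pol_bool.
apply: (@tc_comp R kap init1 init2).
  apply: (@tc_wn R kap 2 (fun w => tsz w) (fun w i => nat_of_bool (valid0W w i))) => //; first exact: nc_tsz.
  - by move=> d k; apply: nc_bool; apply: (@bc_valid0W (ext base d k) (fun a => a.2)); repeat ncdp2.
  - by move=> w i _ _; apply: pol_bool.
apply: (@tc_wr R kap 2 (fun w => tsz w) (fun w i => 0%:R)) => //; first exact: nc_tsz.
by move=> d k; repeat ncdp2.
Qed.

End Passes.

End DPcomp.

Section Sem.
Variable R : realType.
Variable S : nat.
Implicit Types (w : world R).
Notation tsz w := (tsize (nW w) S).

Lemma setNE w j b f x : (x < b)%N -> wN (setN w j b f) j x = f x.
Proof. by move=> h; rewrite /= eqxx h. Qed.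

Lemma setRE w j b f x : (x < b)%N -> wR (setR w j b f) j x = f x.
Proof. by move=> h; rewrite /= eqxx h. Qed.

Lemma tn2P n T idx u v : (idx < T)%N -> (u < n)%N -> (v < n)%N -> let i := ((idx * n + u) * n + v)%N in
  [/\ (i < T * n * n)%N, (i %/ n %/ n = idx)%N, (i %/ n %% n = u)%N & (i %% n = v)%N].
Proof.
move=> h1 h2 h3 i; have n0 : (0 < n)%N by apply: leq_ltn_trans h2.
have e : (i %/ n = idx * n + u)%N by rewrite /i divnMDl // divn_small // addn0.
rewrite e divnMDl // (divn_small h2) addn0 /i !modnMDl !modn_small //; split=> //.
by move: h1 h2 h3; rewrite /i; clear; nia.
Qed.

Definition tabeq n (t t' : table R) : Prop := forall idx, (idx < tsize n S)%N ->
  [/\ tv t idx = tv t' idx, tc t idx = tc t' idx &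
   forall u v, (u < n)%N -> (v < n)%N -> tb t idx u v = tb t' idx u v].

Lemma stepW_tab w : tabeq (nW w) (tabW (stepW S w)) (step (nW w) S (PW w) (tabW w)).
Proof.
move=> idx iT; have e1 x : (x < tsz w)%N -> wN (pass1 S w) 3 x = choiceW S w x by move=> h; rewrite setNE.
have e2 x : (x < tsz w)%N -> wR (pass2 S (pass1 S w)) 3 x = ccW S w (choiceW S w x).-1.
  by move=> h; rewrite setRE // e1.
split.
- have -> : tv (tabW (stepW S w)) idx = (wN (pass5 S (pass4 S (pass3 S (pass2 S (pass1 S w))))) 2 idx != 0%N) by [].
  by rewrite setNE // -[wN _ 3 idx]/(wN (pass1 S w) 3 idx) e1.
- have -> : tc (tabW (stepW S w)) idx = wR (pass4 S (pass3 S (pass2 S (pass1 S w)))) 2 idx by [].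
  by rewrite setRE // -[wR _ 3 idx]/(wR (pass2 S (pass1 S w)) 3 idx) e2.
- move=> u v un vn; have [h1 h2 h3 h4] := tn2P iT un vn.
  have -> : tb (tabW (stepW S w)) idx u v = (wN (stepW S w) 4 ((idx * nW w + u) * nW w + v) != 0%N) by [].
  rewrite setNE // -[wN _ 6 _]/(wN (pass3 S (pass2 S (pass1 S w))) 6 ((idx * nW w + u) * nW w + v)) setNE //.
  rewrite -[nW (pass2 _ _)]/(nW w) h2 h3 h4 -[wN _ 3 idx]/(wN (pass1 S w) 3 idx) e1 //.
  have -> : bbW S (pass2 S (pass1 S w)) (choiceW S w idx).-1 u v = bb (nW w) S (tabW w) (choiceW S w idx).-1 u v by [].
  by rewrite /=; case: (bb _ _ _ _ _ _).
Qed.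

(** Row numbers in a candidate are reduced modulo [tsize], but its digits may name terminals out of
    range, where arrays and table need not agree. A chosen link has passed the range checks of
    [link_ok], so its entries do agree. *)
Lemma step_tabeq n P (t t' : table R) : tabeq n t t' -> tabeq n (step n S P t) (step n S P t').
Proof.
move=> h; have T0 := tsize_gt0 n S.
have zT z : (zi n S z < tsize n S)%N /\ (zj n S z < tsize n S)%N by rewrite /zi /zj !ltn_pmod.
have eok : ok n S P t = ok n S P t'.
  apply/funext => idx; apply/funext => z; have [z1 z2] := zT z.
  have [a1 _ _] := h _ z1; have [b1 _ _] := h _ z2.
  by rewrite /ok /union_ok /link_ok a1 b1.
have ecc : cc n S P t = cc n S P t'.
  apply/funext => z; have [z1 z2] := zT z.
  have [_ a1 _] := h _ z1; have [_ b1 _] := h _ z2.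
  by rewrite /cc a1 b1.
have ech : choice n S P t = choice n S P t' by apply/funext => idx; rewrite /choice eok ecc.
move=> idx iT; rewrite /step /= ech ecc; split=> // u v un vn.
set c := choice n S P t' idx; have [z1 z2] := zT c.-1.
have [_ _ a1] := h _ z1; have [_ _ b1] := h _ z2.
rewrite /bb; case: ifP => z0; first by rewrite a1 // b1.
have okc : ok n S P t' idx c.-1.
  have := aminP (ok n S P t' idx) (cc n S P t') (2 * tsize n S * tsize n S).
  rewrite -/(choice n S P t' idx) -/c; case: (c) z0 => [|z] z0 /=; last by case.
  by move: z0; rewrite /zo div0n div0n.
move: okc; rewrite /ok z0 => /and5P[_ /and4P[x1 x2 x3 x4] _ _ _].
by rewrite !a1.
Qed.

Lemma initW_tab w : tabeq (nW w) (tabW (initW S w)) (tab0 (nW w) S (PW w)).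
Proof.
move=> idx iT; split.
- have -> : tv (tabW (initW S w)) idx = (wN (init1 S w) 2 idx != 0%N) by [].
  by rewrite setNE // /tab0 /= -/(valid0W S w idx); case: (valid0W _ _ _).
- have -> : tc (tabW (initW S w)) idx = wR (init2 S (init1 S w)) 2 idx by [].
  by rewrite setRE.
- move=> u v un vn; have [h1 h2 h3 h4] := tn2P iT un vn.
  have -> : tb (tabW (initW S w)) idx u v = (wN (initW S w) 4 ((idx * nW w + u) * nW w + v) != 0%N) by [].
  rewrite setNE // -[nW (init2 _ _)]/(nW w) h2 h3 h4 /=.
  by rewrite -[inbW _ _ _]/(inb (nW w) (PW w) idx u); case: (_ && _).
Qed.

Lemma tabeq_trans n t1 t2 t3 : tabeq n t1 t2 -> tabeq n t2 t3 -> tabeq n t1 t3.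
Proof.
move=> h1 h2 idx iT; have [a1 a2 a3] := h1 idx iT; have [b1 b2 b3] := h2 idx iT.
by split=> [||u v un vn]; rewrite ?a1 ?a2 ?a3 // b3.
Qed.

Definition same_in w w' : Prop := wN w' 1 =1 wN w 1 /\ wR w' 1 =1 wR w 1.

Lemma same_inP w w' : same_in w w' -> [/\ nW w' = nW w, PW w' = PW w, OW w' = OW w & demW w' = demW w].
Proof.
move=> [h1 h2]; split; rewrite /nW ?h1 //; last by apply/funext => v; rewrite /demW h2.
  by apply/funext => v; rewrite /PW !h2.
by rewrite /OW !h2.
Qed.

Definition dpW r w := iter r (stepW S) (initW S w).

Lemma dpW_in r w : same_in w (dpW r w).
Proof.
by elim: r => [|r [h1 h2]]; split.
Qed.

Lemma dpW_tab r w : tabeq (nW w) (tabW (dpW r w)) (iter r (step (nW w) S (PW w)) (tab0 (nW w) S (PW w))).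
Proof.
elim: r => [|r IH]; first exact: initW_tab.
have [e1 e2 _ _] := same_inP (dpW_in r w).
have := @stepW_tab (dpW r w); rewrite e1 e2 => h.
exact: tabeq_trans h (step_tabeq _ IH).
Qed.

End Sem.

(** * The decoder on the machine *)

(** The exponent in [dgt] is fixed by the program, so a digit at a variable position is found by
    running through [N] fixed positions. Out of range the value is 0. *)
Definition sel (N i : nat) (F : nat -> nat) : nat := nsum N (fun k => if k == i then F k else 0%N).

Lemma selE N i F : (i < N)%N -> sel N i F = F i.
Proof.
move=> iN; rewrite /sel /nsum (bigD1 (Ordinal iN)) //= eqxx big1 ?addn0 // => k /eqP ne.
by case: eqP => // e; case: ne; apply/val_inj.
Qed.

Section Dec.
Variable R : realType.
Variables (S H Nc Q : nat).
Implicit Types (w : world R) (G : ctx R) (A : nat).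
Notation tsz w := (tsize (nW w) S).

(** Labels run from 0 to [H ^ 2 + 1]: 0 for small items, then one per group, and one more because
    the last group too leaves its places to a next one. *)
Definition lim : nat := (H ^ 2 + 2)%N.
Definition cfB : nat := (Nc * (lim * H.+1))%N.

(* An advice lists, in base [tsize], for every cell the table index of its path
   and its rank width, and for every configuration of slots its multiplicity. *)
Definition idxA w A c := sel Nc c (fun k => dgt (tsz w) k A).
Definition widA w A c := sel Nc c (fun k => dgt (tsz w) (Nc + k) A).
Definition xA w A k := sel Q k (fun k' => dgt (tsz w) (2 * Nc + k') A).
Definition inbA w A c v := inbW w (idxA w A c) v.
Definition befA w A c u v := tbW w (idxA w A c) u v.
Definition mA w A := nsum Q (fun k => xA w A k).
(** Tours are listed by type, so [find] on the multiplicities gives the type of the tour containing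
    slot [s]; the digits of the type in base [cfB] are the codes of its slots. *)
Definition eA w A s := sel H (s %% H) (fun i => dgt cfB i (find (fun k => xA w A k) Q (s %/ H))).
Definition scA w A s := (eA w A s %% Nc)%N.
Definition slA w A s := (eA w A s %/ Nc %% lim)%N.
Definition sqA w A s := (eA w A s %/ Nc %/ lim)%N.
Definition Adn : nat := (2 * Nc + Q)%N.

Notation cellA w A := (cellv Nc (inbA w A)).
Notation posA w A := (posv (nW w) Nc (inbA w A) (befA w A)).
Notation largeA w := (large (demW w) H).
Notation rkA w A := (rk (nW w) (demW w) H Nc (inbA w A)).
Notation grpA w A := (grp (nW w) (demW w) H Nc (inbA w A) (widA w A)).
Notation remA w A := (rem (nW w) (demW w) H Nc (inbA w A) (widA w A)).
Notation preA w A := (pre (nW w) (demW w) H Nc (inbA w A) (befA w A)).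
Notation kvA w A := (kv (nW w) (demW w) H Nc (inbA w A) (befA w A)).
Notation uLA w A := (uL (nW w) (demW w) H Nc (inbA w A) (widA w A) (scA w A) (slA w A)).
Notation uSA w A := (uS Nc (inbA w A) (scA w A) (sqA w A)).
Definition sigA w A := sig (nW w) (demW w) H H Nc (mA w A) (inbA w A) (befA w A) (widA w A) (scA w A) (slA w A) (sqA w A).
Definition tripA w A := trip (nW w) (demW w) H H Nc (mA w A) (inbA w A) (befA w A) (widA w A) (scA w A) (slA w A) (sqA w A).
Definition okdA w A := okd (nW w) (demW w) H H Nc (mA w A) (inbA w A) (befA w A) (widA w A) (scA w A) (slA w A) (sqA w A).
Definition keyA w A := key (nW w) (demW w) H H Nc (mA w A) (inbA w A) (befA w A) (widA w A) (scA w A) (slA w A) (sqA w A).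
Definition rankA w A := rank (nW w) (demW w) H H Nc (mA w A) (inbA w A) (befA w A) (widA w A) (scA w A) (slA w A) (sqA w A).
Definition ordA w A := ordv (nW w) (demW w) H H Nc (mA w A) (inbA w A) (befA w A) (widA w A) (scA w A) (slA w A) (sqA w A).
Definition lenA w A := len (nW w) (demW w) H H Nc (mA w A) (inbA w A) (befA w A) (widA w A) (scA w A) (slA w A) (sqA w A).
Definition offA w A := off (nW w) (demW w) H H Nc (mA w A) (inbA w A) (befA w A) (widA w A) (scA w A) (slA w A) (sqA w A).
Definition ptA w A := pt (nW w) (PW w) (OW w) (demW w) H H Nc (mA w A) (inbA w A) (befA w A) (widA w A) (scA w A) (slA w A) (sqA w A).
Definition costdA w A := costd (nW w) (PW w) (OW w) (demW w) H H Nc (mA w A) (inbA w A) (befA w A) (widA w A) (scA w A) (slA w A) (sqA w A).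

Lemma nc_tszE G : ncomp (fun a : car G => tsz (cw a)). Proof. exact: nc_tsz. Qed.

Lemma nc_sel G N (i : car G -> nat) (F : car G -> nat -> nat) :
  ncomp i -> (forall k, ncomp (fun a : car G => F a k)) -> ncomp (fun a : car G => sel N (i a) (F a)).
Proof.
move=> hi hF; apply: nc_nsumc => k; apply: nc_if => //; last exact: nc_const.
by apply: bc_eqn => //; apply: nc_const.
Qed.

Ltac d0 := first [lazymatch goal with
  | |- ncomp (fun a => tsize (nW (@?w a)) ?S) => apply: nc_tszE
  | |- bcomp (fun a => inbW (@?w a) (@?x a) (@?y a)) => apply: bc_inbW
  | |- bcomp (fun a => tbW (@?w a) (@?x a) (@?y a) (@?z a)) => apply: bc_tbW
  | |- rcomp (fun a => edW (@?w a) (@?x a) (@?y a)) => apply: rc_edW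
  | |- ncomp (fun a => sel ?N (@?i a) (@?F a)) => apply: nc_sel => [|?]
  end | ncbase | apply: nc_if | apply: rc_if].

Lemma nc_idxA : NC2 idxA. Proof. by move=> G A c hA hc; rewrite /idxA; repeat d0. Qed.
Lemma nc_widA : NC2 widA. Proof. by move=> G A c hA hc; rewrite /widA; repeat d0. Qed.
Lemma nc_xA : NC2 xA. Proof. by move=> G A c hA hc; rewrite /xA; repeat d0. Qed.

Ltac d1 := first [lazymatch goal with
  | |- ncomp (fun a => idxA (@?w a) (@?x a) (@?y a)) => apply: nc_idxA
  | |- ncomp (fun a => widA (@?w a) (@?x a) (@?y a)) => apply: nc_widA
  | |- ncomp (fun a => xA (@?w a) (@?x a) (@?y a)) => apply: nc_xA
  end | d0].

Lemma bc_inbA : BC3 inbA. Proof. by move=> G A c v hA hc hv; rewrite /inbA; repeat d1. Qed.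
Lemma bc_befA : BC4 befA. Proof. by move=> G A c u v hA hc hu hv; rewrite /befA; repeat d1. Qed.
Lemma nc_mA : NC1 mA. Proof. by move=> G A hA; rewrite /mA; repeat d1. Qed.

Lemma nc_findx : NC2 (fun w A k => find (fun k' => xA w A k') Q k).
Proof. by move=> G A k hA hk; rewrite /find; repeat d1. Qed.

Lemma nc_eA : NC2 eA.
Proof.
by move=> G A c hA hc; rewrite /eA; apply: nc_sel => [|k]; repeat d1; apply: nc_findx; repeat d1.
Qed.

Ltac d2 := first [lazymatch goal with
  | |- bcomp (fun a => inbA (@?w a) (@?x a) (@?y a) (@?z a)) => apply: bc_inbA
  | |- bcomp (fun a => befA (@?w a) (@?x a) (@?y a) (@?z a) (@?t a)) => apply: bc_befA
  | |- ncomp (fun a => mA (@?w a) (@?x a)) => apply: nc_mA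
  | |- ncomp (fun a => eA (@?w a) (@?x a) (@?y a)) => apply: nc_eA
  end | d1].

Lemma nc_scA : NC2 scA. Proof. by move=> G A c hA hc; rewrite /scA; repeat d2. Qed.
Lemma nc_slA : NC2 slA. Proof. by move=> G A c hA hc; rewrite /slA; repeat d2. Qed.
Lemma nc_sqA : NC2 sqA. Proof. by move=> G A c hA hc; rewrite /sqA; repeat d2. Qed.
Lemma nc_cellA : NC2 (fun w A v => cellA w A v).
Proof. by move=> G A c hA hc; rewrite /cellv; repeat d2. Qed.

Ltac d3 := first [lazymatch goal with
  | |- ncomp (fun a => scA (@?w a) (@?x a) (@?y a)) => apply: nc_scA
  | |- ncomp (fun a => slA (@?w a) (@?x a) (@?y a)) => apply: nc_slA
  | |- ncomp (fun a => sqA (@?w a) (@?x a) (@?y a)) => apply: nc_sqA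
  | |- ncomp (fun a => cellv _ (@?x a) (@?y a)) => apply: nc_cellA
  end | d2].

Lemma nc_posA : NC2 (fun w A v => posA w A v).
Proof. by move=> G A c hA hc; rewrite /posv; repeat d3. Qed.

Lemma rc_demW : RC1 (@demW R).
Proof. by move=> G c hc; rewrite /demW; repeat d3. Qed.

Ltac d4 := first [lazymatch goal with
  | |- ncomp (fun a => posv (@?n a) _ (@?x a) (@?y a) (@?z a)) => apply: nc_posA
  | |- rcomp (fun a => demW (@?w a) (@?x a)) => apply: rc_demW
  end | d3].

Lemma bc_largeA : BC1 (fun w v => largeA w v).
Proof.
move=> G c hc; apply: (@nc_ext _ _ (fun a : car G => nat_of_bool (~~ (H%:R * demW (cw a) (c a) <= 1%:R)))) => //.
by repeat d4.
Qed.

Ltac d5 := first [lazymatch goal with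
  | |- bcomp (fun a => large (@?w a) _ (@?x a)) => apply: bc_largeA
  end | d4].

Lemma nc_rkA : NC2 (fun w A v => rkA w A v).
Proof. by move=> G A c hA hc; rewrite /rk /heavier; repeat d5. Qed.

Lemma rc_preA : RC2 (fun w A v => preA w A v).
Proof.
move=> G A c hA hc; apply: (@rc_ext _ _ (fun a : car G => rsum (nW (cw a)) (fun u =>
  if [&& ~~ largeA (cw a) u, cellA (cw a) (A a) u == cellA (cw a) (A a) (c a) &
    ((posA (cw a) (A a) u).+1 <= posA (cw a) (A a) (c a))%N] then demW (cw a) u else 0%:R))) => //.
by repeat d5.
Qed.

Ltac d6 := first [lazymatch goal with
  | |- ncomp (fun a => rk (@?n a) (@?w a) _ _ (@?x a) (@?y a)) => apply: nc_rkA
  | |- rcomp (fun a => pre (@?n a) (@?w a) _ _ (@?x a) (@?y a) (@?z a)) => apply: rc_preA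
  end | d5].

Lemma nc_grpA : NC2 (fun w A v => grpA w A v).
Proof. by move=> G A c hA hc; rewrite /grp; repeat d6. Qed.
Lemma nc_remA : NC2 (fun w A v => remA w A v).
Proof. by move=> G A c hA hc; rewrite /rem; repeat d6. Qed.
Lemma nc_kvA : NC2 (fun w A v => kvA w A v).
Proof. by move=> G A c hA hc; rewrite /kv; repeat d6. Qed.

Ltac d7 := first [lazymatch goal with
  | |- ncomp (fun a => grp (@?n a) (@?w a) _ _ (@?x a) (@?y a) (@?z a)) => apply: nc_grpA
  | |- ncomp (fun a => rem (@?n a) (@?w a) _ _ (@?x a) (@?y a) (@?z a)) => apply: nc_remA
  | |- ncomp (fun a => kv (@?n a) (@?w a) _ _ (@?x a) (@?y a) (@?z a)) => apply: nc_kvA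
  end | d6].

Lemma nc_uLA : NC3 (fun w A v s => uLA w A v s).
Proof. by move=> G A c s hA hc hs; rewrite /uL; repeat d7. Qed.
Lemma nc_uSA : NC3 (fun w A v s => uSA w A v s).
Proof. by move=> G A c s hA hc hs; rewrite /uS; repeat d7. Qed.

Ltac d8 := first [lazymatch goal with
  | |- ncomp (fun a => uL (@?n a) (@?w a) _ _ (@?x a) (@?y a) (@?z a) (@?t a) (@?u a) (@?v a)) => apply: nc_uLA
  | |- ncomp (fun a => uS _ (@?x a) (@?y a) (@?z a) (@?t a) (@?u a)) => apply: nc_uSA
  end | d7].

Lemma nc_findL : NC2 (fun w A v => find (uLA w A v) (mA w A * H) (remA w A v)).
Proof. by move=> G A c hA hc; rewrite /find; repeat d8. Qed.
Lemma nc_findS : NC2 (fun w A v => find (uSA w A v) (mA w A * H) (kvA w A v)).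
Proof. by move=> G A c hA hc; rewrite /find; repeat d8. Qed.

Lemma nc_sigA : NC2 sigA.
Proof.
move=> G A c hA hc; rewrite /sigA /sig; apply: nc_if; first by repeat d8.
  exact: nc_findL.
exact: nc_findS.
Qed.

Lemma nc_tripA : NC2 tripA.
Proof. by move=> G A c hA hc; apply: nc_div; [apply: nc_sigA | apply: nc_const]. Qed.

Ltac d9 := first [lazymatch goal with
  | |- ncomp (fun a => sigA (@?w a) (@?x a) (@?y a)) => apply: nc_sigA
  | |- ncomp (fun a => tripA (@?w a) (@?x a) (@?y a)) => apply: nc_tripA
  end | d8].

Lemma bc_okdA : BC1 okdA.
Proof.
move=> G A hA; rewrite /okdA /okd.
apply: (@nc_ext _ _ (fun a : car G => nat_of_bool (nall (nW (cw a)) (fun v => (sigA (cw a) (A a) v).+1 <= mA (cw a) (A a) * H)%N &&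
  nall (mA (cw a) (A a)) (fun j => rsum (nW (cw a)) (fun v => if tripA (cw a) (A a) v == j then demW (cw a) v else 0%:R) <= 1%:R)))) => //.
by repeat d9.
Qed.

Lemma nc_keyA : NC2 keyA.
Proof.
move=> G A v hA hv; apply: (@nc_ext _ _ (fun a : car G => (sigA (cw a) (A a) (v a) * (nW (cw a)).+1 + posA (cw a) (A a) (v a)) * (nW (cw a)).+1 + v a)%N) => //.
by repeat d9.
Qed.

Ltac d10 := first [lazymatch goal with
  | |- ncomp (fun a => keyA (@?w a) (@?x a) (@?y a)) => apply: nc_keyA
  end | d9].

Lemma nc_rankA : NC2 rankA.
Proof.
move=> G A v hA hv; apply: (@nc_ext _ _ (fun a : car G => nsum (nW (cw a)) (fun u => nat_of_bool ((keyA (cw a) (A a) u).+1 <= keyA (cw a) (A a) (v a))%N))) => //.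
by repeat d10.
Qed.

Ltac d11 := first [lazymatch goal with
  | |- ncomp (fun a => rankA (@?w a) (@?x a) (@?y a)) => apply: nc_rankA
  end | d10].

Lemma nc_ordA : NC2 ordA.
Proof.
move=> G A i hA hi; apply: (@nc_ext _ _ (fun a : car G => nsum (nW (cw a)) (fun v => if rankA (cw a) (A a) v == i a then v else 0%N))) => //.
by repeat d11.
Qed.
Lemma nc_lenA : NC2 lenA.
Proof.
move=> G A i hA hi; apply: (@nc_ext _ _ (fun a : car G => nsum (nW (cw a)) (fun v => nat_of_bool (tripA (cw a) (A a) v == i a)))) => //.
by repeat d11.
Qed.
Lemma nc_offA : NC2 offA.
Proof.
move=> G A i hA hi; apply: (@nc_ext _ _ (fun a : car G => nsum (nW (cw a)) (fun v => nat_of_bool ((tripA (cw a) (A a) v).+1 <= i a)%N))) => //.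
by repeat d11.
Qed.

Ltac d12 := first [lazymatch goal with
  | |- ncomp (fun a => ordA (@?w a) (@?x a) (@?y a)) => apply: nc_ordA
  | |- ncomp (fun a => lenA (@?w a) (@?x a) (@?y a)) => apply: nc_lenA
  | |- ncomp (fun a => offA (@?w a) (@?x a) (@?y a)) => apply: nc_offA
  end | d11].

Lemma rc_pt1 : RC3 (fun w A j i => (ptA w A j i).1).
Proof.
move=> G A j i hA hj hi; apply: (@rc_ext _ _ (fun a : car G => if (1 <= i a)%N && (i a <= lenA (cw a) (A a) (j a))%N then
  wR (cw a) 1 (2 + 3 * ordA (cw a) (A a) (offA (cw a) (A a) (j a) + (i a).-1)) else wR (cw a) 1 0)); last by repeat d12.
by move=> a; rewrite /ptA /pt -/(lenA _ _ _); case: ifP.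
Qed.
Lemma rc_pt2 : RC3 (fun w A j i => (ptA w A j i).2).
Proof.
move=> G A j i hA hj hi; apply: (@rc_ext _ _ (fun a : car G => if (1 <= i a)%N && (i a <= lenA (cw a) (A a) (j a))%N then
  wR (cw a) 1 (3 + 3 * ordA (cw a) (A a) (offA (cw a) (A a) (j a) + (i a).-1)) else wR (cw a) 1 1)); last by repeat d12.
by move=> a; rewrite /ptA /pt -/(lenA _ _ _); case: ifP.
Qed.

Lemma rc_costdA : RC1 costdA.
Proof.
move=> G A hA; apply: (@rc_ext _ _ (fun a : car G => rsum (mA (cw a) (A a)) (fun j => rsum (lenA (cw a) (A a) j).+1 (fun i =>
  Num.sqrt (((ptA (cw a) (A a) j i).1 - (ptA (cw a) (A a) j i.+1).1) * ((ptA (cw a) (A a) j i).1 - (ptA (cw a) (A a) j i.+1).1) +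
  ((ptA (cw a) (A a) j i).2 - (ptA (cw a) (A a) j i.+1).2) * ((ptA (cw a) (A a) j i).2 - (ptA (cw a) (A a) j i.+1).2)))))) => //.
apply: rc_rsum => [|d k]; first by repeat d12.
apply: rc_rsum => [|d' k']; first by repeat d12.
apply: rc_sqrt; apply: rc_add; apply: rc_mul; apply: rc_sub; first [apply: rc_pt1 | apply: rc_pt2]; repeat d12.
Qed.

Definition bestW w := (amin (okdA w) (costdA w) (tsz w ^ Adn)).-1.

Lemma nc_bestW G : ncomp (fun a : car G => bestW (cw a)).
Proof.
apply: nc_pred; apply: (@nc_amin R G (fun a => tsz (cw a) ^ Adn)%N (fun a => okdA (cw a)) (fun a => costdA (cw a))).
- by apply: nc_exp; apply: nc_tszE.
- by move=> d k; apply: (@bc_okdA (ext G d k) (fun a => a.2)); ncvar.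
- by move=> d k; apply: (@rc_costdA (ext G d k) (fun a => a.2)); ncvar.
Qed.

Definition bA w := wN w 7 0.
Definition totW w := (nW w + mA w (bA w))%N.
Definition outf w y : nat := if y == 0%N then mA w (bA w) else if (y <= nW w)%N then tripA w (bA w) y.-1
  else lenA w (bA w) (y - (nW w).+1).
Definition outr w x : R := let v := ordA w (bA w) (x %/ 2) in
  if (x %% 2 == 0)%N then wR w 1 (2 + 3 * v) else wR w 1 (3 + 3 * v).

Definition out1 w := setN w 7 1 (fun _ => bestW w).
(** The integers of the output go to the cells from 0 to [totW w], on top of the arrays. Stored from
    index [(totW w).+1] on, they lie beyond these cells and survive the copying. *)
Definition out2 w := setN w 8 ((totW w).+1 + (totW w).+1)%N (fun x => outf w (x - (totW w).+1)%N).
Definition out3 w := setN w 9 2 (fun x => if x == 0%N then (totW w).+1 else totW w).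
Definition out4 w := setR w 4 (2 * nW w) (outr w).
Definition outW w := out4 (out3 (out2 (out1 w))).

Variable kap : nat.
Hypothesis kapA : ((4 + 2 * S) * Adn <= kap)%N.
Hypothesis kapm : (Q + (4 + 2 * S) + 5 + H <= kap)%N.
Notation tcomp := (@tcomp R kap).
Notation base := (@base R kap).

Lemma nc_bA G : ncomp (fun a : car G => bA (cw a)).
Proof. by rewrite /bA; repeat d12. Qed.

Ltac d13 := first [lazymatch goal with
  | |- ncomp (fun a => bA (@?w a)) => apply: nc_bA
  end | d12].

Lemma nc_totW G : ncomp (fun a : car G => totW (cw a)).
Proof. by rewrite /totW; repeat d13. Qed.

Lemma tsz_pol w : (tsz w <= pol (4 + 2 * S) (nW w))%N.
Proof. by rewrite /tsize /pol; apply: leq_exp2r'; rewrite addn2. Qed.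

Lemma bestW_le w : (bestW w <= pol kap (nW w))%N.
Proof.
apply: leq_trans (leq_pred _) _; apply: leq_trans (amin_le _ _ _) _.
apply: leq_trans (pol_le _ kapA); rewrite /pol expnM; apply: leq_exp2r'.
exact: tsz_pol.
Qed.

Lemma mA_le w A : (mA w A <= Q * tsz w)%N.
Proof.
rewrite /mA /nsum; apply: (@leq_trans (\sum_(i < Q) tsz w)%N); last by rewrite sum_nat_const card_ord.
by apply: leq_sum => i _; rewrite /xA selE //; apply: ltnW; apply: dgt_lt; apply: tsize_gt0.
Qed.

Lemma mA_pol w A : (mA w A <= pol (Q + (4 + 2 * S)) (nW w))%N.
Proof.
apply: leq_trans (mA_le w A) _; apply: pol_mulE; first exact: pol_const.
exact: tsz_pol.
Qed.

Lemma totW_pol w : ((totW w).+1 <= pol (Q + (4 + 2 * S) + 3) (nW w))%N.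
Proof.
have -> : (Q + (4 + 2 * S) + 3 = (Q + (4 + 2 * S) + 1).+2)%N by clear; lia.
apply: polS; rewrite /totW addnC; apply: pol_addE; first exact: mA_pol.
by rewrite /pol expn1 leq_addr.
Qed.

Lemma find_le u N k : (find u N k <= N)%N.
Proof.
rewrite /find nsum_count; apply: leq_trans (count_size _ _) _.
by rewrite size_iota.
Qed.

Lemma outf_le w y : (outf w y <= pol kap (nW w))%N.
Proof.
have p1 : (mA w (bA w) <= pol kap (nW w))%N.
  by apply: leq_trans (mA_pol _ _) _; apply: pol_le; move: kapm; clear; lia.
rewrite /outf; case: eqP => // _; case: ifP => _.
  rewrite /tripA /trip /sig; apply: leq_trans p1.
  have [->|H0] := posnP H; first by rewrite divn0.
  by rewrite -[X in (_ <= X)%N](mulnK _ H0); apply: leq_div2r; case: ifP => _; apply: find_le.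
apply: (@leq_trans (nW w)).
  by rewrite /lenA /len nsum_count; apply: leq_trans (count_size _ _) _; rewrite size_iota.
apply: leq_trans (_ : pol 1 (nW w) <= _)%N; first by rewrite /pol expn1 leq_addr.
by apply: pol_le; move: kapm; clear; lia.
Qed.

Lemma tc_outW : tcomp outW.
Proof.
apply: (@tc_comp R kap (fun w => out3 (out2 (out1 w))) out4); last first.
  apply: (@tc_wr R kap 4 (fun w => 2 * nW w)%N (fun w i => outr w i)) => //.
  by apply: (@nc_mul R base (fun _ => 2%N) (fun w => nW w)); [apply: nc_const | apply: nc_nW].
  by move=> d k; rewrite /outr; repeat d13.
apply: (@tc_comp R kap (fun w => out2 (out1 w)) out3); last first.
  apply: (@tc_wn R kap 9 (fun _ => 2%N) (fun w x => if x == 0%N then (totW w).+1 else totW w)) => //.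
  - exact: nc_const.
  - move=> d k; apply: nc_if; first by repeat d13.
      by apply: nc_succ; apply: nc_totW.
    exact: nc_totW.
  - move=> w i _ _; apply: leq_trans (_ : (totW w).+1 <= _)%N; first by case: ifP.
    by apply: leq_trans (totW_pol w) _; apply: pol_le; move: kapm; clear; lia.
apply: (@tc_comp R kap out1 out2).
  apply: (@tc_wn R kap 7 (fun _ => 1%N) (fun w i => bestW w)) => //; first exact: nc_const.
  - by move=> d k; apply: (@nc_bestW (ext base d k)).
  - by move=> w i _ _; apply: bestW_le.
apply: (@tc_wn R kap 8 (fun w => (totW w).+1 + (totW w).+1)%N (fun w x => outf w (x - (totW w).+1)%N)) => //.
- by apply: nc_add; apply: nc_succ; apply: nc_totW.
- move=> d k.
  have nt : ncomp (fun x : car (ext base d k) => totW (cw x.1)) by apply: (@nc_totW (ext base d k)).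
  by rewrite /outf; repeat d13.
- by move=> w i _ _; apply: outf_le.
Qed.

End Dec.

(** * Writing the output *)

Section Output.
Variable R : realType.
Implicit Types (w : world R) (s : state R).

Definition c0 := NCell (NConst 0).
Definition c1 := NCell (NConst 1).
(** Copying upwards is safe for the reals: when cell [x] is written, the entries still to be read
    are at addresses [16 * y + 4] with [y > x]. *)
Definition realBody : cmd := Seq (RSet c0 (RCell (NAdd (nsc c0) (NConst 4)))) (NSet (NConst 0) (NAdd c0 (NConst 1))).
Definition realLoop : cmd := While (NLe (NAdd c0 (NConst 1)) (NAdd c1 c1)) realBody.
Definition natBody : cmd := Seq (NSet c0 (NCell (NAdd (nsc (NAdd c1 c0)) (NConst 8)))) (NSet (NConst 0) (NSub c0 (NConst 1))).
Definition natLoop : cmd := While (NLe (NConst 2) c0) natBody.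
(* The counter and the offset of the source are kept in the cells 0 and 1 of the
   output, which are therefore written last. *)
Definition Pout : cmd :=
  Seq (NSet (NConst 0) (NConst 0)) (Seq realLoop
  (Seq (NSet (NConst 0) (NCell (NConst 25))) (Seq (NSet (NConst 1) (NCell (NConst 9)))
  (Seq natLoop
  (Seq (NSet (NConst 0) (NCell (NAdd (nsc c1) (NConst 8))))
       (NSet (NConst 1) (NCell (NAdd (nsc (NAdd c1 (NConst 1))) (NConst 8))))))))).

Lemma realLoop_spec k (src : nat -> R) s y n : (k + y = n + n)%N -> nmem s 0 = y -> nmem s 1 = n ->
    (forall x, (x < y)%N -> rmem s x = src x) ->
    (forall x, (y <= x)%N -> rmem s (16 * x + 4) = src x) ->
  exists t s', [/\ exec realLoop s t s', (t <= 3 * k + 1)%N,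
    (forall x, (x != 0)%N -> nmem s' x = nmem s x) & forall x, (x < n + n)%N -> rmem s' x = src x].
Proof.
elim: k y s => [|k IH] y s ky e0 e1 h1 h2.
  exists 1%N, s; split=> //; last by move=> x; rewrite -ky; apply: h1.
  by apply: ExecWhileF; rewrite /= e0 e1 -ky add0n addn1 ltnn.
pose s1 := rset s y (src y); pose s2 := nset s1 0 y.+1.
have [||||t [s' [ex tb m r]]] := IH y.+1 s2 _ erefl.
- by rewrite addnS -addSn.
- by [].
- by move=> x; rewrite ltnS leq_eqVlt => /orP[/eqP->|xy]; rewrite /= ?eqxx //; case: eqP => [->//|_]; apply: h1.
- move=> x yx; rewrite /=; case: eqP => [e|_]; last by apply: h2; apply: ltnW.
  by move: yx; rewrite -e; clear; lia.
exists (1 + 1 + t).+1, s'; split.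
- apply: (@ExecWhileT _ _ _ s _ s2) ex; first by rewrite /= e0 e1 -ky addn1 addSn ltnS leq_addl.
  apply: (@ExecSeq _ _ _ s 1 s1).
    have := ExecRSet c0 (RCell (NAdd (nsc c0) (NConst 4))) s.
    have -> : reval s (RCell (NAdd (nsc c0) (NConst 4))) = src y.
      by rewrite -[LHS]/(rmem s (neval s (NAdd (nsc c0) (NConst 4)))) neval_addr [neval s c0]/= e0 h2.
    by rewrite [neval s c0]/= e0.
  have := ExecNSet (NConst 0) (NAdd c0 (NConst 1)) s1.
  by rewrite [neval s1 (NAdd _ _)]/= e0 addn1.
- by move: tb; clear; lia.
- by move=> x x0; rewrite m //= (negPf x0).
- exact: r.
Qed.

Lemma natLoop_spec y s off (src : nat -> nat) tot : nmem s 0 = y -> nmem s 1 = off -> (y <= tot)%N -> (tot < off)%N ->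
    (forall x, (1 < x)%N -> (y < x <= tot)%N -> nmem s x = src x) ->
    (forall x, (x <= tot)%N -> nmem s (16 * (off + x) + 8) = src x) ->
  exists t s', [/\ exec natLoop s t s', (t <= 3 * y + 1)%N, nmem s' 1 = off /\ rmem s' = rmem s,
    (forall x, (x <= tot)%N -> nmem s' (16 * (off + x) + 8) = src x) &
    forall x, (1 < x <= tot)%N -> nmem s' x = src x].
Proof.
elim: y s => [|y IH] s e0 e1 yt to h1 h2.
  exists 1%N, s; split=> //; last by move=> x /andP[x1 x2]; apply: h1 => //; rewrite x2 andbT; apply: ltnW.
  by apply: ExecWhileF; rewrite /= e0.
have [y0|y1] := leqP y.+1 1.
  exists 1%N, s; split=> //; first by apply: ExecWhileF; rewrite /= e0 -ltnNge.
  by move=> x /andP[x1 x2]; apply: h1 => //; rewrite x2 andbT; apply: leq_ltn_trans x1.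
pose s1 := nset s y.+1 (src y.+1); pose s2 := nset s1 0 y.
have far x : (x <= tot)%N -> (16 * (off + x) + 8 == y.+1)%N = false.
  by move=> _; apply/negbTE; move: yt to; clear; lia.
have [||||x x1|x|t [s' [ex tb [m1 m2] a b]]] := IH s2.
- by [].
- by rewrite /= -e1; move: y1; case: (y).
- exact: ltnW.
- exact: to.
- case/andP=> h3 h4; rewrite /=; case: eqP => [e|_]; first by move: x1; rewrite e.
  case: eqP => [->//|/eqP ne]; apply: h1 => //; by rewrite h4 andbT ltn_neqAle eq_sym ne.
- by move=> xt; rewrite /= far // addn_eq0 andbF h2.
exists (1 + 1 + t).+1, s'; split=> //.
- apply: (@ExecWhileT _ _ _ s _ s2) ex; first by rewrite /= e0.
  apply: (@ExecSeq _ _ _ s 1 s1).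
    have := ExecNSet c0 (NCell (NAdd (nsc (NAdd c1 c0)) (NConst 8))) s.
    have -> : neval s (NCell (NAdd (nsc (NAdd c1 c0)) (NConst 8))) = src y.+1.
      by rewrite -h2 // -e1 -e0 -[LHS]/(nmem s (neval s (NAdd (nsc (NAdd c1 c0)) (NConst 8)))) neval_addr.
    by rewrite [neval s c0]/= e0.
  have := ExecNSet (NConst 0) (NSub c0 (NConst 1)) s1.
  by rewrite [neval s1 (NSub _ _)]/= e0 subn1.
- by move: tb; clear; lia.
Qed.

Lemma Pout_spec kap w s : brep kap w s -> let n := wN w 1 0 in let off := wN w 9 0 in let tot := wN w 9 1 in
    (tot < off)%N ->
  exists t s', [/\ exec Pout s t s', (t <= 6 * n + 3 * tot + 7)%N,
    (forall x, (x <= tot)%N -> nmem s' x = wN w 8 (off + x)) & forall x, (x < n + n)%N -> rmem s' x = wR w 4 x].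
Proof.
move=> rp n off tot to.
pose s1 := nset s 0 0.
have ar j x : (0 < j < 16)%N -> nmem s (16 * x + j) = wN w j x /\ rmem s (16 * x + j) = wR w j x.
  by move=> /(rp j x)[].
have n1 : nmem s 1 = n by have [] := ar 1%N 0%N isT.
have [|||t1 [s2 [e1 b1 m1 r1]]] := @realLoop_spec (n + n) (wR w 4) s1 0 n (addn0 _) erefl.
- exact: n1.
- by [].
- by move=> x _; have [] := ar 4%N x isT.
pose s3 := nset s2 0 tot; pose s4 := nset s3 1 off.
have [||||x x1|x|t2 [s5 [e5 b5 [m5 r5] a5 c5]]] := @natLoop_spec tot s4 off (fun x => wN w 8 (off + x)) tot.
- by [].
- by [].
- exact: leqnn.
- exact: to.
- by rewrite ltnNge andbC => /andP[->].
- move=> _; rewrite /=; case: eqP => [e|_]; first by move: e; clear; lia.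
  rewrite addn_eq0 andbF m1 ?addn_eq0 ?andbF //= addn_eq0 andbF.
  by have [] := ar 8%N (off + x)%N isT.
pose s6 := nset s5 0 (wN w 8 off); pose s7 := nset s6 1 (nmem s6 (16 * (off + 1) + 8)).
exists (1 + (t1 + (1 + (1 + (t2 + (1 + 1))))))%N, s7; split.
- apply: ExecSeq; first exact: ExecNSet.
  apply: ExecSeq e1 _; apply: (@ExecSeq _ _ _ s2 1 s3).
    have := ExecNSet (NConst 0) (NCell (NConst 25)) s2.
    have -> // : neval s2 (NCell (NConst 25)) = tot.
    by rewrite /= m1 //=; have [] := ar 9%N 1%N isT.
  apply: (@ExecSeq _ _ _ s3 1 s4).
    have := ExecNSet (NConst 1) (NCell (NConst 9)) s3.
    have -> // : neval s3 (NCell (NConst 9)) = off.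
    by rewrite /= m1 //=; have [] := ar 9%N 0%N isT.
  apply: ExecSeq e5 _; apply: (@ExecSeq _ _ _ s5 1 s6).
    have := ExecNSet (NConst 0) (NCell (NAdd (nsc c1) (NConst 8))) s5.
    have -> // : neval s5 (NCell (NAdd (nsc c1) (NConst 8))) = wN w 8 off.
    by rewrite -[LHS]/(nmem s5 (neval s5 (NAdd (nsc c1) (NConst 8)))) neval_addr [neval s5 c1]/= m5 -(addn0 off) a5.
  have := ExecNSet (NConst 1) (NCell (NAdd (nsc (NAdd c1 (NConst 1))) (NConst 8))) s6.
  rewrite -[neval s6 (NCell _)]/(nmem s6 (neval s6 (NAdd (nsc (NAdd c1 (NConst 1))) (NConst 8)))) neval_addr.
  by rewrite [neval s6 (NAdd c1 _)]/= m5.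
- by move: b1 b5; clear; lia.
- move=> x xt; rewrite /=; case: eqP => [e1'|x1].
    by rewrite addn_eq0 andbF e1' -a5 // -e1'.
  case: eqP => [->|x0]; first by rewrite addn0.
  by apply: c5; rewrite xt andbT; move: x0 x1; clear; lia.
- by move=> x xn; rewrite /= r5 /= r1.
Qed.

End Output.

(** * The complete program *)

Section Prog.
Variable R : realType.
Variables (S H Nc Q K : nat).
Implicit Types (w : world R).

Definition algW w : world R :=
  outW S H Nc Q (dpW S (K + (2 * K + 1) * nW w) w).

(** An exponent for all stored integers: the summands cover the advice number, the output data and
    the choices of the dynamic programme. *)
Definition kapP : nat := ((4 + 2 * S) * Adn Nc Q + (Q + (4 + 2 * S) + 5 + H) + (2 * (4 + 2 * S) + 1))%N.

Lemma tc_algW : @tcomp R kapP algW.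
Proof.
apply: (@tc_comp R kapP (fun w => dpW S (K + (2 * K + 1) * nW w) w) (outW S H Nc Q)); last first.
  by apply: tc_outW; rewrite /kapP; move: (_ * _)%N; clear; lia.
apply: (@tc_comp R kapP (initW S) (fun w => iter (K + (2 * K + 1) * nW w) (stepW S) w)).
  by apply: tc_initW; rewrite /kapP; move: (_ * Adn _ _)%N; clear; lia.
apply: (@tc_iter R kapP (fun w => K + (2 * K + 1) * nW w)%N).
  apply: (@nc_add R (base R kapP) (fun _ => K)); first exact: nc_const.
  by apply: (@nc_mul R (base R kapP) (fun _ => 2 * K + 1)%N (fun w => nW w)); [apply: nc_const | apply: nc_nW].
by apply: tc_stepW; rewrite /kapP; move: (_ * Adn _ _)%N; clear; lia.
Qed.

Lemma program_exists : exists Pr : cmd, polytime R Pr /\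
  forall n (I : instance R n), exists t s w, [/\ exec Pr (input I) t s,
    wN w 1 0 = n, (forall x, (x < 3 * n + 2)%N -> wR w 1 x = rmem (input I) x) &
    let w' := algW w in let off := wN w' 9 0 in let tot := wN w' 9 1 in
    (forall x, (x <= tot)%N -> nmem s x = wN w' 8 (off + x)) /\ forall x, (x < n + n)%N -> rmem s x = wR w' 4 x].
Proof.
have [c [k hc]] := tc_algW 0.
have kap0 : (0 < kapP)%N by rewrite /kapP addn_gt0 addn1 orbT.
have spec n (I : instance R n) : exists t s w, [/\ exec (Seq Pin (Seq c (Pout))) (input I) t s,
    (t <= 9 * n + 9 + (pol k n + (6 * n + 3 * pol (Q + (4 + 2 * S) + 3) n + 7)))%N, wN w 1 0 = n,
    (forall x, (x < 3 * n + 2)%N -> wR w 1 x = rmem (input I) x) &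
    let w' := algW w in let off := wN w' 9 0 in let tot := wN w' 9 1 in
    (forall x, (x <= tot)%N -> nmem s x = wN w' 8 (off + x)) /\ forall x, (x < n + n)%N -> rmem s x = wR w' 4 x].
  have [t1 [s1 [w [e1 b1 r1 z1 [w1 w2 w3]]]]] := Pin_spec kap0 I.
  have [t2 [s2 [e2 m2 r2 b2]]] := hc w s1 r1.
  have n' : wN (algW w) 1 0 = n by have [h _] := dpW_in S (K + (2 * K + 1) * nW w) w; apply: etrans (h 0%N) w1.
  have [|t3 [s3 [e3 b3 p3 q3]]] := Pout_spec r2; first exact: leqnn.
  exists (t1 + (t2 + t3))%N, s3, w; split=> //.
  - by apply: ExecSeq e1 _; apply: ExecSeq e2 e3.
  - rewrite leq_add // leq_add -?z1 //; apply: leq_trans b3 _; rewrite n' -z1 leq_add2r leq_add2l leq_mul2l /=.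
    apply: leq_trans (ltnW (totW_pol _ _ _ _)) _.
    by rewrite -[nW _]/(wN (algW w) 1 0) n' z1.
  - by split=> // x xn; apply: q3; rewrite n'.
exists (Seq Pin (Seq c Pout)); split; last first.
  by move=> n I; have [t [s [w [h1 h2 h3 h4 h5]]]] := spec n I; exists t, s, w; split.
pose k' := (k + (Q + (4 + 2 * S) + 3) + 1)%N.
exists (30 * 2 ^ k')%N, k' => n I; have [t [s [w [h1 h2 _ _ _]]]] := spec n I.
exists t, s; split=> //; apply: leq_trans h2 _.
have a1 : (pol k n <= pol k' n)%N by apply: pol_le; rewrite /k'; clear; lia.
have a2 : (pol (Q + (4 + 2 * S) + 3) n <= pol k' n)%N by apply: pol_le; rewrite /k'; clear; lia.
have a3 : (n + 2 <= pol k' n)%N.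
  by rewrite -[X in (X <= _)%N]expn1 -/(pol 1 n); apply: pol_le; rewrite /k'; clear; lia.
apply: (@leq_trans (30 * pol k' n)%N).
  by move: a1 a2 a3; move: (pol k n) (pol k' n) (pol _ n) => x y z; clear; lia.
rewrite -mulnA leq_mul2l /= -expnMn /pol; apply: leq_exp2r'; clear; lia.
Qed.

End Prog.

Section OutSem.
Variable R : realType.
Variables (n m : nat) (I : instance R n) (s : state R).
Variables (tr ln ord : nat -> nat) (P : nat -> R * R).
Hypothesis s0 : nmem s 0 = m.
Hypothesis sT : forall v, (v < n)%N -> nmem s v.+1 = tr v.
Hypothesis sL : forall j, (j < m)%N -> nmem s (n.+1 + j) = ln j.
Hypothesis sR : forall i, (i < n)%N -> (rmem s i.*2, rmem s i.*2.+1) = P (ord i).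
Hypothesis sumL : (\sum_(j < m) ln j <= n)%N.
Notation off j := (\sum_(i < j) ln i)%N.

Lemma output_tours : tours (output n s) = mkseq (fun j => mkseq (fun i => P (ord (off j + i))) (ln j)) m.
Proof.
rewrite /output /= s0.
have -> : [seq nmem s (n.+1 + j) | j <- iota 0 m] = mkseq ln m.
  by apply/eq_in_map => j; rewrite mem_iota => /andP[_ jm]; apply: sL.
have sm k : sumn (mkseq ln k) = off k.
  by rewrite sumnE big_map -[X in iota X]/(0)%N -{1}(subn0 k) big_mkord.
have szm : size [seq (rmem s k.*2, rmem s k.*2.+1) | k <- iota 0 (sumn (mkseq ln m))] = sumn (mkseq ln m).
  by rewrite size_map size_iota.
apply: (@eq_from_nth _ [::]); first by rewrite size_reshape !size_mkseq.
move=> j; rewrite size_reshape size_mkseq => jm; rewrite nth_mkseq // nth_reshape nth_mkseq //.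
have -> : take j (mkseq ln m) = mkseq ln j.
  by rewrite /mkseq -map_take take_iota; rewrite (minn_idPl (ltnW jm)).
rewrite sm; have le : (off j + ln j <= off m)%N.
  by rewrite -[off j]/(nsum j ln) -nsumS; apply: nsum_mono.
apply: (@eq_from_nth _ (0, 0)).
  rewrite size_take size_drop size_map size_iota size_mkseq sm.
  by case: ltnP => //; move: le; clear; lia.
move=> i; rewrite size_take size_drop size_map size_iota sm => hi.
have il : (i < ln j)%N by have := hi; case: (ltnP (ln j) _) => // h1 h2; apply: leq_trans h2 h1.
have oi : (off j + i < off m)%N by apply: leq_trans le; rewrite ltn_add2l il.
have oin := leq_trans oi sumL.
by rewrite nth_take ?il // nth_drop nth_mkseq ?il // (nth_map 0%N) ?size_iota ?oi // nth_iota ?oi // add0n sR.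
Qed.

Lemma output_cost : cost I (output n s) =
  \sum_(j < m) plf (@edist R) (depot I) (rcons (mkseq (fun i => P (ord (off j + i))) (ln j)) (depot I)).
Proof.
rewrite /cost output_tours big_map -[X in iota _ X](subn0 m) big_mkord; apply: eq_bigr => j _.
by rewrite /tour_cost -plf_pairmap.
Qed.

Hypothesis posE : forall v : 'I_n, pos I v = P v.
Hypothesis trm : forall v, (v < n)%N -> (tr v < m)%N.
Hypothesis visit : forall v, (v < n)%N -> exists2 i, (i < ln (tr v))%N & ord (off (tr v) + i) = v.
Hypothesis loads : forall j, (j < m)%N -> \sum_(v < n | tr v == j) demand I v <= 1.

Lemma output_feasible : feasible I (output n s).
Proof.
rewrite /feasible output_tours size_mkseq; split.
  move=> v; rewrite /= sT // trm //; split=> //; rewrite inE; apply/orP; right.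
  rewrite nth_mkseq ?trm //; have [i hi e] := visit (ltn_ord v).
  by apply/mapP; exists i; rewrite ?mem_iota // e posE.
move=> j jm; rewrite (eq_bigl (fun v : 'I_n => tr v == j)); first exact: loads.
by move=> v; rewrite /= sT.
Qed.

End OutSem.

(** * Encoding plans as advice *)

Section Classify.
Variables (T : eqType) (f : T -> nat).

(** Sorted by type, the plans are determined by the multiplicities of the types, from which [find]
    recovers the type of each tour. *)
Definition byclass (N : nat) (s : seq T) : seq T := flatten [seq [seq x <- s | f x == k] | k <- iota 0 N].

Lemma perm_byclass N s : all (fun x => f x < N)%N s -> perm_eq (byclass N s) s.
Proof.
move=> h; apply/permP => a; rewrite count_flatten -map_comp sumnE big_map.
rewrite -[X in iota X]/(0)%N -{1}(subn0 N) big_mkord.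
elim: s h => [|x s IH] /=; first by rewrite big1.
case/andP=> xN /IH {}IH; rewrite -IH (bigD1 (Ordinal xN)) //= eqxx /= -addnA; congr (_ + _)%N.
rewrite [in RHS](bigD1 (Ordinal xN)) //=; congr (_ + _)%N; apply: eq_bigr => k /eqP ne.
by case: eqP => // e; case: ne; apply/val_inj.
Qed.

Lemma find_byclass N s x0 j : (j < size (byclass N s))%N ->
  find (fun k => count (fun x => f x == k) s) N j = f (nth x0 (byclass N s) j).
Proof.
set u := (fun k => _); have sz M : size (byclass M s) = nsum M u.
  elim: M => [|M IH]; first by rewrite /nsum big_ord0.
  by rewrite nsumS -IH /byclass -addn1 iotaD map_cat flatten_cat size_cat /= cats0 size_filter.
elim: N => [//|N IH]; rewrite sz => h; rewrite /find nsumS -/(find u N j).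
rewrite [(nsum N.+1 u <= j)%N]leqNgt h addn0.
have e : byclass N.+1 s = byclass N s ++ [seq x <- s | f x == N].
  by rewrite /byclass -addn1 iotaD map_cat flatten_cat /= cats0.
rewrite e nth_cat; case: ltnP => h2; first exact: IH.
rewrite find_all -?sz //; have : nth x0 [seq x <- s | f x == N] (j - size (byclass N s)) \in [seq x <- s | f x == N].
  by apply: mem_nth; move: h; rewrite nsumS -sz size_filter; move: h2; rewrite /u; clear; lia.
by rewrite mem_filter => /andP[/eqP-> _].
Qed.

End Classify.

Section Congr.
Variable R : realType.
Variables (n : nat) (P : nat -> R * R) (O : R * R) (dem : nat -> R) (H J Nc m : nat).
Variables (inbx : nat -> nat -> bool) (bef : nat -> nat -> nat -> bool) (wid : nat -> nat).
Variables (sc sl sq sc' sl' sq' : nat -> nat).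
Hypothesis e1 : forall s, (s < m * J)%N -> [/\ sc s = sc' s, sl s = sl' s & sq s = sq' s].

Lemma find_congr u u' N k : (forall s, (s < N)%N -> u s = u' s) -> find u N k = find u' N k.
Proof.
move=> h; apply: eq_bigr => s _; congr (nat_of_bool (_ <= _)%N); apply: eq_bigr => i _; apply: h.
exact: leq_ltn_trans (ltnSE (ltn_ord i)) (ltn_ord s).
Qed.

(** From slot [m * J] on, a decoded advice and the intended plans may differ; only the slots before
    it are consulted. *)
Lemma sig_congr : sig n dem H J Nc m inbx bef wid sc sl sq = sig n dem H J Nc m inbx bef wid sc' sl' sq'.
Proof.
apply/funext => v; rewrite /sig; case: ifP => _; apply: find_congr => s /e1[x1 x2 x3].
  by rewrite /uL x1 x2.
by rewrite /uS x1 x3.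
Qed.

Lemma okd_congr : okd n dem H J Nc m inbx bef wid sc sl sq = okd n dem H J Nc m inbx bef wid sc' sl' sq'.
Proof. by rewrite /okd /load /trip sig_congr. Qed.

Lemma costd_congr : costd n P O dem H J Nc m inbx bef wid sc sl sq = costd n P O dem H J Nc m inbx bef wid sc' sl' sq'.
Proof. by rewrite /costd /pt /ordv /rank /key /len /off /trip sig_congr. Qed.

End Congr.

Section Advice.
Variable R : realType.
Variables (S H Nc : nat).
Hypothesis H0 : (0 < H)%N.
Hypothesis N0 : (0 < Nc)%N.
Notation base_cf := (cfB H Nc).
Notation base_lab := (lim H).
Notation Q := (base_cf ^ H)%N.
Variables (w : world R).
Notation T := (tsize (nW w) S).
Variables (idx wid : nat -> nat) (cf : seq (seq slot)).
Hypothesis idx_lt : forall c, (c < Nc)%N -> (idx c < T)%N.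
Hypothesis wid_lt : forall c, (c < Nc)%N -> (wid c < T)%N.
Hypothesis cf_lt : (size cf < T)%N.
Hypothesis cf_size : forall pl, pl \in cf -> size pl = H.
Hypothesis cf_range : forall pl s, pl \in cf -> s \in pl ->
  [/\ (s.1.1 < Nc)%N, (s.1.2 <= H ^ 2 + 1)%N & (s.2.1 <= H)%N].

Definition codeS (s : slot) : nat := (s.1.1 + Nc * (s.1.2 + base_lab * s.2.1))%N.
Definition codeP (pl : seq slot) : nat := enc base_cf (map codeS pl).

Lemma codeS_lt pl s : pl \in cf -> s \in pl -> (codeS s < base_cf)%N.
Proof.
move=> h1 h2; have [a b c] := cf_range h1 h2; rewrite /codeS /cfB /lim.
apply: (@leq_trans (Nc * (s.1.2 + (H ^ 2 + 2) * s.2.1).+1)%N).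
  by rewrite mulnS ltn_add2r.
rewrite leq_mul2l; apply/orP; right; rewrite mulnS -addSn.
apply: leq_add; last by rewrite leq_mul2l c orbT.
by apply: leq_trans (_ : H ^ 2 + 1 < _)%N; rewrite ?ltnS // addn2 addn1.
Qed.

Lemma cfB_gt0 : (0 < base_cf)%N.
Proof. by rewrite /cfB /lim muln_gt0 N0 /= muln_gt0 addn2. Qed.

Lemma all_code pl : pl \in cf -> all (fun x => x < base_cf)%N (map codeS pl).
Proof. by move=> h; apply/allP => x /mapP[s hs ->]; apply: codeS_lt h hs. Qed.

Lemma codeP_lt pl : pl \in cf -> (codeP pl < Q)%N.
Proof.
move=> h; have := enc_lt cfB_gt0 (all_code h); by rewrite size_map cf_size.
Qed.

Definition cfs := byclass codeP Q cf.

Lemma cfs_perm : perm_eq cfs cf.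
Proof. by apply: perm_byclass; apply/allP => pl /codeP_lt. Qed.

Definition advice : nat := enc T (mkseq idx Nc ++ mkseq wid Nc ++ mkseq (fun k => count (fun x => codeP x == k) cf) Q).

Lemma all_advice : all (fun x => x < T)%N (mkseq idx Nc ++ mkseq wid Nc ++ mkseq (fun k => count (fun x => codeP x == k) cf) Q).
Proof.
rewrite !all_cat; apply/and3P; split; apply/allP => x /mapP[c]; rewrite mem_iota => /andP[_ h] ->.
- exact: idx_lt.
- exact: wid_lt.
- exact: leq_ltn_trans (count_size _ _) cf_lt.
Qed.

Lemma T0 : (0 < T)%N. Proof. exact: tsize_gt0. Qed.

Lemma advice_lt : (advice < T ^ Adn Nc Q)%N.
Proof.
have := enc_lt T0 all_advice; rewrite !size_cat !size_mkseq /Adn /advice.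
by have -> : (Nc + (Nc + Q) = 2 * Nc + Q)%N by rewrite mul2n -addnn addnA.
Qed.

Lemma advice_idx c : (c < Nc)%N -> idxA S Nc w advice c = idx c.
Proof.
move=> h; rewrite /idxA selE // /advice dgt_enc ?T0 ?all_advice //.
by rewrite nth_cat size_mkseq h nth_mkseq.
Qed.

Lemma advice_wid c : (c < Nc)%N -> widA S Nc w advice c = wid c.
Proof.
move=> h; rewrite /widA selE // /advice dgt_enc ?T0 ?all_advice //.
by rewrite nth_cat size_mkseq ltnNge leq_addr /= addKn nth_cat size_mkseq h nth_mkseq.
Qed.

Lemma advice_x k : (k < Q)%N -> xA S Nc Q w advice k = count (fun x => codeP x == k) cf.
Proof.
move=> h; rewrite /xA selE // /advice dgt_enc ?T0 ?all_advice //.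
rewrite nth_cat size_mkseq mul2n -addnn -addnA ltnNge leq_addr /= addKn.
by rewrite nth_cat size_mkseq ltnNge leq_addr /= addKn nth_mkseq.
Qed.

Lemma advice_m : mA S Nc Q w advice = size cf.
Proof.
rewrite -(perm_size cfs_perm) size_flatten /shape -map_comp sumnE big_map.
rewrite -[X in iota X]/(0)%N -{2}(subn0 Q) big_mkord /mA /nsum; apply: eq_bigr => k _.
by rewrite advice_x // /= size_filter.
Qed.

Lemma advice_e s : (s < size cf * H)%N -> eA S H Nc Q w advice s = codeS (slotat H cfs s).
Proof.
move=> h; have sm : (s %/ H < size cfs)%N by rewrite (perm_size cfs_perm) ltn_divLR.
rewrite /eA selE ?ltn_pmod //.
have -> : find (fun k => xA S Nc Q w advice k) Q (s %/ H) = codeP (nth [::] cfs (s %/ H)).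
  rewrite -find_byclass //; apply: find_congr => k; exact: advice_x.
have pm : nth [::] cfs (s %/ H) \in cf by rewrite -(perm_mem cfs_perm) mem_nth.
rewrite /codeP dgt_enc ?cfB_gt0 ?all_code // (nth_map slot0) // cf_size // ltn_pmod //.
Qed.

Lemma advice_slot s : (s < size cf * H)%N -> let t := slotat H cfs s in
  [/\ scA S H Nc Q w advice s = t.1.1, slA S H Nc Q w advice s = t.1.2 & sqA S H Nc Q w advice s = t.2.1].
Proof.
move=> h t; have sm : (s %/ H < size cfs)%N by rewrite (perm_size cfs_perm) ltn_divLR.
have pm : nth [::] cfs (s %/ H) \in cf by rewrite -(perm_mem cfs_perm) mem_nth.
have tm : t \in nth [::] cfs (s %/ H) by apply: mem_nth; rewrite cf_size // ltn_pmod.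
have [a b c] := cf_range pm tm.
rewrite /scA /slA /sqA advice_e // -/t /codeS.
have e1 : ((t.1.1 + Nc * (t.1.2 + base_lab * t.2.1)) %/ Nc = t.1.2 + base_lab * t.2.1)%N.
  by rewrite [(Nc * _)%N]mulnC addnC divnMDl // divn_small // addn0.
have b' : (t.1.2 < base_lab)%N by rewrite /lim addn2 ltnS -addn1.
have l0 : (0 < base_lab)%N by rewrite /lim addn2.
rewrite e1 [(Nc * _)%N]mulnC [(base_lab * _)%N]mulnC; split.
- by rewrite addnC modnMDl modn_small.
- by rewrite addnC modnMDl modn_small.
- by rewrite addnC divnMDl // divn_small // addn0.
Qed.

End Advice.

(** * Instances and optimal tours *)

Section Input.
Variable R : realType.

Lemma nth_triples (T : Type) (x0 : R) (f g h : T -> R) (s : seq T) (t0 : T) v : (v < size s)%N ->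
  let l := flatten [seq [:: f x; g x; h x] | x <- s] in
  [/\ nth x0 l (3 * v) = f (nth t0 s v), nth x0 l (1 + 3 * v) = g (nth t0 s v) &
      nth x0 l (2 + 3 * v) = h (nth t0 s v)].
Proof.
elim: s v => [//|x s IH] [_|v vs]; first by [].
rewrite mulnS; move: (3 * v)%N (IH v vs) => k [a b c].
by split; [rewrite /= a | rewrite /= -b | rewrite /= -c].
Qed.

Lemma input_point n (I : instance R n) (v : 'I_n) :
  [/\ rmem (input I) (2 + 3 * v) = (pos I v).1, rmem (input I) (3 + 3 * v) = (pos I v).2 &
      rmem (input I) (4 + 3 * v) = demand I v].
Proof.
have vs : (v < size (enum 'I_n))%N by rewrite size_enum_ord.
have [a b c] := @nth_triples _ 0 (fun v => (pos I v).1) (fun v => (pos I v).2) (demand I) _ v _ vs.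
have e : nth v (enum 'I_n) v = v by apply/val_inj; rewrite /= nth_enum_ord.
by move: a b c; rewrite e /input /= => -> -> ->.
Qed.

End Input.

Section Orders.
Variable R : realType.
Variables (n : nat) (I : instance R n) (P : nat -> R * R) (dem : nat -> R).
Hypothesis posE : forall v : 'I_n, pos I v = P v.
Hypothesis demE : forall v : 'I_n, demand I v = dem v.
Notation O := (depot I).
Notation tour o := (plf (@edist R) O ([seq P v | v <- o] ++ [:: O])).

Lemma P_inj u v : (u < n)%N -> (v < n)%N -> P u = P v -> u = v.
Proof.
move=> un vn; rewrite -(posE (Ordinal un)) -(posE (Ordinal vn)) => /pos_inj e.
exact: (congr1 val e).
Qed.

(** A stored walk may visit arbitrary points repeatedly; keeping one visit to each assigned terminal
    does not lengthen it. The depot is put in front because a terminal located there counts as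
    visited. *)
Lemma order_of (A : pred nat) (p : seq (R * R)) :
    (forall v, (v < n)%N -> A v -> P v \in O :: p) ->
  exists o, [/\ uniq o, forall v, (v \in o) = (v < n)%N && A v & tour o <= tour_cost O p].
Proof.
move=> hA; pose s := [seq v <- iota 0 n | A v].
pose q := [seq x <- undup (O :: p) | x \in map P s].
pose inv x := nth 0%N s (index x (map P s)).
have ms v : (v \in s) = (v < n)%N && A v by rewrite mem_filter mem_iota andbC.
have invK x : x \in q -> inv x \in s /\ P (inv x) = x.
  rewrite mem_filter => /andP[xs _]; have i1 : (index x (map P s) < size s)%N by rewrite -(size_map P) index_mem.
  by rewrite /inv mem_nth // -(nth_map _ x) // nth_index.
have mq x : x \in q = (x \in map P s).
  rewrite mem_filter mem_undup; case: (boolP (x \in map P s)) => //= /mapP[v + ->].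
  by rewrite ms => /andP[]; apply: hA.
have e : map P (map inv q) = q.
  by rewrite -map_comp -[RHS]map_id; apply/eq_in_map => x /invK[].
exists (map inv q); split.
- by apply: (@map_uniq _ _ P); rewrite e filter_uniq // undup_uniq.
- move=> v; rewrite -ms; apply/mapP/idP => [[x /invK[h _] ->]//|vs].
  have xq : P v \in q by rewrite mq map_f.
  exists (P v) => //; have [is1 ip] := invK _ xq.
  by apply/esym/P_inj => //; [move: is1 | move: vs]; rewrite ms => /andP[].
- rewrite e tour_costE -cats1.
  have h : subseq (q ++ [:: O]) ((O :: p) ++ [:: O]).
    by apply: cat_subseq => //; apply: subseq_trans (filter_subseq _ _) (undup_subseq _).
  by have := plf_subseq O (@edist_ge0 R) (@edist_tri R) h; rewrite /= edistxx add0r.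
Qed.

(** Dropping the empty orders leaves exactly the tours counted by [ntours], each of which visits a
    terminal. *)
Lemma opt_orders (S : solution R n) : feasible I S -> exists ts : seq (seq nat),
  [/\ perm_eq (flatten ts) (iota 0 n), forall o, o \in ts -> o != [::],
     forall o, o \in ts -> \sum_(v <- o) dem v <= 1, size ts = ntours S &
     \sum_(o <- ts) tour o <= cost I S].
Proof.
move=> [h1 h2]; pose as_ v := if insub v is Some v' then assign S v' else 0%N.
have asE (v : 'I_n) : as_ v = assign S v by rewrite /as_ valK.
pose tr j := nth [::] (tours S) j.
have hj j : exists o, [/\ uniq o, forall v, (v \in o) = (v < n)%N && (as_ v == j) & tour o <= tour_cost O (tr j)].
  apply: order_of => v vn /eqP ej; have [_] := h1 (Ordinal vn).
  by rewrite -asE /= ej posE.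
have [f hf] := @boolp.choice _ _ (fun j o => [/\ uniq o, forall v, (v \in o) = (v < n)%N && (as_ v == j) & tour o <= tour_cost O (tr j)]) hj.
pose k := size (tours S); pose all_ := [seq f j | j <- iota 0 k].
exists [seq o <- all_ | o != [::]].
have fl : flatten [seq o <- all_ | o != [::]] = flatten all_.
  by elim: all_ => [//|o s IH] /=; case: (o) => [|a b] //=; rewrite IH.
have kv v : (v < n)%N -> (as_ v < k)%N.
  by move=> vn; have [] := h1 (Ordinal vn); rewrite -asE.
split.
- rewrite fl; apply: uniq_perm; rewrite ?iota_uniq //.
    have unf J : uniq (flatten [seq f j | j <- iota 0 J]) && all (fun v => as_ v < J)%N (flatten [seq f j | j <- iota 0 J]).
      elim: J => [//|J /andP[u1 a1]]; rewrite -addn1 iotaD map_cat flatten_cat /= cats0 cat_uniq all_cat u1 /=.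
      have [u m _] := hf J; rewrite u andbT; apply/and3P; split.
      - by apply/hasPn => v; rewrite m => /andP[_ /eqP e]; apply/negP => /(allP a1); rewrite e ltnn.
      - by apply/allP => v /(allP a1) h; rewrite addn1 ltnW.
      - by apply/allP => v; rewrite m => /andP[_ /eqP->]; rewrite addn1.
    by have /andP[] := unf k.
  move=> v; rewrite mem_iota; apply/flattenP/idP => [[o /mapP[j _ ->]]|vn].
    by have [_ m _] := hf j; rewrite m => /andP[].
  exists (f (as_ v)); first by rewrite map_f // mem_iota kv.
  by have [_ m _] := hf (as_ v); rewrite m eqxx andbT.
- by move=> o; rewrite mem_filter => /andP[].
- move=> o; rewrite mem_filter => /andP[_ /mapP[j]]; rewrite mem_iota => /andP[_ jk] ->.
  have [u m _] := hf j; apply: le_trans (h2 j jk).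
  rewrite -(@perm_big _ _ _ _ [seq v <- iota 0 n | as_ v == j] (f j)) /=; last first.
    by apply: uniq_perm; rewrite ?filter_uniq ?iota_uniq // => v; rewrite m mem_filter mem_iota andbC.
  rewrite big_filter -[X in iota X]/(0)%N -{1}(subn0 n) big_mkord.
  rewrite le_eqVlt; apply/orP; left; apply/eqP.
  by apply: eq_big => [v|v _]; rewrite ?asE ?demE.
- rewrite size_filter /ntours count_map; apply: eq_in_count => j _ /=; have [u m _] := hf j.
  apply/idP/existsP => [|[v /eqP e]].
    case E : (f j) => [//|v o] _; have := m v; rewrite E mem_head => /esym/andP[vn e].
    by exists (Ordinal vn); rewrite -asE.
  by have := m v; rewrite ltn_ord asE e eqxx; case: (f j).
- rewrite big_filter; apply: (@le_trans _ _ (\sum_(o <- all_) tour o)).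
    rewrite big_mkcond /=; apply: ler_sum => o _; case: ifP => // _.
    by apply: plf_ge0; apply: edist_ge0.
  rewrite /all_ big_map /cost [X in _ <= X](big_nth [::]) big_mkord.
  rewrite -[X in iota X]/(0)%N -{1}(subn0 k) big_mkord; apply: ler_sum => j _.
  by have [_ _] := hf j.
Qed.

Notation d := (@edist R).

(** Skipping the depot between consecutive tours gives a single tour through all terminals, no
    longer than all tours together; it is the one that will be decomposed. *)
Lemma tours_concat (ts : seq (seq nat)) :
  plf d O (map P (flatten ts) ++ [:: O]) <= \sum_(o <- ts) tour o.
Proof.
elim: ts => [|o ts IH]; first by rewrite big_nil /= edistxx addr0.
rewrite big_cons /= map_cat -catA plf_cat; apply: (@le_trans _ _ (tour o + plf d O (map P (flatten ts) ++ [:: O]))).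
  rewrite [X in _ <= X + _]plf_cat /= addr0 -addrA lerD2l.
  by apply: (plf_tri (@edist_ge0 R) (@edist_tri R)).
by rewrite lerD2l.
Qed.

End Orders.

(** * Cells *)

Section Grid.
Variable R : realType.
Variables (D : R) (M N : nat).
Hypothesis D0 : 0 < D.
Hypothesis M1 : (1 < M)%N.
Notation M' := (M%:R : R).

(** Starts at 0 with steps [(grd k + D) / M]: the spacing is at most about 1/M of the distance to
    the depot and never below [D / M], so that few lines reach a given distance. *)
Definition grd (k : nat) : R := D * ((1 + M'^-1) ^+ k - 1).

Let M0 : 0 < M'. Proof. by rewrite ltr0n ltnW. Qed.
Let Mi : 0 < M'^-1. Proof. by rewrite invr_gt0. Qed.

Lemma grd0 : grd 0 = 0. Proof. by rewrite /grd expr0 subrr mulr0. Qed.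
Lemma grdS k : grd k.+1 = grd k + (grd k + D) / M'.
Proof. by rewrite /grd exprS; ring. Qed.

Lemma grd_gap (a b : R) : 0 < a -> a <= b -> b <= grd N ->
  (forall k, (k <= N)%N -> ~ (a <= grd k <= b)) -> b - a <= (a + D) / M'.
Proof.
move=> a0 ab bN h.
have hex : exists k, (k <= N)%N && (a <= grd k) by exists N; rewrite leqnn (le_trans ab bN).
have [k /andP[kN ak] kmin] := ex_minnP hex.
have bk : b < grd k by rewrite ltNge; apply/negP => kb; apply: (h k kN); rewrite ak kb.
case: k kN ak kmin bk => [|k] kN ak kmin bk; first by move: ak; rewrite grd0 leNgt a0.
have ka : grd k < a.
  rewrite ltNge; apply/negP => ak'; have := kmin k; rewrite ak' (ltnW kN) ltnn => /(_ isT).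
  by [].
rewrite grdS in bk; apply: (@le_trans _ _ ((grd k + D) / M')).
  by rewrite lerBlDl; apply: le_trans (ltW bk) _; rewrite lerD2r ltW.
by rewrite ler_pM2r // lerD2r ltW.
Qed.

Definition lines : seq R := map grd (iota 0 N.+1) ++ map (fun k => - grd k) (iota 0 N.+1).

Lemma size_lines : size lines = (2 * N.+1)%N.
Proof. by rewrite size_cat !size_map !size_iota mul2n addnn. Qed.

Lemma lines_in k : (k <= N)%N -> grd k \in lines /\ - grd k \in lines.
Proof.
move=> kN; rewrite !mem_cat; split; apply/orP; [left|right].
  by apply/mapP; exists k; rewrite ?mem_iota.
by apply/mapP; exists k; rewrite ?mem_iota.
Qed.

Lemma lines_gap (x y : R) : x <= y -> - grd N <= x -> y <= grd N ->
  (forall F, F \in lines -> ~ (x <= F <= y)) ->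
  y - x <= (`|x| + D) / M' /\ y - x <= (`|y| + D) / M'.
Proof.
move=> xy xN yN h.
have x0 : 0 < x \/ y < 0.
  have [l1|l1] := ltP 0 x; first by left.
  right; rewrite ltNge; apply/negP => l2; apply: (h 0); last by rewrite l1.
  by rewrite -grd0; have [] := @lines_in 0%N (leq0n _).
have yx : 0 <= y - x by rewrite subr_ge0.
have mono u v : u <= v -> (u + D) / M' <= (v + D) / M' by move=> uv; rewrite ler_pM2r // lerD2r.
case: x0 => [x0|y0].
  have g : y - x <= (x + D) / M'.
    by apply: grd_gap => // k kN; apply: h; have [] := lines_in kN.
  rewrite !gtr0_norm ?(lt_le_trans x0 xy) //; split=> //; exact: le_trans g (mono _ _ xy).
have g : - x - - y <= (- y + D) / M'.
  apply: grd_gap; rewrite ?oppr_gt0 ?lerN2 //; first by rewrite lerNl.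
  move=> k kN /andP[h1 h2]; have [_ hk] := lines_in kN; apply: (h _ hk).
  by rewrite lerNr h2 lerNl h1.
have g' : y - x <= (- y + D) / M' by rewrite (_ : y - x = - x - - y) //; ring.
have xl : x < 0 by apply: le_lt_trans y0.
rewrite !ltr0_norm //; split=> //; apply: le_trans g' _; apply: mono; by rewrite lerN2.
Qed.

(** On each axis the difference is at most [6 * (r / M)]: the spacing of the lines at the coordinate
    of [q], plus the tolerance [D / M] left by the pixels. As [D <= r], both are multiples of
    [r / M]. *)
Lemma cell_diam (p q : R * R) : D <= edist (0, 0) q ->
    (forall b, `|co b p| <= grd N /\ `|co b q| <= grd N) ->
    (forall b F, F \in lines -> ~ (co b p + D / M' <= F <= co b q)) ->
    (forall b F, F \in lines -> ~ (co b q + D / M' <= F <= co b p)) ->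
  edist p q <= 12%:R / M' * edist (0, 0) q.
Proof.
move=> Dq bd h1 h2; set r := edist (0, 0) q in Dq *.
have qr b : `|co b q| <= r.
  by case: b; rewrite -[`|_|]normrN -[- _]sub0r; [apply: (@edist_ge_x R (0,0)) | apply: (@edist_ge_y R (0,0))].
have M2 : 2%:R <= M' by rewrite ler_nat.
have M1' : 1 <= M' by move: M2; lra.
have DD : D / M' <= D by rewrite ler_pdivrMr // ler_peMr // ltW.
have DM : D / M' <= r / M' by rewrite ler_pM2r.
have rM0 : 0 <= r / M' by apply: le_trans DM; apply: mulr_ge0; apply: ltW.
have hb b : `|co b p - co b q| <= 6%:R * (r / M').
  have [bp bq] := bd b; rewrite !ler_norml in bp bq; case/andP: bp => bp1 bp2; case/andP: bq => bq1 bq2.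
  have rq := qr b; have dm0 : 0 <= D / M' by apply: mulr_ge0; apply: ltW.
  have [pq|pq] := lerP (co b p + D / M') (co b q).
    have [|_ g] := lines_gap pq _ bq2 (h1 b); first by move: bp1 dm0; lra.
    have : (`|co b q| + D) / M' <= 2%:R * (r / M').
      by rewrite mulrA ler_pM2r //; move: rq Dq; lra.
    by move=> g2; rewrite ler_norml; move: g g2 pq dm0 DM; lra.
  have [qp|qp] := lerP (co b q + D / M') (co b p).
    have [|g _] := lines_gap qp _ bp2 (h2 b); first by move: bq1 dm0; lra.
    have n1 : `|co b q + D / M'| <= 2%:R * r.
      apply: le_trans (ler_normD _ _) _; rewrite (ger0_norm dm0).
      by move: rq Dq DD; lra.
    have : (`|co b q + D / M'| + D) / M' <= 3%:R * (r / M').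
      by rewrite mulrA ler_pM2r //; move: n1 Dq; lra.
    by move=> g2; rewrite ler_norml; move: g g2 qp dm0 DM; lra.
  by rewrite ler_norml; move: pq qp DM dm0; lra.
apply: le_trans (edist_le1 p q) _.
have a := hb true; have c := hb false; rewrite /= in a c.
rewrite (_ : 12%:R / M' * r = 6%:R * (r / M') + 6%:R * (r / M')); first exact: lerD.
by ring.
Qed.

End Grid.

Lemma plen_switch (R : realType) (A B : pred nat) s : {in s, A =1 B} ->
  plen (fun u v => (A u != A v)%:R : R) s = plen (fun u v => (B u != B v)%:R) s.
Proof.
case: s => [//|x s] /=; elim: s x => [//|y s IH] x h /=.
rewrite !h ?inE ?eqxx ?orbT // IH // => u us; apply: h; by rewrite inE us orbT.
Qed.

Lemma plen_const0 (R : realType) s : plen (fun u v : nat => (xpred0 u != xpred0 v)%:R : R) s = 0.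
Proof. by case: s => [//|x s] /=; elim: s x => [//|y s IH] x /=; rewrite IH addr0. Qed.

Section Paths.
Variable R : realType.
Variables (n S M N m : nat) (P : nat -> R * R) (O : R * R) (D Dm : R) (od : seq nat).
Notation K := (4 * kappa m + 1)%N.
Notation Nc := ((2 * N.+1).+1 * (2 * N.+1).+1)%N.
Notation d := (fun u v => edist (P u) (P v)).
Hypothesis n0 : (0 < n)%N.
Hypothesis D0 : 0 < D.
Hypothesis M1 : (1 < M)%N.
Hypothesis m0 : (0 < m)%N.
Hypothesis PD : forall v, (v < n)%N -> D <= edist O (P v) <= Dm.
Hypothesis DmN : Dm <= grd D M N.
Hypothesis SK : (2 * K <= S)%N.
Hypothesis P_inj : forall u v, (u < n)%N -> (v < n)%N -> P u = P v -> u = v.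
Hypothesis od_perm : perm_eq od (iota 0 n).

Let sh (x : R * R) : R * R := (x.1 - O.1, x.2 - O.2).
Let q v := sh (P v).

Let q_edist u v : edist (q u) (q v) = edist (P u) (P v).
Proof. by rewrite /edist /q /=; congr (Num.sqrt (_ ^+ 2 + _ ^+ 2)); ring. Qed.

Let q0_edist v : edist (0, 0) (q v) = edist O (P v).
Proof. by rewrite /edist /q /=; congr (Num.sqrt (_ ^+ 2 + _ ^+ 2)); ring. Qed.

Let q_inj u v : (u < n)%N -> (v < n)%N -> q u = q v -> u = v.
Proof.
move=> un vn [e1 e2]; apply: P_inj => //; rewrite [P u]surjective_pairing [P v]surjective_pairing.
by rewrite (addIr _ e1) (addIr _ e2).
Qed.

Let od_lt v : (v \in od) = (v < n)%N.
Proof. by rewrite (perm_mem od_perm) mem_iota. Qed.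

Let Dm0 : 0 < Dm.
Proof. by have /andP[h1 h2] := PD n0; apply: lt_le_trans D0 (le_trans h1 h2). Qed.

Let co_q v b : (v < n)%N -> `|co b (q v)| <= Dm.
Proof.
move=> vn; have /andP[_ h] := PD vn; apply: le_trans h; rewrite -q0_edist.
by case: b; rewrite -[`|_|]normrN -[- _]sub0r; [apply: (@edist_ge_x R (0,0)) | apply: (@edist_ge_y R (0,0))].
Qed.

(** The structure theorem is applied with the depot moved to the origin. Its bound [4 * kappa m] on
    the crossings of a node box gives [K] blocks per node, and joining the blocks of a cell costs at
    most [2%:R * Dm] per block, which is the last additive term. *)
Theorem paths_exist : exists (cell : nat -> nat) (p : nat -> seq nat) (idx : nat -> nat),
  [/\ forall v, (cell v < Nc)%N,
      forall u v, (u < n)%N -> (v < n)%N -> cell u = cell v -> edist (P u) (P v) <= 12%:R / M%:R * edist O (P v),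
      forall c, [/\ (idx c < tsize n S)%N, uniq (p c), forall v, (v \in p c) = (v < n)%N && (cell v == c),
        forall v, (v < n)%N -> inb n P (idx c) v = (cell v == c) &
        forall u v, (u < n)%N -> (v < n)%N ->
          tb (iter (K + (2 * K + 1) * n) (step n S P) (tab0 n S P)) (idx c) u v = befs u v (p c)] &
      \sum_(c < Nc) plen d (p c) <=
        (1 + 24%:R / m%:R) * plf (@edist R) O (map P od ++ [:: O]) + 16%:R * Dm * Nc%:R + D / M%:R + 2%:R * K%:R * Dm * Nc%:R].
Proof.
have uq : uniq (map q od).
  rewrite map_inj_in_uniq; last by move=> u v; rewrite !od_lt => un vn; apply: q_inj.
  by rewrite (perm_uniq od_perm) iota_uniq.
case E : od od_perm uq od_lt => [|v0 od'] op uq olt; first by have := olt 0%N; rewrite in_nil n0.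
have zM : 0 < D / M%:R by rewrite divr_gt0 // ltr0n ltnW.
have mq x : x \in map q (v0 :: od') -> exists2 v, (v < n)%N & x = q v.
  by case/mapP => v; rewrite olt => vn ->; exists v.
have qm v : (v < n)%N -> q v \in map q (v0 :: od') by move=> vn; rewrite map_f // olt.
have hB x b : x \in map q (v0 :: od') -> `|co b x| <= Dm by case/mq => v vn ->; apply: co_q.
have [pix [W [t [pi [cell [pm [lv inWt] pne [pp lve plpi] [cl cn cz]]]]]]] :=
  @tsp_structure R (q v0) (map q od') (fun _ => lines D M N) Dm (D / M%:R) m uq hB Dm0 zM m0.
pose inv x := index x (map q (iota 0 n)).
have invK v : (v < n)%N -> inv (q v) = v.
  move=> vn; have uqi : uniq (map q (iota 0 n)).
    by rewrite map_inj_in_uniq ?iota_uniq // => u w; rewrite !mem_iota => un wn; apply: q_inj.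
  have e : q v = nth (q v) (map q (iota 0 n)) v by rewrite (nth_map 0%N) ?size_iota // nth_iota.
  by rewrite /inv {1}e index_uniq // size_map size_iota.
have mpi x : x \in pi -> exists2 v, (v < n)%N & x = q v by rewrite (perm_mem pp); apply: mq.
pose pi' := map inv pi.
have qpi : map q pi' = pi.
  by rewrite -map_comp -[RHS]map_id; apply/eq_in_map => x /mpi[v vn ->] /=; rewrite invK.
have pi'_perm : perm_eq pi' (iota 0 n).
  apply: perm_trans op; have -> : v0 :: od' = map inv (map q (v0 :: od')).
    by rewrite -map_comp -[LHS]map_id; apply/eq_in_map => v; rewrite olt => vn /=; rewrite invK.
  exact: perm_map.
pose pix' b x := pix b (sh x).
pose cell' v := cell (q v).
have sz_lines : size (lines D M N) = (2 * N.+1)%N by rewrite size_lines.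
have hp c : exists ip : nat * seq nat, [/\ (ip.1 < tsize n S)%N, uniq ip.2, forall v, (v \in ip.2) = (v < n)%N && (cell' v == c),
        forall v, (v < n)%N -> inb n P ip.1 v = (cell' v == c) &
        (forall u v, (u < n)%N -> (v < n)%N ->
          tb (iter (K + (2 * K + 1) * n) (step n S P) (tab0 n S P)) ip.1 u v = befs u v ip.2) /\
        plen d ip.2 <= plen d [seq v <- pi' | cell' v == c]].
  have mono b (x y : R * R) : co b x <= co b y -> (pix' b x <= pix' b y)%N.
    by move=> h; apply: pm; case: b h => /= h; rewrite lerD2r.
  have inj u v : (u < n)%N -> (v < n)%N -> (forall b, pix' b (P u) = pix' b (P v)) -> u = v.
    move=> un vn h; have [//|ne] := eqVneq u v; have [|b] := pne _ _ (qm u un) (qm v vn).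
      by apply: contra ne => /eqP e; apply/eqP; apply: q_inj.
    by rewrite -[pix b (q u)]/(pix' b (P u)) h eqxx.
  have [|||idx [p [h1 h2 h3 h4 [h5 h6]]]] := @dp_cells R n S K P pi' pix' pi'_perm mono inj SK W t cell' lv _ _ _ c.
  - move=> U hU; rewrite -(ler_nat R); apply: le_trans (blk_size _ _ _) _.
    rewrite natrD addrC lerD2r; apply: le_trans (lve U hU).
    by rewrite -[X in _ <= plen _ X]qpi plen_map.
  - by rewrite addn1.
  - move=> v vn; have [U hU e] := cn _ (qm v vn); exists U => // u un.
    by rewrite -(e _ (qm u un)).
  by exists (idx, p); split.
have [f hf] := @boolp.choice _ _ _ hp.
exists cell', (fun c => (f c).2), (fun c => (f c).1); split.
- by move=> v; have := cl (q v); rewrite sz_lines.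
- move=> u v un vn e; rewrite -q_edist -q0_edist.
  apply: (@cell_diam R D M N D0 M1 (q u) (q v)).
  + by rewrite q0_edist; have /andP[] := PD vn.
  + by move=> b; split; apply: le_trans DmN; apply: co_q.
  + by move=> b F; apply: cz; rewrite ?qm.
  + by move=> b F; apply: cz; rewrite ?qm.
- by move=> c; have [h1 h2 h3 h4 [h5 _]] := hf c.
apply: (@le_trans _ _ (\sum_(c < Nc) plen d [seq v <- pi' | cell' v == c])).
  by apply: ler_sum => c _; have [_ _ _ _ [_]] := hf c.
have d0 u v : 0 <= d u v by apply: edist_ge0.
apply: (@le_trans _ _ (\sum_(c < Nc) (\sum_(x <- blk (fun v => cell' v == c) pi') plen d x + K%:R * (2%:R * Dm)))).
  apply: ler_sum => c _; have [h1 _ _ h4 _] := hf c.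
  rewrite -blk_flatten; apply: (le_trans (plen_flatten (Dm := 2%:R * Dm) _ _)).
  - move=> x y; rewrite blk_flatten !mem_filter !(perm_mem pi'_perm) !mem_iota => /andP[_ xn] /andP[_ yn].
    apply: le_trans (edist_tri _ O _) _; rewrite (edistC (P x)).
    by have /andP[_ a] := PD xn; have /andP[_ b] := PD yn; move: a b; lra.
  - by rewrite mulr_ge0 // ltW.
  - rewrite lerD2l ler_wpM2r ?mulr_ge0 ?(ltW Dm0) // ler_nat.
    rewrite -(ler_nat R); apply: le_trans (blk_size _ _ _) _; rewrite natrD addrC lerD2r.
    have [/hasP[v vp /eqP ec]|/hasPn none] := boolP (has (fun v => cell' v == c) pi').
      have vn : (v < n)%N by move: vp; rewrite (perm_mem pi'_perm) mem_iota.
      have [U hU e] := cn _ (qm v vn); apply: le_trans (lve U hU); rewrite -[X in _ <= plen _ X]qpi plen_map.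
      rewrite (_ : plen _ _ = plen (fun u v => (inW pix U (q u) != inW pix U (q v))%:R) pi') //.
      apply: (@plen_switch R (fun v => cell' v == c) (fun v => inW pix U (q v))) => u.
      by rewrite (perm_mem pi'_perm) mem_iota => un; rewrite e ?qm // -/(cell' u) -/(cell' v) ec.
    rewrite (@plen_switch R (fun v => cell' v == c) xpred0); last by move=> u /none/negbTE.
    by rewrite plen_const0 ler0n.
rewrite big_split /= sumr_const card_ord.
have b1 := @blk_cells R nat d cell' d0 Nc pi'.
have b2 : plen d pi' = plen (@edist R) pi.
  by rewrite -qpi plen_map; case: (pi') => [//|x s] /=; elim: s x => [//|y s IH] x /=; rewrite q_edist IH.
rewrite b2 in b1; apply: le_trans (lerD b1 (lexx _)) _; apply: le_trans (lerD plpi (lexx _)) _.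
have ct : (cuts (fun _ => lines D M N))%:R <= Nc%:R :> R.
  by rewrite ler_nat /cuts sz_lines; move: (2 * N.+1)%N => z; clear; nia.
have c16 : 16%:R * Dm * (cuts (fun _ : bool => lines D M N))%:R <= 16%:R * Dm * Nc%:R.
  by rewrite ler_wpM2l // mulr_ge0 // ltW.
have Lb : plf (@edist R) (q v0) (rcons (map q od') (q v0)) <= plf (@edist R) O (map P (v0 :: od') ++ [:: O]).
  have -> : plf (@edist R) (q v0) (rcons (map q od') (q v0)) = plf (@edist R) (P v0) (rcons (map P od') (P v0)).
    rewrite -!map_rcons !plf_map; move: (rcons od' v0) => s0; elim: s0 (v0) => [//|y s IH] x /=.
    by rewrite q_edist IH.
  rewrite /= plf_rcons plf_cat /= addr0 addrCA lerD2l addrC.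
  exact: edist_tri.
have m24 : 0 <= 24%:R / m%:R :> R by rewrite divr_ge0.
rewrite -[X in _ + X]mulr_natr.
have h1 := ler_wpM2l m24 Lb; move: h1 c16 Lb; rewrite [map P (v0 :: od') ++ _]/= [plf _ O (P v0 :: _)]/=.
set b := (edist O (P v0) + _); set c := plf _ (q v0) _.
move: b c (24%:R / m%:R) (D / M%:R) (Nc%:R) ((cuts _)%:R) (K%:R) => b c e a x y z; lra.
Qed.

End Paths.

Section OutWorld.
Variable R : realType.
Variables (S H Nc Q : nat).
Implicit Types (w : world R).

Lemma outW_spec w : let A := bestW S H Nc Q w in let t := (nW w + mA S Nc Q w A)%N in let w' := outW S H Nc Q w in
  [/\ wN w' 9 0 = t.+1, wN w' 9 1 = t,
    forall y, (y <= t)%N -> wN w' 8 (t.+1 + y) = if y == 0%N then mA S Nc Q w A else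
      if (y <= nW w)%N then tripA S H Nc Q w A y.-1 else lenA S H Nc Q w A (y - (nW w).+1) &
    forall k, (k < nW w)%N -> (wR w' 4 k.*2, wR w' 4 k.*2.+1) = PW w (ordA S H Nc Q w A k)].
Proof.
move=> A t w'; split=> //.
- move=> y yt; have -> : wN w' 8 (t.+1 + y) = wN (out2 S H Nc Q (out1 S H Nc Q w)) 8 (t.+1 + y) by [].
  rewrite /out2 setNE; last by rewrite -[totW _ _ _ _]/t ltn_add2l ltnS.
  by rewrite -[totW _ _ _ _]/t addKn.
- move=> k kn; have b1 : (k.*2 < 2 * nW w)%N by move: kn; clear; lia.
  have b2 : (k.*2.+1 < 2 * nW w)%N by move: kn; clear; lia.
  have e1 : wR w' 4 k.*2 = outr S H Nc Q (out3 S Nc Q (out2 S H Nc Q (out1 S H Nc Q w))) k.*2 by apply: setRE b1.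
  have e2 : wR w' 4 k.*2.+1 = outr S H Nc Q (out3 S Nc Q (out2 S H Nc Q (out1 S H Nc Q w))) k.*2.+1 by apply: setRE b2.
  rewrite e1 e2 /outr -muln2 mulnK // modnMl -[(k * 2).+1]addn1 divnMDl // modnMDl /= addn0.
  by [].
Qed.

End OutWorld.

Section Final.
Variable R : realType.
Variables (S H Nc Q K n : nat) (I : instance R n) (w : world R) (s : state R).
Hypothesis H0 : (0 < H)%N.
Hypothesis wn : wN w 1 0 = n.
Hypothesis wI : forall x, (x < 3 * n + 2)%N -> wR w 1 x = rmem (input I) x.
Hypothesis ws : let w' := algW S H Nc Q K w in let off := wN w' 9 0 in let tot := wN w' 9 1 in
    (forall x, (x <= tot)%N -> nmem s x = wN w' 8 (off + x)) /\ forall x, (x < n + n)%N -> rmem s x = wR w' 4 x.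
Notation w1 := (dpW S (K + (2 * K + 1) * n) w).

Lemma w_pos (v : 'I_n) : pos I v = PW w v.
Proof.
have [a b _] := input_point I v; have vn := ltn_ord v.
by rewrite /PW !wI ?a ?b -?surjective_pairing //; move: vn; clear; lia.
Qed.

Lemma w_dem (v : 'I_n) : demand I v = demW w v.
Proof.
have [_ _ c] := input_point I v; have vn := ltn_ord v.
by rewrite /demW wI ?c //; move: vn; clear; lia.
Qed.

Lemma w_depot : depot I = OW w.
Proof. by rewrite /OW !wI ?addn2 // /= -surjective_pairing. Qed.

Lemma w1_in : [/\ nW w1 = n, PW w1 = PW w, OW w1 = OW w & demW w1 = demW w].
Proof. by have [a b c e] := same_inP (dpW_in S (K + (2 * K + 1) * n) w); split=> //; rewrite a; exact: wn. Qed.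

Lemma sum_len A j : (\sum_(i < j) lenA S H Nc Q w1 A i)%N = offA S H Nc Q w1 A j.
Proof.
elim: j => [|j IH]; last by rewrite big_ord_recr /= IH /offA offS.
by rewrite big_ord0 /offA /off /nsum big1.
Qed.

(** Feasibility is tested by the program itself, and the minimum over all advices transfers the cost
    bound of any single feasible one to the output. *)
Lemma alg_output A0 : (A0 < tsize n S ^ Adn Nc Q)%N -> okdA S H Nc Q w1 A0 ->
  feasible I (output n s) /\ cost I (output n s) <= costdA S H Nc Q w1 A0.
Proof.
move=> lt0 ok0; have [en eP eO ed] := w1_in.
set A := bestW S H Nc Q w1; pose m := mA S Nc Q w1 A.
have [okA leA] : okdA S H Nc Q w1 A /\ costdA S H Nc Q w1 A <= costdA S H Nc Q w1 A0.
  have := aminP (okdA S H Nc Q w1) (costdA S H Nc Q w1) (tsize (nW w1) S ^ Adn Nc Q).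
  rewrite /A /bestW; case: (amin _ _ _) => [|i] /=; first by rewrite en => /(_ A0 lt0); rewrite ok0.
  by case=> _ h1 h2; split=> //; apply: h2 => //; rewrite en.
case/andP: okA => /nallP sg /nallP ld.
have aE : algW S H Nc Q K w = outW S H Nc Q w1 by rewrite /algW /nW wn.
have [o1 o2 o3 o4] := outW_spec S H Nc Q w1; rewrite -/A -/m en in o1 o2 o3 o4.
case: ws; rewrite aE o1 o2 => s1 s2.
have s0' : nmem s 0 = m by rewrite s1 // o3.
have sT' v : (v < n)%N -> nmem s v.+1 = tripA S H Nc Q w1 A v.
  by move=> vn; rewrite s1 ?o3 /= ?vn //; apply: leq_trans vn (leq_addr _ _).
have sL' j : (j < m)%N -> nmem s (n.+1 + j) = lenA S H Nc Q w1 A j.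
  move=> jm; have h : (n.+1 + j <= n + m)%N by rewrite addSnnS leq_add2l.
  by rewrite s1 // o3 // addSn /= ltnNge leq_addr /= subSS addKn.
have sR' i : (i < n)%N -> (rmem s i.*2, rmem s i.*2.+1) = PW w (ordA S H Nc Q w1 A i).
  by move=> ni; rewrite -eP -o4 // !s2 //; rewrite -addnn; move: ni; clear; lia.
have sumL' : (\sum_(j < m) lenA S H Nc Q w1 A j <= n)%N.
  by rewrite sum_len -[X in (_ <= X)%N]en; apply: off_le.
have trm v : (v < n)%N -> (tripA S H Nc Q w1 A v < m)%N.
  by move=> vn; rewrite /tripA /trip ltn_divLR // sg // en.
split.
- apply: (@output_feasible R n m I s _ _ _ (PW w) s0' sT' sL' sR' sumL' w_pos trm).
    move=> v vn; rewrite sum_len; have vn' : (v < nW w1)%N by rewrite en.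
    have /andP[h1 h2] := @rank_trip R (nW w1) (demW w1) H H Nc (mA S Nc Q w1 A) (inbA S Nc w1 A) (befA S Nc w1 A) (widA S Nc w1 A)
      (scA S H Nc Q w1 A) (slA S H Nc Q w1 A) (sqA S H Nc Q w1 A) v vn'.
    exists (rankA S H Nc Q w1 A v - offA S H Nc Q w1 A (tripA S H Nc Q w1 A v))%N; first by rewrite ltn_subLR.
    by rewrite subnKC // /ordA /rankA ordvE.
  have cast (F : nat -> R) : \sum_(i < nW w1) F i = \sum_(i < n) F i by rewrite en.
  move=> j jm; apply: le_trans (ld j jm); rewrite /load /rsum (cast (fun v => if _ v == j then _ v else 0)) big_mkcond /=.
  by apply: ler_sum => v _; rewrite w_dem -ed.
- rewrite (@output_cost R n m I s _ _ (PW w) s0' sL' sR' sumL').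
  apply: le_trans leA; rewrite /costdA costdE eP eO -w_depot; apply: ler_sum => j _.
  rewrite le_eqVlt; apply/orP; left; apply/eqP; congr (plf _ _ (rcons _ _)).
  rewrite /tl /mkseq -map_comp; apply: eq_map => i /=.
  by rewrite sum_len.
Qed.

End Final.

(** * Parameters *)

Section Params.
Variable R : realType.

Lemma bernoulli (y : R) n : 0 <= y -> 1 + n%:R * y <= (1 + y) ^+ n.
Proof.
move=> y0; elim: n => [|n IH]; first by rewrite mul0r addr0 expr0.
rewrite exprS -natr1; apply: le_trans (ler_wpM2l _ IH); last by rewrite addr_ge0.
have : 0 <= n%:R * y * y by rewrite !mulr_ge0.
by move: (n%:R) => z; nra.
Qed.

(** By Bernoulli's inequality [M] steps at least double the growth factor. *)
Lemma grd_large (D : R) M k : 0 < D -> (0 < M)%N -> D * (2%:R ^+ k - 1) <= grd D M (M * k).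
Proof.
move=> D0 M0; rewrite /grd ler_pM2l // lerD2r exprM; apply: lerXn2r; rewrite ?nnegrE ?exprn_ge0 ?addr_ge0 ?invr_ge0 //.
apply: le_trans (@bernoulli (M%:R^-1) M _); last by rewrite invr_ge0.
by rewrite divff ?pnatr_eq0 -?lt0n // -natr1 -[1%:R]/1.
Qed.

(** With [M = 12 * p ^ 2] the relative diameter 12/M of a cell is p^-2. The grid reaches C D after
    [pN p] lines, because it doubles every [pM p] lines and C + 1 is at most 2^(p^2 + 1). [pK p] is
    [4 * kappa p + 1], and [pNc p] counts the cells cut out by [2 * (pN p).+1] lines on each
    axis. *)
Definition pM p : nat := (12 * p ^ 2)%N.
Definition pN p : nat := (pM p * (p ^ 2 + 1))%N.
Definition pK p : nat := (4 * (2 * p + 4) + 1)%N.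
Definition pNc p : nat := ((2 * (pN p).+1).+1 * (2 * (pN p).+1).+1)%N.

Lemma pNc_bound p : (100 <= p)%N -> (pNc p * p ^ 2 * (pK p + 20) <= p ^ 14)%N.
Proof.
move=> p1; have p0 : (0 < p)%N by apply: leq_trans p1.
have h1 : (pK p + 20 <= p ^ 2)%N by rewrite /pK; move: p1; clear; nia.
have h2 : ((2 * (pN p).+1).+1 <= p ^ 5)%N.
  have : ((2 * (pN p).+1).+1 <= 51 * (p ^ 4))%N by rewrite /pN /pM; move: p1; clear; nia.
  by move=> h; apply: leq_trans h _; rewrite [(p ^ 5)%N]expnS leq_mul2r; apply/orP; right; apply: leq_trans p1.
have -> : (p ^ 14 = p ^ 5 * p ^ 5 * p ^ 2 * p ^ 2)%N by rewrite -!expnD.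
by rewrite /pNc; apply: leq_mul => //; apply: leq_mul => //; apply: leq_mul.
Qed.

Section Eps.
Variable eps : R.
Hypothesis e0 : 0 < eps.
Hypothesis e1 : eps < 100%:R^-1.
Let x := 1 / eps.

Lemma x_large : 100%:R < x.
Proof. by rewrite /x div1r -[100%:R]invrK ltf_pV2 ?posrE ?invr_gt0 ?ltr0n. Qed.

Lemma p_exists : exists p : nat, [/\ (100 <= p)%N, x <= p%:R & p%:R <= x + 1].
Proof.
have x0 : 0 <= x by apply: le_trans (ltW x_large); rewrite ler0n.
exists (Num.truncn x).+1; have /andP[h1 h2] := Num.Theory.truncn_itv x0; split.
- by rewrite ltnW // -(ltr_nat R); apply: lt_trans h2; apply: x_large.
- exact: ltW.
- by rewrite -natr1 lerD2r.
Qed.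

Lemma Cst_le p : x <= p%:R -> (0 < p)%N -> Cst eps + 1 <= 2%:R ^+ (p ^ 2 + 1).
Proof.
move=> xp p0; have x1 : 1 <= x by apply: le_trans (ltW x_large); rewrite ler1n.
have h1 : Cst eps <= 2%:R ^+ (p ^ 2).
  rewrite /Cst -/x; apply: (@le_trans _ _ (p%:R `^ x)).
    by apply: ge0_ler_powR; rewrite ?nnegrE ?ler0n //; apply: le_trans x1.
  apply: (@le_trans _ _ (p%:R `^ p%:R)); first by rewrite ler_powR // ler1n.
  rewrite powR_mulrn ?ler0n // expnS expn1 exprM; apply: lerXn2r; rewrite ?nnegrE ?exprn_ge0 ?ler0n //.
  by rewrite -natrX ler_nat ltnW // ltn_expl.
rewrite exprD expr1; have : 1 <= 2%:R ^+ (p ^ 2) :> R by rewrite exprn_ege1 // ler1n.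
by move: h1; lra.
Qed.

(** The left side is at most p^14; [p <= x + 1 <= x ^ 2] and [x > 100] give p^14 <= x^28 <= x^x. *)
Lemma Cst_ge p : (100 <= p)%N -> p%:R <= x + 1 -> (pNc p * p ^ 2 * (pK p + 20))%:R <= Cst eps.
Proof.
move=> p1 px; have x1 := x_large; have x1' : 1 <= x by apply: le_trans (ltW x1); rewrite ler1n.
apply: (@le_trans _ _ (p ^ 14)%:R); first by rewrite ler_nat pNc_bound.
rewrite natrX; apply: (@le_trans _ _ ((x ^+ 2) ^+ 14)).
  apply: lerXn2r; rewrite ?nnegrE ?exprn_ge0 ?ler0n //; first by apply: le_trans x1'.
  by apply: le_trans px _; rewrite expr2; nra.
rewrite -exprM -powR_mulrn; last by apply: le_trans x1'.
rewrite /Cst -/x ler_powR //; apply: le_trans (ltW x1); by rewrite ler_nat.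
Qed.

Lemma Gamma_ge : 1 <= Cst eps -> Cst eps ^+ 3 <= Gamma eps.
Proof.
move=> C1; rewrite /Gamma; have C3 : 0 <= Cst eps ^+ 3 by rewrite exprn_ge0 // (le_trans _ C1).
have e5 : 1 <= (eps ^+ 5)^-1.
  rewrite invf_ge1 ?exprn_gt0 //; apply: exprn_ile1; first exact: ltW.
  by apply: le_trans (ltW e1) _; rewrite invf_le1 ?ltr0n // ler1n.
apply: (@le_trans _ _ (32%:R * pi * Cst eps ^+ 3)).
  rewrite -{1}[Cst eps ^+ 3]mul1r ler_wpM2r //; have := pi_ge2 R; lra.
by rewrite ler_peMr // mulr_ge0 // mulr_ge0 ?ler0n // pi_ge0.
Qed.

End Eps.

(** The choice [l = 1 / (p C)] makes the term in the number of tours O(u/p), by [Dm <= C * D] and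
    [D * m0 <= u]; the term in 1/l is of order [Dm * Nc * p * C], which u >= D C^3 absorbs. The
    tours through representatives cost at most 1 + 40/p times u, the paths 1 + 27/p; hence 67. *)
Lemma final_bound (p : nat) (C D Dm u m0 dlt eps Nc K : R) (first second : R) :
    (100 <= p)%N -> 0 < D -> 1 <= C -> 0 <= Dm -> Dm <= C * D -> D * m0 <= u -> C ^+ 3 <= m0 ->
    dlt = (p%:R ^+ 2)^-1 -> p%:R^-1 <= eps -> 1 <= Nc -> 0 <= K -> Nc * p%:R ^+ 2 * (K + 20%:R) <= C ->
    first <= (1 + dlt * p%:R) * ((1 + (1 + dlt) / p%:R + 2%:R / p.-1%:R * (1 + dlt)) * u +
      2%:R * Dm * (2%:R * Nc + 2%:R * (2%:R * (p%:R * C)^-1 * m0 + Nc / (4%:R * (p%:R * C)^-1)))) ->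
    second <= (1 + 24%:R / p%:R) * u + 16%:R * Dm * Nc + D / (12 * p ^ 2)%:R + 2%:R * K * Dm * Nc ->
  first + second <= (2%:R + 67%:R * eps) * u.
Proof.
move=> p1 D0 C1 Dm0 DmC Du Cm dE pe Nc1 K0 NC hf hs.
set P := p%:R : R in dE pe NC hf hs *; have P100 : 100%:R <= P by rewrite ler_nat.
have P0 : 0 < P by move: P100; clear; lra.
set i := P^-1; have i0 : 0 < i by rewrite invr_gt0.
have iP : i * P = 1 by rewrite mulVf // gt_eqF.
have i1 : i <= 100%:R^-1 by rewrite -(ler_pM2r P0) iP mulrC ler_pdivlMr ?ltr0n // mul1r.
have C0 : 0 < C by move: C1; clear; lra.
have m00 : 0 < m0 by apply: lt_le_trans Cm; rewrite exprn_gt0.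
have u0 : 0 < u by apply: lt_le_trans Du; apply: mulr_gt0.
have dlE : dlt = i * i by rewrite dE expr2 invfM.
have dP : dlt * P = i by rewrite dlE -mulrA iP mulr1.
have dl1 : dlt <= i by rewrite dlE ler_piMr ?ltW //; move: i1; clear; lra.
have dl0 : 0 <= dlt by rewrite dlE mulr_ge0 ?ltW.
have pm : p.-1%:R^-1 <= 2%:R * i.
  have p2 : P <= 2%:R * p.-1%:R by rewrite -natrM ler_nat; move: p1; clear; lia.
  have q0 : 0 < p.-1%:R :> R by rewrite ltr0n; move: p1; clear; lia.
  by rewrite -[X in X <= _]mul1r ler_pdivrMr // -mulrA [i * _]mulrC mulrA ler_pdivlMr // mul1r.
have pm0 : 0 <= p.-1%:R^-1 :> R by rewrite invr_ge0.
have uC : D * C ^+ 3 <= u by apply: le_trans Du; rewrite ler_pM2l.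
(* The additive terms are absorbed by [u >= D C^3], as [C] exceeds every
   polynomial in [p]. *)
have base : C ^+ 2 * D * Nc * P * (K + 20%:R) <= i * u.
  apply: (@le_trans _ _ (i * (D * C ^+ 3))); last by rewrite ler_pM2l.
  rewrite (_ : C ^+ 2 * D * Nc * P * (K + 20%:R) = i * (D * C ^+ 2 * (Nc * P ^+ 2 * (K + 20%:R)))).
    by rewrite ler_pM2l // (_ : D * C ^+ 3 = D * C ^+ 2 * C) ?ler_wpM2l // ?mulr_ge0 ?exprn_ge0 ?ltW //; ring.
  rewrite (_ : i * _ = i * P * (C ^+ 2 * D * Nc * P * (K + 20%:R))); last by ring.
  by rewrite iP mul1r.
have K20 : 20%:R <= K + 20%:R by move: K0; clear; lra.
have DN : Dm * Nc <= C * D * Nc by rewrite ler_wpM2r //; move: Nc1; clear; lra.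
have CDN0 : 0 <= C * D * Nc by rewrite !mulr_ge0 ?ltW //; move: Nc1; clear; lra.
have DmN0 : 0 <= Dm * Nc by rewrite mulr_ge0 //; move: Nc1; clear; lra.
have CP1 : 1 <= C * P by rewrite -[1]mulr1; apply: ler_pM => //; move: P100; clear; lra.
have t1 : 20%:R * (Dm * Nc) * (C * P) <= i * u.
  apply: le_trans base; rewrite (_ : C ^+ 2 * D * Nc * P * (K + 20%:R) = (K + 20%:R) * (C * D * Nc) * (C * P)); last by ring.
  rewrite ler_wpM2r //; first by move: CP1; clear; lra.
  by apply: ler_pM.
have t2 : (K + 20%:R) * (Dm * Nc) <= i * u.
  apply: le_trans base; rewrite (_ : C ^+ 2 * D * Nc * P * (K + 20%:R) = (K + 20%:R) * (C * D * Nc) * (C * P)); last by ring.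
  apply: (@le_trans _ _ ((K + 20%:R) * (C * D * Nc))); first by rewrite ler_wpM2l //; move: K0; clear; lra.
  by rewrite ler_peMr // mulr_ge0 //; move: K0; clear; lra.
have t3 : Dm * ((P * C)^-1 * m0) <= i * u.
  have -> : Dm * ((P * C)^-1 * m0) = i * (C^-1 * Dm * m0) by rewrite invfM -/i; ring.
  rewrite ler_pM2l //; apply: le_trans Du; rewrite ler_pM2r // mulrC ler_pdivrMr //.
  by rewrite mulrC.
have t4 : D / (12 * p ^ 2)%:R <= i * u.
  have Du' : D <= u by apply: le_trans uC; rewrite -{1}[D]mulr1 ler_pM2l //; apply: exprn_ege1.
  have M1 : ((12 * p ^ 2)%:R)^-1 <= i.
    rewrite lef_pV2 ?posrE // ?ltr0n ?muln_gt0 ?expn_gt0; last by rewrite /= (leq_trans _ p1).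
    by rewrite ler_nat; move: p1; clear; nia.
  by rewrite mulrC; apply: ler_pM => //; [rewrite invr_ge0 ler0n | apply: ltW].
have lE : Nc / (4%:R * (P * C)^-1) = Nc * (C * P) / 4%:R by rewrite invfM invrK; ring.
rewrite lE dP -/i in hf.
have A1 : (1 + dlt) / P <= 2%:R * i by rewrite -/i ler_pM2r //; move: dl1 i1; clear; lra.
have A2 : 2%:R / p.-1%:R * (1 + dlt) <= 8%:R * i.
  rewrite (_ : 2%:R / p.-1%:R * (1 + dlt) = p.-1%:R^-1 * (2%:R * (1 + dlt))); last by ring.
  rewrite (_ : 8%:R * i = (2%:R * i) * 4%:R); last by ring.
  by apply: ler_pM => //; [rewrite mulr_ge0 // addr_ge0 | move: dl1 i1; clear; lra].
have E1 : 2%:R * Dm * (2%:R * Nc + 2%:R * (2%:R * (P * C)^-1 * m0 + Nc * (C * P) / 4%:R)) <= 9%:R * (i * u).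
  have -> : 2%:R * Dm * (2%:R * Nc + 2%:R * (2%:R * (P * C)^-1 * m0 + Nc * (C * P) / 4%:R)) =
    4%:R * (Dm * Nc) + 8%:R * (Dm * ((P * C)^-1 * m0)) + Dm * Nc * (C * P) by field; rewrite ?gt_eqF.
  have : Dm * Nc <= Dm * Nc * (C * P) by rewrite ler_peMr.
  by move: t1 t3 DmN0; move: (Dm * (_ * m0)) (Dm * Nc) (C * P) (i * u) => z x q v; clear; lra.
have u0' := ltW u0.
have B1 : (1 + (1 + dlt) / P + 2%:R / p.-1%:R * (1 + dlt)) * u <= u + 10%:R * (i * u).
  rewrite (_ : u + 10%:R * (i * u) = (1 + 10%:R * i) * u); last by ring.
  by rewrite ler_wpM2r //; move: A1 A2; clear; lra.
have iu0 : 0 <= i * u by rewrite mulr_ge0 ?ltW.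
have F : first <= u + 40%:R * (i * u).
  apply: le_trans hf _; apply: (@le_trans _ _ ((1 + i) * (u + 19%:R * (i * u)))).
    rewrite ler_wpM2l ?addr_ge0 ?(ltW i0) //; apply: le_trans (lerD B1 E1) _.
    by move: (i * u) => v; clear; lra.
  have : i * (i * u) <= i * u by rewrite ler_piMl //; move: i1; clear; lra.
  have -> : (1 + i) * (u + 19%:R * (i * u)) = u + 20%:R * (i * u) + 19%:R * (i * (i * u)) by ring.
  by move: (i * (i * u)) (i * u) iu0 => z v; clear; lra.
have G : second <= u + 27%:R * (i * u).
  apply: le_trans hs _; rewrite -/i.
  have : 16%:R * Dm * Nc + 2%:R * K * Dm * Nc <= 2%:R * ((K + 20%:R) * (Dm * Nc)).
    by move: DmN0; move: K0; clear; nra.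
  rewrite (_ : (1 + 24%:R * i) * u = u + 24%:R * (i * u)); last by ring.
  by move: t2 t4; move: (D / _) (16%:R * _ * _) (_ * K * _ * _) (_ * (Dm * Nc)) (i * u) => z a b c v; clear; lra.
have : i * u <= eps * u by rewrite ler_pM2r.
by move: F G; clear; lra.
Qed.

End Params.

(** * The approximation guarantee *)

Section Good.
Variable R : realType.
Variables (S H Nc n : nat) (w : world R) (cell : nat -> nat) (p : nat -> seq nat) (idx : nat -> nat).
Variables (dlt Dm l : R) (ts : seq (seq nat)).
Notation P := (PW w).
Notation O := (OW w).
Notation dem := (demW w).
Notation d := (fun u v => edist (P u) (P v)).
Notation Q := (cfB H Nc ^ H)%N.
Hypothesis en : nW w = n.
Hypothesis n0 : (0 < n)%N.
Hypothesis H1 : (1 < H)%N.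
Hypothesis N0 : (0 < Nc)%N.
Hypothesis SN : (1 + (H + 4) * Nc <= S)%N.
Hypothesis cell_lt : forall v, (cell v < Nc)%N.
Hypothesis dltP : forall u v, (u < n)%N -> (v < n)%N -> cell u = cell v -> edist (P u) (P v) <= dlt * edist O (P v).
Hypothesis hp : forall c, [/\ (idx c < tsize n S)%N, uniq (p c), forall v, (v \in p c) = (v < n)%N && (cell v == c),
  forall v, (v < n)%N -> inbW w (idx c) v = (cell v == c) &
  forall u v, (u < n)%N -> (v < n)%N -> tbW w (idx c) u v = befs u v (p c)].
Hypothesis dem_in : forall v, (v < n)%N -> 0 < dem v <= 1.
Hypothesis dlt0 : 0 <= dlt.
Hypothesis DmP : forall v, (v < n)%N -> edist O (P v) <= Dm.
Hypothesis Dm0 : 0 <= Dm.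
Hypothesis ts_perm : perm_eq (flatten ts) (iota 0 n).
Hypothesis ts_load : forall o, o \in ts -> \sum_(v <- o) dem v <= 1.
Hypothesis ts_ne : forall o, o \in ts -> o != [::].
Hypothesis l0 : 0 < l.

Lemma sel_out N i F : (N <= i)%N -> sel N i F = 0%N.
Proof.
move=> iN; rewrite /sel /nsum big1 // => k _; case: eqP => // e.
by move: iN; rewrite -e leqNgt ltn_ord.
Qed.

Theorem good_advice : exists A, [/\ (A < tsize n S ^ Adn Nc Q)%N, okdA S H Nc Q w A &
  costdA S H Nc Q w A <= (1 + dlt * H%:R) * ((1 + (1 + dlt) / H%:R + 2%:R / H.-1%:R * (1 + dlt)) *
       (\sum_(o <- ts) plf (@edist R) O ([seq P v | v <- o] ++ [:: O])) +
     2%:R * Dm * (2%:R * Nc%:R + 2%:R * (2%:R * l * (size ts)%:R + Nc%:R / (4%:R * l)))) +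
   \sum_(c < Nc) plen d (p c)].
Proof.
have H0 : (0 < H)%N by apply: ltnW.
(* Outside the cells both functions are 0, the default of [sel], so that the decoded functions equal
   them everywhere. *)
pose idx' c := if (c < Nc)%N then idx c else 0%N.
pose wid c := if (c < Nc)%N then (count (fun v => large dem H v && (cell v == c)) (iota 0 n) %/ H ^ 2).+1 else 0%N.
pose inbx c v := inbW w (idx' c) v.
pose bef c u v := tbW w (idx' c) u v.
have inbxE c v : (c < Nc)%N -> (v < n)%N -> inbx c v = (cell v == c).
  by move=> cN vn; rewrite /inbx /idx' cN; have [_ _ _ h _] := hp c; apply: h.
have befE c u v : (c < Nc)%N -> (u < n)%N -> (v < n)%N -> bef c u v = befs u v (p c).
  by move=> cN un vn; rewrite /bef /idx' cN; have [_ _ _ _ h] := hp c; apply: h.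
have p_uniq c : (c < Nc)%N -> uniq (p c) by have [] := hp c.
have mem_p c v : (c < Nc)%N -> (v \in p c) = (v < n)%N && (cell v == c) by have [_ _ h _ _] := hp c; rewrite h.
have widE c : (c < Nc)%N -> wid c = (count (fun v => large dem H v && (cell v == c)) (iota 0 n) %/ H ^ 2).+1.
  by move=> cN; rewrite /wid cN.
have cl v : (v < n)%N -> (cell v < Nc)%N by [].
have [cf [pok szc cst]] := @plans_exist R n P O dem H Nc inbx bef wid cell dlt Dm ts
  dem_in H1 cl inbxE widE dlt0 dltP DmP Dm0 ts_perm ts_load ts_ne l l0.
have [cf1 _ _ cf4] := pok.
have cf_size pl : pl \in cf -> size pl = H by move=> /cf1[].
have cf_range pl s : pl \in cf -> s \in pl -> [/\ (s.1.1 < Nc)%N, (s.1.2 <= H ^ 2 + 1)%N & (s.2.1 <= H)%N].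
  by move=> h1 h2; have [] := cf4 pl s h1 h2.
(* [S] is large enough for the number of plans, and with it every multiplicity and group width, to
   be a single digit in base [tsize]. *)
have T1 : (n.+1 * (1 + (H + 4) * Nc) < tsize n S)%N.
  have -> : tsize n S = (n.+1 * n.+1 ^ (3 + 2 * S))%N by rewrite -expnS /tsize.
  rewrite ltn_pmul2l //; apply: leq_ltn_trans SN _.
  apply: leq_trans (_ : 2 ^ (3 + 2 * S) <= _)%N; last by apply: leq_exp2r'.
  by apply: leq_trans (ltn_expl _ (ltnSn 1)) _; rewrite leq_exp2l //; clear; lia.
have cf_lt : (size cf < tsize (nW w) S)%N by rewrite en; apply: leq_ltn_trans szc T1.
have idx_lt c : (c < Nc)%N -> (idx' c < tsize (nW w) S)%N.
  by move=> cN; rewrite en /idx' cN; have [] := hp c.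
have wid_lt c : (c < Nc)%N -> (wid c < tsize (nW w) S)%N.
  move=> cN; rewrite en /wid cN; apply: leq_ltn_trans T1.
  apply: (@leq_trans n.+1); last by rewrite leq_pmulr.
  by rewrite ltnS; apply: leq_trans (leq_div _ _) _; rewrite -[X in (_ <= X)%N](size_iota 0) count_size.
pose A := advice S H Nc w idx' wid cf.
pose cf' := cfs H Nc cf.
have cfp : perm_eq cf' cf by apply: cfs_perm.
have cfp' : perm_eq cf cf' by rewrite perm_sym.
have pok' := plans_ok_perm cfp' pok.
exists A; have sl := advice_slot H0 N0 idx_lt wid_lt cf_lt cf_size cf_range.
have eidx : idxA S Nc w A = idx'.
  apply/funext => c; have [cN|cN] := ltnP c Nc; first exact: advice_idx.
  by rewrite /idxA sel_out // /idx' ltnNge cN.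
have ewid : widA S Nc w A = wid.
  apply/funext => c; have [cN|cN] := ltnP c Nc; first exact: advice_wid.
  by rewrite /widA sel_out // /wid ltnNge cN.
have einb : inbA S Nc w A = inbx by apply/funext => c; rewrite /inbA eidx.
have ebef : befA S Nc w A = bef by apply/funext => c; rewrite /befA eidx.
have em : mA S Nc Q w A = size cf' by rewrite (perm_size cfp); apply: advice_m.
have sl' s : (s < size cf' * H)%N -> [/\ scA S H Nc Q w A s = (slotat H cf' s).1.1,
    slA S H Nc Q w A s = (slotat H cf' s).1.2 & sqA S H Nc Q w A s = (slotat H cf' s).2.1].
  by rewrite (perm_size cfp) => /sl.
have dem_gt0 v : (v < n)%N -> 0 < dem v by move=> /dem_in/andP[].
have [q1 q2 q3 q4] := pok'.
have qs pl : pl \in cf' -> size pl = H by move=> /q1[].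
have qlq pl s : pl \in cf' -> s \in pl -> (0 < s.1.2)%N -> s.2.1 = 0%N.
  by move=> h1 h2; have [] := q4 pl s h1 h2.
split.
- by rewrite -en; apply: advice_lt.
- rewrite /okdA en em einb ebef ewid (okd_congr _ _ _ _ _ _ _ sl').
  apply: (goodL_ok (cell := cell) (p := p) (cap := capS dem) dem_gt0 H0 H0 cl inbxE p_uniq mem_p befE qs qlq q2 q3).
  + by move=> s; rewrite /capS; case: ifP.
  + by move=> pl s v h1 h2 vn lv e1 e2; have [_ _ _ _ h] := q4 pl s h1 h2; have [a _] := h v vn e1; apply: a.
  + by move=> pl /q1[].
- rewrite /costdA en em einb ebef ewid (costd_congr _ _ _ _ _ _ _ _ _ sl').
  apply: le_trans (goodL_cost (cell := cell) (p := p) (dl := dlS P O dlt) O dem_gt0 H0 H0 cl inbxE p_uniq mem_p befE qs qlq q2 q3 _ _) _.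
  + by move=> s; rewrite /dlS mulr_ge0 // edist_ge0.
  + by move=> pl s v h1 h2 vn e1; have [_ _ _ _ h] := q4 pl s h1 h2; have [_ a] := h v vn e1; apply: a.
  + rewrite lerD2r; apply: le_trans cst; rewrite le_eqVlt; apply/orP; left; apply/eqP.
    exact: perm_big.
Qed.

End Good.

Theorem theorem4 (R : realType) :
  exists K eps0 : R, 0 < K /\ 0 < eps0 /\
    forall eps : R, 0 < eps < eps0 ->
    exists P : cmd,
      polytime R P /\
      forall (n : nat) (I : instance R n) (OPT : solution R n),
        bounded_distance (Cst eps) I ->
        optimal I OPT ->
        Gamma eps <= (ntours OPT)%:R ->
        forall (t : nat) (s : state R),
          exec P (input I) t s ->
          feasible I (output n s) /\
          cost I (output n s) <= (2%:R + K * eps) * cost I OPT.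
Proof.
(* 67 is the sum of the two error terms in [final_bound]; the bound on eps makes 1/eps exceed 100,
   as the comparison of C with powers of p requires. *)
exists 67%:R, 100%:R^-1; split; first by rewrite ltr0n.
split; first by rewrite invr_gt0 ltr0n.
move=> eps /andP[e0 e1]; have [p [p1 xp px]] := p_exists e0 e1.
have p0 : (0 < p)%N by apply: leq_trans p1.
have p2 : (1 < p)%N by apply: leq_trans p1.
set C := Cst eps; have C1 : 1 <= C.
  apply: le_trans (Cst_ge e0 e1 p1 px); rewrite ler1n.
  by rewrite muln_gt0 muln_gt0 expn_gt0 p0 addn_gt0 orbT.
pose H := p; pose M := pM p; pose N := pN p; pose K := pK p; pose Nc := pNc p.
(* A row must hold [2 * K] paths, since two systems are united before their paths are linked; the
   other summand makes room for the multiplicities of the plans. *)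
pose S := (2 * K + (1 + (H + 4) * Nc))%N; pose Q := (cfB H Nc ^ H)%N.
have N0 : (0 < Nc)%N by [].
have M1 : (1 < M)%N by rewrite /M /pM; move: p1; clear; nia.
have [Pr [poly spec]] := program_exists R S H Nc Q K.
exists Pr; split=> // n I OPT [D0 DC] [fO _] Gm t s ex.
have [t' [s' [w [ex' wn wI ws]]]] := spec n I.
(* The conclusion concerns an arbitrary run, which by determinism ends in the state already
   described. *)
have {ws} : let w' := algW S H Nc Q K w in let off := wN w' 9 0 in let tot := wN w' 9 1 in
    (forall x, (x <= tot)%N -> nmem s x = wN w' 8 (off + x)) /\ forall x, (x < n + n)%N -> rmem s x = wR w' 4 x.
  by rewrite (exec_det ex ex').
move=> ws; set D := dmin I in D0 DC; set Dm := dmax I in DC.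
have posE := w_pos wI; have demE := w_dem wI; have OE := w_depot wI.
have [ts [ts_perm ts_ne ts_load ts_size ts_cost]] := opt_orders posE demE fO.
set u := \sum_(o <- ts) _ in ts_cost.
have m0 : C ^+ 3 <= (size ts)%:R by rewrite ts_size; apply: le_trans (Gamma_ge e0 e1 C1) Gm.
have sz0 : (0 < size ts)%N.
  by rewrite -(ltr_nat R); apply: lt_le_trans m0; rewrite exprn_gt0 //; apply: lt_le_trans C1.
have mts o v : o \in ts -> v \in o -> (v < n)%N.
  move=> ot vo; have : v \in flatten ts by apply/flattenP; exists o.
  by rewrite (perm_mem ts_perm) mem_iota.
have n0 : (0 < n)%N.
  case E : ts sz0 => [//|o ts'] _; have ot : o \in ts by rewrite E mem_head.
  by case F : o (ts_ne o ot) => [//|v o'] _; apply: leq_ltn_trans (mts o v ot _); rewrite // F mem_head.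
have PD v : (v < n)%N -> D <= edist (OW w) (PW w v) <= Dm.
  move=> vn; rewrite edistC -OE -(posE (Ordinal vn)) -/(dist I (Ordinal vn)).
  by rewrite bigmin_le le_bigmax.
have Dm0 : 0 < Dm by have /andP[h1 h2] := PD 0%N n0; apply: lt_le_trans D0 (le_trans h1 h2).
have DmC : Dm <= C * D by rewrite -ler_pdivrMr.
(* Every tour reaches a terminal, at distance at least [D]. This is where the number of tours
   enters: it makes u at least D C^3, against which all additive errors are measured. *)
have Du : D * (size ts)%:R <= u.
  have -> : D * (size ts)%:R = \sum_(o <- ts) D by rewrite big_const_seq count_predT iter_addr_0 mulr_natr.
  rewrite big_seq [X in _ <= X]big_seq; apply: ler_sum => o ot.
  case F : o (ts_ne o ot) => [//|v o'] _ /=; have vn : (v < n)%N by apply: (mts o v ot); rewrite F mem_head.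
  have /andP[h _] := PD v vn; rewrite -OE in h; apply: (le_trans h); rewrite -{1}[edist _ _]addr0 lerD2l.
  by apply: plf_ge0; apply: edist_ge0.
have DmN : Dm <= grd D M N.
  apply: le_trans (grd_large _ D0 (ltnW M1)); apply: (le_trans DmC).
  by rewrite mulrC ler_pM2l // lerBrDr; apply: Cst_le.
have SK : (2 * (4 * kappa p + 1) <= S)%N by apply: leq_addr.
have P_inj' := P_inj posE.
have [cell [q [idx [cl dl hq pl]]]] := @paths_exist R n S M N p (PW w) (OW w) D Dm (flatten ts)
  n0 D0 M1 p0 PD DmN SK P_inj' ts_perm.
pose w1 := dpW S (K + (2 * K + 1) * n) w.
have [en eP eO ed] := w1_in S K wn.
have tab := @dpW_tab R S (K + (2 * K + 1) * n) w.
rewrite -/w1 in en eP eO ed tab.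
have wn' : nW w = n := wn.
rewrite wn' in tab.
pose dlt : R := 12%:R / M%:R.
have dltE : dlt = (p%:R ^+ 2)^-1.
  by rewrite /dlt /M /pM natrM natrX invfM mulrA divff ?mul1r ?pnatr_eq0.
have l0 : 0 < (p%:R * C)^-1 by rewrite invr_gt0 mulr_gt0 ?ltr0n // (lt_le_trans _ C1).
have [||||||||A [A1 A2 A3]] := @good_advice R S H Nc n w1 cell q idx dlt Dm (p%:R * C)^-1 ts en n0 p2 N0 _ cl _ _ _ _ _ _ ts_perm _ ts_ne l0.
- by rewrite /S leq_addl.
- by rewrite eP eO.
- move=> c; have [h1 h2 h3 h4 h5] := hq c; have [_ _ hb] := tab _ h1; split=> //.
    by move=> v vn; rewrite -h4 // /inbW en eP.
  by move=> x v xn vn; rewrite -h5 // -hb //.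
- by move=> v vn; rewrite ed -(demE (Ordinal vn)); apply: demand_in.
- by rewrite dltE invr_ge0 exprn_ge0.
- by move=> v vn; rewrite eP eO; have /andP[] := PD v vn.
- exact: ltW.
- by rewrite ed.
have [f c] := alg_output (ltnW p2) wn wI ws A1 A2.
split=> //; apply: le_trans c _; apply: le_trans A3 _.
have Lu : plf (@edist R) (OW w) (map (PW w) (flatten ts) ++ [:: OW w]) <= u.
  by rewrite /u -OE; apply: tours_concat.
apply: (@le_trans _ _ ((2%:R + 67%:R * eps) * u)); last first.
  by rewrite ler_wpM2l // addr_ge0 // mulr_ge0 // ltW.
apply: (@final_bound R p C D Dm u (size ts)%:R dlt eps Nc%:R K%:R) => //.
- exact: ltW.
- by rewrite -[eps]invrK lef_pV2 ?posrE ?invr_gt0 ?ltr0n // -div1r.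
- by rewrite ler1n.
- have := Cst_ge e0 e1 p1 px; by rewrite natrM natrM natrX natrD.
- by rewrite eP eO -OE.
rewrite eP; apply: le_trans pl _; rewrite -/K -/Nc -/M.
rewrite !lerD2r ler_wpM2l // addr_ge0 // divr_ge0 //.
Qed.
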